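(* Let $b,c\in\mathbb{R}$, let $1=p\leq q<\infty$, and let $\alpha,\beta\in\mathbb{R}$ with $\beta>-1$. The following are equivalent: (i) $T_{bc}$ is bounded from $L^1_\alpha$ to $L^q_\beta$. (ii) $S_{bc}$ is bounded from $L^1_\alpha$ to $L^q_\beta$. (iii) Either ($\alpha<b$ and $c\leq b+\dfrac{n+\beta}{q}-(n+\alpha)$) or ($\alpha\leq b$ and $c<b+\dfrac{n+\beta}{q}-(n+\alpha)$).
   Context: Let $n\geq 2$ be an integer, $\mathbb{B}$ the open unit ball and $\mathbb{S}$ the unit sphere of $\mathbb{R}^n$, and $\nu$, $\sigma$ the volume and surface measures on $\mathbb{B}$, $\mathbb{S}$ normalized so that $\nu(\mathbb{B})=\sigma(\mathbb{S})=1$. For $\alpha\in\mathbb{R}$, $d\nu_\alpha(x)=\frac{1}{V_\alpha}(1-|x|^2)^\alpha d\nu(x)$, where for $\alpha>-1$ the constant $V_\alpha$ is chosen so that $\nu_\alpha(\mathbb{B})=1$, and $V_\alpha=1$ for $\alpha\leq -1$. For $0<p<\infty$, $L^p_\alpha$ is the Lebesgue class $L^p(\mathbb{B},\nu_\alpha)$ with its norm. The harmonic Bergman-Besov kernel is $R_\alpha(x,y)=\sum_{k=0}^\infty \gamma_k(\alpha)Z_k(x,y)$ for $\alpha\in\mathbb{R}$, $x,y\in\mathbb{B}$, where $\gamma_k(\alpha)=\frac{(1+n/2+\alpha)_k}{(n/2)_k}$ if $\alpha>-(1+n/2)$ and $\gamma_k(\alpha)=\frac{(k!)^2}{(1-(n/2+\alpha))_k(n/2)_k}$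 if $\alpha\leq-(1+n/2)$; here $(a)_k=\Gamma(a+k)/\Gamma(a)$ is the Pochhammer symbol and $Z_k(x,y)$ is the zonal harmonic of degree $k$: a real-valued symmetric function, a homogeneous harmonic polynomial of degree $k$ in each variable, with $f(\eta)=\int_{\mathbb{S}}f(\zeta)Z_k(\zeta,\eta)\,d\sigma(\zeta)$ for every $\eta\in\mathbb{S}$ and every homogeneous harmonic polynomial $f$ of degree $k$ (so $Z_0\equiv1$). For $b,c\in\mathbb{R}$, $T_{bc}f(x)=\int_{\mathbb{B}}R_c(x,y)f(y)(1-|y|^2)^b\,d\nu(y)$ and $S_{bc}f(x)=\int_{\mathbb{B}}|R_c(x,y)|f(y)(1-|y|^2)^b\,d\nu(y)$. An operator is bounded from $X$ to $Y$ if it is defined on all of $X$, maps into $Y$, and $\|Tf\|_Y\leq C\|f\|_X$ for a constant $C$ and all $f\in X$. *)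

(* Defs.v *)
From HB Require Import structures.
From mathcomp Require Import all_boot all_order all_algebra.
From mathcomp Require mpoly.
(* The notations of mpoly clash with those of mathcomp-analysis. *)
Import -(notations) mpoly.
From mathcomp Require Import all_classical all_reals all_analysis measurable_realfun.

Set Implicit Arguments.
Unset Strict Implicit.
Unset Printing Implicit Defensive.
Import Order.TTheory GRing.Theory Num.Theory.
Import numFieldNormedType.Exports.
Local Open Scope classical_set_scope.
Local Open Scope ring_scope.

(* Points of R^n are n-tuples, because the library equips tuples (and not
   row vectors) with the product Borel sigma-algebra. *)
Notation Rn R n := (n.-tuple (measurableTypeR R)).

Lemma sigma_finite_product d1 d2 (T1 : measurableType d1)
    (T2 : measurableType d2) (R : realType)
    (m1 : {sigma_finite_measure set T1 -> \bar R})
    (m2 : {sigma_finite_measure set T2 -> \bar R}) :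
  sigma_finite setT (m1 \x m2)%E.
Proof.
have /sigma_finiteP[F [TF ndF Foo]] := sigma_finiteT m1.
have /sigma_finiteP[G [TG ndG Goo]] := sigma_finiteT m2.
exists (fun n => F n `*` G n).
  rewrite -setXTT TF TG predeqE => -[x y]; split.
    move=> [/= [n _ Fnx] [k _ Gky]]; exists (maxn n k) => //; split.
    - by move: x Fnx; exact/subsetPset/ndF/leq_maxl.
    - by move: y Gky; exact/subsetPset/ndG/leq_maxr.
  by move=> [n _ []/= ? ?]; split; exists n.
move=> k; have [? ?] := Foo k; have [? ?] := Goo k.
split; first exact: measurableX.
by rewrite product_measure1E// lte_mul_pinfty// ge0_fin_numE.
Qed.

Section LebesgueRn.
Context {R : realType}.

Definition consR n (z : measurableTypeR R * Rn R n) : Rn R n.+1 :=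
  [the n.+1.-tuple _ of z.1 :: z.2].

Lemma measurable_consR n : measurable_fun setT (@consR n).
Proof. exact: measurable_cons. Qed.

HB.instance Definition _ n :=
  isMeasurableFun.Build _ _ _ _ (@consR n) (@measurable_consR n).

Section step.
Variables (n : nat) (mu : {sigma_finite_measure set (Rn R n) -> \bar R}).

Definition lebesgue_cons : set (Rn R n.+1) -> \bar R :=
  pushforward (lebesgue_measure \x mu)%E (@consR n).

Let lebesgue_cons0 : lebesgue_cons set0 = 0%E.
Proof. by rewrite /lebesgue_cons /pushforward preimage_set0 measure0. Qed.

Let lebesgue_cons_ge0 A : (0 <= lebesgue_cons A)%E.
Proof. exact: measure_ge0. Qed.

Let lebesgue_cons_sigma_additive : semi_sigma_additive lebesgue_cons.
Proof. exact: measure_semi_sigma_additive. Qed.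

HB.instance Definition _ := isMeasure.Build _ _ _ lebesgue_cons
  lebesgue_cons0 lebesgue_cons_ge0 lebesgue_cons_sigma_additive.

Let lebesgue_cons_sigma_finite : sigma_finite setT lebesgue_cons.
Proof.
have [F UF mF] := sigma_finite_product lebesgue_measure mu.
pose g (t : Rn R n.+1) : measurableTypeR R * Rn R n :=
  (thead t, [tuple of behead t]).
have mg : measurable_fun setT g.
  apply/measurable_fun_pair; last exact: measurable_behead.
  exact: measurable_tnth.
exists (fun k => g @^-1` F k).
  by rewrite -preimage_bigcup -UF preimage_setT.
move=> k; have [mFk Fkoo] := mF k; split.
  by rewrite -[X in measurable X]setTI; exact: mg.
rewrite /lebesgue_cons /pushforward -comp_preimage.
rewrite (_ : g \o @consR n = id) ?preimage_id//.
apply/funext => -[x t] /=; congr pair.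
by apply: val_inj.
Qed.

HB.instance Definition _ := Measure_isSigmaFinite.Build _ _ _
  lebesgue_cons lebesgue_cons_sigma_finite.

End step.

(* n-dimensional Lebesgue measure, as the iterated product of
   [lebesgue_measure]. *)
Fixpoint lebesgue_Rn n : {sigma_finite_measure set (Rn R n) -> \bar R} :=
  match n with
  | 0 => \d_ ([tuple] : Rn R 0)
  | m.+1 => lebesgue_cons (lebesgue_Rn m)
  end.

End LebesgueRn.

Section Density.
Context d {T : measurableType d} {R : realType}.
Variables (mu : {measure set T -> \bar R}) (w : T -> R).
Hypotheses (mw : measurable_fun setT w) (w0 : forall x, 0 <= w x).

Definition density : set T -> \bar R := fun A => (\int[mu]_(x in A) (w x)%:E)%E.

Let density0 : density set0 = 0%E.
Proof. by rewrite /density integral_set0. Qed.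

Let density_ge0 A : (0 <= density A)%E.
Proof. by apply: integral_ge0 => x _; rewrite lee_fin. Qed.

Let density_sigma_additive : semi_sigma_additive density.
Proof.
move=> F mF tF mUF; rewrite /density; apply: cvg_toP.
  apply: ereal_nondecreasing_is_cvgn => m n mn.
  apply: lee_sum_nneg_natr => // k _ _.
  by apply: integral_ge0 => x _; rewrite lee_fin.
rewrite ge0_integral_bigcup//.
  by apply: (measurable_funS measurableT) => //; apply/measurable_EFinP.
by move=> x _; rewrite lee_fin.
Qed.

HB.instance Definition _ := isMeasure.Build _ _ _ density
  density0 density_ge0 density_sigma_additive.

Definition density_measure : {measure set T -> \bar R} := density.

End Density.

Section Ball.
Context {R : realType} {n : nat}.
Implicit Types x y : Rn R n.

Definition enorm x : R := Num.sqrt (\sum_(i < n) (tnth x i : R) ^+ 2).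

Definition uball : set (Rn R n) := [set x | enorm x < 1].

Definition usphere : set (Rn R n) := [set x | enorm x = 1].

Lemma measurable_enorm : measurable_fun setT enorm.
Proof.
apply: (measurableT_comp (f := @Num.sqrt R)).
  apply: continuous_measurable_fun; exact: sqrt_continuous.
apply: measurable_sum => i.
apply: (measurableT_comp (f := fun r : R => r ^+ 2)) => //.
exact: measurable_tnth.
Qed.

Lemma measurable_uball : measurable uball.
Proof.
rewrite -[uball]setTI (_ : uball = enorm @^-1` `]-oo, 1[).
  exact: measurable_enorm.
by apply/seteqP; split => x; rewrite /uball /= in_itv.
Qed.

(* Normalized volume measure of the ball, as a measure on R^n that vanishes
   outside the ball. *)
Definition nu : {measure set (Rn R n) -> \bar R} :=
  mscale (NngNum (fine_ge0 (measure_ge0 (lebesgue_Rn n) uball)))%:num^-1%:nng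
    (mrestr (lebesgue_Rn n) measurable_uball).

Definition direction x : Rn R n := [tuple (tnth x i : R) / enorm x | i < n].

Lemma measurable_direction : measurable_fun setT direction.
Proof.
apply/measurable_fun_tnthP => i.
rewrite (_ : _ \o _ = fun x => (tnth x i : R) * (enorm x)^-1); last first.
  by apply/funext => x /=; rewrite tnth_mktuple.
apply: measurable_funM; first exact: measurable_tnth.
rewrite (_ : (fun x => _) = fun x => enorm x `^ (-1)); last first.
  by apply/funext => x; rewrite powR_inv1// sqrtr_ge0.
apply: (measurableT_comp (f := fun r : R => r `^ (-1))).
  exact: measurable_powR.
exact: measurable_enorm.
Qed.

HB.instance Definition _ := isMeasurableFun.Build _ _ _ _
  direction measurable_direction.

(* Normalized surface measure of the sphere, given by polar coordinates:
   [sigma A] is the normalized volume of the cone over [A] in the ball. *)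
Definition sigma : set (Rn R n) -> \bar R := pushforward nu direction.

Let sigma0 : sigma set0 = 0%E.
Proof. exact: measure0. Qed.

Let sigma_ge0 A : (0 <= sigma A)%E.
Proof. exact: measure_ge0. Qed.

Let sigma_sigma_additive : semi_sigma_additive sigma.
Proof. exact: measure_semi_sigma_additive. Qed.

HB.instance Definition _ := isMeasure.Build _ _ _ sigma
  sigma0 sigma_ge0 sigma_sigma_additive.

Definition weight (a : R) x : R := (1 - enorm x ^+ 2) `^ a.

Lemma measurable_weight a : measurable_fun setT (weight a).
Proof.
apply: (measurableT_comp (f := fun r : R => r `^ a)); first exact: measurable_powR.
apply: measurable_funB => //.
by apply: (measurableT_comp (f := fun r : R => r ^+ 2)) => //; exact: measurable_enorm.
Qed.

Definition Vconst (a : R) : R :=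
  if -1 < a then \int[nu]_(x in uball) weight a x else 1.

Lemma Vconst_ge0 a : 0 <= Vconst a.
Proof.
rewrite /Vconst; case: ifP => // _.
by apply: Rintegral_ge0 => x _; exact: powR_ge0.
Qed.

Lemma measurable_nu_density a :
  measurable_fun setT (fun x => weight a x / Vconst a).
Proof. by apply: measurable_funM => //; exact: measurable_weight. Qed.

Lemma nu_density_ge0 a x : 0 <= weight a x / Vconst a.
Proof. by rewrite divr_ge0 ?powR_ge0 ?Vconst_ge0. Qed.

Definition nu_ (a : R) : {measure set (Rn R n) -> \bar R} :=
  density_measure nu (measurable_nu_density a) (nu_density_ge0 a).

(* [f] is (the function of) a homogeneous harmonic polynomial of degree k. *)
Definition homogeneous_harmonic (k : nat) (f : Rn R n -> R) : Prop :=
  exists p : mpoly n R,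
    [/\ p \is ishomog1 k (@mdeg n),
        \sum_(i < n) mderiv i (mderiv i p) = 0 &
        forall x, f x = meval (fun i => tnth x i : R) p].

Definition is_zonal (k : nat) (Z : Rn R n -> Rn R n -> R) : Prop :=
  [/\ forall x y, Z x y = Z y x,
      forall y, homogeneous_harmonic k (fun x => Z x y),
      forall x, homogeneous_harmonic k (fun y => Z x y) &
      forall f, homogeneous_harmonic k f -> forall eta, usphere eta ->
        f eta = \int[sigma]_(zeta in usphere) (f zeta * Z zeta eta)].

End Ball.

Section Kernel.
Context {R : realType}.

(* Euler's integral; it is only used for positive [a]. *)
Definition Gamma (a : R) : R :=
  \int[lebesgue_measure]_(t in `]0, +oo[) (t `^ (a - 1) * expR (- t)).

Definition pochhammer (a : R) (k : nat) : R := Gamma (a + k%:R) / Gamma a.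

Definition gamma_coef (n : nat) (a : R) (k : nat) : R :=
  if - (1 + n%:R / 2) < a then
    pochhammer (1 + n%:R / 2 + a) k / pochhammer (n%:R / 2) k
  else
    (k`!%:R) ^+ 2 /
      (pochhammer (1 - (n%:R / 2 + a)) k * pochhammer (n%:R / 2) k).

Variables (n : nat) (Z : nat -> Rn R n -> Rn R n -> R).

Definition bergman_besov (a : R) (x y : Rn R n) : R :=
  limn (series (fun k => gamma_coef n a k * Z k x y)).

End Kernel.

Section Operators.
Context {R : realType} {n : nat}.
Implicit Types (K : Rn R n -> Rn R n -> R) (f : Rn R n -> R).

Definition integrand K (b : R) f x (y : Rn R n) : R :=
  K x y * f y * weight b y.

(* The integral operator with kernel [K]; its values are extended by 0 outside
   the ball, where the kernel has no meaning. *)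
Definition intop K (b : R) f : Rn R n -> R :=
  (fun x => \int[nu]_(y in uball) integrand K b f x y) \_ uball.

(* Boundedness from L^p_alpha to L^q_beta.  The first clause says that the
   operator is defined at [f]: the integral converges absolutely for almost
   every x in the ball. *)
Definition bounded_intop K (b alpha p beta q : R) : Prop :=
  exists C : R, forall f, f \in Lfun (nu_ alpha) p%:E ->
    [/\ {ae nu, forall x, uball x ->
          nu.-integrable uball (EFin \o integrand K b f x)},
        intop K b f \in Lfun (nu_ beta) q%:E &
        ('N[nu_ beta]_(q%:E)[EFin \o intop K b f] <=
          C%:E * 'N[nu_ alpha]_(p%:E)[EFin \o f])%E].

Variable Z : nat -> Rn R n -> Rn R n -> R.

Definition T_bounded (b c alpha p beta q : R) : Prop :=
  bounded_intop (bergman_besov Z c) b alpha p beta q.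

Definition S_bounded (b c alpha p beta q : R) : Prop :=
  bounded_intop (fun x y => `|bergman_besov Z c x y|) b alpha p beta q.

End Operators.

(* Main.v *)
(* The integrand of T_bc f is f against R_c(x,y)(1-|y|^2)^b, so for p = 1 Minkowski's (here Jensen's)
   inequality reduces everything to sup_y (1-|y|^2)^(b-alpha) ||R_c(.,y)||, in the norm of L^q_beta.
   Averaging against Gaussians shows Z_k(x,y) = dim H_k |x|^k|y|^k G_k(cos) with G_k a normalised Gegenbauer
   polynomial; its generating function solves a first order differential equation in the radius, which gives
   the closed form of the Poisson kernel, P = (1-r^2)Q^(-n/2) with Q = 1-2rt+r^2. The kernel whose
   multipliers are (n/2+m)_k/(n/2)_k is (1-r)^(-m) P times a bounded factor, and real exponents are reached
   by averaging over the radius with a Beta density. Hence the q-th means of R_c over spheres are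
   O((1-r)^(-eq)) with e = n+c-(n-1)/q (any e > 0 if this is not positive), which is what sufficiency needs.

   For necessity, T_bc is tested on f = 1_A P(r_0 y/|y|, eta) (1-|y|^2)^(-b), A a thin shell near |y| = r_0, and
   T_bc f is paired with the Poisson kernel on each sphere: the semigroup property turns the pairing
   into sum_k gamma_k dim H_k rho^k, which is bounded below by a multiple of (1-rho)^(-(n+c)). No oscillation
   of R_c enters, so boundedness of T_bc alone already forces the one-dimensional inequality. *)
Require Import Defs.
From HB Require Import structures.
From mathcomp Require Import all_boot all_order all_algebra.
From mathcomp Require mpoly.
Import -(notations) mpoly.
From mathcomp Require Import all_classical all_reals all_analysis.
From mathcomp Require Import measurable_realfun.
From mathcomp Require Import ring lra zify.
Set Implicit Arguments.
Unset Strict Implicit.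
Unset Printing Implicit Defensive.
Import Order.TTheory GRing.Theory Num.Theory.
Import numFieldNormedType.Exports.
Import HBNNSimple.
Local Open Scope classical_set_scope.
Local Open Scope ring_scope.

(** Three obstacles shape the details. The surface measure is a pushforward of volume, so Green's
    formula on the sphere is replaced by its polynomial form, int lap p = k(k+n-2) int p, read off
    the recurrence of Gaussian moments; orthogonality and the reproducing property both follow from
    it. Next, the radial Beta average can only lower the order of a kernel, so the estimates start
    from an integer order above c, or, for the second form of gamma_k, from the Poisson kernel
    lowered twice. Finally, R_c has no sign while Tonelli needs one: on the test shell |R_c| is
    bounded by a constant M, the kernel R_c + M is used instead, and M cancels because the Poisson
    kernel has mean 1. The two alternatives of the condition come from the radial integral of
    (1-s)^beta (1-s|y|)^(-eq). If alpha < b it may grow like a power, which tolerates equality in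
    the bound on c; if alpha = b it must stay bounded, and equality would produce a logarithm. T and
    S are treated at once through an abstract kernel K with R_c <= K and |K| <= |R_c|. *)

Section IntegralDensity.
Context d (T : measurableType d) (R : realType).
Variables (mu : {measure set T -> \bar R}) (w : T -> R).
Hypotheses (mw : measurable_fun setT w) (w0 : forall x, 0 <= w x).

(** [density] is given on sets only: the formula is its definition on indicators ([ind]), extends by
    linearity to simple functions ([sf]), and then by monotone convergence on both sides. *)
Lemma ge0_integral_density (f : T -> \bar R) :
  measurable_fun setT f -> (forall x, 0 <= f x)%E ->
  (\int[density_measure mu mw w0]_x f x = \int[mu]_x (f x * (w x)%:E))%E.
Proof.
move=> mf f0.
have mwE : measurable_fun setT (EFin \o w) by exact/measurable_EFinP.
have ind (A : set T) : measurable A ->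
  (\int[density_measure mu mw w0]_x (\1_A x)%:E = \int[mu]_x ((\1_A x)%:E * (w x)%:E))%E.
  move=> mA; rewrite integral_indic// setIT /density_measure /= /density.
  rewrite integral_mkcond; apply: eq_integral => x _.
  by rewrite patchE indicE; case: (x \in A); rewrite ?mul1e ?mul0e.
pose g := nnsfun_approx measurableT mf.
have sf (h : {nnsfun T >-> R}) :
  (\int[density_measure mu mw w0]_x (h x)%:E = \int[mu]_x ((h x)%:E * (w x)%:E))%E.
  under eq_integral do rewrite fimfunE -fsumEFin//.
  rewrite ge0_integral_fsum//; last 2 first.
  - by move=> r; exact/measurable_EFinP/measurableT_comp.
  - by move=> r x _; rewrite EFinM nnfun_muleindic_ge0.
  transitivity (\sum_(y \in range h)
     (\int[mu]_x ((y * \1_(h @^-1` [set y]) x)%:E * (w x)%:E)))%E.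
    apply: eq_fsbigr => r rh.
    have r0 : 0 <= r by move: rh => /set_mem[x _ <-].
    under eq_integral do rewrite EFinM.
    rewrite ge0_integralZl//; last first.
      by apply/measurable_EFinP; exact: measurable_indic.
    rewrite ind// -ge0_integralZl//; last 2 first.
    - by apply: emeasurable_funM => //; apply/measurable_EFinP; exact: measurable_indic.
    - by move=> x _; rewrite mule_ge0// lee_fin.
    by apply: eq_integral => x _; rewrite EFinM muleA.
  rewrite -ge0_integral_fsum//; last 2 first.
  - by move=> r; apply: emeasurable_funM => //; exact/measurable_EFinP/measurableT_comp.
  - move=> r x _; apply: mule_ge0; last by rewrite lee_fin.
    by rewrite EFinM nnfun_muleindic_ge0.
  apply: eq_integral => x _; rewrite [in RHS]fimfunE -fsumEFin//.
  rewrite ge0_mule_fsuml//.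
  by move=> r; rewrite EFinM nnfun_muleindic_ge0.
have h1 := @cvg_monotone_convergence _ _ _ (density_measure mu mw w0) _ measurableT
  (fun n => EFin \o g n).
have h2 := @cvg_monotone_convergence _ _ _ mu _ measurableT
  (fun n x => (g n x)%:E * (w x)%:E)%E.
have gf x : (EFin \o g^~ x) n @[n --> \oo] --> f x.
  by apply: cvg_nnsfun_approx.
have nd x : nondecreasing_seq (fun n => (g n x)%:E).
  by move=> m n mn; rewrite lee_fin; exact/lefP/nd_nnsfun_approx.
have l1 : (\int[density_measure mu mw w0]_x (g n x)%:E @[n --> \oo] -->
     \int[density_measure mu mw w0]_x f x)%E.
  rewrite (_ : (\int[_]_x f x)%E = (\int[density_measure mu mw w0]_x limn (fun n => (g n x)%:E))%E).
    apply: h1.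
    - by move=> n; exact/measurable_EFinP.
    - by move=> n x _; rewrite lee_fin.
    - by move=> x _; exact: nd.
  by apply: eq_integral => x _; apply/esym/cvg_lim => //; exact: gf.
have l2 : (\int[mu]_x ((g n x)%:E * (w x)%:E) @[n --> \oo] -->
     \int[mu]_x (f x * (w x)%:E))%E.
  rewrite (_ : (\int[_]_x (f x * _))%E = (\int[mu]_x limn (fun n => (g n x)%:E * (w x)%:E))%E).
    apply: h2.
    - by move=> n; apply: emeasurable_funM => //; exact/measurable_EFinP.
    - by move=> n x _; rewrite mule_ge0// lee_fin.
    - by move=> x _ m n mn; rewrite lee_wpmul2r ?lee_fin//; exact/lefP/nd_nnsfun_approx.
  by apply: eq_integral => x _; apply/esym/cvg_lim => //; apply: cvgeZr => //; exact: gf.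
apply: (cvg_unique _ l1) => //.
apply: cvg_trans l2; apply: near_eq_cvg; apply: nearW => n /=.
by rewrite -sf.
Qed.

End IntegralDensity.

Section JensenHoelder.
Context d (T : measurableType d) (R : realType).
Variables (mu : {measure set T -> \bar R}).

Lemma Rpow_conj (q : R) : 1 < q -> q^-1 + (1 - q^-1)^-1^-1 = 1.
Proof. by move=> q1; rewrite invrK addrC subrK. Qed.

(* Hoelder's inequality for the pair [g h^(1/q)], [h^(1-1/q)]. *)
Lemma jensen_hoelder (D : set T) (g h : T -> R) (q : R) : 1 <= q -> measurable D ->
  measurable_fun D g -> measurable_fun D h ->
  (forall x, D x -> 0 <= g x) -> (forall x, D x -> 0 <= h x) ->
  ((\int[mu]_(x in D) (g x * h x)%:E) `^ q <=
   (\int[mu]_(x in D) (h x)%:E) `^ (q - 1) *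
   \int[mu]_(x in D) (g x `^ q * h x)%:E)%E.
Proof.
move=> q1 mD mg mh g0 h0.
have q0 : 0 < q by apply: lt_le_trans q1.
move: q1; rewrite le_eqVlt => /predU1P[<-|q1].
  rewrite subrr poweRe0 mul1e poweRe1; last first.
    by apply: integral_ge0 => x Dx; rewrite lee_fin mulr_ge0 ?g0 ?h0.
  by apply: ge0_le_integral => //=;
    [move=> x Dx; rewrite lee_fin mulr_ge0 ?g0 ?h0|
     apply/measurable_EFinP/measurable_funM => //|
     by apply/measurable_EFinP/measurable_funM => //; apply: (measurableT_comp (measurable_powR 1))|
     move=> x Dx; rewrite powRr1// g0].
pose p := (1 - q^-1)^-1.
have qi : 0 < 1 - q^-1 by rewrite subr_gt0 invf_lt1.
have p0 : 0 < p by rewrite invr_gt0.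
pose f1 := (fun x => g x * h x `^ (q^-1)) \_ D.
pose f2 := (fun x => h x `^ (1 - q^-1)) \_ D.
have mf1 : measurable_fun setT f1.
  apply/(measurable_restrictT _ _).1 => //; apply: measurable_funM => //.
  exact: (measurableT_comp (measurable_powR _)).
have mf2 : measurable_fun setT f2.
  apply/(measurable_restrictT _ _).1 => //.
  exact: (measurableT_comp (measurable_powR _)).
have := @hoelder _ _ _ mu f1 f2 q p mf1 mf2 q0 p0 (Rpow_conj q1).
have -> : ('N[mu]_1[EFin \o (f1 \* f2)%R] = \int[mu]_(x in D) (g x * h x)%:E)%E.
  rewrite Lnorm1 [RHS]integral_mkcond; apply: eq_integral => x _ /=.
  rewrite /f1 /f2 !patchE; case: ifPn => [/set_mem Dx|_]; last by rewrite mul0r normr0.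
  rewrite -mulrA -powRD; last by rewrite addrC subrK oner_eq0.
  by rewrite (addrC (q^-1)) subrK powRr1 ?h0// ger0_norm// mulr_ge0 ?g0 ?h0.
have -> : ('N[mu]_q%:E[EFin \o f1] = (\int[mu]_(x in D) (g x `^ q * h x)%:E) `^ q^-1)%E.
  rewrite unlock; congr (_ `^ _)%E.
  rewrite [RHS]integral_mkcond; apply: eq_integral => x _ /=.
  rewrite /f1 patchE [in RHS]patchE; case: ifPn => [/set_mem Dx|_]; last first.
    by rewrite normr0 powR0// gt_eqF.
  rewrite ger0_norm ?mulr_ge0 ?powR_ge0 ?g0// powRM ?powR_ge0 ?g0//.
  by rewrite -powRrM mulVf ?gt_eqF// powRr1// h0.
have -> : ('N[mu]_p%:E[EFin \o f2] = (\int[mu]_(x in D) (h x)%:E) `^ (1 - q^-1))%E.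
  rewrite unlock invrK; congr (_ `^ _)%E.
  rewrite [RHS]integral_mkcond; apply: eq_integral => x _ /=.
  rewrite /f2 patchE [in RHS]patchE; case: ifPn => [/set_mem Dx|_]; last first.
    by rewrite normr0 powR0// gt_eqF.
  rewrite ger0_norm ?powR_ge0// -powRrM divff ?gt_eqF//.
  by rewrite powRr1// h0.
have I0 : (0 <= \int[mu]_(x in D) (h x)%:E)%E.
  by apply: integral_ge0 => x Dx; rewrite lee_fin h0.
have I1 : (0 <= \int[mu]_(x in D) (g x `^ q * h x)%:E)%E.
  by apply: integral_ge0 => x Dx; rewrite lee_fin mulr_ge0 ?powR_ge0 ?h0.
move=> /(gt0_ler_poweR (ltW q0)) => /(_ _ _)/le_trans; apply.
- by rewrite in_itv/= leey andbT; apply: integral_ge0 => x Dx; rewrite lee_fin mulr_ge0 ?g0 ?h0.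
- by rewrite in_itv/= leey andbT mule_ge0 ?poweR_ge0.
rewrite poweRM ?poweR_ge0// -!poweRrM mulVf ?gt_eqF// poweRe1// muleC mulrBl mul1r mulVf ?gt_eqF//.
Qed.

End JensenHoelder.

Section RealIntegrand.
Context d (T : measurableType d) (R : realType).
Variables (mu : {measure set T -> \bar R}) (D : set T).
Hypothesis mD : measurable D.
Implicit Types f g : T -> R.

Lemma integralZlR f (k : R) : measurable_fun D f -> (forall x, D x -> 0 <= f x) ->
  0 <= k -> (\int[mu]_(x in D) (k * f x)%:E = k%:E * \int[mu]_(x in D) (f x)%:E)%E.
Proof.
move=> mf f0 k0; rewrite -ge0_integralZl ?lee_fin//.
exact/measurable_EFinP.
Qed.

Lemma integralDR f g : measurable_fun D f -> (forall x, D x -> 0 <= f x) ->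
  measurable_fun D g -> (forall x, D x -> 0 <= g x) ->
  (\int[mu]_(x in D) (f x + g x)%:E =
   \int[mu]_(x in D) (f x)%:E + \int[mu]_(x in D) (g x)%:E)%E.
Proof.
by move=> mf f0 mg g0; rewrite -ge0_integralD//; exact/measurable_EFinP.
Qed.

Lemma le_integralR f g : measurable_fun D f -> measurable_fun D g ->
  (forall x, D x -> 0 <= f x) -> (forall x, D x -> f x <= g x) ->
  (\int[mu]_(x in D) (f x)%:E <= \int[mu]_(x in D) (g x)%:E)%E.
Proof. by move=> mf mg f0 fg; apply: ge0_le_integral => //; exact/measurable_EFinP. Qed.

End RealIntegrand.

(** * Calculus on the half-line and the Beta integral *)

Section RealDerivatives.
Context {R : realType}.
Implicit Types (f g : R -> R) (x : R).

(** The rules of differentiation on explicit lambda terms: a derivative is assembled as one proof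
    term and matched with the wanted expression by [is_derive_eq] and [ring]. *)
Lemma isd_cst (c : R) x : is_derive x 1 (fun=> c) 0.
Proof. exact: is_derive_cst. Qed.

Lemma isd_id x : is_derive x 1 (fun y : R => y) 1.
Proof. exact: is_derive_id. Qed.

Lemma isdM f g x (a b : R) : is_derive x 1 f a -> is_derive x 1 g b ->
  is_derive x 1 (fun y => f y * g y) (f x * b + a * g x).
Proof.
move=> df dg; have -> : (fun y => f y * g y) = f * g by [].
by apply: is_derive_eq; rewrite /GRing.scale/= (mulrC a).
Qed.

Lemma isdD f g x (a b : R) : is_derive x 1 f a -> is_derive x 1 g b ->
  is_derive x 1 (fun y => f y + g y) (a + b).
Proof. by move=> df dg; have -> : (fun y => f y + g y) = f + g by []; apply: is_deriveD. Qed.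

Lemma isdB f g x (a b : R) : is_derive x 1 f a -> is_derive x 1 g b ->
  is_derive x 1 (fun y => f y - g y) (a - b).
Proof. by move=> df dg; have -> : (fun y => f y - g y) = f - g by []; apply: is_deriveB. Qed.

Lemma isdN f x (a : R) : is_derive x 1 f a -> is_derive x 1 (fun y => - f y) (- a).
Proof. by move=> df; have -> : (fun y => - f y) = - f by []; apply: is_deriveN. Qed.

Lemma isdZ f x (k a : R) : is_derive x 1 f a -> is_derive x 1 (fun y => k * f y) (k * a).
Proof. by move=> df; apply: is_deriveZ. Qed.

Lemma isdX f x n (a : R) : is_derive x 1 f a ->
  is_derive x 1 (fun y => f y ^+ n) (n%:R * f x ^+ n.-1 * a).
Proof.
move=> df; have -> : (fun y => f y ^+ n) = f ^+ n.
  by apply/funext => y; rewrite fctE.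
by apply: is_derive_eq.
Qed.

Lemma isdV f x (a : R) : f x != 0 -> is_derive x 1 f a ->
  is_derive x 1 (fun y => (f y)^-1) (- (f x)^-1 ^+ 2 * a).
Proof. by move=> fx df; rewrite exprVn; apply: is_deriveV. Qed.

Lemma isd_expR f x (a : R) : is_derive x 1 f a ->
  is_derive x 1 (fun y => expR (f y)) (expR (f x) * a).
Proof. by move=> df; apply: (is_derive1_comp (f := expR)). Qed.

Lemma isd_powR f x (r a : R) : 0 < f x -> is_derive x 1 f a ->
  is_derive x 1 (fun y => f y `^ r) (r * f x `^ (r - 1) * a).
Proof.
move=> fx df; apply: (is_derive1_comp (f := (@powR R) ^~ r)).
apply: DeriveDef; first by apply: derivable_powR; rewrite in_itv/= fx.
by rewrite -derive1E powR_derive1// in_itv/= fx.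
Qed.

Lemma isd_cont f x (a : R) : is_derive x 1 f a -> {for x, continuous f}.
Proof.
move=> [df _]; apply/differentiable_continuous.
by rewrite -derivable1_diffP.
Qed.

End RealDerivatives.

Section ImproperFTC.
Context {R : realType}.
Local Notation mu := (@lebesgue_measure R).

(** The derivative is split as f - g with both parts nonnegative, because either integral may be
    infinite; keeping g on the right avoids a difference of infinities. On each segment this is the
    usual theorem, and monotone convergence handles f and g separately as the segments exhaust D. *)
Lemma improper_FTC (D : set R) (u v : R^nat) (f g F : R -> R) (l : R) :
  (forall x, D x -> is_derive x 1 F (f x - g x)) ->
  open D -> (forall n, u n < v n) -> nonincreasing_seq u -> nondecreasing_seq v ->
  D = \bigcup_n `[u n, v n]%classic ->
  (forall x, D x -> 0 <= f x) -> (forall x, D x -> 0 <= g x) ->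
  (forall x, D x -> {for x, continuous f}) ->
  (forall x, D x -> {for x, continuous g}) ->
  F (v n) - F (u n) @[n --> \oo] --> l ->
  (\int[mu]_(x in D) (f x)%:E = \int[mu]_(x in D) (g x)%:E + l%:E)%E.
Proof.
move=> dF oD uv ndu ndv DE f0 g0 cf cg Fl.
have sub n : `[u n, v n]%classic `<=` D by rewrite DE => x xn; exists n.
have mf (h : R -> R) : (forall x, D x -> {for x, continuous h}) -> measurable_fun D h.
  by move=> ch; apply: open_continuous_measurable_fun => // x /set_mem; exact: ch.
have wc n (h : R -> R) : (forall x, D x -> {for x, continuous h}) ->
    {within `[u n, v n]%classic, continuous h}.
  by move=> ch; apply: continuous_in_subspaceT => x /set_mem/sub; exact: ch.
have nd : nondecreasing_seq (fun n => `[u n, v n]%classic).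
  move=> m n mn; apply/subsetPset; apply: subset_itv; rewrite bnd_simp.
    exact: ndu.
  exact: ndv.
have cv (h : R -> R) : (forall x, D x -> 0 <= h x) ->
    (forall x, D x -> {for x, continuous h}) ->
    (\int[mu]_(x in `[u n, v n]) (h x)%:E @[n --> \oo] --> \int[mu]_(x in D) (h x)%:E)%E.
  move=> h0 ch; rewrite DE; apply: ge0_nondecreasing_set_cvg_integral => //.
    move=> n; apply/measurable_EFinP; apply: (measurable_funS (open_measurable oD) (sub n)).
    exact: mf.
  by move=> n x /sub Dx; rewrite lee_fin h0.
have key n : (\int[mu]_(x in `[u n, v n]) (f x)%:E =
    \int[mu]_(x in `[u n, v n]) (g x)%:E + (F (v n) - F (u n))%:E)%E.
  have cfg : forall x, D x -> {for x, continuous (f \- g)}.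
    by move=> x Dx; apply: continuousB; [exact: cf|exact: cg].
  have i h : (forall x, D x -> {for x, continuous h}) ->
      mu.-integrable `[u n, v n] (EFin \o h).
    move=> ch; apply: continuous_compact_integrable; first exact: segment_compact.
    exact: wc.
  have dn x : x \in `[u n, v n] -> is_derive x 1 F (f x - g x).
    by move=> xn; apply: dF; apply: (sub n).
  have cn x : x \in `[u n, v n] -> {for x, continuous F}.
    by move=> /dn; exact: isd_cont.
  have := @continuous_FTC2 _ (f \- g) F _ _ (uv n) (wc n _ cfg).
  rewrite integralB_EFin//; [|exact: i..].
  move=> H; rewrite EFinB -H.
  - by rewrite addeC subeK//; apply: integrable_fin_num => //; exact: i.
  - split.
    + by move=> x /subset_itv_oo_cc/dn[].
    + by apply/cvg_at_right_filter/cn; rewrite in_itv/= lexx ltW.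
    + by apply/cvg_at_left_filter/cn; rewrite in_itv/= lexx ltW.
  - by move=> x /subset_itv_oo_cc/dn[? ?]; rewrite derive1E.
have c1 := cv f f0 cf.
have c2 : (\int[mu]_(x in `[u n, v n]) (g x)%:E + (F (v n) - F (u n))%:E @[n --> \oo] -->
   \int[mu]_(x in D) (g x)%:E + l%:E)%E.
  apply: cvgeD; first by rewrite fin_num_adde_defl.
    exact: cv.
  by apply: cvg_EFin => //; exact: nearW.
apply: (cvg_unique _ c1) => //.
by apply: cvg_trans c2; apply: near_eq_cvg; apply: nearW => n; rewrite key.
Qed.

Lemma FTC_oo (a b la lb : R) (f g F : R -> R) :
  (forall x, a < x < b -> is_derive x 1 F (f x - g x)) ->
  a < b ->
  (forall x, a < x < b -> 0 <= f x) -> (forall x, a < x < b -> 0 <= g x) ->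
  (forall x, a < x < b -> {for x, continuous f}) ->
  (forall x, a < x < b -> {for x, continuous g}) ->
  F x @[x --> a^'+] --> la -> F x @[x --> b^'-] --> lb ->
  (\int[mu]_(x in `]a, b[) (f x)%:E = \int[mu]_(x in `]a, b[) (g x)%:E + (lb - la)%:E)%E.
Proof.
move=> dF ab f0 g0 cf cg Fa Fb.
(* The denominators start at 3, so that a + e n < b - e n already holds for n = 0. *)
pose e (n : nat) := (b - a) / n.+3%:R.
have e0 n : 0 < e n by rewrite divr_gt0 ?subr_gt0.
have ecv : e n @[n --> \oo] --> (0:R).
  rewrite -(mulr0 (b - a)); apply: cvgM; first exact: cvg_cst.
  apply: (@cvg_comp _ _ _ (fun n => n.+2) (fun n : nat => n.+1%:R^-1) _ \oo).
    apply/cvgnyPge => m; near=> n; rewrite (leq_trans (n := n)) ?leqnSn//.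
      by near: n; exact: nbhs_infty_ge.
    by rewrite -addn2 leq_addr.
  exact: cvg_harmonic.
have nde m n : (m <= n)%N -> e n <= e m.
  by move=> mn; rewrite ler_pM2l ?subr_gt0// lef_pV2 ?posrE// ler_nat.
have e3 n : e n <= (b - a) / 3 by rewrite ler_pM2l ?subr_gt0// lef_pV2 ?posrE// ler_nat.
have ba : 0 < b - a by rewrite subr_gt0.
have I x : `]a, b[%classic x -> a < x < b by rewrite /= in_itv.
have dF' x : `]a, b[%classic x -> is_derive x 1 F (f x - g x).
  by move=> h; apply: dF; exact: I.
apply: (improper_FTC (u := fun n => a + e n) (v := fun n => b - e n) dF').
- exact: interval_open.
- by move=> n; have := e3 n; lra.
- by move=> m n mn; rewrite lerD2l nde.
- by move=> m n mn; rewrite lerB ?nde.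
- apply/seteqP; split => x /=; rewrite in_itv/=; last first.
    by move=> [n _]; rewrite /= in_itv/= => /andP[? ?]; have := e0 n; lra.
  move=> /andP[ax xb].
  have /cvgrPdist_lt/(_ (Num.min (x - a) (b - x))) := ecv.
  rewrite lt_min !subr_gt0 ax xb => /(_ isT)[N _ /(_ N (leqnn N))].
  rewrite sub0r normrN gtr0_norm// lt_min => /andP[h1 h2].
  by exists N => //=; rewrite in_itv/=; lra.
- by move=> x /I; exact: f0.
- by move=> x /I; exact: g0.
- by move=> x /I; exact: cf.
- by move=> x /I; exact: cg.
- apply: cvgB.
    move/cvg_at_leftP : Fb; apply; split; first by move=> n; rewrite ltrBlDr ltrDl.
    by rewrite -[X in _ --> X]subr0; apply: cvgB => //; exact: cvg_cst.
  move/cvg_at_rightP : Fa; apply; split; first by move=> n; rewrite ltrDl.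
  by rewrite -[X in _ --> X]addr0; apply: cvgD => //; exact: cvg_cst.
Unshelve. all: by end_near. Qed.

Lemma FTC_oy (l0 loo : R) (f g F : R -> R) :
  (forall x : R, 0 < x -> is_derive x 1 F (f x - g x)) ->
  (forall x : R, 0 < x -> 0 <= f x) -> (forall x, 0 < x -> 0 <= g x) ->
  (forall x : R, 0 < x -> {for x, continuous f}) ->
  (forall x : R, 0 < x -> {for x, continuous g}) ->
  F x @[x --> 0^'+] --> l0 -> F x @[x --> +oo] --> loo ->
  (\int[mu]_(x in `]0%R, +oo[) (f x)%:E = \int[mu]_(x in `]0%R, +oo[) (g x)%:E + (loo - l0)%:E)%E.
Proof.
move=> dF f0 g0 cf cg Fa Fb.
have I (x : R) : `]0, +oo[%classic x -> 0 < x by rewrite /= in_itv/= andbT.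
have dF' (x : R) : `]0, +oo[%classic x -> is_derive x 1 F (f x - g x).
  by move=> h; apply: dF; exact: I.
apply: (improper_FTC (u := fun n => n.+2%:R^-1) (v := fun n => n.+2%:R) dF').
- exact: interval_open.
- by move=> n; rewrite (@lt_trans _ _ 1) ?invf_lt1 ?ltr1n.
- by move=> m n mn; rewrite lef_pV2 ?posrE// ler_nat.
- by move=> m n mn; rewrite ler_nat.
- apply/seteqP; split => x /=; rewrite in_itv/= andbT; last first.
    move=> [n _]; rewrite /= in_itv/= => /andP[+ _].
    by apply: lt_le_trans.
  move=> x0.
  pose N := maxn (Num.bound x) (Num.bound x^-1).
  have h1 : x < N.+2%:R.
    apply: (lt_le_trans (archi_boundP (ltW x0))); rewrite ler_nat.
    by rewrite (leq_trans (leq_maxl _ (Num.bound x^-1)))// -addn2 leq_addr.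
  have h2 : x^-1 < N.+2%:R.
    have xi : 0 <= x^-1 by rewrite invr_ge0 ltW.
    apply: (lt_le_trans (archi_boundP xi)); rewrite ler_nat.
    by rewrite (leq_trans (leq_maxr (Num.bound x) _))// -addn2 leq_addr.
  exists N => //=; rewrite in_itv/= (ltW h1) andbT.
  by rewrite -(invrK x) lef_pV2 ?posrE ?invr_gt0// ltW.
- by move=> x /I; exact: f0.
- by move=> x /I; exact: g0.
- by move=> x /I; exact: cf.
- by move=> x /I; exact: cg.
- have h : (fun n => n.+2%:R : R) @ \oo --> +oo.
    apply/cvgryPge => A; near=> n; apply: (@le_trans _ _ n%:R); last by rewrite ler_nat -addn2 leq_addr.
    by near: n; exact: nbhs_infty_ger.
  apply: cvgB.
    by move/cvg_pinftyP : Fb; apply.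
  move/cvg_at_rightP : Fa; apply; split; first by move=> n; rewrite invr_gt0.
  by apply/gtr0_cvgV0 => //; apply: nearW => n.
Unshelve. all: by end_near. Qed.

End ImproperFTC.

(** * Elementary estimates for real powers and limits at endpoints *)

Section PowerBounds.
Context {R : realType}.
Implicit Types (a d r t x : R).

(** On this range |ln t| <= ln 2, whatever the sign of r. Every factor that stays away from 0, such
    as (1 + |x|)^a or s^(a-1) for s >= 1/2, is absorbed into a constant this way. *)
Lemma powR_half2 r t : 2^-1 <= t <= 2 -> 2 `^ (- `|r|) <= t `^ r <= 2 `^ `|r|.
Proof.
move=> /andP[h1 h2]; have t0 : 0 < t by apply: lt_le_trans h1.
have l1 : `|ln t| <= ln 2.
  rewrite ler_norml; apply/andP; split; last by rewrite ler_ln ?posrE.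
  by rewrite -lnV ?posrE// ler_ln ?posrE.
have : `|r * ln t| <= `|r| * ln 2 by rewrite normrM ler_wpM2l.
rewrite /powR !gt_eqF// ler_norml => /andP[h3 h4].
by rewrite !ler_expR mulNr h3.
Qed.

Lemma ler_powRN (e x y : R) : 0 <= e -> 0 < x -> x <= y -> y `^ (- e) <= x `^ (- e).
Proof.
move=> e0 x0 xy; have y0 : 0 < y by apply: lt_le_trans xy.
rewrite !powRN lef_pV2 ?posrE ?powR_gt0//.
by apply: ge0_ler_powR => //; rewrite nnegrE ltW.
Qed.

Lemma powRN_ge1 (e x : R) : 0 <= e -> 0 < x <= 1 -> 1 <= x `^ (- e).
Proof. by move=> e0 /andP[x0 x1]; have := ler_powRN e0 x0 x1; rewrite powR1. Qed.

Lemma cvg_at_left1 (F : R -> R) d (C : R) : 0 < d ->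
  (forall x, 0 < x < 1 -> `|F x| <= C * (1 - x) `^ d) -> F x @[x --> 1^'-] --> 0.
Proof.
move=> d0 FC; apply/cvgr0Pnorm_lt => e e0.
pose k := (e / (`|C| + 1)) `^ d^-1.
have C1 : 0 < `|C| + 1 by rewrite ltr_wpDl.
have k0 : 0 < k by rewrite powR_gt0// divr_gt0.
near=> x.
have x1 : x < 1 by near: x; exact: nbhs_left_lt.
have x0 : 0 < x by near: x; apply: nbhs_left_gt.
have xk : 1 - x < k.
  by rewrite ltrBlDr -ltrBlDl; near: x; apply: nbhs_left_gt; rewrite ltrBlDr ltrDl.
apply: (le_lt_trans (FC x _)); first by rewrite x0.
have : (1 - x) `^ d < k `^ d by apply: gt0_ltr_powR => //; rewrite nnegrE ?subr_ge0 ltW.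
rewrite /k -powRrM mulVf ?gt_eqF// powRr1 ?divr_ge0 ?ltW// ltr_pdivlMr// mulrDr mulr1 => h.
apply: le_lt_trans h.
rewrite (le_trans _ (_ : (1 - x) `^ d * `|C| <= _))// ?lerDl ?powR_ge0//.
by rewrite mulrC ler_wpM2l ?powR_ge0// ler_norm.
Unshelve. all: by end_near. Qed.

Lemma cvg_at_right0 (F : R -> R) a (C : R) : 0 < a ->
  (forall x, 0 < x < 1 -> `|F x| <= C * x `^ a) -> F x @[x --> 0^'+] --> 0.
Proof.
move=> a0 FC; apply/cvgr0Pnorm_lt => e e0.
pose k := (e / (`|C| + 1)) `^ a^-1.
have C1 : 0 < `|C| + 1 by rewrite ltr_wpDl.
have k0 : 0 < k by rewrite powR_gt0// divr_gt0.
near=> x.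
have x1 : x < 1 by near: x; exact: nbhs_right_lt.
have x0 : 0 < x by near: x; apply: nbhs_right_gt.
have xk : x < k by near: x; exact: nbhs_right_lt.
apply: (le_lt_trans (FC x _)); first by rewrite x0.
have : x `^ a < k `^ a by apply: gt0_ltr_powR => //; rewrite nnegrE ltW.
rewrite /k -powRrM mulVf ?gt_eqF// powRr1 ?divr_ge0 ?ltW// ltr_pdivlMr// mulrDr mulr1 => h.
apply: le_lt_trans h.
rewrite (le_trans _ (_ : x `^ a * `|C| <= _))// ?lerDl ?powR_ge0//.
by rewrite mulrC ler_wpM2l ?powR_ge0// ler_norm.
Unshelve. all: by end_near. Qed.

(** With N an integer above |r|, the term of degree N + 1 of the exponential series gives x^r e^(-x)
    <= (N+1)! / x for x >= 1. *)
Lemma powR_expN_cvg0 (F : R -> R) r (C : R) :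
  (forall x, 1 <= x -> `|F x| <= C * (x `^ r * expR (- x))) -> F x @[x --> +oo] --> 0.
Proof.
move=> FC; pose N := Num.bound `|r|.
apply/cvgr0Pnorm_lt => e e0.
have C1 : 0 < `|C| + 1 by rewrite ltr_wpDl.
near=> x.
have x1 : 1 <= x by near: x; apply: nbhs_pinfty_ge; exact: num_real.
have x0 : 0 < x by apply: lt_le_trans x1.
have xk : (`|C| + 1) * N.+1`!%:R / e < x.
  by near: x; apply: nbhs_pinfty_gt; exact: num_real.
apply: (le_lt_trans (FC x x1)).
have h1 : x `^ r <= x ^+ N.
  rewrite -(powR_mulrn N (ltW x0)); apply: ler_powR => //.
  by rewrite (le_trans (ler_norm r))// ltW// archi_boundP.
have h2 : x ^+ N.+1 / N.+1`!%:R <= expR x.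
  by apply: le_trans (expR_ge1Dxn N (ltW x0)); rewrite lerDr.
have h3 : x `^ r * expR (- x) <= N.+1`!%:R / x.
  rewrite expRN ler_pdivrMr ?expR_gt0// (le_trans h1)//.
  rewrite -ler_pdivrMl ?divr_gt0 ?ltr0n ?fact_gt0// (le_trans _ h2)//.
  by rewrite invf_div mulrAC exprSr (mulrC x).
apply: (@le_lt_trans _ _ ((`|C| + 1) * (N.+1`!%:R / x))).
  apply: (@le_trans _ _ ((`|C| + 1) * (x `^ r * expR (- x)))).
    by rewrite ler_wpM2r ?mulr_ge0 ?powR_ge0 ?expR_ge0// (le_trans (ler_norm C))// lerDl.
  by rewrite ler_wpM2l// ltW.
by rewrite mulrA ltr_pdivrMr// -ltr_pdivrMl// mulrC.
Unshelve. all: by end_near. Qed.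

End PowerBounds.

(** * The Gamma integral: functional equation, finiteness, positivity *)

Section GammaFunction.
Context {R : realType}.
Local Notation mu := (@lebesgue_measure R).

Lemma measurable_powR_exp (a : R) (D : set R) : measurable_fun D (fun t : R => (t `^ a * expR (- t))%:E).
Proof.
apply/measurable_EFinP; apply: (measurable_funS measurableT) => //.
apply: measurable_funM; first exact: measurable_powR.
by apply: (measurableT_comp (f := expR)) => //; exact: measurable_expR.
Qed.

(** Valued in the extended reals: the functional equation is proved before finiteness is known, and
    finiteness is then deduced from it. *)
Definition eGamma (a : R) : \bar R := (\int[mu]_(t in `]0%R, +oo[) (t `^ (a - 1) * expR (- t))%:E)%E.

Lemma GammaE (a : R) : Gamma a = fine (eGamma a).
Proof. by []. Qed.

Lemma eGamma_ge0 a : (0 <= eGamma a)%E.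
Proof. by apply: integral_ge0 => x _; rewrite lee_fin mulr_ge0 ?powR_ge0 ?expR_ge0. Qed.

Lemma isd_expRN (x : R) : is_derive x 1 (fun y : R => expR (- y)) (- expR (- x)).
Proof.
apply: (is_derive_eq (isd_expR (isdN (is_derive_id x 1)))).
by rewrite mulrN1.
Qed.

Lemma isd_powR_expN (a x : R) : 0 < x ->
  is_derive x 1 (fun y : R => y `^ a * expR (- y))
    (a * x `^ (a - 1) * expR (- x) - x `^ a * expR (- x)).
Proof.
move=> x0; apply: (is_derive_eq (isdM (isd_powR a (x0 : 0 < id x) (is_derive_id x 1)) (isd_expRN x))).
by rewrite mulr1 mulrN addrC.
Qed.

Lemma cont_powR_expN (a x : R) : 0 < x -> {for x, continuous (fun y : R => y `^ a * expR (- y))}.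
Proof. by move=> /(isd_powR_expN a); exact: isd_cont. Qed.

Lemma eGamma_rec (a : R) : 0 < a -> (eGamma (a + 1) = a%:E * eGamma a)%E.
Proof.
move=> a0.
rewrite /eGamma addrK -ge0_integralZl//; last 3 first.
- exact: measurable_powR_exp.
- by move=> x _; rewrite lee_fin mulr_ge0 ?powR_ge0 ?expR_ge0.
- by rewrite lee_fin ltW.
under [RHS]eq_integral do rewrite -EFinM mulrA.
have dF (x : R) : 0 < x -> is_derive x 1 (fun y : R => - (y `^ a * expR (- y)))
    (x `^ a * expR (- x) - (a * x `^ (a - 1) * expR (- x))).
  by move=> x0; apply: (is_derive_eq (isdN (isd_powR_expN a x0))); rewrite opprB.
rewrite (FTC_oy (l0 := 0) (loo := 0) dF) ?subrr ?adde0//.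
- by move=> x _; rewrite mulr_ge0 ?powR_ge0 ?expR_ge0.
- by move=> x _; rewrite !mulr_ge0 ?powR_ge0 ?expR_ge0// ltW.
- by move=> x; exact: cont_powR_expN.
- move=> x x0.
  have -> : (fun x => a * x `^ (a - 1) * expR (- x)) =
     (fun x => a * (x `^ (a - 1) * expR (- x))) by apply/funext => y; rewrite mulrA.
  exact: (isd_cont (isdZ a (isd_powR_expN (a - 1) x0))).
- apply: (cvg_at_right0 (a := a) (C := 1)) => // x /andP[x0 x1].
  rewrite normrN ger0_norm ?mulr_ge0 ?powR_ge0 ?expR_ge0//.
  rewrite mul1r ler_piMr ?powR_ge0// -[leRHS]expR0 ler_expR lerNl oppr0 ltW//.
- apply: (powR_expN_cvg0 (r := a) (C := 1)) => x x1.
  by rewrite normrN ger0_norm ?mulr_ge0 ?powR_ge0 ?expR_ge0// mul1r.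
Qed.

Lemma eGamma1 : eGamma 1 = 1%E.
Proof.
rewrite /eGamma subrr.
have dF (x : R) : 0 < x -> is_derive x 1 (fun y : R => - expR (- y)) (x `^ 0 * expR (- x) - 0).
  by move=> x0; apply: (is_derive_eq (isdN (isd_expRN x))); rewrite opprK powRr0 mul1r subr0.
rewrite (FTC_oy (l0 := -1) (loo := 0) dF) ?integral0 ?add0e ?sub0r ?opprK//.
- by move=> x _; rewrite mulr_ge0 ?powR_ge0 ?expR_ge0.
- by move=> x; exact: cont_powR_expN.
- by move=> x _; exact: cvg_cst.
- rewrite -[X in _ --> X](_ : - expR (- 0) = - 1); last by rewrite oppr0 expR0.
  by apply: cvg_at_right_filter; exact: (isd_cont (isdN (isd_expRN 0))).
- apply: (powR_expN_cvg0 (r := 0) (C := 1)) => x x1.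
  by rewrite normrN powRr0 !mul1r ger0_norm ?expR_ge0.
Qed.

Lemma eGamma_nat_fin (m : nat) : (eGamma m.+1%:R < +oo)%E.
Proof.
elim: m => [|m IH]; first by rewrite eGamma1 ltry.
by rewrite -natr1 eGamma_rec// lte_mul_pinfty// lee_fin.
Qed.

(** By the functional equation it is enough to bound the value at a + 1, where t^a <= 1 + t^N with N
    an integer above a; at integers finiteness goes by induction from 1. *)
Lemma eGamma_fin (a : R) : 0 < a -> (eGamma a < +oo)%E.
Proof.
move=> a0.
suff : (eGamma (a + 1) < +oo)%E.
  rewrite eGamma_rec//; have := eGamma_ge0 a; case: (eGamma a) => [r _ _|_|//]; first exact: ltry.
  by rewrite gt0_muley ?lte_fin// ltxx.
pose N := Num.bound a.
apply: (@le_lt_trans _ _ (eGamma 1 + eGamma N.+1%:R)%E); last first.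
  by rewrite lte_add_pinfty ?eGamma1 ?ltry// eGamma_nat_fin.
rewrite /eGamma -ge0_integralD//; last 4 first.
- by move=> x _; rewrite lee_fin mulr_ge0 ?powR_ge0 ?expR_ge0.
- exact: measurable_powR_exp.
- by move=> x _; rewrite lee_fin mulr_ge0 ?powR_ge0 ?expR_ge0.
- exact: measurable_powR_exp.
apply: ge0_le_integral => //.
- by move=> x _; rewrite lee_fin mulr_ge0 ?powR_ge0 ?expR_ge0.
- exact: measurable_powR_exp.
- by apply: emeasurable_funD; exact: measurable_powR_exp.
move=> x /=; rewrite in_itv/= andbT => x0.
rewrite -EFinD lee_fin -mulrDl ler_wpM2r ?expR_ge0// addrK subrr powRr0 -natr1 addrK.
have [x1|/ltW x1] := leP x 1.
  apply: (@le_trans _ _ 1); last by rewrite lerDl powR_ge0.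
  by rewrite -(powRr0 x); apply: ger_powR; rewrite ?x0 ?x1 ?ltW.
apply: (@le_trans _ _ (x `^ N%:R)); last by rewrite lerDr.
by apply: ler_powR => //; rewrite ltW// archi_boundP ?ltW.
Qed.

(** On [1, 2] the integrand is at least 2^(-|a-1|) e^(-2), for every real a. *)
Lemma eGamma_gt0 a : (0 < eGamma a)%E.
Proof.
pose c := 2 `^ (- `|a - 1|) * expR (- 2) : R.
have c0 : 0 < c by rewrite mulr_gt0 ?powR_gt0 ?expR_gt0.
apply: (@lt_le_trans _ _ (c%:E)%E); first by rewrite lte_fin.
apply: (@le_trans _ _ (\int[mu]_(t in `[1%R, 2%R]) (t `^ (a - 1) * expR (- t))%:E)%E).
  apply: (@le_trans _ _ (\int[mu]_(t in `[1%R, 2%R]) (c%:E))%E).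
    rewrite integral_cst//= lebesgue_measure_itv/= lte_fin ltr1n/=.
    by rewrite -EFinD -EFinM lee_fin (_ : 2 - 1 = 1) ?mulr1//; lra.
  apply: ge0_le_integral => //.
  - by move=> x _; rewrite lee_fin ltW.
  - exact: measurable_powR_exp.
  move=> x /=; rewrite in_itv/= => /andP[x1 x2]; rewrite lee_fin.
  apply: ler_pM; rewrite ?powR_ge0 ?expR_ge0//.
    have h : 2^-1 <= (x : R) <= 2 by rewrite x2 andbT (le_trans _ x1)// invf_le1// ler1n.
    by have /andP[] := powR_half2 (a - 1) h.
  by rewrite ler_expR lerN2.
apply: ge0_subset_integral => //.
- exact: measurable_powR_exp.
- by move=> x _; rewrite lee_fin mulr_ge0 ?powR_ge0 ?expR_ge0.
- by move=> x /=; rewrite !in_itv/= andbT => /andP[x1 _]; apply: lt_le_trans x1.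
Qed.

Lemma Gamma_gt0 (a : R) : 0 < a -> 0 < Gamma a.
Proof.
move=> a0; rewrite GammaE fine_gt0// eGamma_gt0/=.
exact: eGamma_fin.
Qed.

Lemma Gamma_rec (a : R) : 0 < a -> Gamma (a + 1) = a * Gamma a.
Proof.
move=> a0; rewrite !GammaE eGamma_rec// fineM//.
by rewrite ge0_fin_numE ?eGamma_ge0// eGamma_fin.
Qed.

Lemma pochhammerE (a : R) k : 0 < a -> pochhammer a k = \prod_(j < k) (a + j%:R).
Proof.
move=> a0; rewrite /pochhammer; elim: k => [|k IH].
  by rewrite addr0 big_ord0 divff// gt_eqF// Gamma_gt0.
rewrite big_ord_recr/= -IH -natr1 addrA Gamma_rec ?ltr_wpDr//.
by rewrite -mulrA mulrC.
Qed.

End GammaFunction.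

(** * Beta integrals and the averaging density on (0, 1) *)

Section Beta.
Context {R : realType}.
Local Notation mu := (@lebesgue_measure R).
Local Notation I01 := (`]0, 1[%classic : set R).
Implicit Types (a d e s rho : R).

Lemma isd_1B s : is_derive s 1 (fun y : R => 1 - y) (- 1).
Proof. by apply: (is_derive_eq (isdB (isd_cst 1 s) (isd_id s))); rewrite sub0r. Qed.

Lemma isd_1BM rho s : is_derive s 1 (fun y : R => 1 - y * rho) (- rho).
Proof.
apply: (is_derive_eq (isdB (isd_cst 1 s) (isdM (isd_id s) (isd_cst rho s)))).
by ring.
Qed.

Lemma isd_powR_1B d s : s < 1 ->
  is_derive s 1 (fun y : R => (1 - y) `^ d) (- (d * (1 - s) `^ (d - 1))).
Proof.
rewrite -subr_gt0 => s1.
apply: (is_derive_eq (isd_powR (f := fun y : R => 1 - y) d s1 (isd_1B s))).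
by rewrite mulrN1.
Qed.

Lemma isd_powR_1BM d rho s : 0 < 1 - s * rho ->
  is_derive s 1 (fun y : R => (1 - y * rho) `^ d) (- (d * rho * (1 - s * rho) `^ (d - 1))).
Proof.
move=> s1.
apply: (is_derive_eq (isd_powR (f := fun y : R => 1 - y * rho) d s1 (isd_1BM rho s))).
by ring.
Qed.

Lemma measurable_powR_1B e rho (D : set R) : measurable_fun D (fun s : R => (1 - s * rho) `^ e).
Proof.
apply: (measurable_funS measurableT) => //.
apply: (measurableT_comp (f := fun t : R => t `^ e)); first exact: measurable_powR.
by apply: measurable_funB => //; apply: measurable_funM.
Qed.

Lemma measurable_powR_oneB e (D : set R) : measurable_fun D (fun s : R => (1 - s) `^ e).
Proof.
apply: (measurable_funS measurableT) => //.
apply: (measurableT_comp (f := fun t : R => t `^ e)); first exact: measurable_powR.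
exact: measurable_funB.
Qed.

Lemma measurable_powRs e (D : set R) : measurable_fun D (fun s : R => s `^ e).
Proof. by apply: (measurable_funS measurableT) => //; exact: measurable_powR. Qed.

Lemma in01 (x : R) : `]0%R, 1%R[%classic x -> 0 < x < 1.
Proof. by rewrite /= in_itv. Qed.

Lemma rho_bounds s rho : 0 < s < 1 -> 0 <= rho < 1 -> (0 < 1 - s * rho) * (1 - s <= 1 - s * rho) * (1 - rho <= 1 - s * rho).
Proof.
move=> /andP[s0 s1] /andP[r0 r1]; split; [split|]; nra.
Qed.

Lemma integral_1B_powR d rho : 0 < d -> rho < 1 ->
  (\int[mu]_(s in `]rho, 1%R[) ((1 - s) `^ (d - 1))%:E = ((1 - rho) `^ d / d)%:E)%E.
Proof.
move=> d0 r1.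
have dF (s : R) : rho < s < 1 -> is_derive s 1 (fun y : R => - d^-1 * (1 - y) `^ d) ((1 - s) `^ (d - 1) - 0).
  move=> /andP[_ s1].
  apply: (is_derive_eq (isdZ (- d^-1) (isd_powR_1B d s1))).
  by rewrite subr0 mulrNN mulrA mulVf ?gt_eqF// mul1r.
rewrite (FTC_oo (la := - d^-1 * (1 - rho) `^ d) (lb := 0) dF) ?integral0 ?add0e//.
- by rewrite sub0r mulNr opprK mulrC.
- by move=> x _; rewrite powR_ge0.
- by move=> x /andP[_ x1]; exact: (isd_cont (isd_powR_1B _ x1)).
- by move=> x _; exact: cvg_cst.
- by apply: cvg_at_right_filter; exact: (isd_cont (isdZ _ (isd_powR_1B _ r1))).
- apply: (cvg_at_left1 (d := d) (C := d^-1)) => // x /andP[x0 x1].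
  by rewrite normrM normrN !ger0_norm ?powR_ge0 ?invr_ge0 ?(ltW d0).
Qed.

(** Integration by parts replaces (1-s)^(d-1) (1-s rho)^(-e) by (1-s)^d (1-s rho)^(-e-1); then
    (1-s)^d <= (1-s rho)^d leaves an exact derivative, so the interval is never cut. The strict gap
    d < e is what makes the growth a power and not a logarithm. *)
Lemma J_bound d e : 0 < d -> d < e -> exists C : R, 0 < C /\ forall rho, 0 <= rho < 1 ->
  (\int[mu]_(s in `]0%R, 1%R[) ((1 - s) `^ (d - 1) * (1 - s * rho) `^ (- e))%:E <=
   (C * (1 - rho) `^ (- (e - d)))%:E)%E.
Proof.
move=> d0 de; have e0 : 0 < e by apply: lt_trans de.
have ed0 : 0 < e - d by rewrite subr_gt0.
(* With I the integral, d I = 1 + int g <= 1 + e/(e-d) ((1-rho)^(-(e-d)) - 1), and the last power is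
   at least 1. *)
exists (d^-1 * (1 + e / (e - d))); split.
  by rewrite mulr_gt0 ?invr_gt0// addr_gt0// divr_gt0.
move=> rho r01; have /andP[r0 r1] := r01.
have br0 : 0 < 1 - rho by rewrite subr_gt0.
set I := (X in (X <= _)%E).
have I0 : (0 <= I)%E.
  by apply: integral_ge0 => s _; rewrite lee_fin mulr_ge0 ?powR_ge0.
have mI : measurable_fun I01 (fun s : R => ((1 - s) `^ (d - 1) * (1 - s * rho) `^ (- e))%:E).
  apply/measurable_EFinP/measurable_funM; [exact: measurable_powR_oneB|exact: measurable_powR_1B].
suff h : (d%:E * I <= ((1 + e / (e - d)) * (1 - rho) `^ (- (e - d)))%:E)%E.
  by rewrite -mulrA EFinM lee_pdivlMl// mulrC.
pose f s := d * ((1 - s) `^ (d - 1) * (1 - s * rho) `^ (- e)).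
pose g s := e * rho * ((1 - s) `^ d * (1 - s * rho) `^ (- e - 1)).
have dF (s : R) : 0 < s < 1 -> is_derive s 1 (fun y : R => - ((1 - y) `^ d * (1 - y * rho) `^ (- e))) (f s - g s).
  move=> s01; have [[b1 b2] b3] := rho_bounds s01 r01; have /andP[s0 s1] := s01.
  apply: (is_derive_eq (isdN (isdM (isd_powR_1B d s1) (isd_powR_1BM (- e) b1)))).
  by rewrite /f /g; ring.
have cpow (p : R) (x : R) : x < 1 -> {for x, continuous (fun s : R => (1 - s) `^ p)}.
  by move=> x1; exact: (isd_cont (isd_powR_1B _ x1)).
have cpow2 (p : R) (x : R) : 0 < 1 - x * rho -> {for x, continuous (fun s : R => (1 - s * rho) `^ p)}.
  by move=> x1; exact: (isd_cont (isd_powR_1BM _ x1)).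
have eqI : (d%:E * I = \int[mu]_(s in `]0%R, 1%R[) (g s)%:E + 1%:E)%E.
  rewrite -ge0_integralZl ?lee_fin ?ltW//; last first.
    by move=> x _; rewrite lee_fin mulr_ge0 ?powR_ge0.
  rewrite -[X in _ = (_ + X%:E)%E](_ : (0 - - 1) = 1); last by rewrite opprK add0r.
  under eq_integral do rewrite -EFinM.
  apply: (FTC_oo dF) => //.
  - by move=> x _; rewrite /f !mulr_ge0 ?powR_ge0// ltW.
  - by move=> x _; rewrite /g !mulr_ge0 ?powR_ge0// ltW.
  - move=> x x01; have [[b1 b2] b3] := rho_bounds x01 r01; have /andP[s0 s1] := x01.
    by apply: continuousM; [exact: cvg_cst|apply: continuousM; [exact: cpow|exact: cpow2]].
  - move=> x x01; have [[b1 b2] b3] := rho_bounds x01 r01; have /andP[s0 s1] := x01.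
    by apply: continuousM; [exact: cvg_cst|apply: continuousM; [exact: cpow|exact: cpow2]].
  - rewrite [X in _ --> X](_ : - 1 = - ((1 - 0) `^ d * (1 - 0 * rho) `^ (- e))); last first.
      by rewrite mul0r subr0 !powR1 mulr1.
    have z1 : 0 < 1 - 0 * rho by rewrite mul0r subr0.
    apply: cvg_at_right_filter.
    exact: (isd_cont (isdN (isdM (isd_powR_1B d ltr01) (isd_powR_1BM (- e) z1)))).
  - apply: (cvg_at_left1 (d := d) (C := (1 - rho) `^ (- e))) => // x x01.
    have [[b1 b2] b3] := rho_bounds x01 r01.
    rewrite normrN normrM !ger0_norm ?powR_ge0// mulrC ler_wpM2r ?powR_ge0//.
    by apply: ler_powRN => //; exact: ltW.
(* The derivative of (1 - s rho)^(-(e-d)), whose integral is explicit. *)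
pose k s := rho * (e - d) * (1 - s * rho) `^ (- (e - d) - 1).
have dG (s : R) : 0 < s < 1 -> is_derive s 1 (fun y : R => (1 - y * rho) `^ (- (e - d))) (k s - 0).
  move=> s01; have [[b1 b2] b3] := rho_bounds s01 r01; have /andP[s0 s1] := s01.
  apply: (is_derive_eq (isd_powR_1BM (- (e - d)) b1)).
  by rewrite /k; ring.
have eqK : (\int[mu]_(s in `]0%R, 1%R[) (k s)%:E = ((1 - rho) `^ (- (e - d)) - 1)%:E)%E.
  rewrite (FTC_oo (la := 1) (lb := (1 - rho) `^ (- (e - d))) dG) ?integral0 ?add0e//.
  - by move=> x _; rewrite /k !mulr_ge0 ?powR_ge0// ltW.
  - move=> x x01; have [[b1 b2] b3] := rho_bounds x01 r01.
    by apply: continuousM; [exact: cvg_cst|exact: cpow2].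
  - by move=> x _; exact: cvg_cst.
  - rewrite [X in _ --> X](_ : 1 = (1 - 0 * rho) `^ (- (e - d))); last first.
      by rewrite mul0r subr0 powR1.
    by apply: cvg_at_right_filter; apply: cpow2; rewrite mul0r subr0.
  - rewrite -[in X in _ --> X](mul1r rho).
    by apply: cvg_at_left_filter; apply: cpow2; rewrite mul1r.
have gk : (\int[mu]_(s in `]0%R, 1%R[) (g s)%:E <=
   (e / (e - d))%:E * \int[mu]_(s in `]0%R, 1%R[) (k s)%:E)%E.
  have k0 s : 0 <= k s by rewrite /k !mulr_ge0 ?powR_ge0// ltW.
  have mk : measurable_fun I01 k by apply: measurable_funM => //; exact: measurable_powR_1B.
  rewrite -integralZlR//; last by rewrite divr_ge0 ?(ltW e0) ?(ltW ed0).
  apply: le_integralR => //.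
  - apply: measurable_funM => //; apply: measurable_funM.
      exact: measurable_powR_oneB.
    exact: measurable_powR_1B.
  - exact: measurable_funM.
  - by move=> x _; rewrite /g !mulr_ge0 ?powR_ge0// ltW.
  move=> x /in01 x01; have [[b1 b2] b3] := rho_bounds x01 r01; have /andP[s0 s1] := x01.
  rewrite /g /k.
  rewrite (_ : e / (e - d) * _ = e * rho * (1 - x * rho) `^ (- (e - d) - 1)); last first.
    by field; rewrite gt_eqF.
  rewrite ler_wpM2l ?mulr_ge0 ?(ltW e0)//.
  rewrite (_ : - (e - d) - 1 = d + (- e - 1)); last by ring.
  rewrite powRD; last by rewrite (gt_eqF b1) implybT.
  by rewrite ler_wpM2r ?powR_ge0//; apply: ge0_ler_powR; rewrite ?nnegrE ?(ltW b1) ?(ltW d0) ?subr_ge0 ?(ltW s1).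
rewrite eqI (le_trans (leeD2r _ gk))// eqK -EFinM -EFinD lee_fin.
have : 1 <= (1 - rho) `^ (- (e - d)).
  by apply: powRN_ge1; [exact: ltW|rewrite br0 gerBl].
have : 0 < e / (e - d) by rewrite divr_gt0.
set A := e / _; set B := _ `^ _; nra.
Qed.

Definition ebeta a d : \bar R := (\int[mu]_(s in I01) (s `^ (a - 1) * (1 - s) `^ (d - 1))%:E)%E.

Lemma measurable_beta a d (D : set R) :
  measurable_fun D (fun s : R => s `^ a * (1 - s) `^ d).
Proof. by apply: measurable_funM; [exact: measurable_powRs|exact: measurable_powR_oneB]. Qed.

Lemma ebeta_ge0 a d : (0 <= ebeta a d)%E.
Proof. by apply: integral_ge0 => s _; rewrite lee_fin mulr_ge0 ?powR_ge0. Qed.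

(** Obtained by integrating the derivative of s^a (1-s)^d, which vanishes at both ends. *)
Lemma ebeta_rec a d : 0 < a -> 0 < d ->
  (a%:E * ebeta a d = (a + d)%:E * ebeta (a + 1) d)%E.
Proof.
move=> a0 d0.
pose f s := a * (s `^ (a - 1) * (1 - s) `^ d).
pose g s := d * (s `^ a * (1 - s) `^ (d - 1)).
have dF (s : R) : 0 < s < 1 -> is_derive s 1 (fun y : R => y `^ a * (1 - y) `^ d) (f s - g s).
  move=> /andP[s0 s1].
  apply: (is_derive_eq (isdM (isd_powR (f := fun y => y) a s0 (isd_id s)) (isd_powR_1B d s1))).
  by rewrite /f /g; ring.
have f0 x : 0 < x < 1 -> 0 <= f x by move=> _; rewrite /f !mulr_ge0 ?powR_ge0// ltW.
have g0 x : 0 < x < 1 -> 0 <= g x by move=> _; rewrite /g !mulr_ge0 ?powR_ge0// ltW.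
have cpow (p q x : R) : 0 < x < 1 -> {for x, continuous (fun s : R => s `^ p * (1 - s) `^ q)}.
  by move=> /andP[x0 x1]; apply: (isd_cont (isdM (isd_powR (f := fun y => y) p x0 (isd_id x)) (isd_powR_1B q x1))).
have h : (\int[mu]_(s in I01) (f s)%:E = \int[mu]_(s in I01) (g s)%:E + (0 - 0)%:E)%E.
  apply: (FTC_oo dF) => //.
  - by move=> x x01; apply: continuousM; [exact: cvg_cst|exact: cpow].
  - by move=> x x01; apply: continuousM; [exact: cvg_cst|exact: cpow].
  - apply: (cvg_at_right0 (a := a) (C := 1)) => // x /andP[x0 x1].
    rewrite mul1r ger0_norm ?mulr_ge0 ?powR_ge0// ler_piMr ?powR_ge0//.
    rewrite -[leRHS](powRr0 (1 - x)); apply: ger_powR; last exact: ltW.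
    by rewrite subr_gt0 x1 gerBl ltW.
  - apply: (cvg_at_left1 (d := d) (C := 1)) => // x /andP[x0 x1].
    rewrite mul1r ger0_norm ?mulr_ge0 ?powR_ge0// ler_piMl ?powR_ge0//.
    rewrite -[leRHS](powRr0 x); apply: ger_powR; last exact: ltW.
    by rewrite x0 ltW.
have mf : measurable_fun I01 f by apply/measurable_funM => //; exact: measurable_beta.
have mg : measurable_fun I01 g by apply/measurable_funM => //; exact: measurable_beta.
rewrite /ebeta -!integralZlR//; last 6 first.
- exact: measurable_beta.
- by move=> x _; rewrite mulr_ge0 ?powR_ge0.
- by rewrite addr_ge0 ?(ltW a0) ?(ltW d0).
- exact: measurable_beta.
- by move=> x _; rewrite mulr_ge0 ?powR_ge0.
- exact: ltW.
rewrite addrK.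
(* Adding A to both sides turns a s^(a-1) (1-s)^d into a s^(a-1) (1-s)^(d-1), since (1-s) + s = 1,
   and d s^a (1-s)^(d-1) into the same with factor a + d. *)
pose A s := a * (s `^ a * (1 - s) `^ (d - 1)).
have mA : measurable_fun I01 A by apply/measurable_funM => //; exact: measurable_beta.
transitivity (\int[mu]_(s in I01) (f s)%:E + \int[mu]_(s in I01) (A s)%:E)%E.
  rewrite -integralDR//; last by move=> x _; rewrite /A !mulr_ge0 ?powR_ge0// ltW.
  apply: eq_integral => x /set_mem/in01/andP[x0 x1].
  congr EFin; rewrite /f /A.
  have -> : x `^ a = x * x `^ (a - 1) by rewrite mulr_powRB1// ltW.
  have -> : (1 - x) `^ d = (1 - x) * (1 - x) `^ (d - 1) by rewrite mulr_powRB1// subr_ge0 ltW.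
  by ring.
rewrite h subrr adde0 -integralDR//; last by move=> x _; rewrite /A !mulr_ge0 ?powR_ge0// ltW.
by apply: eq_integral => x _; congr EFin; rewrite /g /A; ring.
Qed.

Lemma integral_powRs a : 0 < a -> (\int[mu]_(s in I01) (s `^ (a - 1))%:E = (a^-1)%:E)%E.
Proof.
move=> a0.
have dF (s : R) : 0 < s < 1 -> is_derive s 1 (fun y : R => a^-1 * y `^ a) (s `^ (a - 1) - 0).
  move=> /andP[s0 s1].
  apply: (is_derive_eq (isdZ a^-1 (isd_powR (f := fun y => y) a s0 (isd_id s)))).
  by rewrite subr0 mulr1 mulrA mulVf ?gt_eqF// mul1r.
rewrite (FTC_oo (la := 0) (lb := a^-1) dF) ?integral0 ?add0e ?subr0//.
- by move=> x _; rewrite powR_ge0.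
- by move=> x /andP[x0 _]; exact: (isd_cont (isd_powR (f := fun y => y) _ x0 (isd_id x))).
- by move=> x _; exact: cvg_cst.
- apply: (cvg_at_right0 (a := a) (C := a^-1)) => // x _.
  by rewrite normrM !ger0_norm ?powR_ge0 ?invr_ge0 ?(ltW a0).
- rewrite -[X in _ --> X](_ : a^-1 * 1 `^ a = _); last by rewrite powR1 mulr1.
  apply: cvg_at_left_filter.
  exact: (isd_cont (isdZ a^-1 (isd_powR (f := fun y => y) a ltr01 (isd_id 1)))).
Qed.

Lemma beta_split a d s : 0 < s < 1 ->
  s `^ a * (1 - s) `^ d <= 2 `^ `|d| * s `^ a + 2 `^ `|a| * (1 - s) `^ d.
Proof.
move=> /andP[s0 s1]; have [h|h] := leP s 2^-1.
  rewrite ler_wpDr ?mulr_ge0 ?powR_ge0// mulrC ler_wpM2r ?powR_ge0//.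
  have hh : 2^-1 <= 1 - s <= 2 by lra.
  by have /andP[] := powR_half2 d hh.
rewrite ler_wpDl ?mulr_ge0 ?powR_ge0// ler_wpM2r ?powR_ge0//.
have hh : 2^-1 <= s <= 2 by lra.
by have /andP[] := powR_half2 a hh.
Qed.

Lemma ebeta_fin a d : 0 < a -> 0 < d -> (ebeta a d < +oo)%E.
Proof.
move=> a0 d0.
apply: (@le_lt_trans _ _ ((2 `^ `|d - 1|)%:E * (a^-1)%:E + (2 `^ `|a - 1|)%:E * ((1 - 0) `^ d / d)%:E)%E); last exact: ltry.
rewrite -integral_powRs// -integral_1B_powR//.
have mp p : measurable_fun I01 (fun s : R => s `^ p) by exact: measurable_powRs.
have mo p : measurable_fun I01 (fun s : R => (1 - s) `^ p) by exact: measurable_powR_oneB.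
have p0 (x y : R) : 0 <= x `^ y by exact: powR_ge0.
rewrite -!integralZlR//.
have mZ (c : R) f : measurable_fun I01 f -> measurable_fun I01 (fun x => c * f x).
  by move=> mf; exact: measurable_funM.
rewrite -integralDR//; try by [exact: mZ|move=> *; rewrite mulr_ge0].
apply: le_integralR => //.
- exact: measurable_beta.
- by apply: measurable_funD; exact: mZ.
- by move=> s _; rewrite mulr_ge0.
- by move=> s /in01 s01; exact: beta_split.
- exact: mo.
- exact: mp.
Qed.

(** For rho >= 1/2 the factor s^(a-1) is bounded below; a smaller rho only enlarges the interval,
    and the constant is reduced accordingly. *)
Lemma beta_low a d : 0 < a -> 0 < d -> exists c : R, 0 < c /\ forall rho, 0 <= rho < 1 ->
  ((c * (1 - rho) `^ d)%:E <= \int[mu]_(s in `]rho, 1%R[) (s `^ (a - 1) * (1 - s) `^ (d - 1))%:E)%E.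
Proof.
move=> a0 d0.
pose c0 := 2 `^ (- `|a - 1|) / d : R.
have c00 : 0 < c0 by rewrite divr_gt0 ?powR_gt0.
have half rho : 2^-1 <= rho < 1 ->
  ((c0 * (1 - rho) `^ d)%:E <= \int[mu]_(s in `]rho, 1%R[) (s `^ (a - 1) * (1 - s) `^ (d - 1))%:E)%E.
  move=> /andP[h r1].
  rewrite /c0 mulrAC -mulrA EFinM -integral_1B_powR// -integralZlR ?powR_ge0//; last 2 first.
  - exact: measurable_powR_oneB.
  - by move=> *; exact: powR_ge0.
  apply: le_integralR => //.
  - by apply: measurable_funM => //; exact: measurable_powR_oneB.
  - exact: measurable_beta.
  - by move=> s _; rewrite mulr_ge0 ?powR_ge0.
  move=> s; rewrite /= in_itv/= => /andP[s0 s1]; rewrite ler_wpM2r ?powR_ge0//.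
  have hh : 2^-1 <= (s : R) <= 2 by lra.
  by have /andP[] := powR_half2 (a - 1) hh.
exists (c0 * 2^-1 `^ d); split; first by rewrite mulr_gt0 ?powR_gt0.
move=> rho /andP[r0 r1].
have [h|h] := leP 2^-1 rho.
  apply: (le_trans _ (half rho _)); last by rewrite h.
  rewrite lee_fin -mulrA ler_wpM2l ?(ltW c00)// ler_piMl ?powR_ge0//.
  by rewrite -[leRHS](powRr0 (2^-1)); apply: ger_powR; [lra|exact: ltW].
apply: (@le_trans _ _ (\int[mu]_(s in `](2^-1)%R, 1%R[) (s `^ (a - 1) * (1 - s) `^ (d - 1))%:E)%E).
  apply: (le_trans _ (half _ _)); last by rewrite lexx invf_lt1 ?ltr1n.
  rewrite lee_fin (_ : 1 - 2^-1 = 2^-1); last by lra.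
  rewrite ler_piMr ?(mulr_ge0 (ltW c00) (powR_ge0 _ _))//.
  rewrite -[leRHS](powRr0 (1 - rho)); apply: ger_powR; last exact: ltW.
  by rewrite subr_gt0 r1 gerBl.
apply: ge0_subset_integral => //.
- by apply/measurable_EFinP; exact: measurable_beta.
- by move=> s _; rewrite lee_fin mulr_ge0 ?powR_ge0.
by move=> s /=; rewrite !in_itv/= => /andP[s1 ->]; rewrite andbT (lt_trans h).
Qed.

(** The witness is the Beta(a, d) probability density. Its k-th moment is the multiplier (a)_k /
    (a+d)_k, so averaging a power series over the radius inserts this multiplier, while the same
    average improves a singularity (1-rho)^(-e) by the power d. *)
Lemma beta_weight a d : 0 < a -> 0 < d -> exists w : R -> R,
  [/\ measurable_fun setT w, (forall s, 0 <= w s),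
   (forall k, (\int[mu]_(s in I01) (s ^+ k * w s)%:E = (\prod_(j < k) ((a + j%:R) / (a + d + j%:R)))%:E)%E),
   (forall e, d < e -> exists C : R, 0 < C /\ forall rho, 0 <= rho < 1 ->
      (\int[mu]_(s in I01) ((1 - s * rho) `^ (- e) * w s)%:E <= (C * (1 - rho) `^ (- (e - d)))%:E)%E) &
   exists c : R, 0 < c /\ forall rho, 0 <= rho < 1 ->
      ((c * (1 - rho) `^ d)%:E <= \int[mu]_(s in `]rho, 1%R[) (w s)%:E)%E].
Proof.
move=> a0 d0.
have ef (x : R) : 0 < x -> ebeta x d \is a fin_num.
  by move=> x0; rewrite ge0_fin_numE ?ebeta_ge0// ebeta_fin.
have [cl [cl0 Hl]] := beta_low a0 d0.
have B0 : 0 < fine (ebeta a d).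
  rewrite -lte_fin fineK ?ef//.
  have := Hl 0 _; rewrite lexx ltr01 => /(_ isT); apply: lt_le_trans.
  by rewrite lte_fin mulr_gt0 ?powR_gt0// subr_gt0.
set B := fine _ in B0.
pose w s := B^-1 * (s `^ (a - 1) * (1 - s) `^ (d - 1)).
have Bi : 0 <= B^-1 by rewrite invr_ge0 ltW.
have mw (D : set R) : measurable_fun D w by apply: measurable_funM => //; exact: measurable_beta.
exists w; split => //.
- by move=> s; rewrite /w !mulr_ge0 ?powR_ge0.
- move=> k.
  have -> : (\int[mu]_(s in I01) (s ^+ k * w s)%:E = (B^-1)%:E * ebeta (a + k%:R) d)%E.
    rewrite /ebeta -integralZlR//; last 2 first.
    - exact: measurable_beta.
    - by move=> s _; rewrite mulr_ge0 ?powR_ge0.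
    apply: eq_integral => s /set_mem/in01/andP[s0 s1].
    congr EFin; rewrite /w mulrCA; congr (_ * _).
    rewrite mulrA; congr (_ * _).
    by rewrite -powR_mulrn ?(ltW s0)// -powRD ?(gt_eqF s0) ?implybT// addrCA addrA.
  elim: k => [|k IH].
    by rewrite addr0 big_ord0 -(fineK (ef a a0)) -EFinM mulVf ?gt_eqF.
  rewrite big_ord_recr/= EFinM -IH -natr1 addrA.
  have ak : 0 < a + k%:R by rewrite ltr_wpDr.
  have := ebeta_rec ak d0; rewrite -(fineK (ef _ ak)) -(fineK (ef (a + k%:R + 1) _)); last first.
    by rewrite addr_gt0.
  rewrite -!EFinM => -[h]; congr EFin; rewrite -mulrA; congr (_ * _).
  have akd : a + d + k%:R != 0 by rewrite gt_eqF// addrAC addr_gt0.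
  by rewrite mulrA (mulrC (fine _)) h (addrAC a k%:R d) mulrAC divff ?mul1r.
- move=> e de; have [C [C0 HC]] := J_bound d0 de.
  pose c1 := 2 `^ e * 1 : R; pose c2 := B^-1 * 2 `^ `|a - 1|.
  have c20 : 0 <= c2 by rewrite mulr_ge0 ?powR_ge0.
  exists (2 `^ e + c2 * C); split; first by rewrite ltr_pwDl ?powR_gt0// mulr_ge0 // ltW.
  move=> rho r01; have /andP[r0 r1] := r01.
  have e0 : 0 < e by apply: lt_trans de.
  have mw2 : measurable_fun I01 (fun s => (1 - s) `^ (d - 1) * (1 - s * rho) `^ (- e)).
    by apply/measurable_funM; [exact: measurable_powR_oneB|exact: measurable_powR_1B].
  have w0 s : 0 <= w s by rewrite /w !mulr_ge0 ?powR_ge0.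
  have mw1 : measurable_fun I01 (fun s => 2 `^ e * w s) by exact: measurable_funM.
  have mw3 : measurable_fun I01 (fun s => c2 * ((1 - s) `^ (d - 1) * (1 - s * rho) `^ (- e))).
    exact: measurable_funM.
  (* For s <= 1/2 the power of 1 - s rho is at most 2^e, and [w] has mass 1; for s > 1/2 the factor
     s^(a-1) is bounded and [J_bound] applies. *)
  apply: (@le_trans _ _ (\int[mu]_(s in I01) (2 `^ e * w s)%:E +
     \int[mu]_(s in I01) (c2 * ((1 - s) `^ (d - 1) * (1 - s * rho) `^ (- e)))%:E)%E).
    rewrite -integralDR//; try by [move=> *; rewrite !mulr_ge0 ?powR_ge0].
    apply: le_integralR => //.
    - by apply: measurable_funM; [exact: measurable_powR_1B|exact: mw].
    - exact: measurable_funD.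
    - by move=> s _; rewrite mulr_ge0 ?powR_ge0.
    move=> s /in01 s01; have [[b1 b2] b3] := rho_bounds s01 r01; have /andP[s0 s1] := s01.
    have [h|h] := leP s 2^-1.
      rewrite ler_wpDr ?mulr_ge0 ?powR_ge0// ler_wpM2r//.
      rewrite powRN -powR_inv1 ?powR_ge0// -powRrM mulrN1.
      have hh : 2^-1 <= 1 - s * rho by nra.
      have := ler_powRN (ltW e0) _ hh; rewrite invr_gt0 => /(_ (ltr0n _ _)) => /le_trans; apply.
      by rewrite -powR_inv1// -powRrM mulN1r opprK.
    rewrite ler_wpDl ?mulr_ge0 ?powR_ge0//.
    rewrite mulrC /w /c2 -!mulrA ler_wpM2l// mulrA mulrA ler_wpM2r ?powR_ge0// ler_wpM2r ?powR_ge0//.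
    have hh : 2^-1 <= s <= 2 by lra.
    by have /andP[] := powR_half2 (a - 1) hh.
  have pp s : 0 <= (1 - s) `^ (d - 1) * (1 - s * rho) `^ (- e) by rewrite mulr_ge0 ?powR_ge0.
  have -> : (\int[mu]_(s in I01) (2 `^ e * w s)%:E = (2 `^ e)%:E * \int[mu]_(s in I01) (w s)%:E)%E.
    by apply: integralZlR => //; exact: mw.
  have -> : (\int[mu]_(s in I01) (c2 * ((1 - s) `^ (d - 1) * (1 - s * rho) `^ (- e)))%:E =
     c2%:E * \int[mu]_(s in I01) ((1 - s) `^ (d - 1) * (1 - s * rho) `^ (- e))%:E)%E.
    by apply: integralZlR.
  have -> : (\int[mu]_(s in I01) (w s)%:E = 1)%E.
    rewrite /w integralZlR//; last 2 first.
    - exact: measurable_beta.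
    - by move=> s _; rewrite mulr_ge0 ?powR_ge0.
    by rewrite -/(ebeta a d) -(fineK (ef a a0)) -EFinM mulVf ?gt_eqF.
  have := HC rho r01 => /(lee_wpmul2l (_ : (0 <= c2%:E)%E)) => /(_ c20) => h.
  rewrite mule1; apply: (le_trans (leeD2l _ h)).
  rewrite -EFinM -EFinD lee_fin mulrDl -(mulrA c2) lerD2r ler_peMr ?powR_ge0//.
  by apply: powRN_ge1; [rewrite subr_ge0 ltW|rewrite subr_gt0 r1 gerBl].
exists (B^-1 * cl); split; first by rewrite mulr_gt0 ?invr_gt0.
move=> rho r01; have := Hl rho r01 => /(lee_wpmul2l (_ : (0 <= (B^-1)%:E)%E)) => /(_ Bi).
rewrite -EFinM mulrA => /le_trans; apply.
rewrite -integralZlR//.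
- exact: measurable_beta.
- by move=> s _; rewrite mulr_ge0 ?powR_ge0.
Qed.

End Beta.

(** * Gaussian integrals and polar coordinates *)

Section GaussMoments.
Context {R : realType}.
Local Notation mu := (@lebesgue_measure R).

Definition gauss (x : R) : R := expR (- x ^+ 2).

Lemma measurable_gauss (D : set R) : measurable_fun D gauss.
Proof.
apply: (measurable_funS measurableT) => //.
apply: (measurableT_comp (f := expR)); first exact: measurable_expR.
by apply: measurableT_comp => //; exact: measurable_funX.
Qed.

Lemma gauss_ge0 (x : R) : 0 <= gauss x. Proof. exact: expR_ge0. Qed.

Lemma isd_gauss (x : R) : is_derive x 1 gauss (- (2 * x) * gauss x).
Proof.
apply: (is_derive_eq (isd_expR (isdN (isdX 2 (isd_id x))))).
by rewrite /gauss expr1 mulr1 mulrC.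
Qed.

Definition hmom (m : nat) : \bar R := (\int[mu]_(x in `]0%R, +oo[) (x ^+ m * gauss x)%:E)%E.

Lemma measurable_hmom m (D : set R) : measurable_fun D (fun x : R => x ^+ m * gauss x).
Proof. by apply: measurable_funM; [exact: measurable_funX|exact: measurable_gauss]. Qed.

(** Follows from x^2 - x + 1 >= 0; it compares Gaussian moments on the half-line with the Gamma
    integral at integers. *)
Lemma gauss_le (x : R) : gauss x <= expR 1 * expR (- x).
Proof. by rewrite -expRD ler_expR; have := sqr_ge0 (x - 2^-1); rewrite sqrrB; nra. Qed.

Lemma pos_oy (x : R) : `]0%R, +oo[%classic x -> 0 < x.
Proof. by rewrite /= in_itv/= andbT. Qed.

Lemma hmom_ge0 m : (0 <= hmom m)%E.
Proof.
by apply: integral_ge0 => x /pos_oy x0; rewrite lee_fin mulr_ge0 ?gauss_ge0// exprn_ge0// ltW.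
Qed.

Lemma hmom_fin m : (hmom m < +oo)%E.
Proof.
apply: (@le_lt_trans _ _ ((expR 1)%:E * eGamma m.+1%:R)%E); last first.
  by rewrite lte_mul_pinfty ?lee_fin ?expR_ge0 ?eGamma_nat_fin.
rewrite /eGamma -integralZlR ?expR_ge0//; last 2 first.
- by apply/measurable_EFinP; exact: measurable_powR_exp.
- by move=> x _; rewrite mulr_ge0 ?powR_ge0 ?expR_ge0.
apply: le_integralR => //.
- exact: measurable_hmom.
- by apply: measurable_funM => //; apply/measurable_EFinP; exact: measurable_powR_exp.
- by move=> x /pos_oy x0; rewrite mulr_ge0 ?gauss_ge0// exprn_ge0// ltW.
move=> x /pos_oy x0; rewrite -natr1 addrK powR_mulrn ?(ltW x0)// mulrCA.
by rewrite ler_wpM2l ?gauss_le// exprn_ge0// ltW.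
Qed.

Lemma hmom_gt0 m : (0 < hmom m)%E.
Proof.
pose c := expR (- 2 ^+ 2) : R.
have c0 : 0 < c by rewrite expR_gt0.
apply: (@lt_le_trans _ _ c%:E); first by rewrite lte_fin.
apply: (@le_trans _ _ (\int[mu]_(t in `[1%R, 2%R]) (t ^+ m * gauss t)%:E)%E).
  apply: (@le_trans _ _ (\int[mu]_(t in `[1%R, 2%R]) c%:E)%E).
    rewrite integral_cst//= lebesgue_measure_itv/= lte_fin ltr1n/=.
    by rewrite -EFinD -EFinM lee_fin (_ : 2 - 1 = 1) ?mulr1//; lra.
  apply: le_integralR => //.
  - exact: measurable_hmom.
  - by move=> *; exact: ltW.
  move=> x /=; rewrite in_itv/= => /andP[x1 x2].
  rewrite -[leLHS]mul1r ler_pM// ?(ltW c0)// ?exprn_ege1//.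
  by rewrite /c /gauss ler_expR lerN2 lerXn2r// ?nnegrE// (le_trans _ x1).
apply: ge0_subset_integral => //.
- by apply/measurable_EFinP; exact: measurable_hmom.
- by move=> x /pos_oy x0; rewrite lee_fin mulr_ge0 ?gauss_ge0// exprn_ge0// ltW.
- by move=> x /=; rewrite !in_itv/= andbT => /andP[x1 _]; apply: lt_le_trans x1.
Qed.

Lemma hmom_rec m : (2%:E * hmom m.+2 = m.+1%:R%:E * hmom m)%E.
Proof.
have hm k : measurable_fun (`]0%R, +oo[%classic : set R) (fun x : R => x ^+ k * gauss x) by exact: measurable_hmom.
have h0 k (x : R) : `]0%R, +oo[%classic x -> 0 <= x ^+ k * gauss x.
  by move=> /pos_oy x0; rewrite mulr_ge0 ?gauss_ge0// exprn_ge0// ltW.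
rewrite /hmom -!integralZlR//; try by first [exact: hm|exact: h0].
have dF (x : R) : 0 < x -> is_derive x 1 (fun y : R => - (y ^+ m.+1 * gauss y))
   (2 * (x ^+ m.+2 * gauss x) - m.+1%:R * (x ^+ m * gauss x)).
  move=> x0; apply: (is_derive_eq (isdN (isdM (isdX m.+1 (isd_id x)) (isd_gauss x)))).
  by rewrite /= !exprS; ring.
have ck k (c x : R) : {for x, continuous (fun x : R => c * (x ^+ k * gauss x))}.
  by apply: (isd_cont (isdZ c (isdM (isdX k (isd_id x)) (isd_gauss x)))).
rewrite (FTC_oy (l0 := 0) (loo := 0) dF) ?subrr ?adde0//.
- by move=> x x0; rewrite mulr_ge0 ?h0//= in_itv/= x0.
- by move=> x x0; rewrite mulr_ge0 ?h0//= in_itv/= x0.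
- rewrite [X in _ --> X](_ : 0 = - (0 ^+ m.+1 * gauss 0)); last by rewrite expr0n mul0r oppr0.
  apply: cvg_at_right_filter.
  exact: (isd_cont (isdN (isdM (isdX m.+1 (isd_id 0)) (isd_gauss 0)))).
- apply: (powR_expN_cvg0 (r := m.+1%:R) (C := expR 1)) => x x1.
  have x0 : 0 <= x by apply: le_trans x1.
  rewrite normrN ger0_norm ?mulr_ge0 ?exprn_ge0 ?gauss_ge0//.
  by rewrite powR_mulrn// mulrCA ler_wpM2l ?exprn_ge0// gauss_le.
Qed.

(** The moments of exp(-x^2) over the whole line, without normalisation. Setting the odd ones to 0
    lets [gmom_rec] hold for all m. *)
Definition gmom (m : nat) : R := if odd m then 0 else 2 * fine (hmom m).

Lemma gmom_rec m : 2 * gmom m.+2 = m.+1%:R * gmom m.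
Proof.
rewrite /gmom /= negbK; case: odd; first by rewrite !mulr0.
rewrite mulrCA [RHS]mulrCA; congr (_ * _).
have := hmom_rec m; have f k : hmom k \is a fin_num.
  by rewrite ge0_fin_numE ?hmom_ge0// hmom_fin.
by rewrite -(fineK (f m)) -(fineK (f m.+2)) -!EFinM => -[].
Qed.

Lemma gmom0_gt0 : 0 < gmom 0.
Proof. by rewrite /gmom/= mulr_gt0// fine_gt0// hmom_gt0 hmom_fin. Qed.

Lemma even_integral (f : R -> R) : measurable_fun setT f -> (forall x, 0 <= f x) ->
  (forall x, f (- x) = f x) ->
  (\int[mu]_x (f x)%:E = 2%:E * \int[mu]_(x in `]0%R, +oo[) (f x)%:E)%E.
Proof.
move=> mf f0 fe.
have mfD (D : set R) : measurable_fun D (EFin \o f).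
  by apply/measurable_EFinP; exact: (measurable_funS measurableT).
have -> : [set: R] = `]-oo, 0%R]%classic `|` `]0%R, +oo[%classic.
  apply/seteqP; split => x //= _; rewrite !in_itv/= andbT.
  by have [h|h] := leP x 0; [left|right].
rewrite ge0_integral_setU//=; last 3 first.
- exact: mfD.
- by move=> x _; rewrite lee_fin.
- apply/disj_setPS => x []/=; rewrite !in_itv/= andbT => h1 h2.
  by have := lt_le_trans h2 h1; rewrite ltxx.
have -> : (\int[mu]_(x in `]-oo, 0%R]) (f x)%:E = \int[mu]_(x in `]0%R, +oo[) (f x)%:E)%E.
  rewrite integral_itv_obnd_cbnd; last exact: mfD.
  rewrite (@ge0_integration_by_substitution0 _ (EFin \o f) (mfD setT))//.
  by apply: eq_integral => x _ /=; rewrite fe.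
by rewrite -[in RHS](_ : (1 + 1)%:E = 2%:E)%E// EFinD ge0_muleDl// !mul1e.
Qed.

End GaussMoments.

(** * Behaviour of Lebesgue measure under dilations *)

Section Scaling.
Context {R : realType}.
Local Notation mu := (@lebesgue_measure R).

Definition scl (c : R) (x : measurableTypeR R) : measurableTypeR R := c * x.

Lemma measurable_scl c : measurable_fun setT (scl c).
Proof. exact: measurable_funM. Qed.

HB.instance Definition _ c := isMeasurableFun.Build _ _ _ _ (scl c) (@measurable_scl c).

(** The measure [m], c times the image of Lebesgue measure under the dilation, has the right value
    on half-open intervals, hence is Lebesgue measure. *)
Lemma integral_scl (c : R) (f : R -> \bar R) : 0 < c -> measurable_fun setT f ->
  (forall x, 0 <= f x)%E -> (\int[mu]_x f (c * x)%R = (c^-1)%:E * \int[mu]_x f x)%E.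
Proof.
move=> c0 mf f0.
pose m : {measure set (measurableTypeR R) -> \bar R} :=
  (fun h => mscale (NngNum (ltW c0)) (measure_function_pushforward__canonical__measure_function_Measure mu h)) (measurable_scl c).
have E : (\int[mu]_x f x = \int[m]_x f x)%E.
  apply: eq_measure_integral => A mA _; apply: lebesgue_measure_unique => // X [[a b]] _ <-.
  change (mu `]a, b]%classic = c%:E * mu (scl c @^-1` `]a, b]%classic))%E.
  have -> : scl c @^-1` `]a, b]%classic = `]a / c, b / c]%classic.
    by apply/seteqP; split => x /=; rewrite !in_itv/= /scl ltr_pdivrMr// ler_pdivlMr// !(mulrC x).
  rewrite !lebesgue_measure_itv/= !lte_fin ltr_pM2r ?invr_gt0//.
  case: ifP => _; last by rewrite mule0.
  by rewrite -!EFinB -EFinM -mulrBl mulrCA divff ?mulr1// gt_eqF.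
rewrite E /m ge0_integral_mscale//= muleA -EFinM mulVf ?gt_eqF// mul1e.
by rewrite (ge0_integral_pushforward (measurable_scl c))//=.
Qed.

Definition rscale n (c : R) (x : Rn R n) : Rn R n := map_tuple (fun t : R => c * t) x.

Lemma tnth_rscale n c (x : Rn R n) i : tnth (rscale c x) i = c * tnth x i.
Proof. by rewrite tnth_map. Qed.

Lemma measurable_rscale2 n : measurable_fun setT (fun p : measurableTypeR R * Rn R n => rscale p.1 p.2).
Proof.
apply/measurable_fun_tnthP => i.
rewrite (_ : _ \o _ = fun p => (p.1 : R) * (tnth p.2 i : R)); last first.
  by apply/funext => p /=; rewrite tnth_rscale.
apply: measurable_funM; first exact: measurable_fst.
by apply: (measurableT_comp (measurable_tnth i)); exact: measurable_snd.
Qed.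

Lemma measurable_rscale n c : measurable_fun setT (@rscale n c).
Proof.
have -> : @rscale n c = (fun p : measurableTypeR R * Rn R n => rscale p.1 p.2) \o (fun x => (c : measurableTypeR R, x)).
  by [].
by apply: measurableT_comp; [exact: measurable_rscale2|exact: measurable_pair1].
Qed.

Lemma rscale_cons n c z (t : Rn R n) : rscale c (consR (z, t)) = consR (c * z, rscale c t).
Proof. exact: val_inj. Qed.

Lemma ge0_integral_cons n (f : Rn R n.+1 -> \bar R) : measurable_fun setT f ->
  (forall x, 0 <= f x)%E ->
  (\int[lebesgue_Rn n.+1]_x f x = \int[mu]_z \int[lebesgue_Rn n]_t f (consR (z, t)))%E.
Proof.
move=> mf f0; rewrite /= (ge0_integral_pushforward (@measurable_consR R n))//=.
rewrite fubini_tonelli1//.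
by apply: measurableT_comp => //; exact: measurable_consR.
Qed.

Lemma measurable_fubini_cons n (f : Rn R n.+1 -> \bar R) : measurable_fun setT f ->
  (forall x, 0 <= f x)%E ->
  measurable_fun setT (fun z => \int[lebesgue_Rn n]_t f (consR (z, t)))%E.
Proof.
move=> mf f0; apply: (measurable_fun_fubini_tonelli_F (m2 := lebesgue_Rn n) (f \o @consR R n)) => /=.
  by apply: measurableT_comp => //; exact: measurable_consR.
by move=> x; exact: f0.
Qed.

Lemma integral_rscale n (c : R) (f : Rn R n -> \bar R) : 0 < c -> measurable_fun setT f ->
  (forall x, 0 <= f x)%E ->
  (\int[lebesgue_Rn n]_x f (rscale c x) = (c ^- n)%:E * \int[lebesgue_Rn n]_x f x)%E.
Proof.
move=> c0; elim: n f => [|n IH] f mf f0.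
  rewrite expr0 invr1 mul1e; apply: eq_integral => x _; congr f.
  by rewrite [x]tuple0; apply: val_inj.
have mfs : measurable_fun setT (f \o @rscale n.+1 c).
  by apply: measurableT_comp => //; exact: measurable_rscale.
transitivity (\int[mu]_z \int[lebesgue_Rn n]_t (f \o @rscale n.+1 c) (consR (z, t)))%E.
  exact: (ge0_integral_cons mfs (fun x => f0 _)).
rewrite ge0_integral_cons//.
have mfc (z : R) : measurable_fun setT (fun t : Rn R n => f (consR (z, t))).
  apply: measurableT_comp => //.
  exact: (measurableT_comp (@measurable_consR R n) (measurable_pair1 (z : measurableTypeR R))).
under eq_integral => z _.
  rewrite (_ : (\int[lebesgue_Rn n]_t _)%E = (c ^- n)%:E * \int[lebesgue_Rn n]_t f (consR ((c * z)%R, t)))%E; last first.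
    by rewrite -(IH (fun t => f (consR ((c * z)%R, t))))//; apply: eq_integral => t _ /=; rewrite rscale_cons.
  over.
have mF := measurable_fubini_cons mf f0.
have F0 z : (0 <= \int[lebesgue_Rn n]_t f (consR (z, t)))%E by apply: integral_ge0.
rewrite ge0_integralZl//; last 2 first.
- exact: (measurableT_comp mF (measurable_scl c)).
- by rewrite lee_fin invr_ge0 exprn_ge0// ltW.
rewrite (integral_scl (f := fun z => \int[lebesgue_Rn n]_t f (consR (z, t)))%E)//.
by rewrite muleA -EFinM exprSr invfM mulrC.
Qed.

End Scaling.

Section Norms.
Context {R : realType}.

Lemma enorm_ge0 n (x : Rn R n) : 0 <= enorm x. Proof. exact: sqrtr_ge0. Qed.

Lemma enorm_sqr n (x : Rn R n) : enorm x ^+ 2 = \sum_(i < n) (tnth x i : R) ^+ 2.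
Proof. by rewrite sqr_sqrtr// sumr_ge0// => i _; rewrite sqr_ge0. Qed.

Lemma enorm_rscale n c (x : Rn R n) : 0 <= c -> enorm (rscale c x) = c * enorm x.
Proof.
move=> c0; apply/eqP; rewrite -(@eqrXn2 _ 2)// ?mulr_ge0 ?enorm_ge0// exprMn !enorm_sqr mulr_sumr.
by apply/eqP/eq_bigr => i _; rewrite tnth_rscale exprMn.
Qed.

Lemma enorm_eq0 n (x : Rn R n) : enorm x = 0 -> forall i, tnth x i = 0 :> R.
Proof.
move=> x0 i; have := enorm_sqr x; rewrite x0 expr0n/= => /esym/eqP.
rewrite psumr_eq0; last by move=> j _; rewrite sqr_ge0.
by move=> /allP/(_ i); rewrite mem_index_enum sqrf_eq0/= => /(_ isT)/eqP.
Qed.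

Lemma tnth_direction n (x : Rn R n) i : tnth (direction x) i = (tnth x i : R) / enorm x.
Proof. by rewrite tnth_mktuple. Qed.

Lemma rscale_direction n (x : Rn R n) : rscale (enorm x) (direction x) = x.
Proof.
apply: eq_from_tnth => i; rewrite tnth_rscale tnth_direction mulrCA.
have [/enorm_eq0 ->|x0] := eqVneq (enorm x) 0; first by rewrite mul0r.
by rewrite divff// mulr1.
Qed.

Lemma direction_rscale n c (x : Rn R n) : 0 < c -> direction (rscale c x) = direction x.
Proof.
move=> c0; apply: eq_from_tnth => i.
rewrite !tnth_direction tnth_rscale enorm_rscale ?(ltW c0)// invfM mulrACA divff ?mul1r//.
by rewrite gt_eqF.
Qed.

Lemma usphere_direction n (x : Rn R n) : enorm x != 0 -> usphere (direction x).
Proof.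
move=> x0; rewrite /usphere /=.
have := enorm_rscale (direction x) (enorm_ge0 x); rewrite rscale_direction => /esym.
by move/(canRL (mulKf x0)); rewrite mulVf.
Qed.

Lemma enorm_cons n z (t : Rn R n) : enorm (consR (z, t)) ^+ 2 = z ^+ 2 + enorm t ^+ 2.
Proof.
rewrite !enorm_sqr big_ord_recl (tnth_nth 0)/=; congr (_ + _).
by apply: eq_bigr => i _; rewrite !(tnth_nth 0).
Qed.

End Norms.

Section GaussRn.
Context {R : realType}.
Local Notation mu := (@lebesgue_measure R).

Definition gaussn n (x : Rn R n) : R := expR (- enorm x ^+ 2).

(** The exponents form a sequence on all of [nat], so that dropping the first coordinate is
    composition with [S] in the induction on the dimension. *)
Definition mon (m : nat -> nat) n (x : Rn R n) : R := \prod_(i < n) (tnth x i : R) ^+ m i.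

Lemma gaussn_cons n z (t : Rn R n) : gaussn (consR (z, t)) = gauss z * gaussn t.
Proof. by rewrite /gaussn enorm_cons opprD expRD. Qed.

Lemma mon_cons m n z (t : Rn R n) : mon m (consR (z, t)) = z ^+ m 0%N * mon (m \o S) t.
Proof.
rewrite /mon big_ord_recl (tnth_nth 0)/=; congr (_ * _).
by apply: eq_bigr => i _; rewrite !(tnth_nth 0).
Qed.

Lemma measurable_gaussn n : measurable_fun setT (@gaussn n).
Proof.
apply: (measurableT_comp (f := expR)); first exact: measurable_expR.
by apply: measurableT_comp => //; apply: measurable_funX; exact: measurable_enorm.
Qed.

Lemma measurable_mon m n : measurable_fun setT (@mon m n).
Proof.
by apply: measurable_prod => i _; apply: measurable_funX; exact: measurable_tnth.
Qed.

Lemma integrable_gmom m : mu.-integrable setT (EFin \o (fun x : R => x ^+ m * gauss x)).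
Proof.
apply/integrableP; split; first by apply/measurable_EFinP; exact: measurable_hmom.
rewrite (_ : (\int[_]_x _)%E = \int[mu]_x (`|x| ^+ m * gauss x)%:E)%E; last first.
  by apply: eq_integral => x _ /=; rewrite normrM normrX (ger0_norm (gauss_ge0 x)).
rewrite even_integral.
- rewrite lte_mul_pinfty// (le_lt_trans _ (hmom_fin m))//.
  rewrite le_eqVlt; apply/orP; left; apply/eqP; apply: eq_integral => x /set_mem/pos_oy x0.
  by rewrite gtr0_norm.
- by apply: measurable_funM; [apply: measurable_funX; exact: normr_measurable|exact: measurable_gauss].
- by move=> x; rewrite mulr_ge0 ?exprn_ge0 ?gauss_ge0.
- by move=> x; rewrite normrN /gauss sqrrN.
Qed.

Lemma integral_gmom m : (\int[mu]_x (x ^+ m * gauss x)%:E = (gmom m)%:E)%E.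
Proof.
rewrite /gmom; case: ifPn => [om|em]; last first.
  rewrite even_integral.
  - by rewrite EFinM fineK// ge0_fin_numE ?hmom_ge0// hmom_fin.
  - exact: measurable_hmom.
  - by move=> x; rewrite mulr_ge0 ?gauss_ge0// exprn_even_ge0.
  - by move=> x; rewrite /gauss sqrrN exprNn -signr_odd (negbTE em) expr0 mul1r.
set f := fun x : R => x ^+ m * gauss x.
have mo : measurable_fun setT (-%R : measurableTypeR R -> measurableTypeR R) by [].
have mf : measurable_fun setT (EFin \o f) by apply/measurable_EFinP; exact: measurable_hmom.
have fN x : f (- x) = - f x.
  by rewrite /f /gauss sqrrN exprNn -signr_odd om expr1 mulN1r mulNr.
have i := integrable_gmom m.
have iN : mu.-integrable setT ((EFin \o f) \o (-%R : measurableTypeR R -> measurableTypeR R)).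
  have -> : (EFin \o f) \o (-%R : measurableTypeR R -> measurableTypeR R) = -%E \o (EFin \o f).
    by apply/funext => x /=; rewrite fN.
  exact: integrableN.
have : (\int[mu]_x (f x)%:E = - \int[mu]_x (f x)%:E)%E.
  transitivity (\int[pushforward mu (-%R : measurableTypeR R -> measurableTypeR R)]_x (f x)%:E)%E.
    by apply: eq_measure_integral => A mA _; exact/esym/lebesgue_measureN.
  rewrite (integral_pushforward mo mf)//.
  rewrite preimage_setT -integralN//; last first.
    by apply: fin_num_adde_defl; rewrite fin_numN; apply: integrable_fin_num => //; exact: integrable_funeneg.
  by apply: eq_integral => x _ /=; rewrite fN.
have := integrable_fin_num measurableT i; rewrite -/f.
case: (\int[mu]_x (f x)%:E)%E => [r| |] //= _ [h]; congr EFin; lra.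
Qed.

(** Induction on the dimension by Fubini. Monomials change sign, so integrability has to be carried
    along with the value. *)
Lemma gauss_moment n m : (lebesgue_Rn n).-integrable setT (EFin \o (fun x : Rn R n => mon m x * gaussn x)) /\
  (\int[lebesgue_Rn n]_x (mon m x * gaussn x)%:E = (\prod_(i < n) gmom (m i))%:E)%E.
Proof.
elim: n m => [|n IH] m.
  have E (x : Rn R 0) : mon m x * gaussn x = 1.
    by rewrite /mon big_ord0 mul1r /gaussn enorm_sqr big_ord0 oppr0 expR0.
  split.
    apply/integrableP; split.
      by apply/measurable_EFinP/measurable_funM; [exact: measurable_mon|exact: measurable_gaussn].
    under eq_integral do rewrite /= E normr1.
    by rewrite integral_cst//= diracT mule1 ltry.
  under eq_integral do rewrite E.
  by rewrite integral_cst//= diracT mule1 big_ord0.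
have [IHi0 IHe] := IH (m \o S); have IHi := IHi0.
set h := fun x : Rn R n => _ in IHi.
set f := fun z : R => z ^+ m 0%N * gauss z.
have fi : mu.-integrable setT (EFin \o f) := integrable_gmom (m 0%N).
have mf : measurable_fun setT f by exact: measurable_hmom.
have mh : measurable_fun setT h.
  by apply/measurable_funM; [exact: measurable_mon|exact: measurable_gaussn].
pose g (p : measurableTypeR R * Rn R n) := (f p.1 * h p.2).
have mg : measurable_fun setT g.
  by apply: measurable_funM; [apply: (measurableT_comp mf)|apply: (measurableT_comp mh)].
have gE z t : mon m (consR (z, t)) * gaussn (consR (z, t)) = g (z, t).
  by rewrite mon_cons gaussn_cons /g /f /h mulrACA.
have mgE : measurable_fun setT (EFin \o g) by exact/measurable_EFinP.
have gi : (mu \x lebesgue_Rn n)%E.-integrable setT (EFin \o g).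
  apply: (proj2 (@integrable12ltyP _ _ _ _ _ (@lebesgue_measure R) (lebesgue_Rn n) _ mgE)).
  move/integrableP : IHi => [_ IHi]; move/integrableP : (fi) => [_ fi'].
  have H0 : (0 <= \int[lebesgue_Rn n]_x `|(EFin \o h) x|)%E by exact: integral_ge0.
  have -> : (\int[mu]_x \int[lebesgue_Rn n]_y `|(EFin \o g) (x, y)| =
      \int[mu]_x (`|(EFin \o f) x| * \int[lebesgue_Rn n]_x `|(EFin \o h) x|))%E.
    apply: eq_integral => z _; rewrite -ge0_integralZl//.
    - by apply: eq_integral => t _; rewrite /= /g normrM EFinM.
    - by apply: measurableT_comp => //; exact/measurable_EFinP.
  rewrite ge0_integralZr//.
  - by apply: lte_mul_pinfty => //; [exact: integral_ge0|rewrite ge0_fin_numE//; exact: integral_ge0].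
  - by apply: measurableT_comp => //; exact/measurable_EFinP.
have mm : measurable_fun setT (EFin \o (fun x : Rn R n.+1 => mon m x * gaussn x)).
  by apply/measurable_EFinP/measurable_funM; [exact: measurable_mon|exact: measurable_gaussn].
have gi' : (mu \x lebesgue_Rn n)%E.-integrable (@consR R n @^-1` setT)
   ((EFin \o (fun x : Rn R n.+1 => mon m x * gaussn x)) \o @consR R n).
  rewrite preimage_setT; apply: eq_integrable gi => // -[z t] _ /=.
  by rewrite gE.
split; first exact: (integrable_pushforward (@measurable_consR R n) mm gi' measurableT).
rewrite [LHS](integral_pushforward (@measurable_consR R n) mm gi' measurableT).
rewrite preimage_setT.
transitivity (\int[(mu \x lebesgue_Rn n)%E]_x (EFin \o g) x)%E.
  by apply: eq_integral => -[z t] _ /=; rewrite gE.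
rewrite -integral12_prod_meas1// big_ord_recl EFinM -[X in (X * _)%E]integral_gmom.
rewrite -integralZr//; apply: eq_integral => z _.
rewrite (_ : (\prod_(i < n) _)%:E = \int[lebesgue_Rn n]_x (mon (m \o S) x * gaussn x)%:E)%E; last first.
  by rewrite IHe.
by rewrite /fubini_F -integralZl.
Qed.

End GaussRn.

Lemma scale_cancel (R : realType) (v c : R) (l : \bar R) : v != 0 ->
  (c%:E * l = v^-1%:E * l * (v * c)%:E)%E.
Proof. by move=> v0; rewrite -muleA muleCA -EFinM mulKf// muleC. Qed.

(** * Polar coordinates *)

Section Polar.
Context {R : realType} {n : nat}.
Local Notation mu := (@lebesgue_measure R).
Local Notation la := (@lebesgue_Rn R n).

(** With radius 1 this is the set whose normalised volume is [sigma D]; its homogeneity in [a] is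
    the source of polar coordinates. *)
Definition cone (a : R) (D : set (Rn R n)) : set (Rn R n) :=
  [set x | enorm x < a] `&` direction @^-1` D.

Lemma measurable_cone a D : measurable D -> measurable (cone a D).
Proof.
move=> mD; apply: measurableI.
  rewrite -[X in measurable X]setTI (_ : [set x | _] = enorm @^-1` `]-oo, a[).
    exact: measurable_enorm.
  by apply/seteqP; split => x /=; rewrite in_itv.
by rewrite -[X in measurable X]setTI; exact: measurable_direction.
Qed.

Lemma cone_scale a D : 0 < a -> measurable D ->
  (la (cone a D) = (a ^+ n)%:E * la (cone 1 D))%E.
Proof.
move=> a0 mD.
have := @integral_rscale R n a (fun x => (\1_(cone a D) x)%:E) a0.
have mc b : measurable_fun setT (fun x => (\1_(cone b D) x : R)%:E).
  by apply/measurable_EFinP; apply: measurable_indic; exact: measurable_cone.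
move=> /(_ (mc a)).
have -> : (fun x => (\1_(cone a D) (rscale a x))%:E) = (fun x => (\1_(cone 1 D) x : R)%:E).
  apply/funext => x; rewrite !indicE; congr (_%:R%:E).
  apply: congr1; apply/idP/idP; rewrite !inE /cone/= direction_rscale// enorm_rscale ?(ltW a0)//.
    by rewrite gtr_pMr.
  by rewrite gtr_pMr.
rewrite !integral_indic ?setIT//; [|exact: measurable_cone..].
move=> -> => [|x]; last by rewrite lee_fin.
by rewrite muleA -EFinM divff ?mul1e// gt_eqF// exprn_gt0.
Qed.

Lemma gaussn_int : (\int[la]_x (gaussn x)%:E = (gmom 0 ^+ n)%:E)%E.
Proof.
have [_] := @gauss_moment R n (fun=> 0%N).
rewrite prodr_const card_ord => <-; apply: eq_integral => x _.
by rewrite /mon big1 ?mul1r// => i _; rewrite expr0.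
Qed.

Lemma uballE : (uball : set (Rn R n)) = cone 1 setT.
Proof. by rewrite /cone preimage_setT setIT. Qed.

(** The indicator of the ball is at most e times the Gaussian, whose integral is known. *)
Lemma vol_fin : (la uball < +oo)%E.
Proof.
have m1 := measurable_uball (R := R) (n := n).
apply: (@le_lt_trans _ _ (\int[la]_x (expR 1 * gaussn x)%:E)%E); last first.
  rewrite integralZlR ?expR_ge0// ?gaussn_int ?ltry//; first exact: measurable_gaussn.
  by move=> x _; exact: expR_ge0.
rewrite -(setIT uball) -integral_indic//.
apply: le_integralR => //.
  by apply: measurable_funM => //; exact: measurable_gaussn.
move=> x _; rewrite indicE; case: (boolP (x \in uball)) => [|_]; last by rewrite mulr_ge0 ?expR_ge0.
rewrite inE /uball /= => x1; rewrite /gaussn -expRD -[leLHS]expR0 ler_expR subr_ge0.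
by rewrite expr_le1 ?enorm_ge0 ?(ltW x1).
Qed.

(** If the ball were null, so would be all its dilates and then the whole space, against the
    positive Gaussian integral. *)
Lemma vol_gt0 : (0 < la uball)%E.
Proof.
rewrite lt_neqAle measure_ge0 andbT; apply/eqP => v0.
have z (k : nat) : la (cone k.+1%:R setT) = 0%E.
  by rewrite cone_scale// -uballE -v0 mule0.
have T0 : la setT = 0%E.
  apply/eqP; rewrite eq_le measure_ge0 andbT.
  have -> : [set: Rn R n] = \bigcup_k cone k.+1%:R setT.
    apply/seteqP; split => x // _; exists (Num.bound (enorm x)) => //.
    split => //=; apply: (lt_le_trans (archi_boundP (enorm_ge0 x))).
    by rewrite ler_nat.
  apply: (le_trans (measure_sigma_subadditive (F := fun k => cone k.+1%:R setT) _ _ _ _)).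
  - by move=> k; exact: measurable_cone.
  - by apply: bigcupT_measurable => k; exact: measurable_cone.
  - by [].
  - by rewrite eseries0// => k _ _; exact: z.
have : (\int[la]_x (gaussn x)%:E = 0)%E.
  apply: null_set_integral => //.
  by apply: measurableT_comp => //; exact: measurable_gaussn.
rewrite gaussn_int => -[] /eqP; rewrite expf_eq0 gt_eqF ?andbF//.
exact: gmom0_gt0.
Qed.

Definition volR : R := fine (la uball).

Lemma volRE : (volR%:E = la uball)%E.
Proof. by rewrite fineK// ge0_fin_numE ?measure_ge0// vol_fin. Qed.

Lemma volR_gt0 : 0 < volR.
Proof. by rewrite -lte_fin volRE vol_gt0. Qed.

Lemma nuE A : (@nu R n A = volR^-1%:E * la (A `&` uball))%E.
Proof. by []. Qed.

Lemma sigmaE A : (@sigma R n A = volR^-1%:E * la (cone 1 A))%E.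
Proof. by rewrite /cone setIC. Qed.

Lemma nuT : (@nu R n setT = 1)%E.
Proof. by rewrite nuE setTI -volRE -EFinM mulVf// gt_eqF// volR_gt0. Qed.

Lemma sigmaT : (@sigma R n setT = 1)%E. Proof. exact: nuT. Qed.

Lemma sigma_fin : fin_num_fun (@sigma R n).
Proof.
move=> A mA; rewrite ge0_fin_numE ?measure_ge0//.
apply: (@le_lt_trans _ _ (sigma (setT : set (Rn R n)))); last by rewrite sigmaT ltry.
by apply: le_measure; rewrite ?inE.
Qed.

HB.instance Definition _ := Measure_isFinite.Build _ _ _ (@sigma R n) sigma_fin.

(** An alias of [nu] that carries the finite-measure structure, from which the Tonelli lemmas get
    sigma-finiteness. *)
Definition nuF : set (Rn R n) -> \bar R := nu.
HB.instance Definition _ := Measure.copy nuF (@nu R n : {measure set _ -> \bar R}).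

Lemma nuF_fin : fin_num_fun nuF.
Proof.
move=> A mA; rewrite ge0_fin_numE ?measure_ge0//.
apply: (@le_lt_trans _ _ (nuF setT)); last by rewrite /nuF nuT ltry.
by apply: le_measure; rewrite ?inE.
Qed.

HB.instance Definition _ := Measure_isFinite.Build _ _ _ nuF nuF_fin.

(** The density of |x| under Lebesgue measure; n vol(B) is the area of the sphere, [sigma] being
    normalised. *)
Definition wrad : R -> R := (fun r => n%:R * volR * r ^+ n.-1) \_ `]0, +oo[.

Lemma wrad_ge0 r : 0 <= wrad r.
Proof.
rewrite /wrad patchE; case: ifPn => // /set_mem/pos_oy r0.
by rewrite !mulr_ge0 ?exprn_ge0 ?(ltW volR_gt0) ?(ltW r0).
Qed.

Lemma measurable_wrad : measurable_fun setT wrad.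
Proof.
apply/(measurable_restrictT _ _).1 => //.
by apply: measurable_funM => //; exact: measurable_funX.
Qed.

Definition radm : set (measurableTypeR R) -> \bar R := density_measure mu measurable_wrad wrad_ge0.
HB.instance Definition _ := Measure.copy radm
  (density_measure mu measurable_wrad wrad_ge0 : {measure set (measurableTypeR R) -> \bar R}).

Lemma radm_ray (a : R) : (0 < n)%N -> radm `]-oo, a[ = ((if 0 < a then volR * a ^+ n else 0)%:E)%E.
Proof.
move=> n0; rewrite /radm /= /density.
have h : (\int[mu]_(x in `]-oo, a[) (wrad x)%:E = \int[mu]_(x in `]0%R, a[) (n%:R * volR * x ^+ n.-1)%:E)%E.
  rewrite integral_mkcond [RHS]integral_mkcond; apply: eq_integral => x _.
  rewrite !patchE /wrad patchE !mem_setE !in_itv/= andbT.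
  by rewrite andbC; case: (x < a) => //=; case: (0 < x).
rewrite h; case: ifPn => [a0|a0]; last first.
  rewrite (_ : `]0%R, a[%classic = set0) ?integral_set0//.
  apply/seteqP; split => x //=; rewrite in_itv/= => /andP[h1 h2].
  by move: a0; rewrite (lt_trans h1 h2).
have dF (x : R) : 0 < x < a -> is_derive x 1 (fun y : R => volR * y ^+ n) (n%:R * volR * x ^+ n.-1 - 0).
  move=> _; apply: (is_derive_eq (isdZ volR (isdX n (isd_id x)))).
  by rewrite subr0 mulr1 mulrCA mulrA.
have c m (k x : R) : {for x, continuous (fun y : R => k * y ^+ m)}.
  exact: (isd_cont (isdZ k (isdX m (isd_id x)))).
rewrite (FTC_oo (la := 0) (lb := volR * a ^+ n) dF) ?integral0 ?add0e ?subr0//.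
- by move=> x /andP[x0 _]; rewrite !mulr_ge0 ?exprn_ge0 ?(ltW volR_gt0) ?(ltW x0).
- by move=> x _; exact: cvg_cst.
- rewrite [X in _ --> X](_ : 0 = volR * 0 ^+ n); last by rewrite expr0n gtn_eqF// mulr0.
  by apply: cvg_at_right_filter; exact: c.
- by apply: cvg_at_left_filter; exact: c.
Qed.

Lemma radm_sigma_finite : sigma_finite setT radm.
Proof.
exists (fun k => `]-oo, k%:R[%classic).
  apply/esym/seteqP; split => // x _; exists (Num.bound `|x|) => //=.
  by rewrite in_itv/= (le_lt_trans (ler_norm x))// archi_boundP.
move=> k; split; first exact: measurable_itv.
have [n0|n0] := posnP n; last by rewrite radm_ray// ltry.
rewrite /radm /= /density (eq_integral (fun=> 0%E)) ?integral0// => x _.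
by rewrite /wrad patchE n0 !mul0r; case: ifP.
Qed.

HB.instance Definition _ := Measure_isSigmaFinite.Build _ _ _ radm radm_sigma_finite.

Lemma measurable_polar : measurable_fun setT
  (fun x : Rn R n => (enorm x : measurableTypeR R, direction x)).
Proof. by apply/measurable_fun_pair; [exact: measurable_enorm|exact: measurable_direction]. Qed.

(** By uniqueness of product measures only rectangles I x D matter. For fixed D both sides are
    measures in I and agree on the rays below a, where [cone_scale] gives the factor a^n; these rays
    generate the Borel sets. *)
Lemma polar_measure A : (0 < n)%N -> measurable A ->
  ((radm \x @sigma R n) A = la ((fun x => (enorm x, direction x)) @^-1` A))%E.
Proof.
move=> n0 mA.
apply: (@product_measure_unique _ _ _ _ _ radm (@sigma R n) (measure_function_pushforward__canonical__measure_function_Measure la measurable_polar)) => // I D mI mD.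
change (la ((fun x => (enorm x, direction x)) @^-1` (I `*` D)) = radm I * sigma D)%E.
have mdD : measurable (direction @^-1` D : set (Rn R n)).
  by rewrite -[X in measurable X]setTI; exact: measurable_direction.
have me : measurable_fun setT (fun x : Rn R n => enorm x : measurableTypeR R) by exact: measurable_enorm.
pose m1' : {measure set (measurableTypeR R) -> \bar R} :=
  measure_function_pushforward__canonical__measure_function_Measure (mrestr la mdD) me.
have s0 : 0 <= fine (@sigma R n D) by rewrite fine_ge0.
pose m2 : {measure set (measurableTypeR R) -> \bar R} := mscale (NngNum s0) radm.
have E : m1' I = m2 I.
  apply: (@measure_unique _ R (measurableTypeR R) (@RGenInftyO.G R) (fun k : nat => `]-oo, (k%:R : R)[%classic) _ _ _ _ m1' m2) => //.
  - exact: RGenInftyO.measurableE.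
  - move=> _ _ [a ->] [b ->]; exists (Num.min a b); apply/seteqP; split => x /=.
      by rewrite !in_itv/= lt_min => -[-> ->].
    by rewrite !in_itv/= lt_min => /andP[-> ->].
  - by move=> i; exists i%:R.
  - apply/seteqP; split => // x _; exists (Num.bound `|x|) => //=.
    by rewrite in_itv/= (le_lt_trans (ler_norm x))// archi_boundP.
  - move=> _ [a ->].
    change (la (enorm @^-1` `]-oo, a[ `&` direction @^-1` D) = (fine (@sigma R n D))%:E * radm `]-oo, a[)%E.
    have -> : enorm @^-1` `]-oo, a[ `&` direction @^-1` D = cone a D.
      by apply/seteqP; split => x; rewrite /cone/= in_itv.
    rewrite (radm_ray a n0) (fineK (sigma_fin mD)).
    case: ifPn => a0.
      rewrite (cone_scale a0 mD) sigmaE; apply: scale_cancel.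
      by rewrite gt_eqF// volR_gt0.
    rewrite mule0 (_ : cone a D = set0) ?measure0//; apply/seteqP; split => x // -[/= xa _].
    by move: a0; rewrite -leNgt => a0; have := le_lt_trans (enorm_ge0 x) (lt_le_trans xa a0); rewrite ltxx.
  - move=> k.
    change (la (enorm @^-1` `]-oo, k%:R[ `&` direction @^-1` D) < +oo)%E.
    apply: (@le_lt_trans _ _ (la (cone k.+1%:R setT))).
      apply: le_measure; rewrite ?inE.
      - apply: measurableI => //; rewrite -[X in measurable X]setTI.
        exact: measurable_enorm.
      - exact: measurable_cone.
      - by move=> x [/=]; rewrite in_itv/= => xk _; split => //=; rewrite (lt_trans xk)// ltr_nat.
    by rewrite cone_scale// -uballE -volRE ltry.
change (la (enorm @^-1` I `&` direction @^-1` D) = radm I * sigma D)%E.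
change (la (enorm @^-1` I `&` direction @^-1` D) = (fine (@sigma R n D))%:E * radm I)%E in E.
rewrite E (fineK (sigma_fin mD)); exact: muleC.
Qed.

Lemma ge0_polar (f : Rn R n -> \bar R) : (0 < n)%N -> measurable_fun setT f ->
  (forall x, 0 <= f x)%E ->
  (\int[la]_x f x = \int[mu]_(r in `]0%R, +oo[)
     ((n%:R * volR * r ^+ n.-1)%:E * \int[@sigma R n]_z f (rscale r z)))%E.
Proof.
move=> n0 mf f0.
pose F (p : measurableTypeR R * Rn R n) := f (rscale p.1 p.2).
have mF : measurable_fun setT F by apply: measurableT_comp => //; exact: measurable_rscale2.
have F0 p : (0 <= F p)%E by exact: f0.
transitivity (\int[(radm \x @sigma R n)%E]_p F p)%E.
  transitivity (\int[measure_function_pushforward__canonical__measure_function_Measure la measurable_polar]_p F p)%E.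
    rewrite (ge0_integral_pushforward measurable_polar)//=.
    by apply: eq_integral => x _; rewrite /F/= rscale_direction.
  apply: eq_measure_integral => A mA _; exact: (esym (polar_measure n0 mA)).
rewrite fubini_tonelli1// /fubini_F.
rewrite (@ge0_integral_density _ _ _ mu _ measurable_wrad wrad_ge0 (fun r => \int[@sigma R n]_z F (r, z))%E).
- rewrite [RHS]integral_mkcond; apply: eq_integral => r _.
  rewrite /wrad !patchE; case: ifPn => _; last by rewrite mule0.
  by rewrite muleC.
- exact: (measurable_fun_fubini_tonelli_F (m2 := @sigma R n) F).
- by move=> r; exact: integral_ge0.
Qed.

(** [nu] is recognised as the measure with density [volR^-1 * \1_uball], so that
    [ge0_integral_density] applies. *)
Lemma integral_nu (D : set (Rn R n)) (f : Rn R n -> \bar R) : measurable D ->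
  measurable_fun D f -> (forall x, D x -> 0 <= f x)%E ->
  (\int[nu]_(x in D) f x = volR^-1%:E * \int[la]_(x in D `&` uball) f x)%E.
Proof.
move=> mD mf f0.
have m1 : measurable_fun setT (fun x : Rn R n => volR^-1 * \1_uball x).
  by apply: measurable_funM => //; apply: measurable_indic; exact: measurable_uball.
have p1 (x : Rn R n) : 0 <= volR^-1 * \1_uball x.
  by rewrite mulr_ge0// invr_ge0 (ltW volR_gt0).
rewrite integral_mkcond.
have mfD : measurable_fun setT (f \_ D) by apply/(measurable_restrictT _ _).1.
have fD0 x : (0 <= (f \_ D) x)%E.
  by rewrite patchE; case: ifPn => // /set_mem; exact: f0.
transitivity (\int[density_measure la m1 p1]_x (f \_ D) x)%E.
  apply: eq_measure_integral => A mA _; rewrite /= /density nuE.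
  rewrite integralZlR// ?invr_ge0 ?(ltW volR_gt0)//; last first.
    by apply: (measurable_funS measurableT) => //; apply: measurable_indic; exact: measurable_uball.
  rewrite integral_indic; [|exact: mA|exact: measurable_uball].
  congr (_ * la _)%E; exact: setIC.
rewrite ge0_integral_density// [X in (_ * X)%E]integral_mkcond -ge0_integralZl//.
- apply: eq_integral => x _; rewrite !patchE in_setI indicE.
  case: (x \in D) => /=; last by rewrite mul0e mule0.
  by case: (x \in uball); rewrite ?mulr1 ?mulr0 ?mule0// muleC.
- apply/(measurable_restrictT _ _).1; first by apply: measurableI => //; exact: measurable_uball.
  by apply: (measurable_funS mD) => // x [].
- by move=> x _; rewrite patchE; case: ifPn => // /set_mem[Dx _]; exact: f0.
- by rewrite lee_fin invr_ge0 (ltW volR_gt0).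
Qed.

End Polar.

(** * Moments of the surface measure *)

Section SphereMeasure.
Context {R : realType} {n : nat}.
Hypothesis n0 : (0 < n)%N.
Local Notation mu := (@lebesgue_measure R).
Local Notation la := (@lebesgue_Rn R n).
Local Notation sg := (@sigma R n).

Lemma measurable_usphere : measurable (usphere : set (Rn R n)).
Proof.
rewrite -[X in measurable X]setTI (_ : usphere = enorm @^-1` [set 1]) //.
exact: measurable_enorm.
Qed.

(** Only the origin can have a direction off the sphere, so the cones of radius 1 and 2 over this
    set coincide. Dilation by 2 multiplies their finite measure by 2^n > 1, hence it is 0. *)
Lemma sigma_nsphere : (sg (~` usphere) = 0)%E.
Proof.
have mD : measurable (~` usphere : set (Rn R n)) by apply: measurableC; exact: measurable_usphere.
have h (x : Rn R n) : (~` usphere) (direction x) -> enorm x = 0.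
  by move=> H; apply/eqP; apply: contrapT => /negP x0; apply: H; exact: usphere_direction.
have E : cone 2 (~` usphere) = cone 1 (~` usphere) :> set (Rn R n).
  by apply/seteqP; split => x [_ Dx]; split => //=; rewrite (h _ Dx).
have := @cone_scale R n 2 _ (ltr0n _ 2) mD; rewrite E sigmaE.
have : (la (cone 1 (~` usphere)) < +oo)%E.
  apply: (@le_lt_trans _ _ (la uball)); last exact: vol_fin.
  rewrite uballE; apply: le_measure; rewrite ?inE; [exact: measurable_cone..|].
  by move=> x [].
have : (0 <= la (cone 1 (~` usphere)))%E by exact: measure_ge0.
case: (la (cone 1 (~` usphere))) => [r r0 _ [hr]|//|//].
have r0' : 0 <= r by [].
suff -> : r = 0 by rewrite mule0.
have : (1 : R) < 2 ^+ n by rewrite exprn_egt1// ?ltr1n// -lt0n.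
nra.
Qed.

Lemma ge0_sphere_integral (f : Rn R n -> \bar R) : measurable_fun setT f ->
  (forall x, 0 <= f x)%E -> (\int[sg]_x f x = \int[sg]_(x in usphere) f x)%E.
Proof.
move=> mf f0.
rewrite (@ge0_negligible_integral _ _ _ _ _ (~` usphere))//.
- by rewrite setTD setCK.
- by apply: measurableC; exact: measurable_usphere.
- exact: sigma_nsphere.
Qed.

Lemma eq_sphere_integral (f g : Rn R n -> \bar R) : measurable_fun setT f ->
  (forall x, 0 <= f x)%E -> measurable_fun setT g -> (forall x, 0 <= g x)%E ->
  (forall x, usphere x -> f x = g x) -> (\int[sg]_x f x = \int[sg]_x g x)%E.
Proof.
move=> mf f0 mg g0 fg; rewrite ge0_sphere_integral// [RHS]ge0_sphere_integral//.
by apply: eq_integral => x /set_mem; exact: fg.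
Qed.

Lemma measurable_polar_section (f : Rn R n -> \bar R) : measurable_fun setT f ->
  (forall x, 0 <= f x)%E -> measurable_fun setT (fun r : measurableTypeR R => \int[sg]_z f (rscale r z))%E.
Proof.
move=> mf f0.
apply: (measurable_fun_fubini_tonelli_F (m2 := sg) (fun p : measurableTypeR R * Rn R n => f (rscale p.1 p.2))) => //.
by apply: measurableT_comp => //; exact: measurable_rscale2.
Qed.

Lemma ge0_nu_polar (f : Rn R n -> \bar R) : measurable_fun setT f ->
  (forall x, 0 <= f x)%E ->
  (\int[nu]_(x in uball) f x = \int[mu]_(r in `]0%R, 1%R[)
     ((n%:R * r ^+ n.-1)%:E * \int[sg]_z f (rscale r z)))%E.
Proof.
move=> mf f0.
have mB := measurable_uball (R := R) (n := n).
rewrite integral_nu// ?setIid; last exact: (measurable_funS measurableT).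
have mfB : measurable_fun setT (f \_ uball).
  by apply/(measurable_restrictT _ _).1 => //; exact: (measurable_funS measurableT).
have fB0 x : (0 <= (f \_ uball) x)%E by rewrite patchE; case: ifP.
rewrite integral_mkcond ge0_polar//.
have mg : measurable_fun setT (fun r : measurableTypeR R => \int[sg]_z (f \_ uball) (rscale r z))%E.
  exact: measurable_polar_section.
have g0 r : (0 <= \int[sg]_z (f \_ uball) (rscale r z))%E by exact: integral_ge0.
rewrite -ge0_integralZl//; last 3 first.
- apply: emeasurable_funM; last exact: (measurable_funS measurableT).
  by apply/measurable_EFinP/measurable_funM => //; exact: measurable_funX.
- move=> r /pos_oy r0; rewrite mule_ge0// lee_fin !mulr_ge0 ?exprn_ge0 ?(ltW volR_gt0) ?(ltW r0)//.
- by rewrite lee_fin invr_ge0 (ltW volR_gt0).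
rewrite integral_mkcond [RHS]integral_mkcond; apply: eq_integral => r _.
rewrite !patchE !mem_setE !in_itv/= andbT.
case: (ltP 0 r) => //= r0.
have -> : ((@volR R n)^-1%:E * ((n%:R * @volR R n * r ^+ n.-1)%:E * \int[sg]_z (f \_ uball) (rscale r z)) =
   (n%:R * r ^+ n.-1)%:E * \int[sg]_z (f \_ uball) (rscale r z))%E.
  rewrite muleA -EFinM; congr (_%:E * _)%E.
  by have := @volR_gt0 R n => h; field; rewrite gt_eqF.
have mr : measurable_fun setT (fun z => f (rscale r z)).
  by apply: measurableT_comp => //; exact: measurable_rscale.
have mrB : measurable_fun setT (fun z => (f \_ uball) (rscale r z)).
  by apply: measurableT_comp => //; exact: measurable_rscale.
case: (ltP r 1) => r1.
  congr (_ * _)%E; apply: eq_sphere_integral => // z.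
  rewrite /usphere/= => z1; rewrite patchE ifT// inE /uball/= enorm_rscale ?z1 ?mulr1//.
  exact: ltW.
rewrite (eq_sphere_integral (g := fun=> 0%E))// ?integral0 ?mule0// => z.
rewrite /usphere/= => z1; rewrite patchE ifF//; apply/negbTE; rewrite notin_setE /uball/= enorm_rscale ?z1 ?mulr1 ?(ltW r0)//.
by apply/negP; rewrite -leNgt.
Qed.

(** The radial factor n vol(B) int r^(n-1+k) exp(-r^2) dr: the Gaussian integral of a k-homogeneous
    function is this constant times its spherical mean. *)
Definition Csph (k : nat) : R := n%:R * @volR R n * fine (@hmom R (n.-1 + k)).

Lemma Csph_gt0 k : 0 < Csph k.
Proof.
rewrite /Csph !mulr_gt0 ?ltr0n ?volR_gt0// fine_gt0// hmom_gt0 hmom_fin//.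
Qed.

Lemma Csph_rec k : 2 * Csph k.+2 = (n + k)%:R * Csph k.
Proof.
rewrite /Csph mulrCA [RHS]mulrCA; congr (_ * _).
have f m : @hmom R m \is a fin_num by rewrite ge0_fin_numE ?hmom_ge0// hmom_fin.
have := congr1 fine (@hmom_rec R (n.-1 + k)); rewrite !fineM// !addnS /= => ->.
by rewrite -addSn prednK.
Qed.

Lemma homog_gauss_sphere (phi : Rn R n -> R) k : measurable_fun setT phi ->
  (forall x, 0 <= phi x) -> (forall r z, 0 < r -> phi (rscale r z) = r ^+ k * phi z) ->
  (\int[la]_x (phi x * gaussn x)%:E = (Csph k)%:E * \int[sg]_z (phi z)%:E)%E.
Proof.
move=> mphi phi0 hphi.
have mg : measurable_fun setT (fun x => (phi x * gaussn x)%:E).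
  by apply/measurable_EFinP/measurable_funM => //; exact: measurable_gaussn.
have g0 (x : Rn R n) : 0 <= gaussn x by exact: expR_ge0.
rewrite ge0_polar//; last by move=> x; rewrite lee_fin mulr_ge0.
have hm : @hmom R (n.-1 + k) \is a fin_num by rewrite ge0_fin_numE ?hmom_ge0// hmom_fin.
have S0 : (0 <= \int[sg]_z (phi z)%:E)%E by apply: integral_ge0 => z _; rewrite lee_fin.
rewrite /Csph EFinM fineK// /hmom.
have ve : 0 <= n%:R * @volR R n by rewrite mulr_ge0// (ltW volR_gt0).
rewrite -integralZlR//; last 2 first.
- exact: measurable_hmom.
- by move=> x /pos_oy x0; rewrite mulr_ge0 ?gauss_ge0 ?exprn_ge0// ltW.
rewrite -ge0_integralZr//; last 2 first.
- by apply/measurable_EFinP/measurable_funM => //; exact: measurable_hmom.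
- by move=> x /pos_oy x0; rewrite lee_fin !mulr_ge0 ?gauss_ge0 ?exprn_ge0 ?(ltW x0) ?(ltW volR_gt0).
apply: eq_integral => r /set_mem/pos_oy r0.
have -> : (\int[sg]_z (phi (rscale r z) * gaussn (rscale r z))%:E =
   (r ^+ k * gauss r)%:E * \int[sg]_z (phi z)%:E)%E.
  rewrite -integralZlR//; last by rewrite mulr_ge0 ?gauss_ge0 ?exprn_ge0// ltW.
  apply: eq_sphere_integral.
  - exact: (measurableT_comp mg (measurable_rscale r)).
  - by move=> x; rewrite lee_fin mulr_ge0.
  - by apply/measurable_EFinP; exact: measurable_funM.
  - by move=> x; rewrite lee_fin !mulr_ge0 ?gauss_ge0 ?exprn_ge0// ltW.
  move=> z; rewrite /usphere/= => z1.
  rewrite hphi// /gaussn enorm_rscale ?(ltW r0)// z1 mulr1 /gauss; congr EFin; ring.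
rewrite muleA -EFinM; congr (_%:E * _)%E; rewrite exprD; ring.
Qed.

Lemma mon_rscale m r (z : Rn R n) : mon m (rscale r z) = r ^+ (\sum_(i < n) m i) * mon m z.
Proof.
rewrite /mon expr_sum -big_split/=; apply: eq_bigr => i _.
by rewrite tnth_rscale exprMn.
Qed.

(** The polar formula concerns nonnegative functions, so the positive and negative parts, each
    homogeneous of the same degree, are treated separately. Dividing the Gaussian moment by [Csph]
    gives the spherical one. *)
Lemma sigma_mon (m : nat -> nat) : sg.-integrable setT (EFin \o @mon R m n) /\
  (\int[sg]_z (mon m z)%:E = ((\prod_(i < n) gmom (m i)) / Csph (\sum_(i < n) m i))%:E)%E.
Proof.
set k := (\sum_(i < n) m i)%N.
have mm := @measurable_mon R m n.
have C0 := Csph_gt0 k.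
have [/integrableP[_ iG] eG] := @gauss_moment R n m.
have g0 (x : Rn R n) : 0 <= gaussn x by exact: expR_ge0.
pose pos (x : Rn R n) := Num.max (mon m x) 0.
pose neg (x : Rn R n) := Num.max (- mon m x) 0.
have mpos : measurable_fun setT pos by apply: measurable_maxr.
have mneg : measurable_fun setT neg by apply: measurable_maxr => //; exact: measurableT_comp.
have pos0 x : 0 <= pos x by rewrite le_max lexx orbT.
have neg0 x : 0 <= neg x by rewrite le_max lexx orbT.
have hpos (r : R) (z : Rn R n) : 0 < r -> pos (rscale r z) = r ^+ k * pos z.
  by move=> r0; rewrite /pos mon_rscale maxr_pMr ?mulr0// exprn_ge0// ltW.
have hneg (r : R) (z : Rn R n) : 0 < r -> neg (rscale r z) = r ^+ k * neg z.
  by move=> r0; rewrite /neg mon_rscale -mulrN maxr_pMr ?mulr0// exprn_ge0// ltW.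
have habs (r : R) (z : Rn R n) : 0 < r -> `|mon m (rscale r z)| = r ^+ k * `|mon m z|.
  by move=> r0; rewrite mon_rscale normrM ger0_norm// exprn_ge0// ltW.
have mabs : measurable_fun setT (fun x : Rn R n => `|mon m x|).
  exact: (measurableT_comp (@normr_measurable R setT) mm).
have iabs := homog_gauss_sphere mabs (fun x => normr_ge0 _) habs.
have ipos := homog_gauss_sphere mpos pos0 hpos.
have ineg := homog_gauss_sphere mneg neg0 hneg.
have I : sg.-integrable setT (EFin \o @mon R m n).
  apply/integrableP; split; first exact/measurable_EFinP.
  move: iG; rewrite (_ : (\int[la]_x _)%E = \int[la]_x (`|mon m x| * gaussn x)%:E)%E; last first.
    by apply: eq_integral => x _; rewrite /= normrM (ger0_norm (g0 x)).
  rewrite iabs /=; case: (\int[sg]_x _)%E => [r _| |//]; first exact: ltry.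
  by rewrite gt0_muley ?lte_fin// ltxx.
split => //.
move: eG; rewrite integralE [in X in _ -> X]integralE.
have e1 (x : Rn R n) : (EFin \o @mon R m n)^\+%E x = (pos x)%:E by rewrite funeposE/= EFin_max.
have e2 (x : Rn R n) : (EFin \o @mon R m n)^\-%E x = (neg x)%:E by rewrite funenegE/= EFin_max.
have ip := integrable_fin_num measurableT (integrable_funepos measurableT I).
have in_ := integrable_fin_num measurableT (integrable_funeneg measurableT I).
rewrite (eq_integral (fun x => (pos x * gaussn x)%:E)); last first.
  by move=> x _; rewrite funeposE/= -EFin_max /pos maxr_pMl// mul0r.
rewrite [X in (_ - X)%E](eq_integral (fun x => (neg x * gaussn x)%:E)); last first.
  by move=> x _; rewrite funenegE/= -EFin_max /neg -mulNr maxr_pMl// mul0r.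
rewrite ipos ineg.
rewrite (eq_integral (fun x => (pos x)%:E)) in ip; last by move=> x _; exact: e1.
rewrite (eq_integral (fun x => (neg x)%:E)) in in_; last by move=> x _; exact: e2.
rewrite [X in _ -> (X - _)%E = _](eq_integral (fun x => (pos x)%:E)); last by move=> x _; exact: e1.
rewrite [X in _ -> (_ - X)%E = _](eq_integral (fun x => (neg x)%:E)); last by move=> x _; exact: e2.
rewrite -(fineK ip) -(fineK in_) -!EFinM -!EFinB => -[] <-.
by rewrite -mulrBr mulrAC divff ?mul1r// gt_eqF.
Qed.

End SphereMeasure.

(** * Zonal harmonics *)

Section Gegenbauer.
Context {R : realType}.

(* Three-term recurrence of the Gegenbauer polynomials of index [n / 2 - 1], rescaled to be 1 at 1. *)
Definition gcoefa (n k : nat) : R := (2 * k%:R + n%:R) / (k%:R + n%:R - 1).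
Definition gcoefb (n k : nat) : R := (k%:R + 1) / (k%:R + n%:R - 1).

Section generic.
Variables (n : nat) (A : comNzRingType) (c : R -> A) (l N : A).

(** Generic in the ring: with l = x.e and N = |x|^2 the same recurrence yields the polynomial [Gp]
    and its value [gegenR]. A pair is carried because the recurrence goes back two steps. *)
Fixpoint gpair (k : nat) : A * A :=
  if k is k'.+1 then
    let p := gpair k' in
    (p.2, c (gcoefa n k') * (l * p.2) - c (gcoefb n k') * (N * p.1))
  else (1, l).

Definition gegen k := (gpair k).1.

Lemma gegen0 : gegen 0 = 1. Proof. by []. Qed.
Lemma gegen1 : gegen 1 = l. Proof. by []. Qed.
Lemma gegenSS k : gegen k.+2 =
  c (gcoefa n k) * (l * gegen k.+1) - c (gcoefb n k) * (N * gegen k).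
Proof. by []. Qed.

End generic.

Lemma nat_ind2 (P : nat -> Prop) : P 0%N -> P 1%N -> (forall k, P k -> P k.+1 -> P k.+2) -> forall k, P k.
Proof.
move=> P0 P1 PS k; suff : P k /\ P k.+1 by case.
by elim: k => // k [IH1 IH2]; split => //; exact: PS.
Qed.

End Gegenbauer.

(** * Differential calculus of homogeneous polynomials *)

Section Polynomials.
Context {R : realType} {n : nat}.
Local Notation MP := (mpoly n R).
Local Notation PX i := (mpolyX R (mnm1 i)).
Implicit Types (p q f : MP) (k m : nat).

Definition homog k p : bool := p \is ishomog1 k (@mdeg n).
Definition lap p : MP := \sum_(i < n) mderiv i (mderiv i p).
Definition pev p (x : Rn R n) : R := meval (fun i => tnth x i : R) p.

Lemma mpoly_ind_homog (P : MP -> Prop) k : P 0 -> (forall p q, P p -> P q -> P (p + q)) ->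
  (forall c (m : multinom n), mdeg m = k -> P (c *: mpolyX R m)) ->
  forall p, homog k p -> P p.
Proof.
move=> P0 PD Pm p hp; rewrite (mpolyE p) big_seq.
apply: big_ind => // m mp; apply: Pm.
by move/dhomogP: hp => /(_ m mp).
Qed.

Lemma mpoly_ind_mon (P : MP -> Prop) : P 0 -> (forall p q, P p -> P q -> P (p + q)) ->
  (forall c (m : multinom n), P (c *: mpolyX R m)) -> forall p, P p.
Proof. by move=> P0 PD Pm p; rewrite (mpolyE p); apply: big_ind => // m _; exact: Pm. Qed.

Lemma lapD p q : lap (p + q) = lap p + lap q.
Proof. by rewrite /lap -big_split; apply: eq_bigr => i _; rewrite !mderivD. Qed.

Lemma lapZ c p : lap (c *: p) = c *: lap p.
Proof. by rewrite /lap scaler_sumr; apply: eq_bigr => i _; rewrite !mderivZ. Qed.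

Lemma lap0 : lap 0 = 0.
Proof. by rewrite /lap big1// => i _; rewrite !mderiv0. Qed.

Lemma lapM p q : lap (p * q) = lap p * q + 2 * (\sum_(i < n) mderiv i p * mderiv i q) + p * lap q.
Proof.
rewrite /lap mulr_suml mulr_sumr [X in _ = _ + X]mulr_sumr -!big_split; apply: eq_bigr => i _ /=.
by rewrite mderivM mderivD !mderivM; ring.
Qed.

Lemma pevM p q x : pev (p * q) x = pev p x * pev q x. Proof. exact: mevalM. Qed.
Lemma pevD p q x : pev (p + q) x = pev p x + pev q x. Proof. exact: mevalD. Qed.
Lemma pevZ c p x : pev (c *: p) x = c * pev p x. Proof. exact: mevalZ. Qed.
Lemma pevX (m : multinom n) x : pev (mpolyX R m) x = mon (nth 0%N m) x.
Proof.
rewrite /pev mevalX /mon; apply: eq_bigr => i _.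
by rewrite (mnm_nth 0%N).
Qed.

Lemma pev_rscale k p r x : homog k p -> pev p (rscale r x) = r ^+ k * pev p x.
Proof.
apply: (@mpoly_ind_homog (fun p => pev p (rscale r x) = r ^+ k * pev p x)).
- by rewrite /pev !meval0 mulr0.
- by move=> u v hu hv; rewrite !pevD hu hv mulrDr.
move=> c m hm; rewrite !pevZ !pevX mon_rscale -hm mdegE mulrCA; congr (_ * _).
by congr (_ ^+ _); apply: eq_bigr => i _; rewrite (mnm_nth 0%N).
Qed.

Lemma homogD k p q : homog k p -> homog k q -> homog k (p + q).
Proof. exact: dhomogD. Qed.
Lemma homogZ k c p : homog k p -> homog k (c *: p).
Proof. exact: dhomogZ. Qed.
Lemma homogM k m p q : homog k p -> homog m q -> homog (k + m) (p * q).
Proof. exact: dhomogM. Qed.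
Lemma homog0 k : homog k 0. Proof. exact: dhomog0. Qed.
Lemma homogX (m : multinom n) k : mdeg m = k -> homog k (mpolyX R m).
Proof. by move=> <-; rewrite /homog dhomogX. Qed.
Lemma homog_sum k (F : 'I_n -> MP) : (forall i, homog k (F i)) -> homog k (\sum_i F i).
Proof. by move=> h; apply: (big_ind (fun p => homog k p)) => [|p q|i _]; [exact: homog0|exact: homogD|exact: h]. Qed.

Lemma homog_mderiv k i p : homog k.+1 p -> homog k (mderiv i p).
Proof.
apply: (@mpoly_ind_homog (fun p => homog k (mderiv i p))).
- by rewrite mderiv0 homog0.
- by move=> u v hu hv; rewrite mderivD homogD.
move=> c m hm; rewrite mderivZ mderivX; do 1 apply: homogZ.
have [->|mi] := eqVneq (m i) 0%N; first by rewrite scale0r homog0.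
apply: homogZ; apply: homogX.
have E : m = mnm_add (mnm_sub m (mnm1 i)) (mnm1 i).
  apply/mnmP => j; rewrite mnmDE mnmBE mnm1E subnK//.
  by case: eqVneq => // <-; rewrite lt0n.
by apply/eqP; rewrite -eqSS -hm {2}E mdegD mdeg1 addn1.
Qed.

Lemma mderiv_homog0 i p : homog 0 p -> mderiv i p = 0.
Proof.
apply: (@mpoly_ind_homog (fun p => mderiv i p = 0)).
- by rewrite mderiv0.
- by move=> u v hu hv; rewrite mderivD hu hv addr0.
move=> c m hm; rewrite mderivZ mderivX.
have -> : m i = 0%N.
  by apply/eqP; rewrite -leqn0 -hm mdegE (bigD1 i)//= leq_addr.
by rewrite scale0r scaler0.
Qed.

(** The derivative along e; [plin e] is the linear form x.e and [pnsq] is |x|^2. *)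
Definition pdot (e : Rn R n) p : MP := \sum_(i < n) (tnth e i : R) *: mderiv i p.
Definition plin (e : Rn R n) : MP := \sum_(i < n) (tnth e i : R) *: PX i.
Definition pnsq : MP := \sum_(i < n) PX i * PX i.

Lemma pdotD e p q : pdot e (p + q) = pdot e p + pdot e q.
Proof. by rewrite /pdot -big_split; apply: eq_bigr => i _; rewrite mderivD scalerDr. Qed.
Lemma pdotZ e c p : pdot e (c *: p) = c *: pdot e p.
Proof. by rewrite /pdot scaler_sumr; apply: eq_bigr => i _; rewrite mderivZ !scalerA mulrC. Qed.
Lemma pdotM e p q : pdot e (p * q) = pdot e p * q + p * pdot e q.
Proof.
rewrite /pdot mulr_suml mulr_sumr -big_split; apply: eq_bigr => i _ /=.
by rewrite mderivM scalerDr scalerAl scalerAr.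
Qed.

Lemma mderiv_X (i j : 'I_n) : mderiv i (PX j) = (i == j)%:R.
Proof.
rewrite mderivX mnm1E eq_sym; case: eqVneq => [->|_]; last by rewrite scale0r.
rewrite scale1r (_ : mnm_sub _ _ = mnm0) ?mpolyX0//.
by apply/mnmP => l; rewrite mnmBE subnn mnm0E.
Qed.

Lemma mderiv_plin e i : mderiv i (plin e) = (tnth e i : R)%:A.
Proof.
rewrite /plin (big_morph (mderiv i) (mderivD i) (mderiv0 _ i)) (bigD1 i)//= big1 ?addr0.
  by rewrite mderivZ mderiv_X eqxx.
by move=> j ji; rewrite mderivZ mderiv_X eq_sym (negbTE ji) scaler0.
Qed.

Lemma mderiv_pnsq i : mderiv i pnsq = PX i + PX i.
Proof.
rewrite /pnsq (big_morph (mderiv i) (mderivD i) (mderiv0 _ i)) (bigD1 i)//= big1 ?addr0.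
  by rewrite mderivM mderiv_X eqxx mul1r mulr1.
by move=> j ji; rewrite mderivM mderiv_X eq_sym (negbTE ji) mul0r mulr0 addr0.
Qed.

Lemma lap_plin e : lap (plin e) = 0.
Proof. by rewrite /lap big1// => i _; rewrite mderiv_plin mderivZ mderivC scaler0. Qed.

Lemma lap_pnsq : lap pnsq = 2 *+ n.
Proof.
rewrite /lap (eq_bigr (fun=> 2)) => [|i _]; last first.
  by rewrite mderiv_pnsq mderivD !mderiv_X eqxx.
by rewrite sumr_const card_ord.
Qed.

Lemma mderiv_lap i p : mderiv i (lap p) = lap (mderiv i p).
Proof.
rewrite /lap (big_morph (mderiv i) (mderivD i) (mderiv0 _ i)); apply: eq_bigr => j _.
by rewrite mderiv_comm; congr mderiv; rewrite mderiv_comm.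
Qed.

Lemma lap_sum (F : 'I_n -> MP) : lap (\sum_i F i) = \sum_i lap (F i).
Proof. exact: (big_morph lap lapD lap0). Qed.

Lemma lap_pdot e p : lap p = 0 -> lap (pdot e p) = 0.
Proof.
move=> p0; rewrite /pdot lap_sum big1// => i _.
by rewrite lapZ -mderiv_lap p0 mderiv0 scaler0.
Qed.

Lemma homog_pdot k e p : homog k.+1 p -> homog k (pdot e p).
Proof. by move=> hp; apply: homog_sum => i; apply: homogZ; exact: homog_mderiv. Qed.

Lemma pdot_homog0 e p : homog 0 p -> pdot e p = 0.
Proof. by move=> hp; rewrite /pdot big1// => i _; rewrite mderiv_homog0// scaler0. Qed.

Lemma homog_plin e : homog 1 (plin e).
Proof. by apply: homog_sum => i; apply: homogZ; apply: homogX; rewrite mdeg1. Qed.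

Lemma homog_pnsq : homog 2 pnsq.
Proof. by apply: homog_sum => i; apply: (@homogM 1 1); apply: homogX; rewrite mdeg1. Qed.

Lemma homog_exp k p m : homog k p -> homog (k * m) (p ^+ m).
Proof. exact: dhomogMn. Qed.

(** Euler's identity for homogeneous functions, read at the point e itself. *)
Lemma homog_euler k e p : homog k p -> pev (pdot e p) e = k%:R * pev p e.
Proof.
apply: (@mpoly_ind_homog (fun p => pev (pdot e p) e = k%:R * pev p e)).
- by rewrite /pdot big1 ?/pev ?meval0 ?mulr0// => i _; rewrite mderiv0 scaler0.
- by move=> u v hu hv; rewrite pdotD !pevD hu hv mulrDr.
move=> c m hm; rewrite pdotZ !pevZ mulrCA; congr (_ * _).
rewrite -hm mdegE natr_sum mulr_suml /pdot /pev raddf_sum; apply: eq_bigr => i _ /=.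
rewrite mevalZ mderivX mevalZ.
have [/eqP mi|mi] := boolP (m i == 0%N); first by rewrite mi !mul0r mulr0.
rewrite mulrCA; congr (_ * _).
have {2}-> : m = mnm_add (mnm_sub m (mnm1 i)) (mnm1 i).
  apply/mnmP => j; rewrite mnmDE mnmBE mnm1E subnK//.
  by case: eqVneq => // <-; rewrite lt0n.
by rewrite mpolyXD mevalM mevalXU mulrC.
Qed.

End Polynomials.

(** * Harmonic polynomials on the sphere: orthogonality and reproduction *)

Section SphereIntegral.
Context {R : realType} {n : nat}.
Hypothesis n1 : (1 < n)%N.
Let n0 : (0 < n)%N. Proof. exact: ltnW. Qed.
Local Notation MP := (mpoly n R).
Local Notation sg := (@sigma R n).
Local Notation PX i := (mpolyX R (mnm1 i)).
Implicit Types (p q f : MP) (k m : nat).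

Lemma pev_integrable p : sg.-integrable setT (EFin \o pev p).
Proof.
apply: (@mpoly_ind_mon _ _ (fun p => sg.-integrable setT (EFin \o pev p))).
- rewrite (_ : EFin \o _ = cst 0%E) ?integrable0//.
  by apply/funext => x /=; rewrite /pev meval0.
- move=> u v hu hv; rewrite (_ : EFin \o _ = (EFin \o pev u) \+ (EFin \o pev v))%E.
    exact: integrableD.
  by apply/funext => x /=; rewrite pevD.
move=> c m; rewrite (_ : EFin \o _ = (fun x => c%:E * (EFin \o @mon R (nth 0%N m) n) x)%E).
  by apply: integrableZl => //; exact: (sigma_mon n0 _).1.
by apply/funext => x /=; rewrite pevZ pevX.
Qed.

Lemma pev_integrableS p : sg.-integrable usphere (EFin \o pev p).
Proof. by apply: integrableS (pev_integrable p) => //; exact: measurable_usphere. Qed.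

Definition Lint p : R := \int[sg]_(z in usphere) pev p z.

Lemma LintE p : Lint p = \int[sg]_z pev p z.
Proof.
rewrite /Lint /Rintegral; congr fine.
rewrite [RHS](@negligible_integral _ _ _ _ _ (~` usphere))//.
- by rewrite setTD setCK.
- by apply: measurableC; exact: measurable_usphere.
- exact: pev_integrable.
- exact: sigma_nsphere.
Qed.

Lemma LintD p q : Lint (p + q) = Lint p + Lint q.
Proof.
rewrite /Lint -RintegralD//; [|exact: measurable_usphere|exact: pev_integrableS..].
by apply: eq_Rintegral => x _; rewrite pevD.
Qed.

Lemma LintZ c p : Lint (c *: p) = c * Lint p.
Proof.
rewrite /Lint -RintegralZl//; [|exact: measurable_usphere|exact: pev_integrableS].
by apply: eq_Rintegral => x _; rewrite pevZ.
Qed.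

Lemma Lint0 : Lint 0 = 0.
Proof. by have := LintZ 0 0; rewrite scale0r mul0r. Qed.

Lemma eq_Lint p q : (forall x, usphere x -> pev p x = pev q x) -> Lint p = Lint q.
Proof. by move=> pq; apply: eq_Rintegral => x /set_mem; exact: pq. Qed.

Lemma LintX (m : multinom n) : Lint (mpolyX R m) =
  (\prod_(i < n) gmom (m i)) / @Csph R n (mdeg m).
Proof.
rewrite LintE /Rintegral (eq_integral (fun x => (mon (nth 0%N m) x)%:E)); last first.
  by move=> x _; rewrite pevX.
rewrite (sigma_mon n0 (nth 0%N m)).2 /= mdegE; congr (_ / _).
  by apply: eq_bigr => i _; rewrite (mnm_nth 0%N).
by congr Csph; apply: eq_bigr => i _; rewrite (mnm_nth 0%N).
Qed.

Lemma Lint_sum (F : 'I_n -> MP) : Lint (\sum_i F i) = \sum_i Lint (F i).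
Proof. exact: (big_morph Lint LintD Lint0). Qed.

Lemma gmom1 : @gmom R 1 = 0. Proof. by []. Qed.

Lemma Lint_mderiv2X (m : multinom n) (i : 'I_n) :
  Lint (mderiv i (mderiv i (mpolyX R m))) =
  (m i)%:R * ((m i).-1)%:R * Lint (mpolyX R (mnm_sub (mnm_sub m (mnm1 i)) (mnm1 i))).
Proof.
by rewrite mderivX mderivZ mderivX !LintZ mulrA mnmBE mnm1E eqxx subn1.
Qed.

(** Green's formula on monomials. By [gmom_rec], m_i (m_i - 1) times the moment of exponent m_i - 2
    is 2 m_i times that of exponent m_i; summing over i gives 2 k, and [Csph_rec] turns 2 /
    Csph(k-2) into (k+n-2) / Csph(k). *)
Lemma Lint_lapX (m : multinom n) :
  Lint (lap (mpolyX R m)) = (mdeg m)%:R * ((mdeg m)%:R + n%:R - 2) * Lint (mpolyX R m).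
Proof.
rewrite /lap Lint_sum.
have [k2|k2] := ltnP (mdeg m) 2.
  (* In degree 0 or 1 the index k - 2 would be truncated, so this case is separate: both sides
     vanish, in degree 1 because the odd moment is 0. *)
  rewrite big1 => [|i _]; last first.
    rewrite Lint_mderiv2X.
    have : (m i <= mdeg m)%N by rewrite mdegE (bigD1 i)//= leq_addr.
    move=> /leq_ltn_trans/(_ k2); case: (m i) => [|[|//]] _; rewrite ?mul0r// mulr0 mul0r//.
  have [k0|] := eqVneq (mdeg m) 0%N; first by rewrite k0 !mul0r.
  move=> k0; have k1 : mdeg m == 1%N by case: (mdeg m) k0 k2 => [|[|]].
  have /mdeg1P[i /eqP mi] := k1.
  by rewrite LintX (bigD1 i)//= mi mnm1E eqxx gmom1 !mul0r mulr0.
set k := mdeg m; set P := \prod_(i < n) gmom (m i) : R.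
have Cr := @Csph_rec R n n0 (k - 2).
have C1 := @Csph_gt0 R n n0 k; have C2 := @Csph_gt0 R n n0 (k - 2).
have kE : (k - 2).+2 = k by rewrite -addn2 subnK.
rewrite kE in Cr.
rewrite (eq_bigr (fun i => (m i)%:R * (2 * P / @Csph R n (k - 2)))).
  rewrite -mulr_suml -natr_sum -mdegE LintX -/k -/P.
  rewrite natrD natrB// in Cr.
  have -> : k%:R * (k%:R + n%:R - 2) * (P / @Csph R n k) =
    k%:R * P * ((n%:R + (k%:R - 2)) * @Csph R n (k - 2)) / (@Csph R n k * @Csph R n (k - 2)).
    by field; rewrite !gt_eqF.
  by rewrite -Cr; field; rewrite !gt_eqF.
move=> i _; rewrite Lint_mderiv2X.
case mi : (m i) => [|[|j]]; first by rewrite !mul0r.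
  have -> : P = 0 by rewrite /P (bigD1 i)//= mi gmom1 mul0r.
  by rewrite /= mulr0 !mul0r mulr0 mul0r mulr0.
set m2 := mnm_sub _ _.
have m2E l : m2 l = if l == i then j else m l.
  rewrite /m2 !mnmBE mnm1E eq_sym; case: eqVneq => [->|_]; last by rewrite !subn0.
  by rewrite mi /= !subn1.
have d2 : mdeg m2 = (k - 2)%N.
  apply/eqP; rewrite -(eqn_add2r 2) subnK// /k !mdegE.
  rewrite (bigD1 i)//= [X in _ == X](bigD1 i)//= m2E eqxx mi.
  rewrite (eq_bigr m) => [|l li]; last by rewrite m2E (negbTE li).
  by rewrite addnAC addn2.
rewrite LintX d2 /P (bigD1 i)//= [in RHS](bigD1 i)//= m2E eqxx mi.
rewrite [in LHS](eq_bigr (fun l => gmom (m l))) => [|l li]; last by rewrite m2E (negbTE li).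
have := @gmom_rec R j; set g := gmom j; set g2 := gmom j.+2 => gr.
set Q := \prod_(_ < n | _) _.
by rewrite [2 * (g2 * Q)]mulrA gr; ring.
Qed.

Lemma Lint_lap k p : homog k p -> Lint (lap p) = k%:R * (k%:R + n%:R - 2) * Lint p.
Proof.
apply: (@mpoly_ind_homog _ _ (fun p => Lint (lap p) = k%:R * (k%:R + n%:R - 2) * Lint p)).
- by rewrite lap0 Lint0 mulr0.
- by move=> u v hu hv; rewrite lapD LintD hu hv LintD; ring.
by move=> c m <-; rewrite lapZ !LintZ Lint_lapX mulrCA.
Qed.

Definition harmonic k f := homog k f /\ lap f = 0.

Lemma harmonic_pdot k e f : harmonic k.+1 f -> harmonic k (pdot e f).
Proof. by move=> [hf lf]; split; [exact: homog_pdot|exact: lap_pdot]. Qed.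

Variable e : Rn R n.
Hypothesis e1 : usphere e.

Lemma sum_sqr_e : \sum_(i < n) (tnth e i : R) * tnth e i = 1.
Proof.
have := enorm_sqr e; rewrite e1 expr1n => ->.
by apply: eq_bigr => i _; rewrite expr2.
Qed.

Lemma mderiv_plinX i m : mderiv i (plin e ^+ m) = (m%:R * (tnth e i : R)) *: plin e ^+ m.-1.
Proof.
elim: m => [|m IH]; first by rewrite expr0 -mpolyC1 mderivC mul0r scale0r.
rewrite exprS mderivM mderiv_plin IH -scalerAl mul1r -scalerAr.
case: m {IH} => [|m]; first by rewrite mul0r scale0r addr0 mul1r.
by rewrite /= -exprS -scalerDl -[in RHS]natr1 mulrDl mul1r addrC.
Qed.

Lemma lap_plinX m : lap (plin e ^+ m) = (m%:R * m.-1%:R) *: plin e ^+ m.-2.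
Proof.
rewrite /lap (eq_bigr (fun i => ((tnth e i : R) * tnth e i) *: ((m%:R * m.-1%:R) *: plin e ^+ m.-2))).
  by rewrite -scaler_suml sum_sqr_e scale1r.
move=> i _; rewrite mderiv_plinX mderivZ mderiv_plinX !scalerA; congr (_ *: _); ring.
Qed.

Lemma sum_mderiv_plinX f m : \sum_(i < n) mderiv i f * mderiv i (plin e ^+ m) =
  m%:R *: (pdot e f * plin e ^+ m.-1).
Proof.
rewrite /pdot mulr_suml scaler_sumr; apply: eq_bigr => i _.
by rewrite mderiv_plinX -scalerAr -scalerAl scalerA.
Qed.

(** [Lint_lap] for the product: as f is harmonic, Leibniz keeps only the cross term and the
    Laplacian of the power of x.e. *)
Lemma Lint_harm_plin k m f : harmonic k f ->
  (k + m)%:R * ((k + m)%:R + n%:R - 2) * Lint (f * plin e ^+ m) =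
  2 * m%:R * Lint (pdot e f * plin e ^+ m.-1) + m%:R * m.-1%:R * Lint (f * plin e ^+ m.-2).
Proof.
move=> [hf lf].
have hm : homog (k + m) (f * plin e ^+ m).
  by apply: homogM => //; have := homog_exp m (homog_plin e); rewrite mul1n.
rewrite -(Lint_lap hm) lapM lf mul0r add0r sum_mderiv_plinX lap_plinX.
rewrite LintD -!scalerAr !LintZ.
rewrite (_ : 2 * (pdot e f * plin e ^+ m.-1) = pdot e f * plin e ^+ m.-1 + pdot e f * plin e ^+ m.-1).
  by rewrite LintD; ring.
by ring.
Qed.

(** Induction on m: the right side of [Lint_harm_plin] involves the pairs (k-1, m-1) and (k, m-2),
    again with the power below the degree, and the factor on its left side does not vanish. *)
Lemma Lint_plin_lt m k f : harmonic k f -> (m < k)%N -> Lint (f * plin e ^+ m) = 0.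
Proof.
elim/ltn_ind: m k f => m IH k f hf mk.
have km : (0 < k + m)%N by rewrite addn_gt0 (leq_ltn_trans _ mk).
have := Lint_harm_plin m hf.
have -> : 2 * m%:R * Lint (pdot e f * plin e ^+ m.-1) + m%:R * m.-1%:R * Lint (f * plin e ^+ m.-2) = 0.
  case: m IH mk {km} => [|m] IH mk; first by rewrite mulr0 !mul0r addr0.
  case: k hf mk => // k hf mk.
  rewrite (IH m _ k)//; last exact: harmonic_pdot.
  case: m IH mk => [|m] IH mk; first by rewrite /= !(mulr0,mul0r) addr0.
  have -> : Lint (f * plin e ^+ m.+2.-2) = 0 by apply: (IH m _ k.+1) => //; lia.
  by rewrite !mulr0 addr0.
move=> /eqP; rewrite mulf_eq0 => /orP[|/eqP//].
rewrite mulf_eq0 pnatr_eq0 (gtn_eqF km)/= -natrD => /eqP h.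
have : (2 : R) < (k + m + n)%:R.
  by rewrite ltr_nat; lia.
by lra.
Qed.

(** The constant by which pairing with (x.e)^k evaluates a harmonic polynomial of degree k at e. *)
Fixpoint repro_coef (k : nat) : R :=
  if k is k'.+1 then k'.+1%:R / (2 * k'.+1%:R + n%:R - 2) * repro_coef k' else 1.

Lemma Lint1 : Lint 1 = 1.
Proof.
rewrite LintE /Rintegral (eq_integral (fun=> 1%E)); last by move=> x _; rewrite /pev meval1.
rewrite integral_cst// mul1e; change (fine (sg setT) = 1).
by rewrite sigmaT.
Qed.

Lemma homog0_const f : homog 0 f -> exists c, f = c *: 1.
Proof.
apply: (@mpoly_ind_homog _ _ (fun f => exists c, f = c *: 1)).
- by exists 0; rewrite scale0r.
- by move=> u v [c ->] [d ->]; exists (c + d); rewrite scalerDl.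
move=> c m /eqP; rewrite mdeg_eq0 => /eqP ->; exists c.
by rewrite mpolyX0.
Qed.

(** In [Lint_harm_plin] with the power equal to the degree, the second term vanishes by
    orthogonality and the first lowers the degree; Euler's identity at e then brings back the value
    of f. *)
Lemma Lint_plin_eq k f : harmonic k f -> Lint (f * plin e ^+ k) = repro_coef k * pev f e.
Proof.
elim: k f => [|k IH] f hf.
  have [c ->] := homog0_const hf.1.
  by rewrite expr0 mulr1 LintZ Lint1 pevZ /pev meval1 mul1r.
have := Lint_harm_plin k.+1 hf.
rewrite /= (IH _ (harmonic_pdot e hf)) (homog_euler _ hf.1).
have -> : k.+1%:R * k%:R * Lint (f * plin e ^+ k.-1) = 0.
  case: k hf {IH} => [|k] hf; first by rewrite mulr0 mul0r.
  by rewrite (Lint_plin_lt hf) ?mulr0// ltnW.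
rewrite addr0 natrD => h.
have k0 : (0 : R) < k.+1%:R by rewrite ltr0n.
have nn : (2 : R) <= n%:R by rewrite ler_nat.
have d1 : k.+1%:R + k.+1%:R != 0 :> R by rewrite gt_eqF// addr_gt0.
have d2 : k.+1%:R + k.+1%:R + n%:R - 2 != 0 :> R by rewrite gt_eqF//; lra.
apply: (mulfI d1); apply: (mulfI d2).
rewrite mulrA [X in X * _]mulrC h.
have -> : 2 * k.+1%:R + n%:R - 2 = k.+1%:R + k.+1%:R + n%:R - 2 :> R by ring.
move: d2; set D := _ - 2 => d2; field; exact: d2.
Qed.

Definition Gp k : MP := gegen n (fun c : R => c%:A : MP) (plin e) pnsq k.

Lemma GpSS k : Gp k.+2 = gcoefa n k *: (plin e * Gp k.+1) - gcoefb n k *: (pnsq * Gp k).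
Proof. by rewrite /Gp gegenSS -!scalerAl !mul1r. Qed.

Lemma homog_Gp k : homog k (Gp k).
Proof.
elim/nat_ind2: k => [||k IH1 IH2].
- exact: dhomog1.
- exact: homog_plin.
rewrite GpSS -scaleNr; apply: homogD; apply: homogZ.
  by rewrite -add1n; apply: homogM => //; exact: homog_plin.
by rewrite -add2n; apply: homogM => //; exact: homog_pnsq.
Qed.

Lemma pdot_plin : pdot e (plin e) = 1.
Proof.
rewrite /pdot (eq_bigr (fun i => ((tnth e i : R) * tnth e i) *: 1)) => [|i _].
  by rewrite -scaler_suml sum_sqr_e scale1r.
by rewrite mderiv_plin scalerA.
Qed.

Lemma pdot_pnsq : pdot e pnsq = 2 * plin e.
Proof.
rewrite /pdot /plin mulr_sumr; apply: eq_bigr => i _.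
by rewrite mderiv_pnsq -scalerAr mulr_natl mulr2n.
Qed.

Lemma pdot1 : pdot e 1 = 0.
Proof. by rewrite pdot_homog0//; exact: dhomog1. Qed.

Let nk (k : nat) : k%:R + n%:R - 1 != 0 :> R.
Proof.
have nn : (2 : R) <= n%:R by rewrite ler_nat.
have k0 : (0 : R) <= k%:R by [].
by rewrite gt_eqF//; lra.
Qed.

Lemma Gp_rec k : k.+1%:R *: (pnsq * Gp k) =
  (2 * k.+1%:R + n%:R - 2) *: (plin e * Gp k.+1) - (k.+1%:R + n%:R - 2) *: Gp k.+2.
Proof.
rewrite GpSS scalerBr !scalerA /gcoefa /gcoefb.
have E (c : R) : (k.+1%:R + n%:R - 2) * (c / (k%:R + n%:R - 1)) = c.
  by rewrite -natr1; field; exact: nk.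
rewrite !E -natr1.
have -> : 2 * (k%:R + 1) + n%:R - 2 = 2 * k%:R + n%:R :> R by ring.
by rewrite subKr.
Qed.

(** Differentiating the three-term recurrence produces |x|^2 times the derivative of an earlier
    polynomial, which [Gp_rec] re-expresses without the factor |x|^2. The formula makes harmonicity
    of [Gp] a closed computation. *)
Lemma pdot_Gp k : pdot e (Gp k.+1) = k.+1%:R *: Gp k.
Proof.
elim/ltn_ind: k => -[|k] IH; first by rewrite /Gp gegen1 gegen0 pdot_plin scale1r.
have H1 : pdot e (Gp k.+1) = k.+1%:R *: Gp k by apply: IH.
rewrite GpSS -scaleNr pdotD !pdotZ !pdotM pdot_plin pdot_pnsq H1 mul1r.
(* For k > 0 this is the induction hypothesis followed by [Gp_rec]; for k = 0 both sides are 0. *)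
have H0 : pnsq * pdot e (Gp k) = (2 * k%:R + n%:R - 2) *: (plin e * Gp k) - (k%:R + n%:R - 2) *: Gp k.+1.
  case: k IH H1 => [|k] IH H1; last by rewrite IH// -scalerAr Gp_rec.
  rewrite /Gp gegen0 gegen1 pdot1 mulr0 mulr1 mulr0.
  by rewrite -scalerBl (_ : _ - _ = 0) ?scale0r//; ring.
rewrite H0.
(* All coefficients are brought to natural numbers, where scaling becomes multiplication in the
   polynomial ring and [ring] decides; writing n = N2 + 2 removes the subtractions. *)
pose N2 := (n - 2)%N.
have nE : n%:R = N2%:R + 2 :> R by rewrite -(subnK n1) natrD.
apply: (scalerI (nk k)); rewrite scalerDr !scalerA mulrN.
have -> : (k%:R + n%:R - 1) * gcoefa n k = (2 * k + N2 + 2)%N%:R :> R.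
  by rewrite /gcoefa mulrC divfK ?nk// nE; ring.
have -> : (k%:R + n%:R - 1) * gcoefb n k = (k + 1)%N%:R :> R.
  by rewrite /gcoefb mulrC divfK ?nk//; ring.
have -> : (k%:R + n%:R - 1) * k.+2%:R = ((k + N2 + 1) * k.+2)%N%:R :> R.
  by rewrite nE; ring.
have -> : 2 * k%:R + n%:R - 2 = (2 * k + N2)%N%:R :> R by rewrite nE; ring.
have -> : k%:R + n%:R - 2 = (k + N2)%N%:R :> R by rewrite nE; ring.
have sn j p : j%:R *: p = j%:R * p by rewrite scaler_nat mulr_natl.
by rewrite scaleNr !sn; ring.
Qed.

Definition peul p : MP := \sum_(i < n) PX i * mderiv i p.

Lemma peulD p q : peul (p + q) = peul p + peul q.
Proof. by rewrite /peul -big_split; apply: eq_bigr => i _; rewrite mderivD mulrDr. Qed.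

Lemma peulZ c p : peul (c *: p) = c *: peul p.
Proof. by rewrite /peul scaler_sumr; apply: eq_bigr => i _; rewrite mderivZ scalerAr. Qed.

Lemma peulM p q : peul (p * q) = peul p * q + p * peul q.
Proof.
rewrite /peul mulr_suml mulr_sumr -big_split; apply: eq_bigr => i _ /=.
by rewrite mderivM; ring.
Qed.

Lemma peul_plin : peul (plin e) = plin e.
Proof. by apply: eq_bigr => i _; rewrite mderiv_plin -scalerAr mulr1. Qed.

Lemma peul_pnsq : peul pnsq = 2 * pnsq.
Proof. by rewrite /pnsq mulr_sumr; apply: eq_bigr => i _; rewrite mderiv_pnsq; ring. Qed.

Lemma peul_Gp k : peul (Gp k) = k%:R *: Gp k.
Proof.
elim/nat_ind2: k => [||k IH1 IH2].
- by rewrite scale0r /peul big1// => i _; rewrite mderiv_homog0 ?mulr0//; exact: dhomog1.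
- by rewrite scale1r; exact: peul_plin.
rewrite GpSS -scaleNr peulD !peulZ !peulM IH1 IH2 peul_plin peul_pnsq.
have sn j p : j%:R *: p = j%:R * p by rewrite scaler_nat mulr_natl.
move: (gcoefa n k) (- gcoefb n k) => a b.
by rewrite !sn mulrDr -!scalerAr; congr (_ *: _ + _ *: _); ring.
Qed.

Lemma sum_PX_mderiv f : \sum_(i < n) mderiv i pnsq * mderiv i f = 2 * peul f.
Proof. by rewrite /peul mulr_sumr; apply: eq_bigr => i _; rewrite mderiv_pnsq; ring. Qed.

Lemma sum_plin_mderiv f : \sum_(i < n) mderiv i (plin e) * mderiv i f = pdot e f.
Proof. by apply: eq_bigr => i _; rewrite mderiv_plin -scalerAl mul1r. Qed.

(** Leibniz on the recurrence: the cross terms are the derivative along e ([pdot_Gp]) and the Euler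
    operator ([peul_Gp]), and the coefficients of the recurrence are those that make everything
    cancel. *)
Lemma lap_Gp k : lap (Gp k) = 0.
Proof.
elim/nat_ind2: k => [||k IH1 IH2].
- by rewrite /lap big1// => i _; rewrite (mderiv_homog0 i (homog_Gp 0)) mderiv0.
- exact: lap_plin.
rewrite GpSS -scaleNr lapD !lapZ !lapM IH1 IH2 lap_plin lap_pnsq.
rewrite sum_PX_mderiv sum_plin_mderiv pdot_Gp peul_Gp.
apply: (scalerI (nk k)); rewrite scalerDr !scalerA scaler0 mulrN.
have -> : (k%:R + n%:R - 1) * gcoefa n k = (2 * k + n)%N%:R :> R.
  by rewrite /gcoefa mulrC divfK ?nk//; ring.
have -> : (k%:R + n%:R - 1) * gcoefb n k = (k + 1)%N%:R :> R.
  by rewrite /gcoefb mulrC divfK ?nk//; ring.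
have sn j p : j%:R *: p = j%:R * p by rewrite scaler_nat mulr_natl.
by rewrite scaleNr !sn; ring.
Qed.

Lemma harmonic_Gp k : harmonic k (Gp k).
Proof. by split; [exact: homog_Gp|exact: lap_Gp]. Qed.

Lemma pev_plin (x : Rn R n) : pev (plin e) x = \sum_(i < n) (tnth x i : R) * tnth e i.
Proof.
rewrite /pev /plin raddf_sum; apply: eq_bigr => i _ /=.
by rewrite mevalZ mevalXU mulrC.
Qed.

Lemma pev_pnsq (x : Rn R n) : pev pnsq x = enorm x ^+ 2.
Proof.
rewrite enorm_sqr /pev /pnsq raddf_sum; apply: eq_bigr => i _ /=.
by rewrite mevalM mevalXU expr2.
Qed.

Lemma Lint_pnsq f : Lint (pnsq * f) = Lint f.
Proof. by apply: eq_Lint => x x1; rewrite pevM pev_pnsq x1 expr1n mul1r. Qed.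

(** The coefficient of (x.e)^k in [Gp k]. *)
Fixpoint gegen_lead (k : nat) : R :=
  if k is k'.+1 then (if k' is k''.+1 then gcoefa n k'' else 1) * gegen_lead k' else 1.

(** Only the top power of x.e is seen: on the sphere |x|^2 = 1, so the second term of the recurrence
    has total degree below k and is killed by orthogonality. *)
Lemma Lint_Gp_plin k m i f : harmonic k f -> (m + i <= k)%N ->
  Lint (f * (Gp m * plin e ^+ i)) =
  if (m + i == k)%N then gegen_lead m * (repro_coef k * pev f e) else 0.
Proof.
move=> hf; elim/nat_ind2: m i => [i|i|m IH1 IH2 i].
- rewrite add0n => ik; rewrite mul1r /= mul1r; case: eqVneq => [ki|ki].
    by move: hf; rewrite -ki => hf'; rewrite Lint_plin_eq.
  by apply: (Lint_plin_lt hf); rewrite ltn_neqAle ki.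
- rewrite add1n => ik; rewrite /Gp gegen1 -exprS /= mul1r mul1r; case: eqVneq => [ki|ki].
    by move: hf; rewrite -ki => hf'; rewrite Lint_plin_eq.
  by apply: (Lint_plin_lt hf); rewrite ltn_neqAle ki.
move=> ik.
have E : f * (Gp m.+2 * plin e ^+ i) = gcoefa n m *: (f * (Gp m.+1 * plin e ^+ i.+1)) +
    (- gcoefb n m) *: (pnsq * (f * (Gp m * plin e ^+ i))).
  rewrite GpSS exprS -scaleNr mulrDl mulrDr -!scalerAl -!scalerAr.
  congr (_ *: _ + _ *: _); ring.
rewrite E LintD !LintZ Lint_pnsq IH1; last by lia.
rewrite IH2; last by lia.
have -> : (m + i == k)%N = false by apply/eqP; lia.
rewrite mulr0 addr0 addnS -addSn; case: ifP => _; last by rewrite mulr0.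
have -> : gegen_lead m.+2 = gcoefa n m * gegen_lead m.+1 by []. exact: mulrA.
Qed.

(** The normalisation that makes [Gp k] reproducing; classically, the dimension of the space of
    homogeneous harmonic polynomials of degree k. *)
Definition dimH (k : nat) : R := (repro_coef k * gegen_lead k)^-1.

Lemma repro_coef_gt0 k : 0 < repro_coef k.
Proof.
have nn : (2 : R) <= n%:R by rewrite ler_nat.
elim: k => //= k IH; rewrite mulr_gt0// divr_gt0 ?ltr0n//.
have k0 : (0 : R) < k.+1%:R by rewrite ltr0n.
lra.
Qed.

Lemma gegen_lead_gt0 k : 0 < gegen_lead k.
Proof.
have nn : (2 : R) <= n%:R by rewrite ler_nat.
elim: k => // -[|k] IH; first by rewrite /= mulr1.
have k0 : (0 : R) <= k%:R by [].
rewrite [gegen_lead _]/= mulr_gt0// /gcoefa divr_gt0//; lra.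
Qed.

Lemma Lint_Gp k f : harmonic k f -> dimH k * Lint (f * Gp k) = pev f e.
Proof.
move=> hf; have := @Lint_Gp_plin k k 0 f hf; rewrite addn0 leqnn eqxx expr0 mulr1 => /(_ isT) ->.
rewrite /dimH [gegen_lead k * _]mulrA [gegen_lead k * _]mulrC mulrA mulVf ?mul1r//.
by rewrite mulf_neq0 ?gt_eqF ?repro_coef_gt0 ?gegen_lead_gt0.
Qed.

Lemma Lint_Gp_lt k m f : harmonic k f -> (m < k)%N -> Lint (f * Gp m) = 0.
Proof.
move=> hf mk; have := @Lint_Gp_plin k m 0 f hf; rewrite addn0 expr0 mulr1 => /(_ (ltnW mk)) ->.
by rewrite (ltn_eqF mk).
Qed.

End SphereIntegral.

(** * Identification of the zonal harmonics *)

Section Zonal.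
Context {R : realType} {n : nat}.
Hypothesis n1 : (1 < n)%N.
Let n0 : (0 < n)%N. Proof. exact: ltnW. Qed.
Local Notation MP := (mpoly n R).
Local Notation sg := (@sigma R n).

Definition rdot (x y : Rn R n) : R := \sum_(i < n) (tnth x i : R) * tnth y i.

Definition gegenR (l N : R) (k : nat) : R := gegen n id l N k.

Lemma gegenR_SS l N k : gegenR l N k.+2 =
  gcoefa n k * (l * gegenR l N k.+1) - gcoefb n k * (N * gegenR l N k).
Proof. by []. Qed.

Lemma pev_Gp (e x : Rn R n) k : pev (Gp e k) x = gegenR (rdot x e) (enorm x ^+ 2) k.
Proof.
elim/nat_ind2: k => [||k IH1 IH2].
- by rewrite /pev meval1.
- by rewrite /Gp gegen1 pev_plin.
rewrite GpSS gegenR_SS -scaleNr pevD !pevZ !pevM IH1 IH2 pev_plin pev_pnsq.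
by rewrite mulNr.
Qed.

Lemma gegenR_homog r l N k : gegenR (r * l) (r ^+ 2 * N) k = r ^+ k * gegenR l N k.
Proof.
elim/nat_ind2: k => [||k IH1 IH2]; [by rewrite mul1r|by rewrite expr1|].
rewrite !gegenR_SS IH1 IH2 !exprS; ring.
Qed.

Variable Z : nat -> Rn R n -> Rn R n -> R.
Hypothesis hZ : forall k, is_zonal k (Z k).

Lemma harmonicP k (f : Rn R n -> R) : homogeneous_harmonic k f ->
  exists2 p : MP, harmonic k p & forall x, f x = pev p x.
Proof. by move=> [p [hp lp fp]]; exists p. Qed.

Lemma harmonic_fun k (p : MP) : harmonic k p -> homogeneous_harmonic k (pev p).
Proof. by move=> [hp lp]; exists p. Qed.

(** The integral of Z_k(z, y) G_k(z, x) in z is evaluated twice: [is_zonal] reproduces G_k at y,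
    while [Lint_Gp] reproduces the harmonic polynomial Z_k(., y) at x. *)
Lemma zonal_sphere k (x y : Rn R n) : usphere x -> usphere y ->
  Z k x y = @dimH R n k * gegenR (rdot x y) 1 k.
Proof.
move=> x1 y1.
have [sZ hx hy rZ] := hZ k.
have [p hp pE] := harmonicP (hx y).
have hG := harmonic_Gp n1 x1 k.
have := rZ _ (harmonic_fun hG) y y1.
have -> : \int[sg]_(zeta in usphere) (pev (Gp x k) zeta * Z k zeta y) = Lint (p * Gp x k).
  by apply: eq_Rintegral => z _; rewrite pevM pE mulrC.
have := Lint_Gp n1 x1 hp; rewrite -pE => <- <-.
congr (_ * _); rewrite pev_Gp y1 expr1n; congr gegenR.
by apply: eq_bigr => i _; rewrite mulrC.
Qed.

Lemma zonal_rscale k r s (x y : Rn R n) :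
  Z k (rscale r x) (rscale s y) = r ^+ k * s ^+ k * Z k x y.
Proof.
have [sZ hx hy rZ] := hZ k.
have [p [hp _] pE] := harmonicP (hx (rscale s y)).
have [q [hq _] qE] := harmonicP (hy x).
by rewrite pE (pev_rscale _ _ hp) -pE qE (pev_rscale _ _ hq) -qE mulrA.
Qed.

Lemma rdot_rscale r s (x y : Rn R n) : rdot (rscale r x) (rscale s y) = r * s * rdot x y.
Proof.
by rewrite /rdot mulr_sumr; apply: eq_bigr => i _; rewrite !tnth_rscale; ring.
Qed.

Lemma usphere_nonempty : exists e : Rn R n, usphere e.
Proof.
exists [tuple if (i == 0 :> nat) then 1 else 0 | i < n].
rewrite /usphere/= /enorm; case: n n0 => // m _.
rewrite big_ord_recl/= tnth_mktuple/= expr1n big1 ?addr0 ?sqrtr1// => i _.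
by rewrite tnth_mktuple/= expr0n.
Qed.

Lemma zonalE k (x y : Rn R n) :
  Z k x y = @dimH R n k * gegenR (rdot x y) (enorm x ^+ 2 * enorm y ^+ 2) k.
Proof.
have key (u v : Rn R n) r s : usphere u -> usphere v ->
    Z k (rscale r u) (rscale s v) = @dimH R n k * gegenR (r * s * rdot u v) ((r * s) ^+ 2 * 1) k.
  by move=> u1 v1; rewrite zonal_rscale zonal_sphere// -exprMn gegenR_homog mulrCA mulrC.

have [e he] := usphere_nonempty.
(* At the origin any unit vector serves as direction, since the radius is 0. *)
have ex (z : Rn R n) : exists2 u, usphere u & z = rscale (enorm z) u.
  have [z0|z0] := eqVneq (enorm z) 0.
    exists e => //; apply: eq_from_tnth => i; rewrite tnth_rscale z0 mul0r.
    exact: enorm_eq0.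
  by exists (direction z); [exact: usphere_direction|rewrite rscale_direction].
have [u u1 xE] := ex x; have [v v1 yE] := ex y.
rewrite {1}xE {1}yE key//; congr (_ * gegenR _ _ _).
  by rewrite [in RHS]xE [in RHS]yE rdot_rscale.
by rewrite mulr1 exprMn.
Qed.

End Zonal.

(** * Power series with multiplier coefficients *)

Section PolynomialGrowth.
Context {R : realType}.
Implicit Types (a b : R^nat) (x : R).

(** A class of coefficients stable under products, shifts and term-by-term differentiation, whose
    power series all converge for |x| < 1; every convergence question below is reduced to membership
    in it. *)
Definition pgrow a := exists C M, 0 <= C /\ forall k, `|a k| <= C * k.+1%:R ^+ M.

Lemma pgrow_le a b : pgrow b -> (forall k, `|a k| <= `|b k|) -> pgrow a.
Proof. by move=> [C [M [C0 H]]] ab; exists C, M; split=> // k; rewrite (le_trans (ab k)). Qed.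

Lemma pgrowM a b : pgrow a -> pgrow b -> pgrow (fun k => a k * b k).
Proof.
move=> [C [M [C0 H]]] [D [L [D0 K]]]; exists (C * D), (M + L)%N; split; first exact: mulr_ge0.
by move=> k; rewrite normrM exprD mulrACA ler_pM.
Qed.

Lemma pgrowD a b : pgrow a -> pgrow b -> pgrow (fun k => a k + b k).
Proof.
move=> [C [M [C0 H]]] [D [L [D0 K]]]; exists (C + D), (M + L)%N; split; first exact: addr_ge0.
have k1 k : 1 <= k.+1%:R :> R by rewrite ler1n.
move=> k; rewrite (le_trans (ler_normD _ _))// mulrDl lerD//.
- by rewrite (le_trans (H k))// ler_wpM2l// ler_weXn2l// leq_addr.
- by rewrite (le_trans (K k))// ler_wpM2l// ler_weXn2l// leq_addl.
Qed.

Lemma pgrow_cst (c : R) : pgrow (fun=> c).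
Proof. by exists `|c|, 0%N; split=> // k; rewrite expr0 mulr1. Qed.

Lemma pgrow_natS : pgrow (fun k => k.+1%:R).
Proof. by exists 1, 1%N; split=> // k; rewrite mul1r expr1 ger0_norm. Qed.

Lemma pgrow_nat : pgrow (fun k => k%:R).
Proof. by apply: (pgrow_le pgrow_natS) => k; rewrite !ger0_norm// ler_nat. Qed.

Lemma pgrowS a : pgrow a -> pgrow (fun k => a k.+1).
Proof.
move=> [C [M [C0 H]]]; exists (C * 2 ^+ M), M; split; first by rewrite mulr_ge0// exprn_ge0.
move=> k; rewrite (le_trans (H _))// -mulrA -exprMn ler_wpM2l// lerXn2r ?nnegrE ?mulr_ge0//.
by rewrite -natrM ler_nat; lia.
Qed.

Lemma pgrow_unS a : pgrow (fun k => a k.+1) -> pgrow a.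
Proof.
move=> [C [M [C0 H]]]; exists (C + `|a 0%N|), M; split; first exact: addr_ge0.
case=> [|k]; first by rewrite expr1n mulr1 lerDr.
apply: (le_trans (H k)); apply: ler_pM; rewrite ?exprn_ge0// ?lerDl//.
by apply: lerXn2r; rewrite ?nnegrE// ler_nat.
Qed.

Lemma pgrow_diffs a : pgrow a -> pgrow (pseries_diffs a).
Proof. by move=> /pgrowS ha; exact: pgrowM pgrow_natS ha. Qed.

Lemma natS_expr_bound x : 0 <= x < 1 -> exists C, forall k : nat, k.+1%:R * x ^+ k <= C.
Proof.
move=> /andP[x0 x1]; exists (1 - x)^-1 => k.
have y0 : 0 < 1 - x by rewrite subr_gt0.
rewrite -[leRHS]mul1r ler_pdivlMr//.
have : 1 - x ^+ k.+1 <= 1 by rewrite gerBl exprn_ge0.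
rewrite -[1 - x ^+ _]opprB subrX1 -mulNr opprB; apply: le_trans.
rewrite [leLHS]mulrC ler_wpM2l ?(ltW y0)//.
rewrite -[X in X%:R](card_ord k.+1) -sum1_card natr_sum mulr_suml ler_sum// => i _.
by rewrite mul1r ler_wiXn2l ?(ltW x1)// -ltnS.
Qed.

(** Each factor k + 1 is paid for with a square root of x: write x = sqrt x sqrt x and induct on
    M. *)
Lemma natSX_expr_bound M x : 0 <= x < 1 -> exists C, forall k : nat, k.+1%:R ^+ M * x ^+ k <= C.
Proof.
elim: M x => [|M IH] x /andP[x0 x1].
  by exists 1 => k; rewrite expr0 mul1r exprn_ile1// ltW.
have y0 : 0 <= Num.sqrt x by exact: sqrtr_ge0.
have y1 : Num.sqrt x < 1 by rewrite -sqrtr1 ltr_sqrt.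
have yE : x = Num.sqrt x * Num.sqrt x by rewrite -expr2 sqr_sqrtr.
have [C HC] := IH _ (introT andP (conj y0 y1)).
have [D HD] := natS_expr_bound (introT andP (conj y0 y1)).
exists (D * C) => k; rewrite {1}yE exprMn exprS mulrACA ler_pM// ?mulr_ge0 ?exprn_ge0//.
Qed.

Lemma pgrow_ncvg a x : pgrow a -> `|x| < 1 -> cvgn [series `|a k| * `|x| ^+ k]_k.
Proof.
move=> [C [M [C0 H]]] x1.
have y0 : 0 <= Num.sqrt `|x| by exact: sqrtr_ge0.
have y1 : Num.sqrt `|x| < 1 by rewrite -sqrtr1 ltr_sqrt.
have yE : `|x| = Num.sqrt `|x| * Num.sqrt `|x| by rewrite -expr2 sqr_sqrtr.
have [D HD] := natSX_expr_bound M (introT andP (conj y0 y1)).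
apply: (@series_le_cvg _ _ (geometric (C * D) (Num.sqrt `|x|))) => /=.
- by move=> k; rewrite mulr_ge0// exprn_ge0.
- move=> k; rewrite mulr_ge0// ?exprn_ge0// mulr_ge0//.
  by have := HD 0%N; rewrite expr1n mul1r expr0 => /(le_trans ler01).
- move=> k; rewrite {1}yE exprMn mulrA ler_wpM2r ?exprn_ge0//.
  rewrite (@le_trans _ _ (C * k.+1%:R ^+ M * Num.sqrt `|x| ^+ k))//.
    by rewrite ler_wpM2r ?exprn_ge0.
  by rewrite -mulrA ler_wpM2l.
- by apply: is_cvg_geometric_series; rewrite ger0_norm.
Qed.

Lemma pgrow_cvg a x : pgrow a -> `|x| < 1 -> cvgn (pseries a x).
Proof.
move=> ha x1; apply: normed_cvg; rewrite /normed_series_of /=.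
rewrite (_ : (fun _ => _) = (fun i => `|a i| * `|x| ^+ i)); first exact: pgrow_ncvg.
by apply/funext => i; rewrite normrM normrX.
Qed.

Definition psum a x : R := limn (pseries a x).

Lemma psum_cvg a x : pgrow a -> `|x| < 1 -> (pseries a x @ \oo --> psum a x).
Proof. by move=> ha x1; exact: pgrow_cvg. Qed.

Lemma psum_isd a x : pgrow a -> `|x| < 1 ->
  is_derive x 1 (psum a) (psum (pseries_diffs a) x).
Proof.
(* A radius strictly between |x| and 1, at which the differentiated series still converge. *)
move=> ha x1; pose K : R := (1 + `|x|) / 2.
have K1 : `|K| < 1.
  rewrite ger0_norm /K; first by rewrite ltr_pdivrMr//; lra.
  by rewrite divr_ge0// addr_ge0.
apply: (@pseries_snd_diffs _ a K).
- exact: pgrow_cvg.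
- by apply: pgrow_cvg => //; exact: pgrow_diffs.
- by apply: pgrow_cvg => //; do 2! apply: pgrow_diffs.
- rewrite (@ger0_norm _ K) /K; first by rewrite ltr_pdivlMr//; lra.
  by rewrite divr_ge0// addr_ge0.
Qed.

Lemma psumD a b x : pgrow a -> pgrow b -> `|x| < 1 ->
  psum (fun k => a k + b k) x = psum a x + psum b x.
Proof.
move=> ha hb x1; apply: cvg_lim => //.
rewrite (_ : pseries _ x = pseries a x + pseries b x).
  by apply: cvgD; exact: psum_cvg.
apply/funext => N; rewrite /pseries /series /= [RHS]/GRing.add/= -big_split/=.
by apply: eq_bigr => k _; rewrite mulrDl.
Qed.

Lemma psumZ c a x : pgrow a -> `|x| < 1 -> psum (fun k => c * a k) x = c * psum a x.
Proof.
move=> ha x1; apply: cvg_lim => //.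
rewrite (_ : pseries _ x = (fun N => c * pseries a x N)).
  by apply: cvgMl_tmp; exact: psum_cvg.
apply/funext => N; rewrite /pseries /series /= mulr_sumr.
by apply: eq_bigr => k _; rewrite mulrA.
Qed.

Lemma psum_rec a x : pgrow a -> `|x| < 1 -> psum a x = a 0%N + x * psum (fun k => a k.+1) x.
Proof.
move=> ha x1; apply: cvg_lim => //; rewrite -cvg_shiftS/=.
rewrite (_ : (fun N => pseries a x N.+1) = (fun N => a 0%N + x * pseries (fun k => a k.+1) x N)).
  apply: cvgD; first exact: cvg_cst.
  by apply: cvgMl_tmp; apply: psum_cvg => //; exact: pgrowS.
apply/funext => N; rewrite /pseries /series /= big_nat_recl// expr0 mulr1 mulr_sumr.
by congr (_ + _); apply: eq_bigr => k _; rewrite exprS; ring.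
Qed.

(** The remainder is controlled by that of a majorant at a larger radius, uniformly in x; this is
    what allows limits to be taken under integrals by hand. *)
Lemma psum_tail a b x r N : pgrow b -> (forall k, `|a k| <= b k) -> `|x| <= r -> r < 1 ->
  `|psum a x - pseries a x N| <= psum b r - pseries b r N.
Proof.
move=> hb ab xr r1.
have b0 k : 0 <= b k by rewrite (le_trans _ (ab k)).
have r0 : 0 <= r by rewrite (le_trans _ xr).
have ha : pgrow a by apply: (pgrow_le hb) => k; rewrite (ger0_norm (b0 k)).
have x1 : `|x| < 1 by rewrite (le_lt_trans xr).
have nr1 : `|r| < 1 by rewrite ger0_norm.
have c1 : (fun m => `|pseries a x m - pseries a x N|) @ \oo --> `|psum a x - pseries a x N|.
  by apply: cvg_norm; apply: cvgB; [exact: psum_cvg|exact: cvg_cst].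
have c2 : (fun m => pseries b r m - pseries b r N) @ \oo --> psum b r - pseries b r N.
  by apply: cvgB; [exact: psum_cvg|exact: cvg_cst].
apply: (ler_cvg_to c1 c2); exists N => // m /= Nm.
rewrite /pseries /= !sub_series_geq//.
rewrite (le_trans (ler_norm_sum _ _ _))// ler_sum_nat// => k _.
by rewrite normrM normrX ler_pM// ?exprn_ge0// lerXn2r ?nnegrE.
Qed.

Lemma psum_le a b x : pgrow a -> pgrow b -> 0 <= x < 1 -> (forall k, a k <= b k) ->
  psum a x <= psum b x.
Proof.
move=> ha hb /andP[x0 x1] ab.
have nx1 : `|x| < 1 by rewrite ger0_norm.
apply: (ler_cvg_to (psum_cvg ha nx1) (psum_cvg hb nx1)); apply: nearW => m.
by rewrite /pseries /series /= ler_sum// => k _; rewrite ler_wpM2r ?exprn_ge0.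
Qed.

Lemma psum_norm a b x r : pgrow b -> (forall k, `|a k| <= b k) -> `|x| <= r -> r < 1 ->
  `|psum a x| <= psum b r.
Proof.
move=> hb ab xr r1; have := psum_tail 0 hb ab xr r1.
by rewrite /pseries /series /= !big_geq// !subr0.
Qed.

Lemma psum0 x : psum (fun=> 0) x = 0.
Proof.
apply: cvg_lim => //; rewrite (_ : pseries _ x = fun=> 0); first exact: cvg_cst.
by apply/funext => N; rewrite /pseries /series /= big1// => k _; rewrite mul0r.
Qed.

Lemma psum_ge0 a x : pgrow a -> 0 <= x < 1 -> (forall k, 0 <= a k) -> 0 <= psum a x.
Proof.
move=> ha hx a0; rewrite -(psum0 x); apply: psum_le => //; exact: pgrow_cst.
Qed.

Lemma psum_ge_a0 a x : pgrow a -> 0 <= x < 1 -> (forall k, 0 <= a k) -> a 0%N <= psum a x.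
Proof.
move=> ha /andP[x0 x1] a0; rewrite psum_rec//; last by rewrite ger0_norm.
by rewrite lerDl mulr_ge0// psum_ge0 ?x0//; exact: pgrowS.
Qed.

Lemma psum_homo a x y : pgrow a -> 0 <= x -> x <= y -> y < 1 -> (forall k, 0 <= a k) ->
  psum a x <= psum a y.
Proof.
move=> ha x0 xy y1 a0.
have nx1 : `|x| < 1 by rewrite ger0_norm// (le_lt_trans xy).
have ny1 : `|y| < 1 by rewrite ger0_norm// (le_trans x0).
apply: (ler_cvg_to (psum_cvg ha nx1) (psum_cvg ha ny1)); apply: nearW => m.
by rewrite /pseries /series /= ler_sum// => k _; rewrite ler_wpM2l// lerXn2r ?nnegrE// (le_trans x0).
Qed.

(** The uniqueness argument behind each closed form below: the series times the inverse of the
    expected solution has zero derivative, and its value at 0 is known. *)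
Lemma eq_of_isd0 (f : R -> R) x : `|x| < 1 ->
  (forall y : R, `|y| < 1 -> is_derive y 1 f 0) -> f x = f 0.
Proof.
move=> x1 H.
have key u v : u <= v -> `|u| < 1 -> `|v| < 1 -> f v = f u.
  move=> uv; rewrite !ltr_norml => /andP[u1 _] /andP[_ v1].
  have H' y : u <= y <= v -> is_derive y 1 f 0.
    move=> /andP[uy yv]; apply: H.
    by rewrite ltr_norml (lt_le_trans u1)//= (le_lt_trans yv).
  have [|y|c _] := @MVT_segment R f (fun=> 0) u v uv.
  - by move=> y; rewrite in_itv/= => /andP[y0 yx]; apply: H'; rewrite !ltW.
  - apply: continuous_in_subspaceT => z; rewrite inE/= in_itv/= => zz.
    exact: (isd_cont (H' z zz)).
  by rewrite mul0r => /eqP; rewrite subr_eq0 => /eqP.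
have z1 : `|0 : R| < 1 by rewrite normr0.
by have [x0|x0] := leP 0 x; [exact: key|rewrite (key x 0) ?ltW].
Qed.

Lemma psum_nat a x : pgrow a -> `|x| < 1 ->
  psum (fun k => k%:R * a k) x = x * psum (pseries_diffs a) x.
Proof.
move=> ga hx; rewrite psum_rec ?mul0r ?add0r//.
by apply: pgrowM => //; exact: pgrow_nat.
Qed.

Lemma pseries_norm_le a b x r N : pgrow b -> (forall k, `|a k| <= b k) -> `|x| <= r -> r < 1 ->
  `|pseries a x N| <= psum b r.
Proof.
move=> hb ab xr r1.
have b0 k : 0 <= b k by rewrite (le_trans _ (ab k)).
have hr : pseries b r N <= psum b r.
  have r0 : 0 <= r by rewrite (le_trans _ xr).
  have nr1 : `|r| < 1 by rewrite ger0_norm.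
  apply: (limr_ge (pgrow_cvg hb nr1)); exists N => // m /= Nm.
  by rewrite -subr_ge0 /pseries sub_series_geq// sumr_ge0// => k _; rewrite mulr_ge0 ?exprn_ge0.
apply: (le_trans _ hr); rewrite /pseries /series /= (le_trans (ler_norm_sum _ _ _))// ler_sum// => k _.
by rewrite normrM normrX ler_pM ?exprn_ge0// lerXn2r ?nnegrE// (le_trans _ xr).
Qed.

End PolynomialGrowth.

(** * Quotients of rising factorials *)

Section RatioProduct.
Context {R : realType}.
Implicit Types a b : R.

(** The quotient (a)_k / (b)_k for positive a and b, kept as a product so that indices telescope
    ([pratio_trans]) without Gamma values. *)
Definition pratio a b (k : nat) : R := \prod_(j < k) ((a + j%:R) / (b + j%:R)).

Lemma pratio0 a b : pratio a b 0 = 1. Proof. by rewrite /pratio big_ord0. Qed.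

Lemma pratioSr a b k : pratio a b k.+1 = pratio a b k * ((a + k%:R) / (b + k%:R)).
Proof. by rewrite /pratio big_ord_recr. Qed.

Lemma pratioS a b k : pratio a b k.+1 = a / b * pratio (a + 1) (b + 1) k.
Proof.
rewrite /pratio big_ord_recl !addr0; congr (_ * _); apply: eq_bigr => j _.
by rewrite /bump/= natrD !addrA.
Qed.

Lemma addr_nat_gt0 a k : 0 < a -> 0 < a + k%:R.
Proof. by move=> a0; rewrite ltr_wpDr. Qed.

Lemma pratio_gt0 a b k : 0 < a -> 0 < b -> 0 < pratio a b k.
Proof. by move=> a0 b0; apply: prodr_gt0 => j _; rewrite divr_gt0 ?addr_nat_gt0. Qed.

Lemma pratio_trans a b c k : 0 < b -> pratio a b k * pratio b c k = pratio a c k.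
Proof.
move=> b0; rewrite /pratio -big_split/=; apply: eq_bigr => j _.
by rewrite mulrA divfK// gt_eqF// addr_nat_gt0.
Qed.

Lemma pratio_id a k : 0 < a -> pratio a a k = 1.
Proof. by move=> a0; rewrite /pratio big1// => j _; rewrite divff// gt_eqF// addr_nat_gt0. Qed.

Lemma pratio_succ a k : 0 < a -> pratio (a + 1) a k = (a + k%:R) / a.
Proof.
move=> a0; elim: k => [|k IH]; first by rewrite pratio0 addr0 divff// gt_eqF.
rewrite pratioSr IH -natr1; have := addr_nat_gt0 k a0 => ak.
by field; rewrite !gt_eqF.
Qed.

Lemma pratioE a b k : 0 < a -> 0 < b -> pratio a b k = pochhammer a k / pochhammer b k.
Proof. by move=> a0 b0; rewrite !pochhammerE// /pratio prodf_div. Qed.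

Lemma fact_pratio k : k`!%:R = pochhammer (1 : R) k.
Proof.
rewrite pochhammerE//; elim: k => [|k IH]; first by rewrite big_ord0.
by rewrite big_ord_recr/= -IH factS natrM mulrC nat1r.
Qed.

(** Each factor is 1 + (a-b)/(b+k) <= 1 + M/(k+1) <= ((k+2)/(k+1))^M, the last by Bernoulli's
    inequality, and the right-hand sides telescope. *)
Lemma pgrow_pratio a b : 0 < a -> 0 < b -> pgrow (pratio a b).
Proof.
move=> a0 b0.
(* This choice gives m (k+1) <= b + k for all k, also when b is small. *)
pose m : R := Num.min b 1.
have m0 : 0 < m by rewrite lt_min b0/=.
pose M := (Num.truncn (`|a - b| / m)).+1.
exists 1, M; split=> // k; rewrite mul1r gtr0_norm ?pratio_gt0//.
elim: k => [|k IH]; first by rewrite pratio0 expr1n.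
have k0 : 0 < k.+1%:R :> R by rewrite ltr0n.
rewrite pratioSr.
have -> : k.+2%:R ^+ M = k.+1%:R ^+ M * (k.+2%:R / k.+1%:R) ^+ M :> R.
  by rewrite expr_div_n mulrCA divff ?mulr1// expf_neq0// gt_eqF.
rewrite ler_pM// ?(ltW (pratio_gt0 _ _ _))//; first by rewrite divr_ge0// ltW// addr_nat_gt0.
apply: (@le_trans _ _ (1 + M%:R / k.+1%:R)); last first.
  elim: (M) => [|j]; first by rewrite mul0r addr0 expr0.
  have q0 : 0 <= k.+1%:R^-1 :> R by rewrite invr_ge0.
  have -> : k.+2%:R / k.+1%:R = 1 + k.+1%:R^-1 :> R.
    by rewrite -[k.+2%:R]natr1 mulrDl divff ?mul1r// gt_eqF.
  rewrite exprS => H; apply: (le_trans _ (ler_wpM2l _ H)); last by rewrite addr_ge0.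
  rewrite -natr1 mulrDl mul1r.
  have : 0 <= k.+1%:R^-1 * (j%:R / k.+1%:R) :> R by rewrite !mulr_ge0.
  move: (k.+1%:R^-1) (j%:R / _) => u v; lra.
have bk := addr_nat_gt0 k b0.
have -> : (a + k%:R) / (b + k%:R) = 1 + (a - b) / (b + k%:R).
  by field; rewrite gt_eqF.
rewrite lerD2l ler_pdivrMr// mulrAC ler_pdivlMr//.
have MH : `|a - b| <= M%:R * m.
  by rewrite -ler_pdivrMr// ltW// truncnS_gt.
have mk : m * k.+1%:R <= b + k%:R.
  have mb : m <= b by rewrite ge_min lexx.
  have m1 : m <= 1 by rewrite ge_min lexx orbT.
  rewrite -natr1 mulrDr mulr1 addrC lerD// ler_piMl//.
apply: (@le_trans _ _ (`|a - b| * k.+1%:R)); first by rewrite ler_wpM2r// ler_norm.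
apply: (@le_trans _ _ (M%:R * m * k.+1%:R)); first by rewrite ler_wpM2r.
by rewrite -mulrA ler_wpM2l.
Qed.

(* Both quotients are decreasing rearrangements of [x |-> (x + j) / (x + d + j)];
   replacing [b] by [a + N >= b] makes the product telescope. *)
Let pratio_balanced_pos (a b d : R) : 0 < a -> 0 < b -> 0 <= d -> exists2 c : R, 0 < c &
  forall k, c <= pratio a (a + d) k * pratio (b + d) b k.
Proof.
move=> a0 b0 d0.
have ad : 0 < a + d by rewrite ltr_wpDr.
have le1 k (x : R) : 0 < x -> pratio x (x + d) k <= 1.
  move=> x0; rewrite /pratio; apply: prodr_ile1 => j _.
  have xj := addr_nat_gt0 j x0; have xdj : 0 < x + d + j%:R by rewrite addr_nat_gt0// ltr_wpDr.
  by rewrite divr_ge0 ?(ltW xj) ?(ltW xdj)//= ler_pdivrMr// mul1r lerD2r lerDl.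
have [N Nb] : exists N : nat, b <= a + N%:R.
  by exists (Num.truncn b).+1; rewrite (le_trans (ltW (truncnS_gt b)))// lerDr ltW.
exists (pratio a (a + d) N); first exact: pratio_gt0.
have shift k : pratio a (a + d) N * pratio (a + N%:R) (a + N%:R + d) k = pratio a (a + d) (N + k).
  elim: k => [|k IH]; first by rewrite pratio0 mulr1 addn0.
  rewrite addnS !pratioSr -IH natrD -mulrA; congr (_ * (_ * _)).
  by congr (_ / _); ring.
move=> k.
have bd : 0 < b + d by rewrite ltr_wpDr.
have mono : pratio b (b + d) k <= pratio (a + N%:R) (a + N%:R + d) k.
  rewrite /pratio ler_prod// => j _.
  have bj := addr_nat_gt0 j b0; have bdj := addr_nat_gt0 j bd.
  have aN : 0 < a + N%:R by rewrite ltr_wpDr.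
  have aNd : 0 < a + N%:R + d + j%:R by rewrite addr_nat_gt0// ltr_wpDr.
  rewrite divr_ge0 ?(ltW bj) ?(ltW bdj)//= ler_pdivrMr// mulrAC ler_pdivlMr//.
  have : 0 <= d * (a + N%:R - b) by rewrite mulr_ge0// subr_ge0.
  lra.
have inv : pratio b (b + d) k * pratio (b + d) b k = 1 by rewrite pratio_trans// pratio_id.
have r0 := pratio_gt0 k bd b0.
rewrite -[leLHS]mulr1 -inv mulrA ler_wpM2r ?(ltW r0)//.
have step : pratio a (a + d) N * pratio b (b + d) k <= pratio a (a + d) (N + k).
  by rewrite -shift ler_wpM2l// ltW// pratio_gt0.
apply: (le_trans step).
rewrite addnC /pratio big_split_ord/= ler_piMr//.
  by rewrite ltW// pratio_gt0.
have := le1 N (a + k%:R) (addr_nat_gt0 k a0); rewrite /pratio; apply: le_trans.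
rewrite le_eqVlt; apply/orP; left; apply/eqP; apply: eq_bigr => j _.
by rewrite natrD; congr (_ / _); ring.
Qed.

(** Stands in for Gamma asymptotics: with equal index sums the product tends to a positive constant,
    of which only a positive lower bound is kept. The two orders of a and b reduce to the same
    telescoping. *)
Lemma pratio_balanced a a' b b' : 0 < a -> 0 < a' -> 0 < b -> 0 < b' -> a + a' = b + b' ->
  exists2 c : R, 0 < c & forall k, c <= pratio a b k * pratio a' b' k.
Proof.
move=> a0 a'0 b0 b'0 E.
have [ab|ba] := leP a b.
  have [c c0 H] := @pratio_balanced_pos a b' (b - a) a0 b'0 (etrans (subr_ge0 _ _) ab).
  exists c => // k; have := H k; have -> : a + (b - a) = b by ring.
  by have -> : b' + (b - a) = a' by move: E; lra.
have [c c0 H] := @pratio_balanced_pos a' b (a - b) a'0 b0 (etrans (subr_ge0 _ _) (ltW ba)).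
exists c => // k; have := H k; have -> : b + (a - b) = a by ring.
by have -> : a' + (a - b) = b' by [move: E; lra]; rewrite mulrC.
Qed.

(** The series F solves (1-y) F' = s F, so F (1-y)^s is constant. *)
Lemma psum_binomial s x : 0 < s -> 0 <= x < 1 -> psum (pratio s 1) x = (1 - x) `^ (- s).
Proof.
move=> s0 hx; have s1 := pgrow_pratio s0 (@ltr01 R).
pose F := psum (pratio s 1).
have dF (y : R) : `|y| < 1 -> is_derive y 1 (fun z => F z * (1 - z) `^ s) 0.
  move=> ny; have y1 : y < 1 by rewrite (le_lt_trans (ler_norm y)).
  have y1' : 0 < 1 - y by rewrite subr_gt0.
  have dif := psum_isd s1 ny.
  have eqd : (1 - y) * psum (pseries_diffs (pratio s 1)) y = s * F y.
    have gd := pgrow_diffs s1; have gr := pgrowS s1.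
    rewrite mulrBl mul1r {1}(psum_rec gd ny) /F (psum_rec s1 ny).
    have -> : psum (fun k => pseries_diffs (pratio s 1) k.+1) y =
      psum (pseries_diffs (pratio s 1)) y + s * psum (fun k => pratio s 1 k.+1) y.
      rewrite -psumZ// -psumD//; last by apply: pgrowM => //; exact: pgrow_cst.
      congr psum; apply/funext => k; rewrite /pseries_diffs [pratio s 1 k.+2]pratioSr.
      rewrite [1 + k.+1%:R]addrC natr1.
      have k2 : k.+2%:R != 0 :> R by rewrite pnatr_eq0.
      by rewrite mulrCA [k.+2%:R * _]mulrCA mulfV// mulr1 mulrC mulrDl addrC.
    rewrite /pseries_diffs pratioSr pratio0 !addr0 divr1; ring.
  apply: is_derive_eq.
    by apply: isdM dif _; exact: isd_powR_1B.
  have -> : (1 - y) `^ s = (1 - y) * (1 - y) `^ (s - 1).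
    rewrite -{2}[1 - y]powRr1 ?(ltW y1')// -powRD ?(gt_eqF y1') ?implybT//.
    by rewrite addrCA subrr addr0.
  by rewrite mulrA [_ * (1 - y)]mulrC eqd /F; ring.
have nx : `|x| < 1 by case/andP: hx => x0 x1; rewrite ger0_norm.
have := eq_of_isd0 nx dF; rewrite subr0 powR1 mulr1.
have -> : F 0 = 1.
  by rewrite /F psum_rec ?normr0// mul0r addr0 pratio0.
have x1 : 0 < 1 - x by rewrite subr_gt0; case/andP: hx.
have nz : (1 - x) `^ s != 0 by rewrite gt_eqF// powR_gt0.
by move=> E; rewrite powRN; apply: (mulIf nz); rewrite mulVf.
Qed.


End RatioProduct.

(** * The closed form of the Poisson kernel *)

Section Cosine.
Context {R : realType} {n : nat}.
Hypothesis n1 : (1 < n)%N.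
Let n0 : (0 < n)%N. Proof. exact: ltnW. Qed.
Let nn : (2 : R) <= n%:R. Proof. by rewrite ler_nat. Qed.
(* [lra] ignores section variables. *)
Ltac lran := have ? := nn; lra.
Ltac nzs := do ?[apply/andP; split]; rewrite gt_eqF//; lran.
Local Notation d := (@dimH R n).
Local Notation G t k := (@gegenR R n t 1 k).

Let natr2 m : m.+2%:R = m%:R + 2 :> R.
Proof. by rewrite -natrD addn2. Qed.

Let natr_predD k : (k + n)%N.-1%:R = k%:R + n%:R - 1 :> R.
Proof.
have e : (k + n = (k + n).-1.+1)%N by rewrite prednK// addn_gt0 n0 orbT.
by rewrite -natrD [in RHS]e -natr1 addrK.
Qed.

Lemma dimH_gt0 k : 0 < d k.
Proof. by rewrite /dimH invr_gt0 mulr_gt0 ?repro_coef_gt0 ?gegen_lead_gt0. Qed.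

Lemma dimH0 : d 0%N = 1.
Proof. by rewrite /dimH /= mulr1 invr1. Qed.

Lemma dimH1 : d 1%N = n%:R.
Proof.
have -> : d 1%N = (1 / (2 * 1 + n%:R - 2) * 1 * (1 * 1))^-1 by [].
by rewrite !mulr1 mul1r invrK; ring.
Qed.

Lemma dimHSS k : d k.+2 =
  d k.+1 * (((2 * k + n)%N.+2%:R * (k + n)%N.-1%:R) / (k.+2%:R * (2 * k + n)%N%:R)).
Proof.
have -> : (2 * k + n)%N.+2%:R = 2 * k%:R + n%:R + 2 :> R by rewrite natr2 natrD natrM.
have E : @repro_coef R n k.+2 = k.+2%:R / (2 * k.+2%:R + n%:R - 2) * @repro_coef R n k.+1 by [].
have F : @gegen_lead R n k.+2 = gcoefa n k * @gegen_lead R n k.+1 by [].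
rewrite /dimH E F /gcoefa natr_predD natrD natrM. clear E F.
have r0 := @repro_coef_gt0 R n n1 k.+1; have l0 := @gegen_lead_gt0 R n n1 k.+1.
have k0 : (0 : R) <= k%:R by [].
have -> : k.+2%:R = k%:R + 2 :> R by exact: natr2.
by field; rewrite ?(gt_eqF r0) ?(gt_eqF l0)/=; nzs.
Qed.

(** In this form the growth of dim H_k, and later its lower bounds, come from those of [pratio]. *)
Lemma dimHS k : d k.+1 = n%:R * pratio (1 + n%:R / 2) (n%:R / 2) k * pratio (n%:R - 1) 2 k.
Proof.
elim: k => [|k IH]; first by rewrite dimH1 !pratio0 !mulr1.
rewrite dimHSS IH !pratioSr natr_predD.
have -> : (2 * k + n)%N.+2%:R = 2 * k%:R + n%:R + 2 :> R by rewrite natr2 natrD natrM.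
rewrite natrD natrM.
have k0 : (0 : R) <= k%:R by [].
have -> : k.+2%:R = k%:R + 2 :> R by exact: natr2.
by field; nzs.
Qed.

Lemma pgrow_dimH : pgrow d.
Proof.
apply: pgrow_unS; rewrite (_ : (fun _ => _) = fun k =>
  n%:R * (pratio (1 + n%:R / 2) (n%:R / 2) k * pratio (n%:R - 1) 2 k)).
  apply: pgrowM; first exact: pgrow_cst.
  by apply: pgrowM; apply: pgrow_pratio; lran.
by apply/funext => k; rewrite dimHS mulrA.
Qed.

(** Realised by two unit vectors rather than by an interval, because the bound on G_k(t) comes from
    integrals of zonal polynomials attached to two such vectors. *)
Definition cosine (t : R) := exists x y : Rn R n, [/\ usphere x, usphere y & t = rdot x y].

Lemma gegenR_sphere (x y : Rn R n) k : usphere x -> G (rdot x y) k = pev (Gp y k) x.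
Proof. by move=> x1; rewrite pev_Gp x1 expr1n. Qed.

Lemma rdot_self (x : Rn R n) : usphere x -> rdot x x = 1.
Proof.
move=> x1; rewrite -[RHS](expr1n _ 2) -[in RHS]x1 enorm_sqr.
by apply: eq_bigr => i _; rewrite expr2.
Qed.

Lemma gegenR_1 k : G 1 k = 1.
Proof.
elim/nat_ind2: k => [||k IH1 IH2] //; rewrite gegenR_SS IH1 IH2 /gcoefa /gcoefb.
have k0 : (0 : R) <= k%:R by [].
by field; nzs.
Qed.

Lemma rdotC (x y : Rn R n) : rdot x y = rdot y x.
Proof. by apply: eq_bigr => i _; rewrite mulrC. Qed.

Lemma Lint_Gp_Gp (x y : Rn R n) k : usphere x -> usphere y ->
  d k * Lint (Gp x k * Gp y k) = G (rdot x y) k.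
Proof.
move=> x1 y1; rewrite (Lint_Gp n1 y1 (harmonic_Gp n1 x1 k)).
by rewrite -gegenR_sphere// rdotC.
Qed.

Let sqr_scaleD (A : comAlgType R) (u v : A) (s : R) : (u + s *: v) * (u + s *: v) =
  u * u + ((2 * s) *: (u * v) + (s ^+ 2) *: (v * v)).
Proof.
rewrite mulrDl !mulrDr -!scalerAl -!scalerAr scalerA expr2 mulr2n mulrDl mul1r scalerDl.
by rewrite [v * u]mulrC -!addrA.
Qed.

Let Lint_lin (A B C : mpoly n R) a b :
  Lint (A + (a *: B + b *: C)) = Lint A + (a * Lint B + b * Lint C).
Proof. by rewrite (LintD n1 A) (LintD n1 (a *: B)) (LintZ n1 a) (LintZ n1 b). Qed.

(* [G (x . y) = dim H_k * \int Z_k(., x) Z_k(., y)], so AM-GM bounds it by [G 1 = 1]. *)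
Lemma gegenR_le1 (t : R) k : cosine t -> `|G t k| <= 1.
Proof.
move=> [x [y [x1 y1 ->]]].
have alg (D a b c g s : R) : D * a = 1 -> D * b = g -> D * c = 1 ->
    2 + 2 * (s * g) = D * (a + (2 * s * b + 1 * c)).
  by move=> ha <- hc; rewrite !mulrDr ha mul1r hc; ring.
have key (s : R) : s ^+ 2 = 1 -> 0 <= 2 + 2 * (s * G (rdot x y) k).
  move=> s1.
  have -> : 2 + 2 * (s * G (rdot x y) k) =
      d k * Lint ((Gp x k + s *: Gp y k) * (Gp x k + s *: Gp y k)).
    have -> : (Gp x k + s *: Gp y k) * (Gp x k + s *: Gp y k) =
      Gp x k * Gp x k + ((2 * s) *: (Gp x k * Gp y k) + (s ^+ 2) *: (Gp y k * Gp y k)).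
      exact: sqr_scaleD.
    rewrite Lint_lin s1.
    apply: alg.
    - by rewrite (Lint_Gp_Gp k x1 x1) (rdot_self x1) gegenR_1.
    - exact: (Lint_Gp_Gp k x1 y1).
    - by rewrite (Lint_Gp_Gp k y1 y1) (rdot_self y1) gegenR_1.
  rewrite mulr_ge0 ?(ltW (dimH_gt0 _))//.
  by apply: Rintegral_ge0 => z _; rewrite pevM -expr2 sqr_ge0.
have h1 := key 1 (expr1n _ _); have := key (-1) (sqrr_sign _ 1).
by rewrite ler_norml; lran.
Qed.

Lemma cosine_le1 (t : R) : cosine t -> `|t| <= 1.
Proof. exact: (gegenR_le1 1). Qed.

Lemma cosine1 : cosine 1.
Proof.
have [e e1] := @usphere_nonempty R n n1.
by exists e, e; split=> //; rewrite rdot_self.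
Qed.

(* [t] is the cosine of the angle between [x] and [y], and [rho = |x| |y|]. *)
Definition zker (a : R^nat) (t rho : R) := psum (fun k => a k * d k * G t k) rho.

Lemma pgrow_ker a t : pgrow a -> cosine t -> pgrow (fun k => a k * d k * G t k).
Proof.
move=> ga ht; apply: (pgrow_le (pgrowM ga pgrow_dimH)) => k.
by rewrite normrM ler_piMr// gegenR_le1.
Qed.

(** For k >= 1 the denominator is 2k+n-2, and (n-2) U_k is the Gegenbauer polynomial of index n/2 -
    1 in its usual normalisation. Leaving the factor n - 2 outside keeps n = 2, where that index is
    0, in the same argument. *)
Let U t (k : nat) : R := if k is k'.+1 then d k / (2 * k' + n)%N%:R * G t k else 0.

Let U0 t : U t 0%N = 0. Proof. by []. Qed.

Let UE t k : U t k.+1 = d k.+1 / (2 * k + n)%N%:R * G t k.+1. Proof. by []. Qed.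

Let pgrowU (t : R) : cosine t -> pgrow (U t).
Proof.
move=> ht; apply: pgrow_unS; apply: (pgrow_le (pgrowS pgrow_dimH)) => k.
rewrite UE normrM normrM -[leRHS]mulr1 -[leRHS]mulr1 ler_pM ?gegenR_le1// ?mulr_ge0//.
rewrite ler_wpM2l// ger0_norm ?invr_ge0// invf_le1 ?ltr0n ?ler1n; lia.
Qed.

(** U_0 is 0 where the Gegenbauer pattern would require 1/(n-2); the last term makes up for this at
    k = 0 and stays meaningful for n = 2. *)
Let URec t k : k.+2%:R * U t k.+2 =
  (2 * k + n)%N%:R * t * U t k.+1 - (k + n - 2)%N%:R * U t k - (k == 0%N)%:R.
Proof.
have k0 : (0 : R) <= k%:R by [].
have N1 := natr_predD k.
have N2 : (k + n - 2)%N%:R = k%:R + n%:R - 2 :> R by rewrite natrB ?natrD//; lia.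
have E2 : k.+2%:R * U t k.+2 = d k.+1 / (2 * k + n)%N%:R *
    ((2 * k%:R + n%:R) * t * G t k.+1 - (k%:R + 1) * G t k).
  rewrite UE dimHSS gegenR_SS N1 /gcoefa /gcoefb !natrD !natrM mul1r.
  have -> : (2 * k + n)%N.+2%:R = 2 * k%:R + n%:R + 2 :> R by rewrite natr2 natrD natrM.
  have -> : k.+1%:R = k%:R + 1 :> R by rewrite natr1.
  have -> : k.+2%:R = k%:R + 2 :> R by exact: natr2.
  by field; nzs.
rewrite E2 N2; case: k k0 {N1 N2 E2} => [|k] _.
  have -> : G t 0%N = 1 by [].
  have -> : (0%N == 0%N)%:R = 1 :> R by [].
  by rewrite UE U0 muln0 add0n dimH1 !mulr0n; field; nzs.
have dE : d k.+2 / (2 * k.+1 + n)%N%:R = d k.+1 * (k%:R + n%:R - 1) / (k.+2%:R * (2 * k + n)%N%:R).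
  rewrite dimHSS natr_predD.
  have -> : (2 * k + n)%N.+2%:R = (2 * k.+1 + n)%N%:R :> R by congr _%:R; lia.
  have k0 : (0 : R) <= k%:R by [].
  by field; nzs.
rewrite !UE dE /= subr0.
have -> : k.+2%:R = k%:R + 2 :> R by exact: natr2.
have -> : k.+1%:R = k%:R + 1 :> R by rewrite natr1.
have -> : (2 * k.+1 + n)%N%:R = 2 * k%:R + 2 + n%:R :> R by rewrite natrD natrM -natr1; ring.
have k0' : (0 : R) <= k%:R by [].
rewrite natrD natrM; by field; nzs.
Qed.

Definition Qf (t y : R) : R := 1 - 2 * t * y + y ^+ 2.

Lemma Qf_gt0 (t y : R) : `|t| <= 1 -> `|y| < 1 -> 0 < Qf t y.
Proof.
move=> ht hy.
have h : t * y <= `|y|.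
  by rewrite (le_trans (ler_norm _))// normrM ler_piMl.
have : 0 < (1 - `|y|) ^+ 2 by rewrite exprn_gt0// subr_gt0.
rewrite sqrrB expr1n mul1r real_normK ?num_real// /Qf -mulrA; lra.
Qed.

Lemma Qf_ge (t y : R) : `|t| <= 1 -> 0 <= y -> (1 - y) ^+ 2 <= Qf t y.
Proof.
move=> ht hy; rewrite /Qf sqrrB expr1n mul1r -mulrA.
have : t * y <= y by rewrite ler_piMl// (le_trans (ler_norm _)).
lra.
Qed.

Lemma isd_Qf (t y : R) : is_derive y 1 (Qf t) (2 * (y - t)).
Proof.
by rewrite /Qf; apply: is_derive_eq; rewrite /GRing.scale/=; ring.
Qed.

(** Obtained by summing [URec] against powers of y, the factors k becoming derivatives. *)
Let Uode (t y : R) : cosine t -> `|y| < 1 ->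
  Qf t y * psum (pseries_diffs (U t)) y = (t - y) * (1 + (n%:R - 2) * psum (U t) y).
Proof.
move=> ht hy.
have gU := pgrowU ht; have gD := pgrow_diffs gU.
set D := pseries_diffs (U t).
have D0 : D 0%N = t.
  by rewrite /D /pseries_diffs UE muln0 add0n dimH1 divff ?mul1r// pnatr_eq0 -lt0n.
have eU : psum (U t) y = y * psum (fun k => U t k.+1) y by rewrite psum_rec// add0r.
pose E (k : nat) := k%:R * U t k.
have gE : pgrow E by apply: pgrowM => //; exact: pgrow_nat.
have eE : psum E y = y * psum D y by rewrite psum_rec// /E mul0r add0r.
have e1 : psum (fun k : nat => (k == 0%N)%:R) y = 1.
  rewrite psum_rec//=; first by rewrite psum0 mulr0 addr0.
  by apply: pgrow_unS; exact: pgrow_cst.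
have gd : pgrow (fun k : nat => (k == 0%N)%:R : R) by apply: pgrow_unS; exact: pgrow_cst.
have gz c (a : R^nat) : pgrow a -> pgrow (fun k => c * a k).
  by move=> ga; apply: pgrowM => //; exact: pgrow_cst.
have gUS := pgrowS gU.
have eD : psum (fun k => D k.+1) y = 2 * t * psum D y + ((n%:R - 2) * t * psum (fun k => U t k.+1) y
   + (- 1 * psum E y + (- (n%:R - 2) * psum (U t) y + -1 * psum (fun k : nat => (k == 0%N)%:R) y))).
  rewrite -!psumZ// -!psumD//; do ?[apply: pgrowD]; do ?[apply: gz]; rewrite //.
  congr psum; apply/funext => k; rewrite /D /pseries_diffs URec /E.
  have -> : (k + n - 2)%N%:R = k%:R + n%:R - 2 :> R by rewrite natrB ?natrD//; lia.
  by rewrite natrD natrM -natr1; ring.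
have eD' := psum_rec gD hy; rewrite -/D D0 eD eE e1 in eD'.
rewrite /Qf {1}mulrDl mulrBl mul1r {1}eD' eU; ring.
Qed.

(* [V = 1 + (n - 2) U] satisfies [Q V' = (n - 2) (t - y) V], hence is [Q ^ (1 - n / 2)]. *)
Let Vsum (t y : R) : cosine t -> `|y| < 1 ->
  1 + (n%:R - 2) * psum (U t) y = Qf t y `^ (- (n%:R / 2 - 1)).
Proof.
move=> ht hy; have ht1 := cosine_le1 ht.
pose F (z : R) := (1 + (n%:R - 2) * psum (U t) z) * Qf t z `^ (n%:R / 2 - 1).
have dF (z : R) : `|z| < 1 -> is_derive z 1 F 0.
  move=> hz; have Q0 := Qf_gt0 ht1 hz.
  apply: is_derive_eq.
    apply: isdM.
      apply: isdD (isd_cst _ _) _; apply: isdZ.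
      exact: psum_isd (pgrowU ht) hz.
    exact: isd_powR Q0 (isd_Qf t z).
  have -> : Qf t z `^ (n%:R / 2 - 1) = Qf t z * Qf t z `^ (n%:R / 2 - 1 - 1).
    rewrite -{2}[Qf t z]powRr1 ?(ltW Q0)// -powRD ?(gt_eqF Q0) ?implybT//.
    by congr (_ `^ _); ring.
  have := Uode ht hz; set D := psum _ z; set W := 1 + _ => odeE.
  rewrite add0r [X in _ + X](_ : _ = (n%:R - 2) * (Qf t z * D) * Qf t z `^ (n%:R / 2 - 1 - 1)); last by ring.
  by rewrite odeE; field.
have := eq_of_isd0 hy dF; rewrite /F.
have -> : psum (U t) 0 = 0.
  by rewrite psum_rec ?normr0//; [rewrite mul0r addr0|exact: pgrowU].
have -> : Qf t 0 = 1 by rewrite /Qf mulr0 subr0 expr0n addr0.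
rewrite mulr0 addr0 mul1r powR1 => E.
have nz : Qf t y `^ (n%:R / 2 - 1) != 0 by rewrite gt_eqF// powR_gt0// Qf_gt0.
by apply: (mulIf nz); rewrite E powRN mulVf.
Qed.

(** Since d_k G_k = (n-2) U_k + 2 k U_k for k >= 1, the kernel is V + 2 y U' with V = 1 + (n-2) U,
    and [Uode] expresses U' through V = Q^(1-n/2). The numerator Q + 2 y (t-y) that appears is 1 -
    y^2. *)
Lemma poisson (t y : R) : cosine t -> `|y| < 1 ->
  zker (fun=> 1) t y = (1 - y ^+ 2) * Qf t y `^ (- (n%:R / 2)).
Proof.
move=> ht hy; have ht1 := cosine_le1 ht; have Q0 := Qf_gt0 ht1 hy.
have gU := pgrowU ht; have gD := pgrow_diffs gU.
pose E (k : nat) := k%:R * U t k.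
have gE : pgrow E by apply: pgrowM => //; exact: pgrow_nat.
have eE : psum E y = y * psum (pseries_diffs (U t)) y by rewrite psum_rec// /E mul0r add0r.
have gd : pgrow (fun k : nat => (k == 0%N)%:R : R) by apply: pgrow_unS; exact: pgrow_cst.
have gz c (a : R^nat) : pgrow a -> pgrow (fun k => c * a k).
  by move=> ga; apply: pgrowM => //; exact: pgrow_cst.
have e1 : psum (fun k : nat => (k == 0%N)%:R) y = 1.
  by rewrite psum_rec//= psum0 mulr0 addr0.
have -> : zker (fun=> 1) t y = psum (fun k : nat => (k == 0%N)%:R) y + ((n%:R - 2) * psum (U t) y + 2 * psum E y).
  rewrite -!psumZ// -!psumD//; do ?[apply: pgrowD]; do ?[apply: gz]; rewrite //.
  congr psum; apply/funext => -[|k]; rewrite /E ?U0 ?UE.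
    have -> : G t 0%N = 1 by [].
    by rewrite dimH0 mulr0n eqxx mulr1n; ring.
  rewrite /= mul1r natrD natrM -natr1; have k0 : (0 : R) <= k%:R by [].
  by field; nzs.
rewrite e1 eE.
have Q1 : Qf t y != 0 by rewrite gt_eqF.
have -> : psum (pseries_diffs (U t)) y = (t - y) * (1 + (n%:R - 2) * psum (U t) y) / Qf t y.
  by rewrite -Uode// mulrC mulKf.
have V := Vsum ht hy; set W := psum (U t) y in V *.
have -> : Qf t y `^ (- (n%:R / 2)) = (1 + (n%:R - 2) * W) / Qf t y.
  rewrite V -[X in _ = _ / X]powRr1 ?(ltW Q0)// -powRN -powRD ?(gt_eqF Q0) ?implybT//.
  by congr (_ `^ _); ring.
have hq : 1 - y ^+ 2 = Qf t y + 2 * (y * (t - y)) by rewrite /Qf; ring.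
by rewrite hq; field.
Qed.

End Cosine.

(** * Tonelli's theorem on measurable rectangles *)

Section TonelliOn.
Context d1 d2 (T1 : measurableType d1) (T2 : measurableType d2) (R : realType).
Variables (m1 : {sigma_finite_measure set T1 -> \bar R}) (m2 : {sigma_finite_measure set T2 -> \bar R}).
Variables (D1 : set T1) (D2 : set T2) (f : T1 * T2 -> \bar R).
Hypotheses (mD1 : measurable D1) (mD2 : measurable D2).
Hypotheses (mf : measurable_fun (D1 `*` D2) f) (f0 : forall p, (D1 `*` D2) p -> (0 <= f p)%E).

Let g := f \_ (D1 `*` D2).

Let mg : measurable_fun setT g.
Proof. exact: (iffLR (measurable_restrictT f (measurableX mD1 mD2)) mf). Qed.

Let g0 p : (0 <= g p)%E.
Proof. by rewrite /g patchE; case: ifPn => // /set_mem /f0. Qed.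

Let inner1 x : ((fun x => \int[m2]_(y in D2) f (x, y)) \_ D1 x = \int[m2]_y g (x, y))%E.
Proof.
rewrite patchE; case: ifPn => [/set_mem D1x|/negP D1x].
  rewrite integral_mkcond; apply: eq_integral => y _.
  rewrite !patchE /g patchE; case: ifPn => [/set_mem D2y|/negP D2y]; case: ifPn => //.
    by move=> /negP; case; apply/mem_set.
  by move=> /set_mem[_ /= /mem_set].
rewrite (eq_integral (fun=> 0%E)) ?integral0// => y _.
by rewrite /g patchE; case: ifPn => // /set_mem[/= /mem_set].
Qed.

Let inner2 y : ((fun y => \int[m1]_(x in D1) f (x, y)) \_ D2 y = \int[m1]_x g (x, y))%E.
Proof.
rewrite patchE; case: ifPn => [/set_mem D2y|/negP D2y].
  rewrite integral_mkcond; apply: eq_integral => x _.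
  rewrite !patchE /g patchE; case: ifPn => [/set_mem D1x|/negP D1x]; case: ifPn => //.
    by move=> /negP; case; apply/mem_set.
  by move=> /set_mem[/= /mem_set].
rewrite (eq_integral (fun=> 0%E)) ?integral0// => x _.
by rewrite /g patchE; case: ifPn => // /set_mem[_ /= /mem_set].
Qed.

(** The kernels are known to be measurable only on products such as ball x ball, so the integrand is
    extended by 0 outside the rectangle before the global theorem is used. *)
Lemma tonelli_on : (\int[m1]_(x in D1) \int[m2]_(y in D2) f (x, y) =
  \int[m2]_(y in D2) \int[m1]_(x in D1) f (x, y))%E.
Proof.
rewrite integral_mkcond [RHS]integral_mkcond.
under eq_integral do rewrite inner1.
under [RHS]eq_integral do rewrite inner2.
exact: (fubini_tonelli g mg g0).
Qed.

Lemma measurable_tonelli_on : measurable_fun D1 (fun x => \int[m2]_(y in D2) f (x, y))%E.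
Proof.
apply/(measurable_restrictT _ mD1).
rewrite (_ : _ \_ _ = fun x => \int[m2]_y g (x, y))%E; last exact/funext/inner1.
exact: (measurable_fun_fubini_tonelli_F (m2 := m2) g mg g0).
Qed.

End TonelliOn.

(** * Kernels of integer order *)

Section Good.
Context {R : realType} {n : nat}.
Hypothesis n1 : (1 < n)%N.
Let n0 : (0 < n)%N. Proof. exact: ltnW. Qed.
Let nn : (2 : R) <= n%:R. Proof. by rewrite ler_nat. Qed.
Local Notation d := (@dimH R n).
Local Notation G t k := (@gegenR R n t 1 k).
Local Notation cosine := (@cosine R n).
Local Notation ker := (@zker R n).

(* Functions of [t] and [y] generated by the logarithmic derivative of the Poisson kernel;
   the index is the order of the singularity at [y = 1]. *)
Inductive good : nat -> (R -> R -> R) -> Prop :=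
| good_cst c : good 0 (fun _ _ => c)
| good_up j w : good j w -> good j.+1 w
| good_D j v w : good j v -> good j w -> good j (fun t y => v t y + w t y)
| good_Z c j w : good j w -> good j (fun t y => c * w t y)
| good_y j w : good j w -> good j (fun t y => y * w t y)
| good_A j w : good j w -> good j.+1 (fun t y => (1 - y ^+ 2)^-1 * w t y)
| good_B j w : good j w -> good j.+1 (fun t y => ((y - t) / Qf t y) * w t y)
| good_C j w : good j w -> good j.+2 (fun t y => (Qf t y)^-1 * w t y).

(** Rests on Q >= (1-y)^2 and |y-t|^2 <= Q, the latter because Q = (y-t)^2 + 1 - t^2; together they
    give (1-y) |y-t| <= Q by the arithmetic-geometric inequality. Each constructor then costs at
    most as many powers of 1/(1-y) as it adds to the index. *)
Lemma good_bound j w : good j w -> exists2 C : R, 0 <= C &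
  forall t y : R, cosine t -> 0 <= y < 1 -> `|w t y| <= C * (1 - y)^-1 ^+ j.
Proof.
elim=> {j w} [c|j w _ [C C0 H]|j v w _ [C C0 H] _ [D D0 K]|c j w _ [C C0 H]|j w _ [C C0 H]|
  j w _ [C C0 H]|j w _ [C C0 H]|j w _ [C C0 H]].
- by exists `|c| => // t y _ _; rewrite expr0 mulr1.
- exists C => // t y ht hy; rewrite (le_trans (H t y ht hy))// exprS mulrCA ler_peMl//.
    by rewrite mulr_ge0// exprn_ge0// invr_ge0 subr_ge0; case/andP: hy => _ /ltW.
  case/andP: hy => y0 y1; rewrite invf_ge1 ?subr_gt0//; lra.
- exists (C + D); first exact: addr_ge0.
  by move=> t y ht hy; rewrite (le_trans (ler_normD _ _))// mulrDl lerD ?H ?K.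
- exists (`|c| * C); first exact: mulr_ge0.
  by move=> t y ht hy; rewrite normrM -mulrA ler_wpM2l ?H.
- exists C => // t y ht hy; rewrite normrM (le_trans _ (H t y ht hy))// ler_piMl//.
  by case/andP: hy => y0 y1; rewrite ger0_norm// ltW.
- exists C => // t y ht hy; rewrite normrM [_ ^+ j.+1]exprS mulrCA ler_pM ?H//.
  case/andP: hy => y0 y1.
  have yy : y ^+ 2 <= y by rewrite expr2 ler_piMl// ltW.
  have p1 : 0 < 1 - y by lra.
  have p2 : 0 < 1 - y ^+ 2 by lra.
  rewrite ger0_norm ?invr_ge0 ?(ltW p2)// lef_pV2 ?posrE//; lra.
- exists C => // t y ht hy; rewrite normrM [_ ^+ j.+1]exprS mulrCA ler_pM ?H//.
  case/andP: hy => y0 y1; have ht1 := cosine_le1 n1 ht.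
  have p1 : 0 < 1 - y by lra.
  have ny : `|y| < 1 by rewrite ger0_norm.
  have q0 := Qf_gt0 ht1 ny; have q1 := Qf_ge ht1 y0.
  rewrite normrM normfV (ger0_norm (ltW q0)) ler_pdivrMr// ler_pdivlMl//.
  have q2 : `|y - t| ^+ 2 <= Qf t y.
    rewrite real_normK ?num_real// /Qf.
    have : t ^+ 2 <= 1 by rewrite -real_normK ?num_real// exprn_ile1.
    lra.
  have := sqr_ge0 ((1 - y) - `|y - t|); rewrite sqrrB; lra.
- exists C => // t y ht hy; rewrite normrM [_ ^+ j.+2]exprS [_ ^+ j.+1]exprS [(1 - y)^-1 * (_ * _)]mulrA mulrCA ler_pM ?H//.
  case/andP: hy => y0 y1; have ht1 := cosine_le1 n1 ht.
  have p1 : 0 < 1 - y by lra.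
  have ny : `|y| < 1 by rewrite ger0_norm.
  have q0 := Qf_gt0 ht1 ny; have q1 := Qf_ge ht1 y0.
  by rewrite ger0_norm ?invr_ge0 ?(ltW q0)// -invfM -expr2 lef_pV2 ?posrE// exprn_gt0.
Qed.

(** The derivative of Q is 2 (y-t), so differentiating a generator gives products of generators,
    with total index one higher. *)
Lemma good_deriv j w : good j w -> exists2 w', good j.+1 w' &
  forall t y : R, cosine t -> `|y| < 1 -> is_derive y 1 (w t) (w' t y).
Proof.
have yy (y : R) : `|y| < 1 -> 1 - y ^+ 2 != 0.
  by move=> hy; rewrite gt_eqF// subr_gt0 -real_normK ?num_real// exprn_ilt1.
have qq (t y : R) : cosine t -> `|y| < 1 -> Qf t y != 0.
  by move=> ht hy; rewrite gt_eqF// Qf_gt0//; exact: cosine_le1 ht.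
elim=> {j w} [c|j w gw [w' gw' H]|j v w gv [v' gv' H] gw [w' gw' K]|c j w gw [w' gw' H]|j w gw [w' gw' H]|
  j w gw [w' gw' H]|j w gw [w' gw' H]|j w gw [w' gw' H]].
- exists (fun _ _ => 0); first by apply: good_up; exact: good_cst.
  by move=> t y _ _; exact: isd_cst.
- by exists w' => //; exact: good_up.
- exists (fun t y => v' t y + w' t y); first exact: good_D.
  by move=> t y ht hy; apply: isdD; [exact: H|exact: K].
- exists (fun t y => c * w' t y); first exact: good_Z.
  by move=> t y ht hy; apply: isdZ; exact: H.
- exists (fun t y => w t y + y * w' t y).
    by apply: good_D; [exact: good_up|exact: good_y].
  move=> t y ht hy; apply: (is_derive_eq (isdM (isd_id y) (H t y ht hy))).
  by rewrite mul1r addrC.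
- exists (fun t y => 2 * (y * ((1 - y ^+ 2)^-1 * ((1 - y ^+ 2)^-1 * w t y))) + (1 - y ^+ 2)^-1 * w' t y).
    apply: good_D; last exact: good_A.
    by apply: good_Z; apply: good_y; apply: good_A; exact: good_A.
  move=> t y ht hy.
  have dI : is_derive y 1 (fun z : R => (1 - z ^+ 2)^-1) (2 * (y * ((1 - y ^+ 2)^-1 * (1 - y ^+ 2)^-1))).
    apply: (is_derive_eq (isdV (f := fun z : R => 1 - z ^+ 2) (yy y hy) (isdB (isd_cst 1 y) (isdX 2 (isd_id y))))).
    by rewrite /=; ring.
  by apply: (is_derive_eq (isdM dI (H t y ht hy))); ring.
- exists (fun t y => (Qf t y)^-1 * w t y + (-2 * ((y - t) / Qf t y * ((y - t) / Qf t y * w t y)) +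
    (y - t) / Qf t y * w' t y)).
    apply: good_D; first exact: good_C.
    apply: good_D; last exact: good_B.
    by apply: good_Z; apply: good_B; exact: good_B.
  move=> t y ht hy; have q0 := qq t y ht hy.
  have dI : is_derive y 1 (fun z : R => (z - t) / Qf t z)
      ((Qf t y)^-1 - 2 * ((y - t) / Qf t y * ((y - t) / Qf t y))).
    apply: (is_derive_eq (isdM (isdB (isd_id y) (isd_cst t y)) (isdV q0 (isd_Qf t y)))).
    by field.
  by apply: (is_derive_eq (isdM dI (H t y ht hy))); ring.
- exists (fun t y => -2 * ((y - t) / Qf t y * ((Qf t y)^-1 * w t y)) + (Qf t y)^-1 * w' t y).
    apply: good_D; last exact: good_C.
    by apply: good_Z; apply: good_B; exact: good_C.
  move=> t y ht hy; have q0 := qq t y ht hy.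
  have dI : is_derive y 1 (fun z : R => (Qf t z)^-1) (- 2 * ((y - t) / Qf t y * (Qf t y)^-1)).
    by apply: (is_derive_eq (isdV q0 (isd_Qf t y))); field.
  by apply: (is_derive_eq (isdM dI (H t y ht hy))); ring.
Qed.

Lemma isd_unique (f : R -> R) (x a b : R) : is_derive x 1 f a -> is_derive x 1 f b -> a = b.
Proof. by move=> h1 h2; rewrite -(@derive_val _ _ _ _ _ _ _ h1) (@derive_val _ _ _ _ _ _ _ h2). Qed.

Lemma near_norm_lt1 (y : R) : `|y| < 1 -> \forall z \near y, `|z| < 1.
Proof.
move=> hy; have : open [set z : R | `|z| < 1].
  rewrite (_ : [set z : R | _] = ball 0 1); first exact: ball_open.
  by apply/seteqP; split => z; rewrite /ball/= sub0r normrN.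
by rewrite openE => /(_ y hy).
Qed.

(** Differentiates the closed form; the result is P times its logarithmic derivative, whose
    ingredients are generators of [good]. *)
Lemma poisson_isd (t y : R) : cosine t -> `|y| < 1 ->
  is_derive y 1 (ker (fun=> 1) t)
    (ker (fun=> 1) t y * ((- 2) * (y * (1 - y ^+ 2)^-1) + (- n%:R) * ((y - t) / Qf t y))).
Proof.
move=> ht hy; have ht1 := cosine_le1 n1 ht; have q0 := Qf_gt0 ht1 hy.
have yy : 1 - y ^+ 2 != 0.
  by rewrite gt_eqF// subr_gt0 -real_normK ?num_real// exprn_ilt1.
apply: (@near_eq_is_derive R R R (fun y : R => (1 - y ^+ 2) * Qf t y `^ (- (n%:R / 2)))).
  by near=> z; rewrite poisson//; near: z; exact: near_norm_lt1.
apply: (is_derive_eq (isdM (isdB (isd_cst 1 y) (isdX 2 (isd_id y)))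
  (isd_powR (- (n%:R / 2)) q0 (isd_Qf t y)))).
rewrite (poisson n1 ht hy).
have -> : Qf t y `^ (- (n%:R / 2)) = Qf t y * Qf t y `^ (- (n%:R / 2) - 1).
  rewrite -{2}[Qf t y]powRr1 ?(ltW q0)// -powRD ?(gt_eqF q0) ?implybT//.
  by congr (_ `^ _); ring.
move: (Qf t y `^ _) => P; have q1 : Qf t y != 0 by rewrite gt_eqF.
by rewrite /=; field; rewrite q1 yy.
Unshelve. all: by end_near. Qed.

Lemma ker_ext (a b : R^nat) (t y : R) : (forall k, a k = b k) -> ker a t y = ker b t y.
Proof. by move=> ab; congr ker; apply/funext. Qed.

(** Raising the index from a to a + 1 multiplies the k-th coefficient by 1 + k/a, that is, applies 1
    + (1/a) y d/dy to the kernel. On w P this operator acts through w' and the logarithmic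
    derivative of P, which stay in [good] and cost one order. *)
Lemma ker_pratio_good m : exists2 w, good m w & forall t y : R, cosine t -> `|y| < 1 ->
  ker (pratio (n%:R / 2 + m%:R) (n%:R / 2)) t y = w t y * ker (fun=> 1) t y.
Proof.
have n20 : (0 : R) < n%:R / 2 by rewrite divr_gt0 ?ltr0n.
elim: m => [|m [w gw IH]].
  exists (fun _ _ => 1); first exact: good_cst.
  by move=> t y _ _; rewrite mul1r; apply: ker_ext => k; rewrite addr0 pratio_id.
have [w' gw' dw] := good_deriv gw.
pose a : R := n%:R / 2 + m%:R.
have a0 : 0 < a by rewrite addr_nat_gt0.
exists (fun t y => w t y + a^-1 * (y * (w' t y + (- 2 * (y * ((1 - y ^+ 2)^-1 * w t y))
   + (- n%:R) * ((y - t) / Qf t y * w t y))))).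
  apply: good_D; first exact: good_up.
  apply: good_Z; apply: good_y; apply: good_D => //; apply: good_D.
    by apply: good_Z; apply: good_y; exact: good_A.
  by apply: good_Z; exact: good_B.
move=> t y ht hy.
have gr := pgrow_pratio a0 n20.
have gk := pgrow_ker n1 gr ht.
have E : ker (pratio (n%:R / 2 + m.+1%:R) (n%:R / 2)) t y =
    ker (pratio a (n%:R / 2)) t y +
    a^-1 * (y * psum (pseries_diffs (fun k => pratio a (n%:R / 2) k * d k * G t k)) y).
  rewrite -psum_nat// -psumZ//; last by apply: pgrowM => //; exact: pgrow_nat.
  rewrite -psumD//; last by apply: pgrowM; [exact: pgrow_cst|apply: pgrowM => //; exact: pgrow_nat].
  congr psum; apply/funext => k.
  have -> : n%:R / 2 + m.+1%:R = a + 1 by rewrite /a -[m.+1%:R]natr1 addrA.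
  rewrite -(@pratio_trans _ (a + 1) a)// pratio_succ//.
  by field; rewrite gt_eqF.
have d1 := psum_isd gk hy.
have d2 : is_derive y 1 (ker (pratio a (n%:R / 2)) t)
   (w t y * (ker (fun=> 1) t y * ((- 2) * (y * (1 - y ^+ 2)^-1) + (- n%:R) * ((y - t) / Qf t y)))
    + w' t y * ker (fun=> 1) t y).
  apply: (@near_eq_is_derive R R R (fun y : R => w t y * ker (fun=> 1) t y)).
    by near=> z; rewrite IH//; near: z; exact: near_norm_lt1.
  exact: isdM (dw t y ht hy) (poisson_isd ht hy).
by rewrite E (isd_unique d1 d2) IH//; ring.
Unshelve. all: by end_near. Qed.

Lemma poisson_gt0 (t y : R) : cosine t -> `|y| < 1 -> 0 < ker (fun=> 1) t y.
Proof.
move=> ht hy; rewrite poisson// mulr_gt0//.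
  by rewrite subr_gt0 -real_normK ?num_real// exprn_ilt1.
by rewrite powR_gt0// Qf_gt0//; exact: cosine_le1 ht.
Qed.

(** From 1 - y^2 <= 2 (1-y) and Q >= (1-y)^2. *)
Lemma poisson_le (t y : R) : cosine t -> 0 <= y < 1 ->
  ker (fun=> 1) t y <= 2 * (1 - y) `^ (- (n%:R - 1)).
Proof.
move=> ht /andP[y0 y1]; have ny : `|y| < 1 by rewrite ger0_norm.
have p1 : 0 < 1 - y by lra.
rewrite poisson//.
have -> : (1 - y) `^ (- (n%:R - 1)) = (1 - y) * ((1 - y) ^+ 2) `^ (- (n%:R / 2)).
  rewrite -powR_mulrn ?(ltW p1)// -powRrM -{2}[1 - y]powRr1 ?(ltW p1)// -powRD ?(gt_eqF p1) ?implybT//.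
  by congr (_ `^ _); field.
rewrite mulrA ler_pM ?powR_ge0//.
- by rewrite subr_ge0 exprn_ile1// ltW.
- have : y ^+ 2 <= 1 by rewrite exprn_ile1// ltW.
  have := sqr_ge0 (1 - y); rewrite sqrrB; lra.
- apply: ler_powRN; first by rewrite divr_ge0.
    by rewrite exprn_gt0.
  by apply: Qf_ge => //; exact: cosine_le1 ht.
Qed.

(* The kernel as a function of the scalar product [l] and the squared product [N] of the norms. *)
Definition kerLN (a : R^nat) (l N : R) : R := limn (series (fun k => a k * (d k * @gegenR R n l N k))).

Lemma kerLN_series a (t y : R) :
  series (fun k => a k * (d k * @gegenR R n (y * t) (y ^+ 2) k)) = pseries (fun k => a k * d k * G t k) y.
Proof.
rewrite /pseries; congr series; apply/funext => k.
by have := @gegenR_homog R n y t 1 k; rewrite mulr1 => ->; rewrite -[RHS]/(a k * d k * G t k * y ^+ k); ring.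
Qed.

Lemma kerLN_ker a (t y : R) : kerLN a (y * t) (y ^+ 2) = ker a t y.
Proof. by rewrite /kerLN kerLN_series. Qed.

Lemma measurable_gegenR d0 (T : measurableType d0) (D : set T) (l N : T -> R) k :
  measurable_fun D l -> measurable_fun D N -> measurable_fun D (fun x => @gegenR R n (l x) (N x) k).
Proof.
move=> ml mN; elim/nat_ind2: k => [||k IH1 IH2]; [exact: measurable_cst|exact: ml|].
under eq_fun do rewrite gegenR_SS.
apply: measurable_funB; apply: measurable_funM; first exact: measurable_cst.
- exact: measurable_funM.
- exact: measurable_cst.
- exact: measurable_funM.
Qed.

(** The partial sums are polynomials in l and N, hence measurable without reference to the angle,
    which has no meaning at the origin; t and y only justify convergence at each point. *)
Lemma measurable_kerLN d0 (T : measurableType d0) (D : set T) (l N : T -> R) a : pgrow a ->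
  measurable_fun D l -> measurable_fun D N ->
  (forall x, D x -> exists t y : R, [/\ cosine t, `|y| < 1, l x = y * t & N x = y ^+ 2]) ->
  measurable_fun D (fun x => kerLN a (l x) (N x)).
Proof.
move=> ga ml mN H.
apply: (measurable_realfun.measurable_fun_cvg (h := fun m x => series (fun k => a k * (d k * @gegenR R n (l x) (N x) k)) m)).
  move=> m; apply: measurable_sum => k; do 2! (apply: measurable_funM; first exact: measurable_cst).
  exact: measurable_gegenR.
move=> x /H[t [y [ht hy -> ->]]]; rewrite kerLN_ker kerLN_series.
by apply: psum_cvg => //; exact: pgrow_ker.
Qed.

End Good.

(** * Spherical means of the kernels *)

Section SphereKernels.
Context {R : realType} {n : nat}.
Hypothesis n1 : (1 < n)%N.
Let n0 : (0 < n)%N. Proof. exact: ltnW. Qed.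
Local Notation d := (@dimH R n).
Local Notation G t k := (@gegenR R n t 1 k).
Local Notation cosine := (@cosine R n).
Local Notation ker := (@zker R n).
Local Notation sg := (@sigma R n).
Local Notation mu := (@lebesgue_measure R).
Local Notation I01 := (`]0%R, 1%R[%classic : set R).
Local Notation mS := (@measurable_usphere R n).

Let sgF : {finite_measure set (Rn R n) -> \bar R} := @sigma R n.

Lemma measurable_rdot (e : Rn R n) : measurable_fun setT (fun z : Rn R n => rdot z e).
Proof.
apply: measurable_sum => i; apply: measurable_funM; last exact: measurable_cst.
exact: measurable_tnth.
Qed.

Lemma measurable_rdot2 : measurable_fun setT (fun p : Rn R n * Rn R n => rdot p.1 p.2).
Proof.
apply: measurable_sum => i; apply: measurable_funM.
- apply: (measurableT_comp (f := fun z : Rn R n => tnth z i : measurableTypeR R)); last exact: measurable_fst.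
  exact: measurable_tnth.
- apply: (measurableT_comp (f := fun z : Rn R n => tnth z i : measurableTypeR R)); last exact: measurable_snd.
  exact: measurable_tnth.
Qed.

Lemma cosine_sphere (x y : Rn R n) : usphere x -> usphere y -> cosine (rdot x y).
Proof. by move=> x1 y1; exists x, y. Qed.

Lemma measurable_ker_sphere (a : R^nat) (e : Rn R n) (y : R) : pgrow a -> usphere e -> `|y| < 1 ->
  measurable_fun usphere (fun z => ker a (rdot z e) y).
Proof.
move=> ga e1 hy; under eq_fun do rewrite -kerLN_ker.
apply: (measurable_kerLN n1 ga).
- by apply: measurable_funM => //; apply: (measurable_funS measurableT) => //; exact: measurable_rdot.
- exact: measurable_cst.
- by move=> x x1; exists (rdot x e), y; split=> //; exact: cosine_sphere.
Qed.

Let prod_sum_scale (A : comAlgType R) (u v : nat -> A) (c f : nat -> R) N :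
  (\sum_(k < N) c k *: u k) * (\sum_(l < N) f l *: v l) =
  \sum_(k < N) \sum_(l < N) (c k * f l) *: (u k * v l).
Proof.
rewrite mulr_suml; apply: eq_bigr => k _; rewrite mulr_sumr; apply: eq_bigr => l _.
by rewrite -scalerAl -scalerAr scalerA.
Qed.

Let Lint_sum2 N (F : 'I_N -> mpoly n R) : Lint (\sum_(k < N) F k) = \sum_(k < N) Lint (F k).
Proof. by elim/big_ind2: _ => [|p a q b <- <-|//]; [exact: Lint0|rewrite (LintD n1)]. Qed.

Let Lint_Gp_neq (x y : Rn R n) k l : usphere x -> usphere y -> k != l -> Lint (Gp x k * Gp y l) = 0.
Proof.
move=> x1 y1; rewrite neq_ltn => /orP[kl|lk].
  rewrite (mulrC (Gp x k) (Gp y l)); exact: (Lint_Gp_lt n1 x1 (harmonic_Gp n1 y1 l) kl).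
exact: (Lint_Gp_lt n1 y1 (harmonic_Gp n1 x1 k) lk).
Qed.

Let Sp (a : R^nat) (r : R) (x : Rn R n) (N : nat) : mpoly n R := \sum_(k < N) (a k * d k * r ^+ k) *: Gp x k.

Let pev_Sp a r x N (z : Rn R n) : usphere z ->
  pev (Sp a r x N) z = pseries (fun k => a k * d k * G (rdot z x) k) r N.
Proof.
move=> z1; rewrite /pseries /series /= big_mkord /Sp /pev raddf_sum; apply: eq_bigr => k _ /=.
by rewrite mevalZ -/(pev (Gp x k) z) -gegenR_sphere// mulrAC.
Qed.

Let pev_Sp2 a b r s x y N (z : Rn R n) : usphere z -> pev (Sp a r x N * Sp b s y N) z =
  pseries (fun k => a k * d k * G (rdot z x) k) r N * pseries (fun k => b k * d k * G (rdot z y) k) s N.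
Proof.
move=> z1; apply: (etrans (pevM (Sp a r x N) (Sp b s y N) z)).
exact: (f_equal2 *%R (pev_Sp a r x N z1) (pev_Sp b s y N z1)).
Qed.

Let Lint_Sp a b r s x y N : usphere x -> usphere y -> Lint (Sp a r x N * Sp b s y N) =
  pseries (fun k => a k * b k * d k * G (rdot x y) k) (r * s) N.
Proof.
move=> x1 y1; rewrite /Sp (prod_sum_scale (Gp x) (Gp y) (fun k => a k * d k * r ^+ k) (fun k => b k * d k * s ^+ k) N) Lint_sum2 /pseries /series /= big_mkord.
apply: eq_bigr => k _; rewrite Lint_sum2 (bigD1 k)//= big1 ?addr0.
  by rewrite (LintZ n1) -Lint_Gp_Gp// exprMn; ring.
by move=> l lk; rewrite (LintZ n1) Lint_Gp_neq ?mulr0// eq_sym.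
Qed.

(** For truncated series the product is a polynomial, and orthogonality leaves the diagonal terms.
    The majorants [Ma] and [Mb], finite since |r| and |s| are below 1, give dominated
    convergence. *)
Lemma sphere_conv a b x y (r s : R) : pgrow a -> pgrow b -> usphere x -> usphere y ->
  `|r| < 1 -> `|s| < 1 ->
  (\int[sg]_(z in usphere) (ker a (rdot z x) r * ker b (rdot z y) s)%:E =
   (ker (fun k => a k * b k) (rdot x y) (r * s))%:E)%E.
Proof.
move=> ga gb x1 y1 hr hs.
pose Ma := psum (fun k => `|a k| * d k) `|r|; pose Mb := psum (fun k => `|b k| * d k) `|s|.
have gabs (c : R^nat) : pgrow c -> pgrow (fun k => `|c k| * d k).
  move=> gc; apply: pgrowM; last exact: pgrow_dimH.
  by apply: (pgrow_le gc) => k; rewrite normr_id.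
have bnd (c : R^nat) t k : cosine t -> `|c k * d k * G t k| <= `|c k| * d k.
  move=> ht; rewrite !normrM (ger0_norm (ltW (dimH_gt0 n1 k))) ler_piMr ?gegenR_le1//.
  by rewrite mulr_ge0// ltW// dimH_gt0.
have rs : `|r * s| < 1 by rewrite normrM mulr_ilt1.
pose f_ N (z : Rn R n) := (pev (Sp a r x N * Sp b s y N) z)%:E.
have L1 : (fun N => \int[sg]_(z in usphere) f_ N z)%E @ \oo -->
    (\int[sg]_(z in usphere) (ker a (rdot z x) r * ker b (rdot z y) s)%:E)%E.
  have H1 N : measurable_fun usphere (f_ N).
    by case/integrableP: (pev_integrableS n1 (Sp a r x N * Sp b s y N)).
  have H2 z : usphere z -> f_ ^~ z @ \oo --> (ker a (rdot z x) r * ker b (rdot z y) s)%:E.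
    move=> z1.
    have E N : f_ N z = (pseries (fun k => a k * d k * G (rdot z x) k) r N *
        pseries (fun k => b k * d k * G (rdot z y) k) s N)%:E.
      by congr EFin; exact: pev_Sp2.
    rewrite (_ : (fun N => f_ N z) = EFin \o (fun N => pseries (fun k => a k * d k * G (rdot z x) k) r N *
        pseries (fun k => b k * d k * G (rdot z y) k) s N)); last by apply/funext => N; exact: E.
    apply: cvg_EFin; first by apply: nearW.
    by apply: cvgM; apply: psum_cvg => //; apply: (pgrow_ker n1) => //; exact: cosine_sphere.
  have H3 N z : usphere z -> (`|f_ N z| <= (Ma * Mb)%:E)%E.
    move=> z1; rewrite [f_ N z](_ : _ = (pseries (fun k => a k * d k * G (rdot z x) k) r N *
        pseries (fun k => b k * d k * G (rdot z y) k) s N)%:E); last by congr EFin; exact: pev_Sp2.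
    rewrite abse_EFin lee_fin normrM ler_pM ?normr_ge0//.
    + apply: pseries_norm_le => //; first exact: gabs.
      by move=> k; apply: bnd; exact: cosine_sphere.
    + apply: pseries_norm_le => //; first exact: gabs.
      by move=> k; apply: bnd; exact: cosine_sphere.
  have H4 : sg.-integrable usphere (fun=> (Ma * Mb)%:E) by exact: (@finite_measure_integrable_cst _ _ _ sgF usphere (Ma * Mb) mS).
  have L := @dominated_cvg _ _ _ sg usphere mS f_ _ (fun=> (Ma * Mb)%:E) H1 H2 (fun _ _ => isT) H4 H3.
  exact: L.
have L2 : (fun N => \int[sg]_(z in usphere) f_ N z)%E @ \oo -->
    (ker (fun k => a k * b k) (rdot x y) (r * s))%:E.
  rewrite (_ : (fun N => _) = EFin \o pseries (fun k => a k * b k * d k * G (rdot x y) k) (r * s)); last first.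
    apply/funext => N; rewrite -[RHS]/((pseries (fun k => a k * b k * d k * G (rdot x y) k) (r * s) N)%:E).
    rewrite -(Lint_Sp a b r s N x1 y1); symmetry; apply: fineK.
    exact: (integrable_fin_num mS (pev_integrableS n1 (Sp a r x N * Sp b s y N))).
  apply: cvg_EFin; first by apply: nearW.
  apply: psum_cvg => //; apply: (pgrow_ker n1); first exact: pgrowM.
  exact: cosine_sphere.
exact: (cvg_unique _ L1 L2).
Qed.

Lemma ker_delta (t y : R) : cosine t -> `|y| < 1 -> ker (fun k => (k == 0%N)%:R) t y = 1.
Proof.
move=> ht hy; have gd : pgrow (fun k : nat => (k == 0%N)%:R : R) by apply: pgrow_unS; exact: pgrow_cst.
rewrite /zker psum_rec//; last exact: pgrow_ker.
rewrite dimH0 (_ : (fun k => _) = fun=> 0) ?psum0 ?mulr0 ?addr0 ?mul1r//.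
by apply/funext => k; rewrite /= !mul0r.
Qed.

(** [sphere_conv] against the kernel of the Kronecker sequence, which is identically 1. *)
Lemma sphere_ker a x (r : R) : pgrow a -> usphere x -> `|r| < 1 ->
  (\int[sg]_(z in usphere) (ker a (rdot z x) r)%:E = (a 0%N)%:E)%E.
Proof.
move=> ga x1 hr.
have gd : pgrow (fun k : nat => (k == 0%N)%:R : R) by apply: pgrow_unS; exact: pgrow_cst.
have z1 : `|0 : R| < 1 by rewrite normr0.
have := sphere_conv ga gd x1 x1 hr z1.
under eq_integral => z /set_mem z1' do rewrite (ker_delta (cosine_sphere z1' x1) z1) mulr1.
move=> ->; congr EFin; rewrite mulr0 /zker psum_rec ?mul0r ?addr0 ?dimH0//=.
  by rewrite !mulr1.
by apply: (pgrow_ker n1); [exact: pgrowM|exact: cosine_sphere].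
Qed.

(** The exponent e measures the L^q norm over spheres; the factor q appears because the q-th power
    is integrated and no root is taken. *)
Definition mean_bound (q : R) (a : R^nat) (e : R) := exists2 C : R, 0 <= C & forall (eta : Rn R n) (y : R),
  usphere eta -> 0 <= y < 1 ->
  (\int[sg]_(z in usphere) (`|ker a (rdot z eta) y| `^ q)%:E <= (C * (1 - y) `^ (- (e * q)))%:E)%E.

Lemma mean_bound_le q a e e' : 0 <= q -> e <= e' -> mean_bound q a e -> mean_bound q a e'.
Proof.
move=> q0 ee [C C0 H]; exists C => // eta y eta1 hy; apply: (le_trans (H eta y eta1 hy)).
case/andP: hy => y0 y1; rewrite lee_fin ler_wpM2l// ger_powR ?lerN2 ?ler_wpM2r//.
by rewrite subr_gt0 y1/= gerBl.
Qed.

Lemma mean_bound_ext q a b e : (forall k, a k = b k) -> mean_bound q a e -> mean_bound q b e.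
Proof. by move=> ab; have -> : a = b by apply/funext. Qed.

Lemma exprV_powR (L : R) m : 0 < L -> L^-1 ^+ m = L `^ (- m%:R).
Proof.
move=> L0; rewrite -powR_inv1 ?(ltW L0)// -powR_mulrn ?powR_ge0// -powRrM.
by congr powR; ring.
Qed.

Lemma measurable_norm_powR d0 (T : measurableType d0) (D : set T) (f : T -> R) q :
  measurable_fun D f -> measurable_fun D (fun x => `|f x| `^ q).
Proof.
move=> mf; apply: (measurableT_comp (f := fun r : R => r `^ q)); first exact: measurable_powR.
exact: (measurableT_comp (f := @Num.norm R R)).
Qed.

(** In P^q = P^(q-1) P the first factor is bounded by the maximum of the Poisson kernel and the
    second has mean 1. The total exponent is m q + (n-1)(q-1). *)
Lemma mean_bound_base q m : 1 <= q ->
  mean_bound q (pratio (n%:R / 2 + m%:R) (n%:R / 2)) (m%:R + (n%:R - 1) * (1 - q^-1)).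
Proof.
move=> q1; have q0 : 0 < q by rewrite (lt_le_trans _ q1).
have n20 : (0 : R) < n%:R / 2 by rewrite divr_gt0 ?ltr0n.
have gr := @pgrow_pratio R _ _ (addr_nat_gt0 m n20) n20.
have [w gw Hw] := @ker_pratio_good R n n1 m; have [C C0 HC] := good_bound n1 gw.
set e := m%:R + _.
exists (C `^ q * 2 `^ (q - 1)); first by rewrite mulr_ge0 ?powR_ge0.
move=> eta y eta1 hy; have [y0 y1] := andP hy.
have ny : `|y| < 1 by rewrite ger0_norm.
have L0 : 0 < 1 - y by rewrite subr_gt0.
have gone := @pgrow_cst R 1.
set K := C `^ q * _ * _.
have K0 : 0 <= K by rewrite !mulr_ge0 ?powR_ge0.
have -> : (K%:E = K%:E * \int[sg]_(z in usphere) (ker (fun=> 1) (rdot z eta) y)%:E)%E.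
  by rewrite sphere_ker// mule1.
rewrite -(integralZlR sg mS)//; last 2 first.
- exact: measurable_ker_sphere.
- by move=> z z1; rewrite ltW// poisson_gt0//; exact: cosine_sphere.
apply: le_integralR => //.
- exact: mS.
- by apply: measurable_norm_powR; exact: measurable_ker_sphere.
- by apply: measurable_funM => //; exact: measurable_ker_sphere.
move=> z z1; have ht := cosine_sphere z1 eta1; set t := rdot z eta in ht *.
have P0 := poisson_gt0 n1 ht ny; have P1 := poisson_le n1 ht hy.
rewrite Hw// normrM (gtr0_norm P0).
set P := ker (fun=> 1) t y in P0 P1 *.
apply: (@le_trans _ _ ((C * (1 - y)^-1 ^+ m * P) `^ q)).
  by rewrite ge0_ler_powR ?nnegrE ?(ltW q0) ?mulr_ge0 ?(ltW P0) ?exprn_ge0 ?invr_ge0 ?(ltW L0)// ler_wpM2r ?(ltW P0)// HC.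
rewrite exprV_powR// !powRM ?mulr_ge0 ?powR_ge0 ?(ltW P0)// -powRrM.
have -> : P `^ q = P `^ (q - 1) * P.
  by rewrite -{3}[P]powRr1 ?(ltW P0)// -powRD ?(gt_eqF P0) ?implybT// subrK.
rewrite mulrA ler_wpM2r ?(ltW P0)//.
apply: (@le_trans _ _ (C `^ q * (1 - y) `^ (- m%:R * q) * (2 * (1 - y) `^ (- (n%:R - 1))) `^ (q - 1))).
  rewrite ler_wpM2l ?mulr_ge0 ?powR_ge0// ge0_ler_powR ?nnegrE ?subr_ge0 ?(ltW P0)//.
  by rewrite mulr_ge0 ?powR_ge0.
rewrite powRM ?powR_ge0// -powRrM /K -!mulrA ler_wpM2l ?powR_ge0// mulrCA ler_wpM2l ?powR_ge0//.
rewrite -powRD ?(gt_eqF L0) ?implybT// le_eqVlt; apply/orP; left; apply/eqP; congr powR.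
by rewrite /e; field; rewrite gt_eqF.
Qed.

Lemma le_poweR (x y : \bar R) (r : R) : 0 <= r -> (0 <= x)%E -> (x <= y)%E -> (x `^ r <= y `^ r)%E.
Proof.
move=> r0 x0 xy; apply: gt0_ler_poweR => //; rewrite in_itv/= leey andbT//.
exact: le_trans xy.
Qed.

Lemma measurable_ker_radial (a : R^nat) (t y : R) : pgrow a -> cosine t -> 0 <= y < 1 ->
  measurable_fun I01 (fun s => ker a t (y * s)).
Proof.
move=> ga ht /andP[y0 y1].
rewrite (_ : (fun s => _) = (fun s : R => @kerLN R n a ((y * s) * t) ((y * s) ^+ 2))); last first.
  by apply/funext => s; rewrite kerLN_ker.
apply: (measurable_kerLN n1 ga).
- by apply: measurable_funM => //; exact: measurable_funM.
- by apply: (measurableT_comp (f := fun r : R => r ^+ 2)) => //; exact: measurable_funM.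
move=> s /in01 /andP[s0 s1]; exists t, (y * s); split=> //.
by rewrite normrM (ger0_norm y0) (gtr0_norm s0) mulr_ilt1// ltW.
Qed.

(** As the moments of [w] are m_k, averaging the kernel of a over the radii y s inserts m_k into its
    series. The right side is not known to be finite, so partial sums are compared with it up to the
    uniform tail [eps N], which tends to 0. *)
Lemma ker_moment_le (a m : R^nat) (w : R -> R) (t y : R) : pgrow a -> pgrow m -> m 0%N = 1 ->
  measurable_fun setT w -> (forall s, 0 <= w s) ->
  (forall k, \int[mu]_(s in I01) (s ^+ k * w s)%:E = (m k)%:E)%E ->
  cosine t -> 0 <= y < 1 ->
  ((`|ker (fun k => a k * m k)%R t y|)%:E <= \int[mu]_(s in I01) (`|ker a t (y * s)%R| * w s)%:E)%E.
Proof.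
move=> ga gm m0 mw w0 wm ht hy; have [y0 y1] := andP hy.
have ny : `|y| < 1 by rewrite ger0_norm.
pose c k := a k * d k * G t k; pose b k := `|a k| * d k.
have gc : pgrow c by exact: pgrow_ker.
have gb : pgrow b.
  apply: pgrowM; last exact: pgrow_dimH.
  by apply: (pgrow_le ga) => k; rewrite normr_id.
have cb k : `|c k| <= b k.
  rewrite /c /b !normrM (ger0_norm (ltW (dimH_gt0 n1 k))) ler_piMr ?gegenR_le1//.
  by rewrite mulr_ge0// ltW// dimH_gt0.
have mI : measurable I01 by [].
have mw' : measurable_fun I01 w by exact: (measurable_funS measurableT).
have mX k : measurable_fun I01 (fun s : R => s ^+ k).
  by apply: (measurable_funS measurableT) => //; exact: measurable_funX.
have isw k : mu.-integrable I01 (EFin \o (fun s : R => s ^+ k * w s)).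
  apply/integrableP; split; first by apply/measurable_EFinP; exact: measurable_funM.
  under eq_integral => s /set_mem /in01 /andP[s0 _] do
    rewrite /= ger0_norm ?mulr_ge0 ?exprn_ge0 ?(ltW s0)//.
  by rewrite wm ltry.
have step N : mu.-integrable I01 (EFin \o (fun s => pseries c (y * s) N * w s)) /\
    (\int[mu]_(s in I01) (pseries c (y * s) N * w s)%:E = (pseries (fun k => a k * m k * d k * G t k) y N)%:E)%E.
  elim: N => [|N [iN eN]].
    rewrite (_ : (fun s => _) = fun=> 0); last first.
      by apply/funext => s; rewrite /pseries /series /= big_geq// mul0r.
    split; first exact: integrable0.
    rewrite [RHS](_ : _ = 0%E); last by rewrite /pseries /series /= big_geq.
    under eq_integral do rewrite /pseries /series /= big_geq// mul0r.
    exact: integral0.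
  have E s : pseries c (y * s) N.+1 * w s = pseries c (y * s) N * w s + (c N * y ^+ N) * (s ^+ N * w s).
    by rewrite /pseries /series /= big_nat_recr//= exprMn; ring.
  have iZ : mu.-integrable I01 (EFin \o (fun s => (c N * y ^+ N) * (s ^+ N * w s))).
    rewrite (_ : _ \o _ = (fun s : R => ((c N * y ^+ N)%:E * (s ^+ N * w s)%:E)%E)).
      by apply: integrableZl => //; exact: isw.
    by apply/funext => s; rewrite /= EFinM.
  split.
    rewrite (_ : _ \o _ = (EFin \o (fun s => pseries c (y * s) N * w s)) \+
       (EFin \o (fun s => (c N * y ^+ N) * (s ^+ N * w s)))); first exact: integrableD.
    by apply/funext => s; rewrite /= E EFinD.
  under eq_integral do rewrite E EFinD.
  rewrite integralD; [|exact: mI|exact: iN|exact: iZ]; rewrite eN.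
  rewrite (_ : (\int[mu]_(x in I01) _)%E = ((c N * y ^+ N) * m N)%:E); last first.
    under eq_integral do rewrite EFinM.
    by rewrite integralZl; [rewrite wm -EFinM|exact: mI|exact: isw].
  rewrite -EFinD; congr EFin; rewrite /pseries /series /= big_nat_recr//=; congr (_ + _).
  by rewrite /c; ring.
set X := (\int[mu]_(s in _) _)%E.
have mk : measurable_fun I01 (fun s => `|ker a t (y * s)|).
  by apply: (measurableT_comp (f := @Num.norm R R)) => //; exact: measurable_ker_radial.
pose eps N := psum b y - pseries b y N.
have key N : ((`|pseries (fun k => a k * m k * d k * G t k) y N|)%R%:E <= X + (eps N)%:E)%E.
  have [iN eN] := step N; rewrite -abse_EFin -eN.
  have eps0 : 0 <= eps N by rewrite (le_trans _ (psum_tail N gb cb (_ : `|y| <= y) y1))// ger0_norm.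
  have -> : ((eps N)%:E = \int[mu]_(s in I01) (eps N * w s)%:E)%E.
    rewrite integralZlR//.
    have -> : (\int[mu]_(s in I01) (w s)%:E = 1)%E.
      transitivity ((m 0%N)%:E); last by rewrite m0.
      by rewrite -(wm 0%N); apply: eq_integral => s _; rewrite expr0 mul1r.
    by rewrite mule1.
  rewrite /X -integralDR//; last 4 first.
  - exact: measurable_funM.
  - by move=> s _; rewrite mulr_ge0.
  - exact: measurable_funM.
  - by move=> s _; rewrite mulr_ge0.
  apply: (le_trans (le_abse_integral mu mI _)).
    by case/integrableP: iN.
  apply: ge0_le_integral => //.
  - by apply: measurableT_comp => //; case/integrableP: iN.
  - by apply/measurable_EFinP; apply: measurable_funD; exact: measurable_funM.
  move=> s /in01 /andP[s0 s1]; rewrite abse_EFin lee_fin normrM (ger0_norm (w0 s)) -mulrDl ler_wpM2r//.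
  have ys : `|y * s| <= y by rewrite normrM (ger0_norm y0) (gtr0_norm s0) ler_piMr// ltW.
  have := psum_tail N gb cb ys y1; rewrite -/(eps N) => h.
  rewrite -[pseries _ _ _](subrK (ker a t (y * s))) (le_trans (ler_normD _ _))// addrC lerD2l.
  by rewrite distrC.
have X0 : (0 <= X)%E by apply: integral_ge0 => s _; rewrite lee_fin mulr_ge0.
have gam : pgrow (fun k => a k * m k) by exact: pgrowM.
move: X X0 key => [x| |] // _ key; last by rewrite leey.
rewrite lee_fin.
have c1 : (fun N => `|pseries (fun k => a k * m k * d k * G t k) y N|) @ \oo -->
    `|ker (fun k => a k * m k) t y|.
  by apply: cvg_norm; apply: psum_cvg => //; exact: (pgrow_ker n1 gam ht).
have c2 : (fun N => x + eps N) @ \oo --> x + (psum b y - psum b y).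
  by apply: cvgD; [exact: cvg_cst|apply: cvgB; [exact: cvg_cst|exact: psum_cvg]].
rewrite subrr addr0 in c2.
by apply: (ler_cvg_to c1 c2); apply: nearW => N; have := key N; rewrite -EFinD lee_fin.
Qed.

(** Jensen is applied to the measure h ds with h = (1-sy)^(-e) w, and to the function |ker|
    (1-sy)^e: the mass of h is O((1-y)^(-(e-dd))) by the Beta weight, while the q-th means of that
    function are bounded uniformly in s. Jensen for w ds itself would improve the exponent by dd
    only, instead of dd q. *)
Lemma mean_bound_frac q a e aa dd : 1 <= q -> pgrow a -> 0 < aa -> 0 < dd -> dd < e ->
  mean_bound q a e -> mean_bound q (fun k => a k * pratio aa (aa + dd) k) (e - dd).
Proof.
move=> q1 ga aa0 dd0 dde [C C0 HC].
have q0 : 0 < q by rewrite (lt_le_trans _ q1).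
have [w [mw w0 wm wu _]] := beta_weight aa0 dd0.
have [C' [C'0 HC']] := wu e dde.
exists (C * C' `^ q); first by rewrite mulr_ge0 ?powR_ge0.
move=> eta y eta1 hy; have [y0 y1] := andP hy.
have L0 : 0 < 1 - y by rewrite subr_gt0.
have mw' : measurable_fun I01 w by exact: (measurable_funS measurableT).
have gp : pgrow (pratio aa (aa + dd)) by apply: pgrow_pratio => //; exact: addr_gt0.
pose h s := (1 - s * y) `^ (- e) * w s.
have mh : measurable_fun I01 h by apply: measurable_funM => //; exact: measurable_powR_1B.
have h0 s : 0 <= h s by rewrite mulr_ge0 ?powR_ge0.
pose B := C' * (1 - y) `^ (- (e - dd)).
have B0 : 0 <= B by rewrite mulr_ge0 ?powR_ge0 ?(ltW C'0).
have hB : (\int[mu]_(s in I01) (h s)%:E <= B%:E)%E by exact: HC'.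
pose v s := (1 - s * y) `^ (e * q) * h s.
have v0 s : 0 <= v s by rewrite mulr_ge0 ?powR_ge0.
have mv : measurable_fun I01 v by apply: measurable_funM => //; exact: measurable_powR_1B.
pose F (p : Rn R n * R) := (`|ker a (rdot p.1 eta) (y * p.2)| `^ q * v p.2)%:E.
have mI : measurable I01 by [].
have mF : measurable_fun (usphere `*` I01) F.
  apply/measurable_EFinP; apply: measurable_funM; last first.
    apply: (measurable_comp (F := I01) mI _ mv); last first.
      by apply: (measurable_funS measurableT) => //; exact: measurable_snd.
    by move=> _ [[z s] [/= _ hs] <-].
  apply: measurable_norm_powR.
  rewrite (_ : (fun p => _) = (fun p : Rn R n * R =>
    @kerLN R n a ((y * p.2) * rdot p.1 eta) ((y * p.2) ^+ 2))); last first.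
    by apply/funext => p; rewrite kerLN_ker.
  have m1 : measurable_fun (usphere `*` I01) (fun p : Rn R n * R => rdot p.1 eta).
    apply: (measurable_funS measurableT) => //.
    exact: (measurableT_comp (f := fun z => rdot z eta) (measurable_rdot eta) measurable_fst).
  have m2 : measurable_fun (usphere `*` I01) (fun p : Rn R n * R => y * p.2).
    by apply: measurable_funM => //; apply: (measurable_funS measurableT) => //; exact: measurable_snd.
  apply: (measurable_kerLN n1 ga).
  - exact: measurable_funM.
  - by apply: (measurableT_comp (f := fun r : R => r ^+ 2)).
  - move=> [z s] [/= z1 /in01 /andP[s0 s1]]; exists (rdot z eta), (y * s); split=> //.
      exact: cosine_sphere.
    by rewrite normrM (ger0_norm y0) (gtr0_norm s0) mulr_ilt1// ltW.
have F0 p : (0 <= F p)%E by rewrite lee_fin mulr_ge0 ?powR_ge0.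
have pt z : usphere z -> ((`|ker (fun k => a k * pratio aa (aa + dd) k)%R (rdot z eta) y| `^ q)%:E <=
    (B `^ (q - 1))%:E * \int[mu]_(s in I01) F (z, s))%E.
  move=> z1; have ht := cosine_sphere z1 eta1; set t := rdot z eta in ht *.
  have mk := measurable_ker_radial ga ht hy.
  have mg : measurable_fun I01 (fun s => `|ker a t (y * s)| * (1 - s * y) `^ e).
    apply: measurable_funM; last exact: measurable_powR_1B.
    exact: (measurableT_comp (f := @Num.norm R R)).
  have g0 s : 0 <= `|ker a t (y * s)| * (1 - s * y) `^ e by rewrite mulr_ge0 ?powR_ge0.
  have J := jensen_hoelder mu q1 mI mg mh (fun s _ => g0 s) (fun s _ => h0 s).
  have sy s : I01 s -> 0 < 1 - s * y by move=> /in01 hs; have [[+ _] _] := rho_bounds hs hy.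
  rewrite -poweR_EFin; apply: (@le_trans _ _ _ _ _ (le_trans _ J)).
    apply: le_poweR; rewrite ?(ltW q0)// ?lee_fin//.
    have := ker_moment_le ga gp (pratio0 _ _) mw w0 wm ht hy.
    move=> /le_trans; apply; rewrite le_eqVlt; apply/orP; left; apply/eqP.
    apply: eq_integral => s /set_mem hs; congr EFin; rewrite /h mulrA -[_ * _ * (_ `^ - e)]mulrA -powRD.
      by rewrite subrr powRr0 mulr1.
    by rewrite (gt_eqF (sy s hs)) implybT.
  have -> : (\int[mu]_(s in I01) F (z, s) =
     \int[mu]_(s in I01) ((`|ker a t (y * s)%R| * (1 - s * y) `^ e) `^ q * h s)%:E)%E.
    apply: eq_integral => s /set_mem hs; congr EFin; rewrite /v powRM ?powR_ge0//.
    by rewrite mulrA powRrM.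
  apply: lee_wpmul2r.
    by apply: integral_ge0 => s _; rewrite lee_fin mulr_ge0 ?powR_ge0.
  rewrite -poweR_EFin; apply: le_poweR => //; first by rewrite subr_ge0.
  by apply: integral_ge0 => s _; rewrite lee_fin.
have mT := @measurable_tonelli_on _ _ _ _ _ mu usphere I01 F mS mI mF (fun p _ => F0 p).
apply: (@le_trans _ _ (\int[sg]_(z in usphere) ((B `^ (q - 1))%:E * \int[mu]_(s in I01) F (z, s)))%E).
  apply: ge0_le_integral => //.
  - exact: mS.
  - apply/measurable_EFinP; apply: measurable_norm_powR; apply: measurable_ker_sphere => //.
      exact: pgrowM.
    by rewrite ger0_norm.
  - exact: measurable_funeM.
rewrite ge0_integralZl//; last 3 first.
- exact: mS.
- by move=> z _; exact: integral_ge0.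
- by rewrite lee_fin powR_ge0.
rewrite (@tonelli_on _ _ _ _ _ sgF mu usphere I01 F mS mI mF (fun p _ => F0 p)).
apply: (@le_trans _ _ ((B `^ (q - 1))%:E * (C * B)%:E)%E); last first.
  rewrite -EFinM lee_fin mulrCA -mulrA ler_wpM2l// le_eqVlt; apply/orP; left; apply/eqP.
  have B1 : 0 < B by rewrite mulr_gt0// powR_gt0.
  rewrite -[X in _ * X]powRr1// -powRD ?(gt_eqF B1) ?implybT// subrK /B powRM ?powR_ge0 ?(ltW C'0)//.
  by rewrite -powRrM mulNr.
apply: lee_wpmul2l; first by rewrite lee_fin powR_ge0.
apply: (@le_trans _ _ (\int[mu]_(s in I01) (C * h s)%:E)%E); last first.
  by rewrite integralZlR// EFinM lee_wpmul2l.
apply: ge0_le_integral => //.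
- by move=> s _; exact: integral_ge0.
- have mF' : measurable_fun (I01 `*` usphere) (fun p => F (p.2, p.1)).
    apply: (measurable_comp (F := usphere `*` I01) (f := F) _ _ mF).
    + by apply: measurableX => //; exact: mS.
    + by move=> _ [[s z] [/= hs hz] <-].
    + apply: (measurable_funS measurableT) => //.
      by apply/measurable_fun_pair; [exact: measurable_snd|exact: measurable_fst].
  exact: (@measurable_tonelli_on _ _ _ _ _ sgF I01 usphere (fun p => F (p.2, p.1)) mI mS mF' (fun p _ => F0 _)).
- by apply/measurable_EFinP; exact: measurable_funM.
move=> s hs; have /in01 /andP[s0 s1] := hs.
have ys : 0 <= y * s < 1 by rewrite mulr_ge0 ?(ltW s0)//= mulr_ilt1// ltW.
have ys1 : `|y * s| < 1 by case/andP: ys => ? ?; rewrite ger0_norm.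
have L1 : 0 < 1 - s * y by rewrite mulrC subr_gt0; case/andP: ys.
rewrite /F /=; under eq_integral do rewrite mulrC.
rewrite integralZlR//; last 2 first.
- exact: mS.
- by apply: measurable_norm_powR; exact: measurable_ker_sphere.
apply: (le_trans (lee_wpmul2l _ (HC eta (y * s) eta1 ys))); first by rewrite lee_fin.
rewrite -EFinM lee_fin /v mulrCA ler_wpM2l// mulrAC [y * s]mulrC -powRD.
  by rewrite addrN powRr0 mul1r.
by rewrite (gt_eqF L1) implybT.
Qed.

End SphereKernels.

(** * The Bergman-Besov kernel on the ball *)

Section GammaCoef.
Context {R : realType} {n : nat}.
Hypothesis n1 : (1 < n)%N.
Let n0 : (0 < n)%N. Proof. exact: ltnW. Qed.
Let nn : (2 : R) <= n%:R. Proof. by rewrite ler_nat. Qed.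
Local Notation d := (@dimH R n).
Local Notation gam := (@gamma_coef R n).
Local Notation mean_bound := (@mean_bound R n).

Lemma gamma_coefE1 c k : - (1 + n%:R / 2) < c -> gam c k = pratio (1 + n%:R / 2 + c) (n%:R / 2) k.
Proof. by have n2 := nn; move=> hc; rewrite /gamma_coef hc pratioE//; lra. Qed.

Lemma gamma_coefE2 c k : c <= - (1 + n%:R / 2) ->
  gam c k = pratio 1 (1 - (n%:R / 2 + c)) k * pratio 1 (n%:R / 2) k.
Proof.
have n2 := nn; move=> hc; rewrite /gamma_coef ltNge hc /= !pratioE//; try lra.
by rewrite (fact_pratio k) invfM expr2; ring.
Qed.

Lemma gamma_coef_gt0 c k : 0 < gam c k.
Proof.
have n2 := nn; have [hc|hc] := ltP (- (1 + n%:R / 2)) c.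
  by rewrite gamma_coefE1// pratio_gt0//; lra.
by rewrite gamma_coefE2// mulr_gt0// pratio_gt0//; lra.
Qed.

Lemma gamma_coef0 c : gam c 0%N = 1.
Proof.
have [hc|hc] := ltP (- (1 + n%:R / 2)) c; first by rewrite gamma_coefE1// pratio0.
by rewrite gamma_coefE2// !pratio0 mulr1.
Qed.

Lemma pgrow_gamma_coef c : pgrow (gam c).
Proof.
have n2 := nn; have [hc|hc] := ltP (- (1 + n%:R / 2)) c.
  rewrite (_ : gam c = pratio (1 + n%:R / 2 + c) (n%:R / 2)).
    by apply: pgrow_pratio; lra.
  by apply/funext => k; rewrite gamma_coefE1.
rewrite (_ : gam c = fun k => pratio 1 (1 - (n%:R / 2 + c)) k * pratio 1 (n%:R / 2) k).
  by apply: pgrowM; apply: pgrow_pratio; lra.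
by apply/funext => k; rewrite gamma_coefE2.
Qed.

(** Above the threshold the start is an integer order m > c + 1, lowered by m - 1 - c. Below it,
    gamma_k is a product of two quotients with numerator (1)_k, and the Poisson kernel is lowered
    twice, by n/2 - 1 and by -(n/2+c). Positivity of e keeps every step in the range of
    [mean_bound_frac]. *)
Lemma mean_bound_gamma c q e : 1 <= q -> 0 < e -> n%:R + c - (n%:R - 1) / q <= e ->
  mean_bound q (gam c) e.
Proof.
have n2 := nn; move=> q1 e0 he; have q0 : 0 < q by rewrite (lt_le_trans _ q1).
have [hc|hc] := ltP (- (1 + n%:R / 2)) c.
  pose m := (Num.truncn `|c + 1|).+1.
  have mc : 0 < m%:R - 1 - c.
    by have := truncnS_gt `|c + 1|; have := ler_norm (c + 1); rewrite -/m; lra.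
  have a0 : 0 < 1 + n%:R / 2 + c by lra.
  have m0 : 0 < n%:R / 2 + m%:R :> R by rewrite addr_nat_gt0//; lra.
  have B := mean_bound_base n1 m q1.
  have B' : mean_bound q (pratio (n%:R / 2 + m%:R) (n%:R / 2)) ((m%:R - 1 - c) + e).
    apply: (mean_bound_le _ _ B); first exact: ltW.
    by move: he; rewrite mulrBr mulr1; lra.
  have gr : pgrow (pratio (n%:R / 2 + m%:R) (n%:R / 2) : R^nat) by apply: pgrow_pratio => //; lra.
  have := mean_bound_frac n1 q1 gr a0 mc _ B'; rewrite [_ + e - _]addrAC subrr add0r ltrDl => /(_ e0).
  apply: mean_bound_ext => k; rewrite gamma_coefE1// mulrC.
  have -> : 1 + n%:R / 2 + c + (m%:R - 1 - c) = n%:R / 2 + m%:R by ring.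
  by rewrite pratio_trans.
(* The amount d1 is 0 when n = 2; then the multiplier is 1 and no Beta density is involved. *)
have p1 (b : R^nat) x d1 : pgrow b -> 0 <= d1 -> 0 < x -> mean_bound q b (d1 + x) ->
    mean_bound q (fun k => b k * pratio 1 (1 + d1) k) x.
  move=> gb; rewrite le_eqVlt => /orP[/eqP <-|d0] x0 B.
    by move: B; rewrite add0r addr0; apply: mean_bound_ext => k; rewrite pratio_id// mulr1.
  have := mean_bound_frac n1 q1 gb (@ltr01 R) d0 _ B.
  by rewrite [d1 + x - d1]addrAC subrr add0r ltrDl; exact.
have B := mean_bound_base n1 0 q1.
pose d1 : R := n%:R / 2 - 1; pose d2 : R := - (n%:R / 2 + c).
have d10 : 0 <= d1 by rewrite /d1; lra.
have d20 : 0 <= d2 by rewrite /d2; lra.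
have B' : mean_bound q (fun=> 1) (d1 + (d2 + e)).
  apply: (@mean_bound_ext _ _ q (pratio (n%:R / 2 + 0%:R) (n%:R / 2))).
    by move=> k; rewrite addr0 pratio_id//; lra.
  apply: (mean_bound_le _ _ B); first exact: ltW.
  by move: he; rewrite mulr0n add0r /d1 /d2 mulrBr mulr1; lra.
have B1 := p1 _ (d2 + e) d1 (pgrow_cst 1) d10 (ltr_wpDl d20 e0) B'.
have gr : pgrow (fun k => 1 * pratio 1 (1 + d1) k).
  by apply: pgrowM; [exact: pgrow_cst|apply: pgrow_pratio => //; rewrite ltr_wpDr].
have := p1 _ e d2 gr d20 e0 B1.
apply: mean_bound_ext => k; rewrite gamma_coefE2// mul1r mulrC.
by congr (pratio _ _ _ * pratio _ _ _); rewrite /d1 /d2; ring.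
Qed.

(* [gamma_k dim H_k] is comparable to the binomial coefficients of [(1 - x)^(-(n + c))]. *)
Lemma gamma_coef_dimH_ge c : 0 < n%:R + c -> exists2 K : R, 0 < K &
  forall k, K * pratio (n%:R + c) 1 k <= gam c k * d k.
Proof.
have n2 := nn; move=> nc.
suff [K K0 H] : exists2 K : R, 0 < K &
    forall k, K * pratio (n%:R + c) 1 k.+1 <= gam c k.+1 * d k.+1.
  exists (Num.min K 1); first by rewrite lt_min K0/=.
  case=> [|k]; first by rewrite pratio0 gamma_coef0 dimH0 !mulr1 ge_min lexx orbT.
  apply: (le_trans _ (H k)); rewrite ler_wpM2r ?ge_min ?lexx//.
  by rewrite ltW// pratio_gt0.
have r2 k : pratio (n%:R + c) 1 k.+1 = (n%:R + c) * pratio (n%:R + c + 1) 2 k.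
  by rewrite pratioS divr1.
have rp k : 0 < pratio (n%:R + c + 1) 2 k by rewrite pratio_gt0//; lra.
have [hc|hc] := ltP (- (1 + n%:R / 2)) c.
  have [|||||c0 c00 Hc] := @pratio_balanced R (2 + n%:R / 2 + c) (n%:R - 1) (n%:R / 2) (n%:R + c + 1);
    try lra.
  pose kap : R := (1 + n%:R / 2 + c) / (n%:R / 2) * n%:R.
  have kap0 : 0 < kap by rewrite !mulr_gt0 ?invr_gt0//; lra.
  exists (kap * c0 / (n%:R + c)); first by rewrite divr_gt0// mulr_gt0.
  move=> k; rewrite r2 gamma_coefE1// pratioS dimHS// [leLHS]mulrA divfK ?gt_eqF//.
  have -> : 1 + n%:R / 2 + c + 1 = 2 + n%:R / 2 + c by ring.
  have -> : (1 + n%:R / 2 + c) / (n%:R / 2) * pratio (2 + n%:R / 2 + c) (n%:R / 2 + 1) k *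
      (n%:R * pratio (1 + n%:R / 2) (n%:R / 2) k * pratio (n%:R - 1) 2 k) =
      kap * (pratio (2 + n%:R / 2 + c) (n%:R / 2 + 1) k * pratio (1 + n%:R / 2) (n%:R / 2) k *
      pratio (n%:R - 1) 2 k) by rewrite /kap; ring.
  rewrite [n%:R / 2 + 1]addrC pratio_trans; last lra.
  rewrite -(@pratio_trans _ (n%:R - 1) (n%:R + c + 1) 2); last lra.
  rewrite -mulrA ler_wpM2l ?(ltW kap0)// mulrA ler_wpM2r ?(ltW (rp k))//.
(* z links two balanced pairs, 2 + (n-1) = p + z and z + 2 = (n+c+1) + n/2; it is positive because n
   + c > 0 and n >= 2. *)
pose z : R := n%:R - 1 + n%:R / 2 + c; pose p : R := 2 - n%:R / 2 - c.
have z0 : 0 < z by rewrite /z; lra.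
have p0 : 0 < p by rewrite /p; lra.
have [|||||c0 c00 Hc] := @pratio_balanced R 2 (n%:R - 1) p z; rewrite ?/z ?/p; try lra.
have [|||||c1 c10 Hc1] := @pratio_balanced R z 2 (n%:R + c + 1) (n%:R / 2); rewrite ?/z ?/p; try lra.
pose kap : R := (1 - (n%:R / 2 + c))^-1 * (n%:R / 2)^-1 * n%:R.
have kap0 : 0 < kap by rewrite !mulr_gt0 ?invr_gt0//; lra.
exists (kap * (c0 * c1) / (n%:R + c)); first by rewrite divr_gt0// mulr_gt0// mulr_gt0.
move=> k; rewrite r2 gamma_coefE2// !pratioS dimHS// [leLHS]mulrA divfK ?gt_eqF//.
have -> : 1 - (n%:R / 2 + c) + 1 = p by rewrite /p; ring.
have -> : 1 / (1 - (n%:R / 2 + c)) * pratio (1 + 1) p k * (1 / (n%:R / 2) * pratio (1 + 1) (n%:R / 2 + 1) k) *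
      (n%:R * pratio (1 + n%:R / 2) (n%:R / 2) k * pratio (n%:R - 1) 2 k) =
      kap * (pratio 2 p k * (pratio 2 (n%:R / 2 + 1) k * pratio (1 + n%:R / 2) (n%:R / 2) k) *
      pratio (n%:R - 1) 2 k) by rewrite /kap; ring.
rewrite [n%:R / 2 + 1]addrC pratio_trans; last lra.
rewrite -(@pratio_trans _ (n%:R - 1) z 2)// -(@pratio_trans _ z (n%:R + c + 1) 2); last lra.
rewrite -mulrA ler_wpM2l ?(ltW kap0)//.
have -> : pratio 2 p k * pratio 2 (n%:R / 2) k * (pratio (n%:R - 1) z k *
   (pratio z (n%:R + c + 1) k * pratio (n%:R + c + 1) 2 k)) =
   (pratio 2 p k * pratio (n%:R - 1) z k) * (pratio z (n%:R + c + 1) k * pratio 2 (n%:R / 2) k) *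
   pratio (n%:R + c + 1) 2 k by ring.
by rewrite ler_wpM2r ?(ltW (rp k))// ler_pM ?(ltW c00) ?(ltW c10).
Qed.

(** The kernel at cosine 1, where every G_k equals 1: a power series with positive coefficients. *)
Definition Ssum c (y : R) := psum (fun k => gam c k * d k) y.

Let gS c : pgrow (fun k => gam c k * d k).
Proof. by apply: pgrowM; [exact: pgrow_gamma_coef|exact: pgrow_dimH]. Qed.

Let S0 c k : 0 <= gam c k * d k.
Proof. by rewrite mulr_ge0// ltW ?gamma_coef_gt0 ?dimH_gt0. Qed.

Lemma Ssum_ge1 c y : 0 <= y < 1 -> 1 <= Ssum c y.
Proof. by move=> hy; have := psum_ge_a0 (gS c) hy (S0 c); rewrite gamma_coef0 dimH0 mulr1. Qed.

Lemma Ssum_homo c x y : 0 <= x -> x <= y -> y < 1 -> Ssum c x <= Ssum c y.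
Proof. by move=> x0 xy y1; exact: psum_homo. Qed.

Lemma Ssum_ge c : 0 < n%:R + c -> exists2 K : R, 0 < K &
  forall y, 0 <= y < 1 -> K * (1 - y) `^ (- (n%:R + c)) <= Ssum c y.
Proof.
move=> nc; have [K K0 H] := gamma_coef_dimH_ge nc.
exists K => // y hy; have gr := @pgrow_pratio R _ _ nc ltr01.
rewrite -psum_binomial// -psumZ//; last by case/andP: hy => ? ?; rewrite ger0_norm.
by apply: psum_le => //; apply: pgrowM => //; exact: pgrow_cst.
Qed.

Lemma ker_gamma_1 c y : @zker R n (gam c) 1 y = Ssum c y.
Proof. by congr psum; apply/funext => k; rewrite gegenR_1// mulr1. Qed.

Section Ball.
Variable Z : nat -> Rn R n -> Rn R n -> R.
Hypothesis hZ : forall k, is_zonal k (Z k).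

Lemma polar_rep (x : Rn R n) : exists2 u : Rn R n, usphere u & x = rscale (enorm x) u.
Proof.
have [e he] := @usphere_nonempty R n n1.
have [z0|z0] := eqVneq (enorm x) 0.
  exists e => //; apply: eq_from_tnth => i; rewrite tnth_rscale z0 mul0r.
  exact: enorm_eq0.
by exists (direction x); [exact: usphere_direction|rewrite rscale_direction].
Qed.

Lemma bergman_kerLN c (x y : Rn R n) : bergman_besov Z c x y =
  @kerLN R n (gam c) (rdot x y) (enorm x ^+ 2 * enorm y ^+ 2).
Proof. by rewrite /bergman_besov /kerLN; under eq_fun do rewrite (zonalE n1 hZ). Qed.

Lemma bergman_rscale c (r s : R) (u v : Rn R n) : 0 <= r -> 0 <= s -> usphere u -> usphere v ->
  bergman_besov Z c (rscale r u) (rscale s v) = @zker R n (gam c) (rdot u v) (r * s).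
Proof.
by move=> r0 s0 u1 v1; rewrite bergman_kerLN rdot_rscale !enorm_rscale// u1 v1 !mulr1 -exprMn kerLN_ker.
Qed.

Lemma measurable_bergman c : measurable_fun (uball `*` uball) (fun p : Rn R n * Rn R n => bergman_besov Z c p.1 p.2).
Proof.
under eq_fun do rewrite bergman_kerLN.
have me (f : Rn R n * Rn R n -> Rn R n) : measurable_fun setT f ->
    measurable_fun (uball `*` uball) (fun p => enorm (f p) ^+ 2).
  move=> mf; apply: (measurable_funS measurableT) => //.
  apply: (measurableT_comp (f := fun r : R => r ^+ 2)) => //.
  exact: (measurableT_comp (f := @enorm R n) (@measurable_enorm R n) mf).
apply: (measurable_kerLN n1 (pgrow_gamma_coef c)).
- by apply: (measurable_funS measurableT) => //; exact: measurable_rdot2.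
- by apply: measurable_funM; apply: me; [exact: measurable_fst|exact: measurable_snd].
move=> [x y] [/= hx hy]; have [u u1 xE] := polar_rep x; have [v v1 yE] := polar_rep y.
exists (rdot u v), (enorm x * enorm y); split.
- exact: cosine_sphere.
- by rewrite normrM !ger0_norm ?enorm_ge0// mulr_ilt1 ?enorm_ge0.
- by rewrite {1}xE {1}yE rdot_rscale.
- by rewrite exprMn.
Qed.

Lemma measurable_bergman_l c (y : Rn R n) : uball y -> measurable_fun uball (fun x => bergman_besov Z c x y).
Proof.
move=> hy; apply: (measurable_comp (F := uball `*` uball) (f := fun p : Rn R n * Rn R n => bergman_besov Z c p.1 p.2)
  (g := fun x => (x, y))).
- by apply: measurableX; exact: measurable_uball.
- by move=> _ [x hx <-].
- exact: measurable_bergman.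
- by apply: (measurable_funS measurableT) => //; apply/measurable_fun_pair.
Qed.

Lemma measurable_bergman_r c (x : Rn R n) : uball x -> measurable_fun uball (fun y => bergman_besov Z c x y).
Proof.
move=> hx; apply: (measurable_comp (F := uball `*` uball) (f := fun p : Rn R n * Rn R n => bergman_besov Z c p.1 p.2)
  (g := fun y => (x, y))).
- by apply: measurableX; exact: measurable_uball.
- by move=> _ [y hy <-].
- exact: measurable_bergman.
- by apply: (measurable_funS measurableT) => //; apply/measurable_fun_pair.
Qed.

End Ball.
End GammaCoef.

(** * Weighted integrals over the ball and means of the kernel *)

Section BallIntegrals.
Context {R : realType} {n : nat}.
Hypothesis n1 : (1 < n)%N.
Let n0 : (0 < n)%N. Proof. exact: ltnW. Qed.
Local Notation nu := (@nu R n).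
Local Notation sg := (@sigma R n).
Local Notation mu := (@lebesgue_measure R).
Local Notation I01 := (`]0%R, 1%R[%classic : set R).
Local Notation mS := (@measurable_usphere R n).
Local Notation mB := (@measurable_uball R n).

Lemma uball_rscale (r : R) (z : Rn R n) : 0 <= r < 1 -> usphere z -> uball (rscale r z).
Proof. by move=> /andP[r0 r1] z1; rewrite /uball/= enorm_rscale// z1 mulr1. Qed.

Lemma integral_nuT (f : Rn R n -> \bar R) : measurable_fun setT f -> (forall x, 0 <= f x)%E ->
  (\int[nu]_x f x = \int[nu]_(x in uball) f x)%E.
Proof.
move=> mf f0; rewrite (integral_nu measurableT mf (fun x _ => f0 x)).
have mf' : measurable_fun uball f by exact: (measurable_funS measurableT).
by rewrite (integral_nu mB mf' (fun x _ => f0 x)) setTI setIid.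
Qed.

Section PolarOn.
Variable f : Rn R n -> \bar R.
Hypotheses (mf : measurable_fun uball f) (f0 : forall x, uball x -> (0 <= f x)%E).

Let g := f \_ uball.

Let mg : measurable_fun setT g.
Proof. exact: (iffLR (measurable_restrictT f mB) mf). Qed.

Let g0 x : (0 <= g x)%E.
Proof. by rewrite /g patchE; case: ifPn => // /set_mem /f0. Qed.

Let sect (r : R) : I01 r -> (\int[sg]_z g (rscale r z) = \int[sg]_(z in usphere) f (rscale r z))%E.
Proof.
move=> /in01 /andP[r0 r1].
have mgr : measurable_fun setT (fun z : Rn R n => g (rscale r z)).
  by apply: measurableT_comp => //; exact: measurable_rscale.
rewrite (ge0_sphere_integral n0 mgr (fun z => g0 _)).
apply: eq_integral => z /set_mem z1; rewrite /g patchE mem_set//.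
by apply: uball_rscale => //; rewrite (ltW r0).
Qed.

(** Polar coordinates for functions measurable on the ball only, as the kernels are. *)
Lemma nu_polar_on : (\int[nu]_(x in uball) f x =
  \int[mu]_(r in I01) ((n%:R * r ^+ n.-1)%:E * \int[sg]_(z in usphere) f (rscale r z)))%E.
Proof.
transitivity (\int[nu]_(x in uball) g x)%E.
  by apply: eq_integral => x xB; rewrite /g patchE xB.
rewrite (ge0_nu_polar n0 mg g0); apply: eq_integral => r /set_mem hr.
by rewrite sect.
Qed.

Lemma measurable_sphere_section :
  measurable_fun I01 (fun r => \int[sg]_(z in usphere) f (rscale r z))%E.
Proof.
have := measurable_polar_section mg g0.
move=> /(measurable_funS measurableT (@subsetT _ I01)).
by apply: eq_measurable_fun => r /set_mem hr; rewrite sect.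
Qed.

End PolarOn.

(** The factor 1 + |x| lies in [1, 2], so weights of any exponent are comparable to powers of 1 -
    |x|. *)
Lemma weight_split a (x : Rn R n) : uball x ->
  weight a x = (1 - enorm x) `^ a * (1 + enorm x) `^ a.
Proof.
move=> xB; have e0 := enorm_ge0 x; rewrite -powRM ?subr_ge0 ?(ltW xB)//; last exact: addr_ge0.
by rewrite /weight; congr powR; ring.
Qed.

Let one_enorm a (x : Rn R n) : uball x -> 2 `^ (- `|a|) <= (1 + enorm x) `^ a <= 2 `^ `|a|.
Proof.
move=> xB; have e0 := enorm_ge0 x; have e1 : enorm x < 1 := xB.
by apply: powR_half2; apply/andP; split; lra.
Qed.

Lemma weight_le a (x : Rn R n) : uball x -> weight a x <= 2 `^ `|a| * (1 - enorm x) `^ a.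
Proof.
by move=> xB; rewrite weight_split// mulrC ler_wpM2r ?powR_ge0//; case/andP: (one_enorm a xB).
Qed.

Lemma sqr_enorm_lt1 (x : Rn R n) : uball x -> 0 < 1 - enorm x ^+ 2.
Proof. by move=> xB; rewrite subr_gt0 exprn_ilt1 ?enorm_ge0. Qed.

Lemma weight_gt0 a (x : Rn R n) : uball x -> 0 < weight a x.
Proof. by move=> xB; rewrite powR_gt0// sqr_enorm_lt1. Qed.

Lemma weightD a b (x : Rn R n) : uball x -> weight (a + b) x = weight a x * weight b x.
Proof. by move=> xB; rewrite /weight powRD// (gt_eqF (sqr_enorm_lt1 xB)) implybT. Qed.

Lemma weightM a b (x : Rn R n) : weight (a * b) x = weight a x `^ b.
Proof. by rewrite /weight powRrM. Qed.

Lemma sphere_cst (k : R) : (\int[sg]_(z in usphere) k%:E = k%:E)%E.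
Proof.
have s1 : (sg usphere = 1)%E.
  have E := measureU sg mS (measurableC mS) (setICr usphere).
  have E2 : (sg setT = sg usphere + sg (~` usphere))%E := etrans (congr1 sg (esym (setUCr _))) E.
  by rewrite sigmaT// sigma_nsphere// adde0 in E2.
rewrite integral_cst; last exact: mS.
by apply: (etrans (congr1 (fun u => k%:E * u)%E s1)); exact: mule1.
Qed.

Lemma nu_radial (g : R -> R) : measurable_fun I01 g -> (forall r, I01 r -> 0 <= g r) ->
  measurable_fun uball (fun x : Rn R n => g (enorm x)) -> (forall x : Rn R n, uball x -> 0 <= g (enorm x)) ->
  (\int[nu]_(x in uball) (g (enorm x))%:E = \int[mu]_(r in I01) (n%:R * r ^+ n.-1 * g r)%:E)%E.
Proof.
move=> mg g0 mge ge0; rewrite (nu_polar_on (f := fun x => (g (enorm x))%:E)); last 2 first.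
- exact/measurable_EFinP.
- by move=> x xB; rewrite lee_fin ge0.
apply: eq_integral => r /set_mem hr; have /andP[r0 r1] := in01 hr.
rewrite (eq_integral (fun=> (g r)%:E)); last first.
  by move=> z /set_mem z1; rewrite enorm_rscale ?(ltW r0)// z1 mulr1.
by rewrite sphere_cst -EFinM.
Qed.

(** For a > -1, [Vconst] is the real part of an integral and would be 0 if that integral were
    infinite, so finiteness is shown too; both bounds come from comparing (1-r^2)^a with (1-r)^a. *)
Lemma Vconst_gt0 a : 0 < @Vconst R n a.
Proof.
rewrite /Vconst; case: ifPn => // a1; rewrite /Rintegral.
have mw (D : set R) : measurable_fun D (fun r : R => (1 - r ^+ 2) `^ a).
  apply: (measurable_funS measurableT) => //.
  apply: (measurableT_comp (f := fun r : R => r `^ a)); first exact: measurable_powR.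
  by apply: measurable_funB => //; exact: measurable_funX.
have E : (\int[nu]_(x in uball) (weight a x)%:E = \int[mu]_(r in I01) (n%:R * r ^+ n.-1 * (1 - r ^+ 2) `^ a)%:E)%E.
  apply: (nu_radial (g := fun r : R => (1 - r ^+ 2) `^ a)) => //.
  - by move=> r _; exact: powR_ge0.
  - by apply: (measurable_funS measurableT) => //; exact: measurable_weight.
  - by move=> x _; exact: powR_ge0.
have cmp (r : R) : 0 < r < 1 -> 2 `^ (- `|a|) * (1 - r) `^ a <= (1 - r ^+ 2) `^ a <= 2 `^ `|a| * (1 - r) `^ a.
  move=> /andP[r0 r1].
  have -> : (1 - r ^+ 2) `^ a = (1 + r) `^ a * (1 - r) `^ a.
    by rewrite -powRM; [congr powR; ring|lra|lra].
  have /andP[h1 h2] : 2 `^ (- `|a|) <= (1 + r) `^ a <= 2 `^ `|a|.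
    by apply: powR_half2; apply/andP; split; lra.
  by rewrite !ler_wpM2r ?powR_ge0.
have a10 : 0 < a + 1 by lra.
have I0 := integral_1B_powR a10 (@ltr01 R); rewrite addrK subr0 powR1 in I0.
have h1 : 2^-1 < 1 :> R by rewrite invf_lt1// ltr1n.
have I1 := integral_1B_powR a10 h1; rewrite addrK in I1.
have mP (D : set R) : measurable_fun D (fun r : R => r ^+ n.-1).
  by apply: (measurable_funS measurableT) => //; exact: measurable_funX.
have mF (D : set R) : measurable_fun D (fun r : R => n%:R * r ^+ n.-1 * (1 - r ^+ 2) `^ a).
  by apply: measurable_funM => //; apply: measurable_funM.
have mI : measurable I01 by [].
rewrite fine_gt0//; apply/andP; split.
  rewrite E; pose H := `]2^-1, 1[%classic : set R.
  have mH : measurable H by exact: measurable_itv.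
  have HI : H `<=` I01.
    move=> r; rewrite /H/= !in_itv/= => /andP[h ->]; rewrite andbT.
    by rewrite (lt_trans _ h)// invr_gt0.
  pose c0 : R := n%:R * 2^-1 ^+ n.-1 * 2 `^ (- `|a|).
  have c00 : 0 < c0 by rewrite !mulr_gt0 ?powR_gt0 ?exprn_gt0 ?ltr0n// invr_gt0.
  apply: (@lt_le_trans _ _ (\int[mu]_(r in H) (c0 * (1 - r) `^ a)%:E)%E).
    rewrite (integralZlR mu mH)//; last 3 first.
    - exact: measurable_powR_oneB.
    - by move=> r _; exact: powR_ge0.
    - exact: ltW.
    by rewrite I1 -EFinM lte_fin mulr_gt0// divr_gt0// powR_gt0// subr_gt0.
  apply: (@le_trans _ _ (\int[mu]_(r in H) (n%:R * r ^+ n.-1 * (1 - r ^+ 2) `^ a)%:E)%E).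
    apply: (le_integralR mu mH) => //.
    - by apply: measurable_funM => //; exact: measurable_powR_oneB.
    - exact: mF.
    - by move=> r _; rewrite mulr_ge0 ?powR_ge0 ?(ltW c00).
    move=> r; rewrite /H/= in_itv/= => /andP[h r1].
    have r0 : 0 < r by rewrite (lt_trans _ h)// invr_gt0.
    have /andP[h2 _] := cmp r (introT andP (conj r0 r1)).
    rewrite /c0 -[leLHS]mulrA; apply: ler_pM => //.
    - by rewrite mulr_ge0 ?powR_ge0.
    rewrite ler_wpM2l//.
    by rewrite lerXn2r ?nnegrE ?invr_ge0 ?(ltW r0) ?(ltW h).
  apply: ge0_subset_integral => //.
  - by apply/measurable_EFinP; exact: mF.
  - move=> r /in01 /andP[r0 r1]; rewrite lee_fin !mulr_ge0 ?powR_ge0// exprn_ge0// ltW//.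
rewrite E; apply: (@le_lt_trans _ _ (\int[mu]_(r in I01) (n%:R * 2 `^ `|a| * (1 - r) `^ a)%:E)%E).
  apply: (le_integralR mu mI) => //.
  - exact: mF.
  - by apply: measurable_funM => //; exact: measurable_powR_oneB.
  - by move=> r /in01 /andP[r0 _]; rewrite !mulr_ge0 ?powR_ge0// exprn_ge0// ltW.
  move=> r /in01 hr; have /andP[_ h2] := cmp r hr; case/andP: hr => r0 r1.
  rewrite -mulrA -[leRHS]mulrA ler_wpM2l// -[leRHS]mul1r ler_pM ?powR_ge0 ?exprn_ge0 ?(ltW r0)//.
  by rewrite exprn_ile1// ltW.
rewrite (integralZlR mu mI)//; last 2 first.
- exact: measurable_powR_oneB.
- by move=> r _; exact: powR_ge0.
by rewrite I0 -EFinM ltry.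
Qed.

Lemma integral_nu_ a (f : Rn R n -> \bar R) : measurable_fun setT f -> (forall x, 0 <= f x)%E ->
  (\int[nu_ a]_x f x = \int[nu]_(x in uball) (f x * (weight a x / @Vconst R n a)%:E))%E.
Proof.
move=> mf f0; rewrite /nu_ (ge0_integral_density _ (measurable_nu_density a) (@nu_density_ge0 R n a) mf f0).
rewrite integral_nuT//.
  apply: emeasurable_funM => //; apply/measurable_EFinP; exact: measurable_nu_density.
by move=> x; rewrite mule_ge0// lee_fin nu_density_ge0.
Qed.

Lemma Lnorm_nu1 a (f : Rn R n -> R) : measurable_fun setT f ->
  ('N[nu_ a]_1[EFin \o f] = \int[nu]_(x in uball) (`|f x| * (weight a x / @Vconst R n a))%:E)%E.
Proof.
move=> mf; rewrite Lnorm1 integral_nu_//.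
by apply: measurableT_comp => //; exact/measurable_EFinP.
Qed.

Lemma Lnorm_nuq a q (f : Rn R n -> R) : q != 0 -> measurable_fun setT f ->
  ('N[nu_ a]_(q%:E)[EFin \o f] `^ q = \int[nu]_(x in uball) (`|f x| `^ q * (weight a x / @Vconst R n a))%:E)%E.
Proof.
move=> q0 mf; rewrite poweR_Lnorm//.
transitivity (\int[nu_ a]_x (`|f x| `^ q)%:E)%E.
  by apply: eq_integral => x _; rewrite /= ?poweR_EFin.
rewrite integral_nu_//.
by apply/measurable_EFinP; exact: measurable_norm_powR.
Qed.

Lemma mem_Lfun (m : {measure set (Rn R n) -> \bar R}) p (f : Rn R n -> R) :
  (f \in Lfun m p) <-> measurable_fun setT f /\ ('N[m]_p[EFin \o f] < +oo)%E.
Proof.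
split=> [/andP[/set_mem mf /set_mem nf]|[mf nf]]; first by split.
by apply/andP; split; apply/mem_set.
Qed.

Section Sufficiency.
Variable Z : nat -> Rn R n -> Rn R n -> R.
Hypothesis hZ : forall k, is_zonal k (Z k).
Local Notation Rc := (bergman_besov Z).

(** On the sphere of radius s the kernel is seen at radius s |y|; the bound on spherical means
    leaves a one-dimensional integral. *)
Let radial_kernel_le c q e beta : 1 <= q -> @mean_bound R n q (@gamma_coef R n c) e ->
  exists2 C : R, 0 <= C & forall y, uball y ->
  (\int[nu]_(x in uball) (`|Rc c x y| `^ q * weight beta x)%:E <=
   C%:E * \int[mu]_(s in I01) ((1 - s) `^ beta * (1 - s * enorm y) `^ (- (e * q)))%:E)%E.
Proof.
move=> q1 [C C0 HC].
exists (n%:R * (2 `^ `|beta| * C)); first by rewrite !mulr_ge0// powR_ge0.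
move=> y yB; have [v v1 yE] := polar_rep n1 y.
have e0 := enorm_ge0 y; have e1 : enorm y < 1 := yB.
pose f x := (`|Rc c x y| `^ q * weight beta x)%:E.
have mI : measurable I01 by [].
have mf : measurable_fun uball f.
  apply/measurable_EFinP; apply: measurable_funM.
    by apply: measurable_norm_powR; exact: (measurable_bergman_l n1 hZ).
  by apply: (measurable_funS measurableT) => //; exact: measurable_weight.
have f0 x : uball x -> (0 <= f x)%E by move=> _; rewrite lee_fin mulr_ge0 ?powR_ge0.
rewrite (nu_polar_on mf f0).
rewrite -(integralZlR mu mI); last 3 first.
- by apply: measurable_funM; [exact: measurable_powR_oneB|exact: measurable_powR_1B].
- by move=> s _; rewrite mulr_ge0 ?powR_ge0.
- by rewrite !mulr_ge0 ?powR_ge0.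
apply: ge0_le_integral => //.
- move=> r /in01 /andP[r0 _]; rewrite mule_ge0//; first by rewrite lee_fin mulr_ge0// exprn_ge0// ltW.
  by apply: integral_ge0 => z _; rewrite lee_fin mulr_ge0 ?powR_ge0.
- have mP : measurable_fun I01 (fun r : R => r ^+ n.-1).
    by apply: (measurable_funS measurableT) => //; exact: measurable_funX.
  apply: emeasurable_funM; last exact: (measurable_sphere_section mf f0).
  by apply/measurable_EFinP; apply: measurable_funM.
- apply/measurable_EFinP; apply: measurable_funM => //.
  by apply: measurable_funM; [exact: measurable_powR_oneB|exact: measurable_powR_1B].
move=> r hr; have /andP[r0 r1] := in01 hr.
have ry : 0 <= r * enorm y < 1 by rewrite mulr_ge0 ?(ltW r0)//= mulr_ilt1 ?(ltW r0).
have wr (z : Rn R n) : usphere z -> weight beta (rscale r z) <= 2 `^ `|beta| * (1 - r) `^ beta.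
  move=> z1; have rB : uball (rscale r z) by apply: uball_rscale => //; rewrite (ltW r0).
  by have := weight_le beta rB; rewrite enorm_rscale ?(ltW r0)// z1 mulr1.
apply: (@le_trans _ _ (n%:R%:E * ((2 `^ `|beta| * (1 - r) `^ beta) * (C * (1 - r * enorm y) `^ (- (e * q))))%:E)%E); last first.
  by rewrite -EFinM lee_fin le_eqVlt; apply/orP; left; apply/eqP; ring.
apply: lee_pmul.
- by rewrite lee_fin mulr_ge0// exprn_ge0// ltW.
- by apply: integral_ge0 => z _; rewrite lee_fin mulr_ge0 ?powR_ge0.
- by rewrite lee_fin ler_piMr// exprn_ile1// ltW.
rewrite EFinM; apply: (le_trans _ (lee_wpmul2l _ (HC v (r * enorm y) v1 ry))); last first.
  by rewrite lee_fin mulr_ge0 ?powR_ge0.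
have ny : `|r * enorm y| < 1 by case/andP: ry => ? ?; rewrite ger0_norm.
have mk : measurable_fun usphere (fun z => `|@zker R n (@gamma_coef R n c) (rdot z v) (r * enorm y)| `^ q).
  by apply: measurable_norm_powR; apply: measurable_ker_sphere => //; exact: pgrow_gamma_coef.
rewrite -(integralZlR sg mS)//; last by rewrite mulr_ge0 ?powR_ge0.
apply: ge0_le_integral => //.
- exact: mS.
- by move=> z _; rewrite lee_fin mulr_ge0 ?powR_ge0.
- have mr : measurable_fun setT (fun z : Rn R n => rscale r z) by exact: measurable_rscale.
  apply: (measurable_comp (F := uball) (f := f)) => //.
  + exact: mB.
  + by move=> _ [z z1 <-]; apply: uball_rscale => //; rewrite (ltW r0).
  + exact: (measurable_funS measurableT).
- by apply/measurable_EFinP; exact: measurable_funM.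
move=> z z1; rewrite /f lee_fin {1}yE (bergman_rscale n1 hZ)// ?(ltW r0)// mulrC.
by rewrite ler_wpM2r ?powR_ge0// wr.
Qed.

Lemma kernel_mean b c alpha beta q : 1 <= q -> -1 < beta ->
  ((alpha < b /\ c <= b + (n%:R + beta) / q - (n%:R + alpha)) \/
   (alpha <= b /\ c < b + (n%:R + beta) / q - (n%:R + alpha))) ->
  exists2 C : R, 0 <= C & forall y, uball y ->
  (\int[nu]_(x in uball) (`|Rc c x y| `^ q * weight beta x)%:E <=
   (C * (1 - enorm y) `^ (- ((b - alpha) * q)))%:E)%E.
Proof.
move=> q1 hb cond; have q0 : 0 < q by rewrite (lt_le_trans _ q1).
have b1 : 0 < beta + 1 by lra.
have nq : (n%:R + beta) / q = (n%:R - 1) / q + (beta + 1) / q by field; rewrite gt_eqF.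
have bq : 0 < (beta + 1) / q by rewrite divr_gt0.
have [ab|ab] := ltP alpha b.
  pose e := b - alpha + (beta + 1) / q.
  have e0 : 0 < e by rewrite /e; lra.
  have ce : n%:R + c - (n%:R - 1) / q <= e.
    by case: cond => -[_ h]; move: h; rewrite nq /e; lra.
  have [C C0 HC] := radial_kernel_le beta q1 (mean_bound_gamma n1 q1 e0 ce).
  have eq : e * q = (b - alpha) * q + (beta + 1) by rewrite /e; field; rewrite gt_eqF.
  have lt : beta + 1 < e * q by rewrite eq ltrDr mulr_gt0 ?subr_gt0.
  have [C' [C'0 HJ]] := J_bound b1 lt.
  exists (C * C'); first by rewrite mulr_ge0 ?(ltW C'0).
  move=> y yB; apply: (le_trans (HC y yB)); rewrite -mulrA EFinM lee_wpmul2l//.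
  have ey : 0 <= enorm y < 1 by rewrite enorm_ge0.
  by have := HJ _ ey; rewrite !addrK eq addrK.
have {ab} ab : alpha = b by apply/eqP; rewrite eq_le ab andbT; case: cond => -[h _] //; exact: ltW.
rewrite {cond}ab in cond *; case: cond => -[]; rewrite ?ltxx// => _ h.
pose s := n%:R + c - (n%:R - 1) / q; have sb : s < (beta + 1) / q by rewrite /s; move: h; rewrite nq; lra.
(* For alpha = b the radial integral must stay bounded, which asks for e q < beta + 1 strictly; the
   maximum with half of (beta+1)/q keeps e positive. *)
pose e := Num.max ((beta + 1) / q / 2) s.
have e0 : 0 < e by rewrite lt_max divr_gt0.
have eb : e * q < beta + 1.
  by rewrite -ltr_pdivlMr// gt_max sb andbT ltr_pdivrMr// mulr_natr mulr2n ltrDl.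
have se : s <= e by rewrite le_max lexx orbT.
have [C C0 HC] := radial_kernel_le beta q1 (mean_bound_gamma n1 q1 e0 se).
have dd : 0 < beta + 1 - e * q by rewrite subr_gt0.
exists (C / (beta + 1 - e * q)); first by rewrite divr_ge0// ltW.
move=> y yB; apply: (le_trans (HC y _)) => //.
rewrite subrr mul0r oppr0 powRr0 mulr1 EFinM lee_wpmul2l//.
have e00 := enorm_ge0 y; have e1 : enorm y < 1 := yB.
have := integral_1B_powR dd (@ltr01 R); rewrite subr0 powR1 div1r => <-.
apply: le_integralR => //.
- by apply: measurable_funM; [exact: measurable_powR_oneB|exact: measurable_powR_1B].
- exact: measurable_powR_oneB.
- by move=> r _; rewrite mulr_ge0 ?powR_ge0.
move=> r hr; have h01 := in01 hr; have [[h1 h2] _] := rho_bounds h01 (introT andP (conj e00 e1)).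
have r1 : 0 < 1 - r by case/andP: h01; lra.
have -> : beta + 1 - e * q - 1 = beta + - (e * q) by ring.
rewrite powRD ?(gt_eqF r1) ?implybT// ler_wpM2l ?powR_ge0//.
by apply: ler_powRN => //; rewrite mulr_ge0 ?(ltW e0) ?(ltW q0).
Qed.

End Sufficiency.
End BallIntegrals.

Lemma measurable_fun_poweR d (T : measurableType d) (R : realType) (D : set T) (g : T -> \bar R) (q : R) :
  measurable_fun D g -> measurable_fun D (fun x => g x `^ q)%E.
Proof.
by move=> mg; apply: (measurableT_comp (f := fun r : \bar R => (r `^ q)%E)) => //; exact: measurable_poweR.
Qed.

(** * From means of a kernel to boundedness of its operator *)

Section BoundedOfMean.
Context {R : realType} {n : nat}.
Hypothesis n1 : (1 < n)%N.
Let n0 : (0 < n)%N. Proof. exact: ltnW. Qed.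
Local Notation nu := (@nu R n).
Local Notation mB := (@measurable_uball R n).
Let nuf : {finite_measure set (Rn R n) -> \bar R} := @nuF R n.

Variables (K : Rn R n -> Rn R n -> R) (b alpha beta q C : R).
Hypotheses (mK : measurable_fun (uball `*` uball) (fun p : Rn R n * Rn R n => K p.1 p.2)).
Hypotheses (q1 : 1 <= q) (C0 : 0 <= C).
Hypothesis HC : forall y, uball y -> (\int[nu]_(x in uball) (`|K x y| `^ q * weight beta x)%:E <=
   (C * (1 - enorm y) `^ (- ((b - alpha) * q)))%:E)%E.
Let q0 : 0 < q. Proof. exact: lt_le_trans q1. Qed.

Let mKr (x : Rn R n) : uball x -> measurable_fun uball (fun y => K x y).
Proof.
move=> hx; apply: (measurable_comp (F := uball `*` uball) (f := fun p : Rn R n * Rn R n => K p.1 p.2)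
  (g := fun y => (x, y))).
- by apply: measurableX; exact: mB.
- by move=> _ [y hy <-].
- exact: mK.
- by apply: (measurable_funS measurableT) => //; apply/measurable_fun_pair.
Qed.

Let mKl (y : Rn R n) : uball y -> measurable_fun uball (fun x => K x y).
Proof.
move=> hy; apply: (measurable_comp (F := uball `*` uball) (f := fun p : Rn R n * Rn R n => K p.1 p.2)
  (g := fun x => (x, y))).
- by apply: measurableX; exact: mB.
- by move=> _ [x hx <-].
- exact: mK.
- by apply: (measurable_funS measurableT) => //; apply/measurable_fun_pair.
Qed.

Let mcomp1 (g : Rn R n -> R) : measurable_fun setT g ->
  measurable_fun (uball `*` uball) (fun p : Rn R n * Rn R n => g p.1).
Proof.
by move=> mg; apply: (measurable_funS measurableT) => //; apply: (measurableT_comp (f := g)) => //; exact: measurable_fst.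
Qed.

Let mcomp2 (g : Rn R n -> R) : measurable_fun setT g ->
  measurable_fun (uball `*` uball) (fun p : Rn R n * Rn R n => g p.2).
Proof.
by move=> mg; apply: (measurable_funS measurableT) => //; apply: (measurableT_comp (f := g)) => //; exact: measurable_snd.
Qed.

Let mres (g : Rn R n -> R) : measurable_fun setT g -> measurable_fun uball g.
Proof. by move=> mg; exact: (measurable_funS measurableT). Qed.

Section Fixf.
Variable f : Rn R n -> R.
Hypothesis mf : measurable_fun setT f.

(** Density of the measure to which Jensen's inequality is applied; its mass is the L^1 norm of f
    times [Vconst]. *)
Let h y := `|f y| * weight alpha y.
Let mh : measurable_fun setT h.
Proof.
apply: measurable_funM; last exact: measurable_weight.
exact: (measurableT_comp (f := @Num.norm R R)).
Qed.
Let h0 y : 0 <= h y. Proof. by rewrite mulr_ge0 ?powR_ge0. Qed.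

Let I x := (\int[nu]_(y in uball) (`|K x y| * `|f y| * weight b y)%:E)%E.
Let I0 x : (0 <= I x)%E.
Proof. by apply: integral_ge0 => y _; rewrite lee_fin !mulr_ge0 ?powR_ge0. Qed.

Let C2 := C * 2 `^ `|(b - alpha) * q|.
Let C20 : 0 <= C2. Proof. by rewrite mulr_ge0 ?powR_ge0. Qed.
Let H := (\int[nu]_(y in uball) (h y)%:E)%E.

Let mI : measurable_fun uball I.
Proof.
apply: (@measurable_tonelli_on _ _ _ _ _ nuf uball uball
  (fun p : Rn R n * Rn R n => (`|K p.1 p.2| * `|f p.2| * weight b p.2)%:E) mB mB).
- apply/measurable_EFinP; apply: measurable_funM; last by apply: mcomp2; exact: measurable_weight.
  apply: measurable_funM; first exact: (measurableT_comp (f := @Num.norm R R)).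
  apply: (measurableT_comp (f := @Num.norm R R)) => //; exact: mcomp2.
- by move=> p _; rewrite lee_fin !mulr_ge0 ?powR_ge0.
Qed.

Let mIq : measurable_fun uball (fun x => I x `^ q)%E.
Proof. exact: measurable_fun_poweR mI. Qed.

(** With g = |K| (1-|y|^2)^(b-alpha), the modulus of the integrand is g h. Jensen for h and Tonelli
    bring the integral in x inside, where [HC] compensates the q-th power of the weight in g. *)
Let Iq : (\int[nu]_(x in uball) (I x `^ q * (weight beta x)%:E) <= H `^ (q - 1) * (C2%:E * H))%E.
Proof.
pose g x y := `|K x y| * weight (b - alpha) y.
have g0 x y : 0 <= g x y by rewrite mulr_ge0 ?powR_ge0.
have mg x : uball x -> measurable_fun uball (g x).
  move=> xB; apply: measurable_funM; last by apply: mres; exact: measurable_weight.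
  by apply: (measurableT_comp (f := @Num.norm R R)) => //; exact: mKr.
pose F (p : Rn R n * Rn R n) := (g p.1 p.2 `^ q * h p.2 * weight beta p.1)%:E.
have F0 p : (0 <= F p)%E by rewrite lee_fin !mulr_ge0 ?powR_ge0.
have mF : measurable_fun (uball `*` uball) F.
  apply/measurable_EFinP; apply: measurable_funM; last by apply: mcomp1; exact: measurable_weight.
  apply: measurable_funM; last exact: mcomp2.
  apply: (measurableT_comp (f := fun r : R => r `^ q)); first exact: measurable_powR.
  apply: measurable_funM; last by apply: mcomp2; exact: measurable_weight.
  exact: (measurableT_comp (f := @Num.norm R R)).
have pt x : uball x -> (I x `^ q * (weight beta x)%:E <= H `^ (q - 1) * \int[nu]_(y in uball) F (x, y))%E.
  move=> xB.
  have J := jensen_hoelder nu q1 mB (mg x xB) (mres mh) (fun y _ => g0 x y) (fun y _ => h0 y).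
  have IE : I x = (\int[nu]_(y in uball) (g x y * h y)%:E)%E.
    apply: eq_integral => y /set_mem yB; congr EFin.
    have -> : weight b y = weight (b - alpha) y * weight alpha y by rewrite -weightD// subrK.
    by rewrite /g /h; ring.
  have -> : (\int[nu]_(y in uball) F (x, y) = (weight beta x)%:E * \int[nu]_(y in uball) (g x y `^ q * h y)%:E)%E.
    rewrite -(integralZlR nu mB).
    - by apply: eq_integral => y _; congr EFin; rewrite /= mulrC.
    - apply: measurable_funM; last exact: mres.
      apply: (measurableT_comp (f := fun r : R => r `^ q)); first exact: measurable_powR.
      exact: mg.
    - by move=> y _; rewrite mulr_ge0 ?powR_ge0.
    - exact: powR_ge0.
  rewrite IE muleC muleCA lee_wpmul2l//.
  by rewrite lee_fin powR_ge0.
have mT : measurable_fun uball (fun x => \int[nu]_(y in uball) F (x, y))%E.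
  exact: (@measurable_tonelli_on _ _ _ _ _ nuf uball uball F mB mB mF (fun p _ => F0 p)).
apply: (@le_trans _ _ (\int[nu]_(x in uball) (H `^ (q - 1) * \int[nu]_(y in uball) F (x, y)))%E).
  apply: ge0_le_integral => //.
  - exact: mB.
  - by move=> x _; rewrite mule_ge0 ?poweR_ge0// lee_fin powR_ge0.
  - apply: emeasurable_funM; last by apply/measurable_EFinP; apply: mres; exact: measurable_weight.
    exact: mIq.
  - exact: measurable_funeM.
rewrite ge0_integralZl//; last 3 first.
- exact: mB.
- by move=> x _; exact: integral_ge0.
- exact: poweR_ge0.
apply: lee_wpmul2l; first exact: poweR_ge0.
have -> : (\int[nu]_(x in uball) \int[nu]_(y in uball) F (x, y) =
    \int[nu]_(y in uball) \int[nu]_(x in uball) F (x, y))%E.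
  exact: (@tonelli_on _ _ _ _ _ nuf nuf uball uball F mB mB mF (fun p _ => F0 p)).
rewrite /H -(integralZlR nu mB (mres mh) (fun y _ => h0 y) C20).
apply: ge0_le_integral.
- exact: mB.
- by move=> y _; exact: integral_ge0.
- have mF' : measurable_fun (uball `*` uball) (fun p => F (p.2, p.1)).
    apply: (measurable_comp (F := uball `*` uball) (f := F) _ _ mF).
    + by apply: measurableX; exact: mB.
    + by move=> _ [[s z] [/= hs hz] <-].
    + apply: (measurable_funS measurableT) => //.
      by apply/measurable_fun_pair; [exact: measurable_snd|exact: measurable_fst].
  exact: (@measurable_tonelli_on _ _ _ _ _ nuf uball uball (fun p => F (p.2, p.1)) mB mB mF' (fun p _ => F0 _)).
- by apply/measurable_EFinP; apply: measurable_funM; [exact: measurable_cst|exact: mres].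
move=> y yB; rewrite /F /=.
have y1 : 0 < 1 - enorm y by rewrite subr_gt0.
have E x : g x y `^ q * h y * weight beta x = (weight ((b - alpha) * q) y * h y) * (`|K x y| `^ q * weight beta x).
  by rewrite /g powRM ?powR_ge0// weightM; ring.
under eq_integral do rewrite E.
rewrite (integralZlR nu mB); last 3 first.
- apply: measurable_funM; last by apply: mres; exact: measurable_weight.
  by apply: measurable_norm_powR; exact: mKl.
- by move=> x _; rewrite mulr_ge0 ?powR_ge0.
- by rewrite mulr_ge0 ?powR_ge0.
apply: (le_trans (lee_wpmul2l _ (HC yB))); first by rewrite lee_fin mulr_ge0 ?powR_ge0.
rewrite -EFinM lee_fin mulrAC ler_wpM2r//.
apply: (@le_trans _ _ (2 `^ `|(b - alpha) * q| * (1 - enorm y) `^ ((b - alpha) * q) *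
    (C * (1 - enorm y) `^ (- ((b - alpha) * q))))).
  by rewrite ler_wpM2r ?mulr_ge0 ?powR_ge0// weight_le.
rewrite /C2 powRN le_eqVlt; apply/orP; left; apply/eqP; field.
by rewrite gt_eqF// powR_gt0.
Qed.

Let HE : H = ((@Vconst R n alpha)%:E * 'N[nu_ alpha]_1[EFin \o f])%E.
Proof.
have V0 := Vconst_gt0 n1 alpha.
rewrite Lnorm_nu1// -(integralZlR nu mB).
- apply: eq_integral => y _; congr EFin; rewrite /h; field; rewrite gt_eqF//.
- apply: mres; apply: measurable_funM; last exact: measurable_nu_density.
  exact: (measurableT_comp (f := @Num.norm R R)).
- by move=> y _; rewrite mulr_ge0// nu_density_ge0.
- exact: ltW.
Qed.

Hypothesis ff : ('N[nu_ alpha]_1[EFin \o f] < +oo)%E.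

Let N1 := fine ('N[nu_ alpha]_1[EFin \o f])%E.
Let N1E : ('N[nu_ alpha]_1[EFin \o f] = N1%:E)%E.
Proof. by rewrite fineK// ge0_fin_numE// Lnorm_ge0. Qed.
Let N10 : 0 <= N1. Proof. by rewrite fine_ge0// Lnorm_ge0. Qed.

Let D := (@Vconst R n alpha) `^ q * C2.

Let Iq2 : (\int[nu]_(x in uball) (I x `^ q * (weight beta x)%:E) <= (D * N1 `^ q)%:E)%E.
Proof.
have HE2 : H = (@Vconst R n alpha * N1)%:E by rewrite HE N1E -EFinM.
apply: (le_trans Iq); rewrite HE2 poweR_EFin -!EFinM lee_fin le_eqVlt; apply/orP; left; apply/eqP.
set X := _ * N1; have X0 : 0 <= X by rewrite mulr_ge0// Vconst_ge0.
rewrite mulrCA; have -> : X `^ (q - 1) * X = X `^ q.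
  have [->|Xn] := eqVneq X 0; first by rewrite mulr0 powR0// gt_eqF.
  by rewrite -{2}[X]powRr1// -powRD ?subrK// Xn implybT.
by rewrite /X powRM ?Vconst_ge0// /D; ring.
Qed.

Let mintegrand x : uball x -> measurable_fun uball (integrand K b f x).
Proof.
move=> xB; apply: measurable_funM; last by apply: mres; exact: measurable_weight.
by apply: measurable_funM; [exact: mKr|exact: mres].
Qed.

Let abs_integrand x : (\int[nu]_(y in uball) `|(integrand K b f x y)%:E| = I x)%E.
Proof.
by apply: eq_integral => y _; rewrite abse_EFin /integrand !normrM (ger0_norm (powR_ge0 _ _)).
Qed.

(** The q-th power of [I] is integrable against a positive weight, so [I] is finite almost
    everywhere. *)
Lemma ae_integrable_integrand : {ae nu, forall x, uball x ->
  nu.-integrable uball (EFin \o integrand K b f x)}.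
Proof.
have mJ : measurable_fun uball (fun x => I x `^ q * (weight beta x)%:E)%E.
  apply: emeasurable_funM; last by apply/measurable_EFinP; apply: mres; exact: measurable_weight.
  exact: mIq.
have iJ : nu.-integrable uball (fun x => I x `^ q * (weight beta x)%:E)%E.
  apply/integrableP; split => //.
  apply: (@le_lt_trans _ _ (D * N1 `^ q)%:E); last exact: ltry.
  apply: le_trans Iq2; rewrite le_eqVlt; apply/orP; left; apply/eqP.
  by apply: eq_integral => x _; rewrite gee0_abs// mule_ge0 ?poweR_ge0// lee_fin powR_ge0.
have := integrable_ae mB iJ; apply: filterS => x hx xB.
apply/integrableP; split; first by apply/measurable_EFinP; exact: mintegrand.
rewrite abs_integrand ltNge; apply/negP; rewrite leye_eq => /eqP E.
have := hx xB; rewrite E poweRyr ?gt_eqF// gt0_mulye//.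
by rewrite lte_fin weight_gt0.
Qed.

Let Tf := intop K b f.

(** Holds even where the integral diverges: the value is [fine] of the difference between the
    integrals of the positive and negative parts, each measurable by Tonelli. *)
Lemma measurable_intop : measurable_fun setT Tf.
Proof.
apply/(measurable_restrictT _ mB).
pose F (p : Rn R n * Rn R n) := (integrand K b f p.1 p.2)%:E.
have mF : measurable_fun (uball `*` uball) F.
  apply/measurable_EFinP; apply: measurable_funM; last by apply: mcomp2; exact: measurable_weight.
  by apply: measurable_funM => //; exact: mcomp2.
have m1 : measurable_fun uball (fun x => \int[nu]_(y in uball) (F^\+ (x, y)))%E.
  apply: (@measurable_tonelli_on _ _ _ _ _ nuf uball uball (F^\+)%E mB mB) => //.
  exact: measurable_funepos.
have m2 : measurable_fun uball (fun x => \int[nu]_(y in uball) (F^\- (x, y)))%E.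
  apply: (@measurable_tonelli_on _ _ _ _ _ nuf uball uball (F^\-)%E mB mB) => //.
  exact: measurable_funeneg.
have E : (fun x => \int[nu]_(y in uball) integrand K b f x y) =
    fine \o (fun x => \int[nu]_(y in uball) (F^\+ (x, y)) - \int[nu]_(y in uball) (F^\- (x, y)))%E.
  apply/funext => x; rewrite /Rintegral /= integralE.
  by congr (fine (_ - _)%E); apply: eq_integral => y _; rewrite ?funeposE ?funenegE.
rewrite E; apply: (measurableT_comp (f := fine)); first exact: fine_measurable.
exact: emeasurable_funB.
Qed.

Let Tf_le x : uball x -> (`|Tf x|%:E <= I x)%E.
Proof.
move=> xB; rewrite /Tf /intop patchE mem_set//.
have fle (X : \bar R) : (`|fine X|%:E <= `|X|)%E by case: X => [r| |]; rewrite /= ?normr0 ?lexx ?leey.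
apply: (le_trans (fle _)).
apply: (le_trans (le_abse_integral nu mB _)); first by apply/measurable_EFinP; exact: mintegrand.
by rewrite abs_integrand.
Qed.

Lemma Lnorm_intop_le : ('N[nu_ beta]_(q%:E)[EFin \o Tf] <=
  ((D / @Vconst R n beta) `^ q^-1 )%:E * 'N[nu_ alpha]_1[EFin \o f])%E.
Proof.
have W0 := Vconst_gt0 n1 beta.
have D0 : 0 <= D by rewrite mulr_ge0 ?powR_ge0.
have key : ('N[nu_ beta]_(q%:E)[EFin \o Tf] `^ q <= (D / @Vconst R n beta * N1 `^ q)%:E)%E.
  rewrite Lnorm_nuq ?gt_eqF//; last exact: measurable_intop.
  have mTq : measurable_fun uball (fun x => `|Tf x| `^ q).
    by apply: measurable_norm_powR; apply: mres; exact: measurable_intop.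
  have E x : `|Tf x| `^ q * (weight beta x / @Vconst R n beta) =
      (@Vconst R n beta)^-1 * (`|Tf x| `^ q * weight beta x) by ring.
  under eq_integral do rewrite E.
  rewrite (integralZlR nu mB); last 3 first.
  - by apply: measurable_funM => //; apply: mres; exact: measurable_weight.
  - by move=> x _; rewrite mulr_ge0 ?powR_ge0.
  - by rewrite invr_ge0 ltW.
  have -> : D / @Vconst R n beta * N1 `^ q = (@Vconst R n beta)^-1 * (D * N1 `^ q) by ring.
  rewrite EFinM lee_wpmul2l//; first by rewrite lee_fin invr_ge0 ltW.
  apply: le_trans Iq2; apply: ge0_le_integral.
  - exact: mB.
  - by move=> x _; rewrite lee_fin mulr_ge0 ?powR_ge0.
  - by apply/measurable_EFinP; apply: measurable_funM => //; apply: mres; exact: measurable_weight.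
  - apply: emeasurable_funM; last by apply/measurable_EFinP; apply: mres; exact: measurable_weight.
    exact: mIq.
  move=> x xB; rewrite EFinM lee_wpmul2r ?lee_fin ?powR_ge0// -poweR_EFin.
  by apply: le_poweR; rewrite ?(ltW q0) ?lee_fin//; exact: Tf_le.
have := le_poweR (_ : 0 <= q^-1) (poweR_ge0 _ _) key.
rewrite -poweRrM divff ?gt_eqF// poweRe1 ?Lnorm_ge0// invr_ge0 (ltW q0) => /(_ isT) /le_trans; apply.
rewrite poweR_EFin powRM ?powR_ge0 ?divr_ge0 ?(ltW W0)// N1E -EFinM -powRrM divff ?gt_eqF// powRr1//.
Qed.

Lemma intop_Lfun : Tf \in Lfun (nu_ beta) q%:E.
Proof.
apply/mem_Lfun; split; first exact: measurable_intop.
apply: (le_lt_trans Lnorm_intop_le); rewrite N1E -EFinM; exact: ltry.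
Qed.

End Fixf.

(** Stated for an abstract kernel, so that R_c and its modulus, which satisfy the same mean bound,
    are both covered. *)
Lemma bounded_of_mean : bounded_intop K b alpha 1 beta q.
Proof.
exists (((@Vconst R n alpha) `^ q * (C * 2 `^ `|(b - alpha) * q|) / @Vconst R n beta) `^ q^-1).
move=> f /mem_Lfun[mf ff]; split.
- exact: ae_integrable_integrand.
- exact: intop_Lfun.
- exact: Lnorm_intop_le.
Qed.

End BoundedOfMean.

Section Sufficiency.
Context {R : realType} {n : nat}.
Hypothesis n1 : (1 < n)%N.
Variable Z : nat -> Rn R n -> Rn R n -> R.
Hypothesis hZ : forall k, is_zonal k (Z k).

Lemma TS_bounded b c alpha beta q : 1 <= q -> -1 < beta ->
  ((alpha < b /\ c <= b + (n%:R + beta) / q - (n%:R + alpha)) \/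
   (alpha <= b /\ c < b + (n%:R + beta) / q - (n%:R + alpha))) ->
  T_bounded Z b c alpha 1 beta q /\ S_bounded Z b c alpha 1 beta q.
Proof.
move=> q1 hb cond; have [C C0 HC] := kernel_mean n1 hZ q1 hb cond.
have mK := measurable_bergman n1 hZ c.
split; apply: (bounded_of_mean n1 _ q1 C0) => //.
- exact: (measurableT_comp (f := @Num.norm R R)).
- by move=> y yB; under eq_integral do rewrite normr_id; exact: HC.
Qed.

End Sufficiency.

(** * Necessity *)

Section TestFunction.
Context {R : realType} {n : nat}.
Hypothesis n1 : (1 < n)%N.
Let n0 : (0 < n)%N. Proof. exact: ltnW. Qed.
Local Notation nu := (@nu R n).
Local Notation sg := (@sigma R n).
Local Notation mu := (@lebesgue_measure R).
Local Notation I01 := (`]0%R, 1%R[%classic : set R).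
Local Notation mS := (@measurable_usphere R n).
Local Notation mB := (@measurable_uball R n).
Local Notation ker := (@zker R n).
Local Notation pone := (fun _ : nat => 1 : R).
Let nuf : {finite_measure set (Rn R n) -> \bar R} := @nuF R n.
Let sgF : {finite_measure set (Rn R n) -> \bar R} := @sigma R n.

Variables (r0 : R) (eta : Rn R n).
Hypotheses (hr0 : 2^-1 <= r0 < 1) (eta1 : usphere eta).
(** The outer radius of the shell lies halfway to the boundary, so that 1 - |y| is comparable with 1
    - r0 throughout. *)
Let r1 := (1 + r0) / 2.

Let bnds : [/\ 0 < r0, r0 < 1, r0 < r1, r1 < 1 & 1 - r1 = (1 - r0) / 2].
Proof.
have h2 : 0 < 2^-1 :> R by rewrite invr_gt0.
by case/andP: hr0 => h h'; rewrite /r1; split; lra.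
Qed.

Let A : set (Rn R n) := [set y | r0 <= enorm y <= r1].
Let J : set R := `[r0, r1]%classic.

Let mJ : measurable J. Proof. exact: measurable_itv. Qed.

Let mA : measurable A.
Proof.
rewrite -[A]setTI (_ : A = enorm @^-1` J); last first.
  by apply/seteqP; split => x; rewrite /A /J /= in_itv.
exact: measurable_enorm.
Qed.

Let AB : A `<=` uball.
Proof. by move=> y /andP[_ h]; have [_ _ _ h1 _] := bnds; exact: le_lt_trans h1. Qed.

Let Apos y : A y -> 0 < enorm y.
Proof. by move=> /andP[h _]; have [h1 _ _ _ _] := bnds; exact: lt_le_trans h. Qed.

Let Adir y : A y -> usphere (direction y).
Proof. by move=> yA; apply: usphere_direction; rewrite gt_eqF// Apos. Qed.

Let dir_sphere (z : Rn R n) : usphere z -> direction z = z.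
Proof. by move=> z1; apply: eq_from_tnth => i; rewrite tnth_mktuple z1 divr1. Qed.

Let JI : J `<=` I01.
Proof.
move=> r; rewrite /J /= !in_itv/= => /andP[h h']; have [h1 h2 h3 h4 _] := bnds.
by rewrite (lt_le_trans h1)//= (le_lt_trans h').
Qed.

(** The radius is frozen at r0, so P depends on the direction of y alone and has mean 1 over every
    sphere of the shell. *)
Let P (y : Rn R n) := ker pone (rdot (direction y) eta) r0.

Let nr0 : `|r0| < 1. Proof. by have [h1 h2 _ _ _] := bnds; rewrite gtr0_norm. Qed.

Let P0 y : A y -> 0 < P y.
Proof. by move=> yA; apply: poisson_gt0 => //; apply: cosine_sphere => //; exact: Adir. Qed.

Let mdir (D : set (Rn R n)) : measurable_fun D (fun y : Rn R n => rdot (direction y) eta).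
Proof.
apply: (measurable_funS measurableT) => //.
apply: (measurableT_comp (f := fun y : Rn R n => rdot y eta)); first exact: measurable_rdot.
exact: measurable_direction.
Qed.

Let mker_dir a kap : pgrow a -> 0 <= kap < 1 ->
  measurable_fun A (fun y => ker a (rdot (direction y) eta) (kap * enorm y)).
Proof.
move=> ga /andP[k0 k1].
rewrite (_ : (fun y => _) = (fun y : Rn R n =>
  @kerLN R n a ((kap * enorm y) * rdot (direction y) eta) ((kap * enorm y) ^+ 2))); last first.
  by apply/funext => y; rewrite kerLN_ker.
have mk : measurable_fun A (fun y : Rn R n => kap * enorm y).
  by apply: measurable_funM => //; apply: (measurable_funS measurableT) => //; exact: measurable_enorm.
apply: (measurable_kerLN n1 ga).
- by apply: measurable_funM => //; exact: mdir.
- exact: (measurableT_comp (f := fun r : R => r ^+ 2)).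
move=> y yA; exists (rdot (direction y) eta), (kap * enorm y); split => //.
  by apply: cosine_sphere => //; exact: Adir.
have h := Apos yA; have h1 : enorm y < 1 := AB yA.
by rewrite ger0_norm ?mulr_ge0 ?(ltW h)// mulr_ilt1 ?(ltW h).
Qed.

Let mP : measurable_fun A P.
Proof.
rewrite (_ : P = (fun y : Rn R n => @kerLN R n pone (r0 * rdot (direction y) eta) (r0 ^+ 2))); last first.
  by apply/funext => y; rewrite kerLN_ker.
apply: (measurable_kerLN n1 (pgrow_cst 1)).
- by apply: measurable_funM => //; exact: mdir.
- exact: measurable_cst.
move=> y yA; exists (rdot (direction y) eta), r0; split => //.
by apply: cosine_sphere => //; exact: Adir.
Qed.

(** On each sphere of the shell the semigroup property merges both kernels into one, at cosine 1 and
    radius r0 kap r. *)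
Let A_polar a kap : pgrow a -> 0 <= kap < 1 ->
  (forall y, A y -> 0 <= ker a (rdot (direction y) eta) (kap * enorm y)) ->
  (\int[nu]_(y in A) (P y * ker a (rdot (direction y) eta) (kap * enorm y))%:E =
   \int[mu]_(r in J) (n%:R * r ^+ n.-1 * ker a 1 (r0 * (kap * r)))%:E)%E.
Proof.
move=> ga hk a0; pose F y := (P y * ker a (rdot (direction y) eta) (kap * enorm y))%:E.
have mF : measurable_fun A F by apply/measurable_EFinP; apply: measurable_funM => //; exact: mker_dir.
have F0 y : A y -> (0 <= F y)%E by move=> yA; rewrite lee_fin mulr_ge0 ?(ltW (P0 yA)) ?a0.
have mFA : measurable_fun uball (F \_ A).
  by apply: (measurable_funS measurableT) => //; exact: (iffLR (measurable_restrictT F mA) mF).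
have FA0 y : uball y -> (0 <= (F \_ A) y)%E by move=> _; rewrite patchE; case: ifPn => // /set_mem /F0.
have -> : (\int[nu]_(y in A) F y = \int[nu]_(y in uball) (F \_ A) y)%E.
  rewrite integral_mkcond [RHS]integral_mkcond; apply: eq_integral => y _.
  rewrite !patchE; case: ifPn => [/set_mem yA|_]; first by rewrite mem_set//; exact: AB.
  by case: ifP.
rewrite (nu_polar_on n1 mFA FA0).
have -> : (\int[mu]_(r in J) (n%:R * r ^+ n.-1 * ker a 1 (r0 * (kap * r)))%:E =
    \int[mu]_(r in I01) ((fun r => (n%:R * r ^+ n.-1 * ker a 1 (r0 * (kap * r)))%:E) \_ J) r)%E.
  rewrite integral_mkcond [RHS]integral_mkcond; apply: eq_integral => y _.
  rewrite !patchE; case: ifPn => [/set_mem yA|_]; first by rewrite mem_set//; exact: JI.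
  by case: ifP.
apply: eq_integral => r /set_mem /in01 /andP[rp rl]; rewrite patchE.
have rA z : usphere z -> A (rscale r z) = J r.
  by move=> z1; rewrite /A /J /= enorm_rscale ?(ltW rp)// z1 mulr1 in_itv.
case: ifPn => [/set_mem rJ|/negP rJ]; last first.
  rewrite (eq_integral (fun=> 0%E)) ?integral0 ?mule0// => z /set_mem z1.
  rewrite patchE memNset// rA// => h; apply: rJ; exact: mem_set.
rewrite (eq_integral (fun z => (ker pone (rdot z eta) r0 * ker a (rdot z eta) (kap * r))%:E)); last first.
  move=> z /set_mem z1; rewrite patchE mem_set ?rA// /F /P direction_rscale// enorm_rscale ?(ltW rp)//.
  by rewrite dir_sphere// z1 mulr1.
have nk : `|kap * r| < 1.
  by case/andP: hk => k0 k1; rewrite ger0_norm ?mulr_ge0 ?(ltW rp)// mulr_ilt1 ?(ltW rp).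
rewrite (sphere_conv n1 (pgrow_cst 1) ga eta1 eta1 nr0 nk) rdot_self// -EFinM.
by congr (_ * _)%:E; apply: ker_ext => k; rewrite mul1r.
Qed.

Let m0 : \bar R := (\int[mu]_(r in J) (n%:R * r ^+ n.-1)%:E)%E.

Let mnr : measurable_fun J (fun r : R => n%:R * r ^+ n.-1).
Proof.
apply: measurable_funM => //; apply: (measurable_funS measurableT) => //; exact: measurable_funX.
Qed.

Let nr_ge0 r : J r -> 0 <= n%:R * r ^+ n.-1.
Proof. by move=> /JI /in01 /andP[h _]; rewrite mulr_ge0// exprn_ge0// ltW. Qed.

Let gdelta : pgrow (fun k : nat => (k == 0%N)%:R : R).
Proof. by apply: pgrow_unS; exact: pgrow_cst. Qed.

Let intP : (\int[nu]_(y in A) (P y)%:E = m0)%E.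
Proof.
have h0 : 0 <= (0 : R) < 1 by rewrite lexx ltr01.
have z1 : `|0 : R| < 1 by rewrite normr0.
have del (y : Rn R n) : A y -> ker (fun k => (k == 0%N)%:R) (rdot (direction y) eta) (0 * enorm y) = 1.
  by move=> yA; rewrite mul0r ker_delta//; apply: cosine_sphere => //; exact: Adir.

have pos (y : Rn R n) : A y -> 0 <= ker (fun k => (k == 0%N)%:R) (rdot (direction y) eta) (0 * enorm y).
  by move=> yA; rewrite del.
have := A_polar gdelta h0 pos.
rewrite (eq_integral (fun y => (P y)%:E)); last by move=> y /set_mem yA; rewrite del ?mulr1.
move=> ->; apply: eq_integral => r _; rewrite mul0r mulr0 ker_delta ?mulr1//.
exact: cosine1.
Qed.

Let m0_gt0 : (0 < m0)%E.
Proof.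
have [h1 h2 h3 h4 _] := bnds.
apply: (@lt_le_trans _ _ (\int[mu]_(r in J) (n%:R * r0 ^+ n.-1)%:E)%E); last first.
  apply: (le_integralR mu mJ) => //.
  - by move=> r _; rewrite mulr_ge0// exprn_ge0// ltW.
  - move=> r; rewrite /J /= in_itv/= => /andP[h _]; rewrite ler_wpM2l// lerXn2r ?nnegrE ?(ltW h1)//.
    exact: (le_trans (ltW h1) h).
rewrite integral_cst//= lebesgue_measure_itv/= lte_fin h3 -EFinD -EFinM lte_fin.
by rewrite mulr_gt0 ?subr_gt0// mulr_gt0 ?ltr0n// exprn_gt0.
Qed.

Let m0_fin : (m0 < +oo)%E.
Proof.
have [h1 h2 h3 h4 _] := bnds.
apply: (@le_lt_trans _ _ (\int[mu]_(r in J) (n%:R)%:E)%E).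
  apply: (le_integralR mu mJ) => //.
  move=> r /JI /in01 /andP[h h']; rewrite ler_piMr// exprn_ile1// ltW//.
by rewrite integral_cst//= lebesgue_measure_itv/= lte_fin h3 -EFinD -EFinM ltry.
Qed.

Let mm := fine m0.
Let m0E : (m0 = mm%:E)%E. Proof. by rewrite fineK// ge0_fin_numE ?(ltW m0_gt0). Qed.
Lemma testf_mass_gt0 : 0 < mm.
Proof. by rewrite -lte_fin -m0E m0_gt0. Qed.

Let mm0 : 0 < mm := testf_mass_gt0.

Variables (b c : R).

Definition testf (y : Rn R n) : R := (P \_ A) y * weight (- b) y.

Lemma measurable_testf : measurable_fun setT testf.
Proof.
apply: measurable_funM; last exact: measurable_weight.
exact: (iffLR (measurable_restrictT P mA) mP).
Qed.

(** One factor 2^|alpha-b| passes from 1 - |y|^2 to 1 - |y|, the other from 1 - |y| to 1 - r0; [mm]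
    is the integral of P over the shell. *)
Lemma testf_norm alpha : ('N[nu_ alpha]_1[EFin \o testf] <=
  (2 `^ `|alpha - b| * 2 `^ `|alpha - b| / @Vconst R n alpha * (1 - r0) `^ (alpha - b) * mm)%:E)%E.
Proof.
have [h1 h2 h3 h4 h5] := bnds.
have V0 := Vconst_gt0 n1 alpha.
rewrite (Lnorm_nu1 _ measurable_testf).
set k := _ / _ * _; have k0 : 0 <= k by rewrite !mulr_ge0 ?powR_ge0 ?invr_ge0 ?(ltW V0).
rewrite EFinM -m0E -intP -(integralZlR nu mA mP (fun y yA => ltW (P0 yA)) k0).
have -> : (\int[nu]_(x in uball) (`|testf x| * (weight alpha x / @Vconst R n alpha))%:E =
    \int[nu]_(y in A) (P y * (weight (alpha - b) y / @Vconst R n alpha))%:E)%E.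
  rewrite integral_mkcond [RHS]integral_mkcond; apply: eq_integral => y _.
  rewrite !patchE /testf patchE; case: ifPn => [yB|yB]; case: ifPn => yA.
  - congr EFin; rewrite normrM (ger0_norm (powR_ge0 _ _)) gtr0_norm; last by apply: P0; exact: set_mem.
    rewrite -!mulrA; congr (_ * _); rewrite mulrA; congr (_ / _).
    by rewrite -weightD; [congr weight; ring|exact: set_mem].
  - by rewrite mul0r normr0 mul0r.
  - by case/negP: yB; apply: mem_set; apply: AB; exact: set_mem.
  - by [].
apply: (le_integralR nu mA).
- apply: measurable_funM => //; apply: measurable_funM => //.
  by apply: (measurable_funS measurableT) => //; exact: measurable_weight.
- by apply: measurable_funM.
- by move=> y yA; rewrite !mulr_ge0 ?powR_ge0 ?invr_ge0 ?(ltW V0) ?(ltW (P0 yA)).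
move=> y yA; rewrite mulrC ler_wpM2r ?(ltW (P0 yA))// /k mulrAC ler_wpM2r ?invr_ge0 ?(ltW V0)//.
apply: (le_trans (weight_le _ (AB yA))); rewrite -mulrA ler_wpM2l ?powR_ge0//.
have r00 : 0 < 1 - r0 by lra.
have -> : 1 - enorm y = (1 - enorm y) / (1 - r0) * (1 - r0) by rewrite divfK// gt_eqF.
have t2 : 2^-1 <= (1 - enorm y) / (1 - r0) <= 2.
  case/andP: yA => e1 e2; rewrite ler_pdivlMr// ler_pdivrMr//; apply/andP; split; last lra.
  by rewrite mulrC; move: h5; lra.
rewrite powRM ?(ltW r00)//; last by case/andP: t2 => t2 _; rewrite (le_trans _ t2)// invr_ge0.
by rewrite ler_wpM2r ?powR_ge0//; case/andP: (powR_half2 (alpha - b) t2).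
Qed.

(** [K] stands for R_c or its modulus; besides measurability, the two comparisons below are all that
    the lower bound asks of it. *)
Variables (Z : nat -> Rn R n -> Rn R n -> R) (K : Rn R n -> Rn R n -> R).
Hypothesis hZ : forall k, is_zonal k (Z k).
Local Notation Rc := (bergman_besov Z c).
Hypothesis mK : measurable_fun (uball `*` uball) (fun p : Rn R n * Rn R n => K p.1 p.2).
Hypotheses (KR : forall x y, uball x -> uball y -> Rc x y <= K x y).
Hypotheses (KN : forall x y, uball x -> uball y -> `|K x y| <= `|Rc x y|).

Let M := Ssum (n := n) c r1.

Let hr1 : 0 <= r1 < 1. Proof. by have [h1 _ h3 h4 _] := bnds; rewrite (ltW (lt_trans h1 h3)). Qed.

Let M1 : 1 <= M. Proof. exact: Ssum_ge1. Qed.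
Let M0 : 0 <= M. Proof. exact: le_trans M1. Qed.

(** Adding the bound M makes the kernel nonnegative on the shell, as Tonelli and the polar formula
    require; among the multipliers only that of degree 0 changes. *)
Let gM (k : nat) : R := gamma_coef n c k + M * (k == 0%N)%:R.

Let ggM : pgrow gM.
Proof.
apply: pgrowD; first exact: pgrow_gamma_coef.
by apply: pgrowM => //; exact: pgrow_cst.
Qed.

Let kerM (t y : R) : @cosine R n t -> `|y| < 1 -> ker gM t y = ker (@gamma_coef R n c) t y + M.
Proof.
move=> ht hy; rewrite -[X in _ + X]mulr1 -(ker_delta n1 ht hy) /zker -psumZ//; last exact: pgrow_ker.
rewrite -psumD//.
- by congr psum; apply/funext => k; rewrite /gM; ring.
- by apply: pgrow_ker => //; exact: pgrow_gamma_coef.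
- by apply: pgrowM; [exact: pgrow_cst|exact: pgrow_ker].
Qed.

Let ker_le (t y : R) : @cosine R n t -> `|y| <= r1 -> `|ker (@gamma_coef R n c) t y| <= M.
Proof.
move=> ht hy; case/andP: hr1 => _ r11; apply: psum_norm => //.
  by apply: pgrowM; [exact: pgrow_gamma_coef|exact: pgrow_dimH].
move=> k; have g0 : 0 <= gamma_coef n c k * @dimH R n k by rewrite mulr_ge0 ?ltW ?gamma_coef_gt0 ?dimH_gt0.
by rewrite normrM (ger0_norm g0) ler_piMr// gegenR_le1.
Qed.

Let Rc_ker rho (z y : Rn R n) : 0 <= rho < 1 -> usphere z -> A y ->
  Rc (rscale rho z) y = ker (@gamma_coef R n c) (rdot z (direction y)) (rho * enorm y) /\
  `|rho * enorm y| <= r1.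
Proof.
move=> /andP[p0 p1] z1 yA; have e0 := Apos yA; split.
  by rewrite -{1}[y]rscale_direction (bergman_rscale n1 hZ c p0 (ltW e0) z1 (Adir yA)).
case/andP: yA => _ e1; rewrite ger0_norm ?mulr_ge0 ?(ltW e0)// (le_trans _ e1)//.
by rewrite ler_piMl ?(ltW e0)// ltW.
Qed.

Let Tf := intop K b testf.

(** Since K >= R_c, the function P K + M P dominates P (R_c + M); |K| <= M on the shell makes both
    terms integrable, so the integral splits. The weight in [testf] cancels that of the operator. *)
Let Tf_test rho (z : Rn R n) : 0 <= rho < 1 -> usphere z ->
  (\int[nu]_(y in A) (P y * (Rc (rscale rho z) y + M))%:E <= (`|Tf (rscale rho z)| + M * mm)%:E)%E.
Proof.
move=> hrho z1; set x := rscale rho z; have xB : uball x by exact: uball_rscale.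
have Rb y : A y -> `|Rc x y| <= M.
  move=> yA; have [-> h] := Rc_ker hrho z1 yA; apply: ker_le => //.
  by apply: cosine_sphere => //; exact: Adir.
have mKx : measurable_fun A (fun y => K x y).
  apply: (measurable_comp (F := uball `*` uball) (f := fun p : Rn R n * Rn R n => K p.1 p.2)
    (g := fun y => (x, y))).
  - by apply: measurableX; exact: mB.
  - by move=> _ [y hy <-]; split => //; exact: AB.
  - exact: mK.
  - by apply: (measurable_funS measurableT) => //; apply/measurable_fun_pair.
have mRx : measurable_fun A (fun y => Rc x y).
  by apply: (measurable_funS mB AB); exact: (measurable_bergman_r n1 hZ).
have iP : nu.-integrable A (EFin \o P).
  apply/integrableP; split; first exact/measurable_EFinP.
  rewrite (eq_integral (fun y => (P y)%:E)) ?intP// => y /set_mem yA.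
  by rewrite /= gtr0_norm// P0.
have iM : nu.-integrable A (fun y => (M * P y)%:E).
  rewrite (_ : (fun y => _) = (fun y => (M%:E * (EFin \o P) y)%E)); last by apply/funext => y; rewrite /= EFinM.
  by apply: integrableZl.
have mPK : measurable_fun A (fun y => P y * K x y) by exact: measurable_funM.
have iK : nu.-integrable A (fun y => (P y * K x y)%:E).
  apply: (le_integrable mA _ _ iM); first exact/measurable_EFinP.
  move=> y yA; rewrite !abse_EFin lee_fin normrM [leRHS]ger0_norm ?mulr_ge0 ?(ltW (P0 yA))// mulrC.
  rewrite (gtr0_norm (P0 yA)) ler_wpM2r ?(ltW (P0 yA))//.
  by rewrite (le_trans (KN xB (AB yA)))// Rb.
apply: (@le_trans _ _ (\int[nu]_(y in A) ((P y * K x y)%:E + (M * P y)%:E))%E).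
  apply: ge0_le_integral.
  - exact: mA.
  - move=> y yA; rewrite lee_fin mulr_ge0 ?(ltW (P0 yA))//.
    by have := Rb y yA; rewrite ler_norml; lra.
  - by apply/measurable_EFinP; apply: measurable_funM => //; exact: measurable_funD.
  - apply: emeasurable_funD; apply/measurable_EFinP => //; exact: measurable_funM.
  move=> y yA; rewrite -EFinD lee_fin mulrDr [M * _]mulrC lerD2r ler_wpM2l ?(ltW (P0 yA))//.
  by apply: KR => //; exact: AB.
rewrite (integralD mA iK iM) (integralZlR nu mA mP (fun y yA => ltW (P0 yA)) M0) intP m0E -EFinM EFinD.
apply: leeD => //.
have EQ : (\int[nu]_(y in A) (P y * K x y)%:E = \int[nu]_(y in uball) (integrand K b testf x y)%:E)%E.
  rewrite integral_mkcond [RHS]integral_mkcond; apply: eq_integral => y _.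
  rewrite !patchE /integrand /testf patchE; case: ifPn => [yA|yA].
    have yB : uball y by apply: AB; exact: set_mem.
    rewrite mem_set//; congr EFin; rewrite mulrA -!mulrA -weightD// addNr /weight powRr0 mulr1.
    by rewrite mulrC.
  by case: ifP => // _; rewrite mul0r mulr0 mul0r.
have fin : (\int[nu]_(y in uball) (integrand K b testf x y)%:E)%E \is a fin_num.
  rewrite -EQ.
  exact: (integrable_fin_num mA (iK : nu.-integrable A (EFin \o (fun y => P y * K x y)))).
rewrite EQ -(fineK fin) lee_fin /Tf /intop patchE mem_set//.
exact: ler_norm.
Qed.

(** Tonelli brings the integral in z inside, where the semigroup property yields one kernel at
    radius rho rho' |y|; [A_polar] then reaches cosine 1, and |y| >= r0 with the monotonicity of
    [Ssum] gives the argument. *)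
Lemma test_lower rho rho' : 0 <= rho < 1 -> 0 <= rho' < 1 ->
  ((Ssum (n := n) c (r0 * (rho * rho' * r0)) * mm)%:E <=
   \int[sg]_(z in usphere) (`|Tf (rscale rho z)| * ker pone (rdot z eta) rho')%:E)%E.
Proof.
move=> hrho hrho'; have [h1 h2 h3 h4 _] := bnds.
have [p0 p1] := andP hrho; have [p0' p1'] := andP hrho'.
have np' : `|rho'| < 1 by rewrite ger0_norm.
have hk : 0 <= rho * rho' < 1 by rewrite mulr_ge0//= mulr_ilt1.
have mTz : measurable_fun usphere (fun z => `|Tf (rscale rho z)|).
  apply: (measurableT_comp (f := @Num.norm R R)) => //.
  apply: (measurable_funS measurableT) => //.
  apply: (measurableT_comp (f := Tf)); first exact: (measurable_intop b mK measurable_testf).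
  exact: measurable_rscale.
have mP' : measurable_fun usphere (fun z => ker pone (rdot z eta) rho').
  by apply: measurable_ker_sphere => //; exact: pgrow_cst.
have P'0 z : usphere z -> 0 < ker pone (rdot z eta) rho'.
  by move=> z1; apply: poisson_gt0 => //; exact: cosine_sphere.
pose F (p : Rn R n * Rn R n) := (P p.2 * ker gM (rdot p.1 (direction p.2)) (rho * enorm p.2) * ker pone (rdot p.1 eta) rho')%:E.
have kM0 (t y : R) : @cosine R n t -> `|y| <= r1 -> 0 <= ker gM t y.
  move=> ht hy; have ny : `|y| < 1 by exact: le_lt_trans h4.
  by rewrite kerM//; have := ker_le ht hy; rewrite ler_norml; lra.
have cz z y : usphere z -> A y -> @cosine R n (rdot z (direction y)).
  by move=> z1 yA; apply: cosine_sphere => //; exact: Adir.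
have F0 p : (usphere `*` A) p -> (0 <= F p)%E.
  move=> [z1 yA]; rewrite lee_fin !mulr_ge0 ?(ltW (P0 yA)) ?(ltW (P'0 _ z1))//.
  by apply: kM0; [exact: cz|have [] := Rc_ker hrho z1 yA].
have mF : measurable_fun (usphere `*` A) F.
  apply/measurable_EFinP; apply: measurable_funM; last first.
    apply: (measurable_comp (F := usphere) (f := fun z => ker pone (rdot z eta) rho')) => //.
    - exact: mS.
    - by move=> _ [[z y] [/= z1 _] <-].
    - by apply: (measurable_funS measurableT) => //; exact: measurable_fst.
  apply: measurable_funM.
    apply: (measurable_comp (F := A) (f := P)) => //.
    - by move=> _ [[z y] [/= _ yA] <-].
    - by apply: (measurable_funS measurableT) => //; exact: measurable_snd.
  rewrite (_ : (fun p => _) = (fun p : Rn R n * Rn R n =>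
    @kerLN R n gM ((rho * enorm p.2) * rdot p.1 (direction p.2)) ((rho * enorm p.2) ^+ 2))); last first.
    by apply/funext => p; rewrite kerLN_ker.
  have mr : measurable_fun (usphere `*` A) (fun p : Rn R n * Rn R n => rho * enorm p.2).
    apply: measurable_funM => //; apply: (measurable_funS measurableT) => //.
    by apply: (measurableT_comp (f := @enorm R n)); [exact: measurable_enorm|exact: measurable_snd].
  apply: (measurable_kerLN n1 ggM).
  - apply: measurable_funM => //; apply: (measurable_funS measurableT) => //.
    apply: (measurableT_comp (f := fun p : Rn R n * Rn R n => rdot p.1 p.2) (g := fun p : Rn R n * Rn R n => (p.1, direction p.2))).
      exact: measurable_rdot2.
    apply/measurable_fun_pair; first exact: measurable_fst.
    by apply: (measurableT_comp (f := @direction R n)); [exact: measurable_direction|exact: measurable_snd].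
  - exact: (measurableT_comp (f := fun r : R => r ^+ 2)).
  move=> [z y] [/= z1 yA]; exists (rdot z (direction y)), (rho * enorm y); split => //; first exact: cz.
  by have [_ h] := Rc_ker hrho z1 yA; exact: le_lt_trans h4.
have T := @tonelli_on _ _ _ _ _ sgF nuf usphere A F mS mA mF F0.
have inner y : A y -> (\int[sg]_(z in usphere) F (z, y) =
   (P y * ker gM (rdot (direction y) eta) (rho * rho' * enorm y))%:E)%E.
  move=> yA; have nry : `|rho * enorm y| < 1.
    by have [_ h] := Rc_ker hrho eta1 yA; exact: le_lt_trans h4.
  have C := sphere_conv n1 ggM (pgrow_cst 1) (Adir yA) eta1 nry np'.
  transitivity (\int[sg]_(z in usphere) ((P y)%:E * (ker gM (rdot z (direction y)) (rho * enorm y) * ker pone (rdot z eta) rho')%:E))%E.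
    by apply: eq_integral => z _; rewrite /F /= -EFinM mulrA.
  rewrite ge0_integralZl//; last 4 first.
  - exact: mS.
  - apply/measurable_EFinP; apply: measurable_funM => //.
    by apply: measurable_ker_sphere => //; exact: Adir.
  - move=> z z1; rewrite lee_fin mulr_ge0 ?(ltW (P'0 _ z1))//.
    by apply: kM0; [exact: cz|have [] := Rc_ker hrho z1 yA].
  - by rewrite lee_fin ltW// P0.
  rewrite C -EFinM; congr (_ * _)%:E.
  rewrite (_ : rho * enorm y * rho' = rho * rho' * enorm y); last ring.
  by apply: ker_ext => k; rewrite mulr1.
have low : (((Ssum (n := n) c (r0 * (rho * rho' * r0)) + M) * mm)%:E <=
    \int[nu]_(y in A) (P y * ker gM (rdot (direction y) eta) (rho * rho' * enorm y))%:E)%E.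
  rewrite A_polar//; last first.
    move=> y yA; apply: kM0; first by apply: cosine_sphere => //; exact: Adir.
    by have [_ h] := Rc_ker hk eta1 yA.
  rewrite EFinM -m0E /m0.
  have k0 : 0 <= Ssum (n := n) c (r0 * (rho * rho' * r0)) + M.
    rewrite addr_ge0// (le_trans ler01)// Ssum_ge1// !mulr_ge0 ?(ltW h1)//=.
    by rewrite mulr_ilt1 ?mulr_ge0 ?(ltW h1)// mulr_ilt1 ?mulr_ge0 ?(ltW h1)//; case/andP: hk.
  rewrite -(integralZlR mu mJ mnr nr_ge0 k0).
  have ks r : J r -> [/\ 0 <= r0 * (rho * rho' * r0), r0 * (rho * rho' * r0) <= r0 * (rho * rho' * r), r0 * (rho * rho' * r) <= r1 & r0 * (rho * rho' * r) < 1].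
    move=> rJ; have /in01 /andP[q0 q1] := JI rJ; move: rJ; rewrite /J /= in_itv/= => /andP[e1 e2].
    case/andP: hk => k0' k1.
    have s1 : rho * rho' * r <= r1 by rewrite (le_trans _ e2)// ler_piMl ?(ltW q0)// ltW.
    have s2 : r0 * (rho * rho' * r) <= r1.
      by rewrite (le_trans _ s1)// ler_piMl ?mulr_ge0 ?(ltW q0)// ltW.
    split=> //.
    - by rewrite !mulr_ge0 ?(ltW h1).
    - by rewrite ler_wpM2l ?(ltW h1)// ler_wpM2l.
    - exact: le_lt_trans h4.
  apply: (@le_trans _ _ (\int[mu]_(r in J) (n%:R * r ^+ n.-1 * (Ssum (n := n) c (r0 * (rho * rho' * r)) + M))%:E)%E).
    have cc := @cosine1 R n n1.
    apply: ge0_le_integral.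
    - exact: mJ.
    - by move=> r rJ; rewrite lee_fin mulr_ge0 ?nr_ge0.
    - by apply/measurable_EFinP; apply: measurable_funM.
    - apply/measurable_EFinP; apply: measurable_funM => //; apply: measurable_funD => //.
      under eq_fun do rewrite -(ker_gamma_1 n1).
      rewrite (_ : (fun r => _) = (fun r : R => @kerLN R n (@gamma_coef R n c) ((r0 * (rho * rho' * r)) * 1) ((r0 * (rho * rho' * r)) ^+ 2))); last first.
        by apply/funext => r; rewrite kerLN_ker.
      have mq : measurable_fun J (fun r : R => r0 * (rho * rho' * r)).
        by apply: measurable_funM => //; apply: measurable_funM.
      apply: (measurable_kerLN n1 (pgrow_gamma_coef n1 c)).
      + exact: measurable_funM.
      + exact: (measurableT_comp (f := fun r : R => r ^+ 2)).
      move=> r rJ; exists 1, (r0 * (rho * rho' * r)); split=> //.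
      by have [s0 s1 s2 s3] := ks r rJ; rewrite ger0_norm// (le_trans s0).
    move=> r rJ; rewrite lee_fin mulrC ler_wpM2l ?nr_ge0// lerD2r.
    by have [s0 s1 s2 s3] := ks r rJ; exact: Ssum_homo.
  rewrite le_eqVlt; apply/orP; left; apply/eqP; apply: eq_integral => r /set_mem rJ.
  have [s0 s1 s2 s3] := ks r rJ; rewrite kerM ?ker_gamma_1//; first exact: cosine1.
  by rewrite ger0_norm// (le_trans s0).
(* The constant M contributes M mm on both sides, because the Poisson kernel has mean 1; it is
   restored here so that nonnegative integrals can be compared. *)
rewrite -(@leeD2rE _ (M * mm)%:E)// -EFinD -mulrDl; apply: (le_trans low).
have -> : ((M * mm)%:E = \int[sg]_(z in usphere) (M * mm * ker pone (rdot z eta) rho')%:E)%E.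
  rewrite (integralZlR sg mS mP' (fun z z1 => ltW (P'0 z z1))); last by rewrite mulr_ge0// ltW.
  by rewrite (sphere_ker n1 (pgrow_cst 1) eta1 np') mule1.
rewrite -(integralDR sg mS); last 4 first.
- exact: measurable_funM.
- by move=> z z1; rewrite mulr_ge0 ?(ltW (P'0 _ z1)).
- exact: measurable_funM.
- by move=> z z1; rewrite !mulr_ge0 ?(ltW mm0) ?(ltW (P'0 _ z1)).
have -> : (\int[nu]_(y in A) (P y * ker gM (rdot (direction y) eta) (rho * rho' * enorm y))%:E =
   \int[nu]_(y in A) \int[sg]_(z in usphere) F (z, y))%E.
  by apply: eq_integral => y /set_mem yA; rewrite inner.
rewrite -[leLHS]T.
apply: ge0_le_integral.
- exact: mS.
- by move=> z z1; apply: integral_ge0 => y yA; exact: F0.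
- exact: (@measurable_tonelli_on _ _ _ _ _ nuf usphere A F mS mA mF F0).
- by apply/measurable_EFinP; apply: measurable_funD; exact: measurable_funM.
move=> z z1; rewrite -mulrDl EFinM muleC.
have E y : A y -> F (z, y) = (ker pone (rdot z eta) rho' * (P y * (Rc (rscale rho z) y + M)))%:E.
  move=> yA; have [-> h] := Rc_ker hrho z1 yA; rewrite /F /= kerM; last exact: le_lt_trans h4.
    by congr EFin; ring.
  exact: cz.
rewrite (eq_integral (fun y => (ker pone (rdot z eta) rho' * (P y * (Rc (rscale rho z) y + M)))%:E)); last first.
  by move=> y /set_mem yA; rewrite -E.
rewrite (integralZlR nuf mA); last 3 first.
- apply: measurable_funM => //; apply: measurable_funD => //.
  by apply: (measurable_funS mB AB); apply: (measurable_bergman_r n1 hZ); exact: uball_rscale.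
- move=> y yA; rewrite mulr_ge0 ?(ltW (P0 yA))//; have [-> h] := Rc_ker hrho z1 yA.
  by have := ker_le (cz _ _ z1 yA) h; rewrite ler_norml; lra.
- by rewrite ltW// P'0.
by apply: lee_wpmul2l; [rewrite lee_fin ltW// P'0|exact: Tf_test].
Qed.

End TestFunction.

(** * The one-dimensional inequality and its consequences for the parameters *)

Section Necessity.
Context {R : realType} {n : nat}.
Hypothesis n1 : (1 < n)%N.
Let n0 : (0 < n)%N. Proof. exact: ltnW. Qed.
Local Notation nu := (@nu R n).
Local Notation sg := (@sigma R n).
Local Notation mu := (@lebesgue_measure R).
Local Notation I01 := (`]0%R, 1%R[%classic : set R).
Local Notation mS := (@measurable_usphere R n).
Local Notation mB := (@measurable_uball R n).
Local Notation ker := (@zker R n).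
Local Notation Ssum := (@Ssum R n).

Let mI : measurable I01. Proof. exact: measurable_itv. Qed.

Lemma measurable_Ssum (D : set R) c (u : R -> R) : measurable_fun D u -> (forall r, D r -> 0 <= u r < 1) ->
  measurable_fun D (fun r => Ssum c (u r)).
Proof.
move=> mu0 h; have cc := @cosine1 R n n1.
rewrite (_ : (fun r => _) = (fun r : R => @kerLN R n (@gamma_coef R n c) (u r * 1) (u r ^+ 2))); last first.
  by apply/funext => r; rewrite kerLN_ker ker_gamma_1.
apply: (measurable_kerLN n1 (pgrow_gamma_coef n1 c)).
- exact: measurable_funM.
- exact: (measurableT_comp (f := fun r : R => r ^+ 2)).
move=> r rD; exists 1, (u r); split=> //.
by have /andP[u0 u1] := h r rD; rewrite ger0_norm.
Qed.

(** Radial integrand of the lower bound for the q-th power of the norm. The argument r0^3 rho^2 is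
    that of [test_lower] with rho' = r0 rho, and (1 - r0 rho)^(n-1) comes from the maximum of the
    Poisson kernel. *)
Definition lowint (c beta q r0 rho : R) : R :=
  n%:R * rho ^+ n.-1 * (1 - rho ^+ 2) `^ beta *
  ((1 - r0 * rho) `^ (n%:R - 1) * Ssum c (r0 ^+ 3 * rho ^+ 2) `^ q).

Let arg_bnd (r0 rho : R) : 0 <= r0 < 1 -> 0 <= rho <= 1 -> 0 <= r0 ^+ 3 * rho ^+ 2 < 1.
Proof.
move=> /andP[r00 r01] /andP[p0 p1]; rewrite mulr_ge0 ?exprn_ge0//=.
apply: (@le_lt_trans _ _ (r0 ^+ 3)); last by rewrite exprn_ilt1.
by rewrite ler_piMr ?exprn_ge0// exprn_ile1.
Qed.

Let I01b (rho : R) : I01 rho -> 0 <= rho <= 1.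
Proof. by move=> /in01 /andP[p0 p1]; rewrite !ltW. Qed.

Lemma measurable_lowint c beta q r0 : 0 <= r0 < 1 -> measurable_fun I01 (lowint c beta q r0).
Proof.
move=> hr0.
have mX k : measurable_fun I01 (fun r : R => r ^+ k).
  by apply: (measurable_funS measurableT) => //; exact: measurable_funX.
have mp a (u : R -> R) : measurable_fun I01 u -> measurable_fun I01 (fun r => u r `^ a).
  by move=> mu0; apply: (measurableT_comp (f := fun r : R => r `^ a)) => //; exact: measurable_powR.
apply: measurable_funM; first apply: measurable_funM; first by apply: measurable_funM.
- by apply: mp; apply: measurable_funB.
- apply: measurable_funM; first by apply: mp; apply: measurable_funB => //; exact: measurable_funM.
  apply: mp; apply: measurable_Ssum; first exact: measurable_funM.
  by move=> r /I01b h; exact: arg_bnd.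
Qed.

Lemma lowint_ge0 c beta q r0 rho : I01 rho -> 0 <= lowint c beta q r0 rho.
Proof. by move=> /in01 /andP[p0 _]; rewrite !mulr_ge0 ?powR_ge0// exprn_ge0// ltW. Qed.

Section Key.
Variables (Z : nat -> Rn R n -> Rn R n -> R) (K : Rn R n -> Rn R n -> R) (b c alpha beta q : R).
Hypothesis hZ : forall k, is_zonal k (Z k).
Local Notation Rc := (bergman_besov Z c).
Hypothesis mK : measurable_fun (uball `*` uball) (fun p : Rn R n * Rn R n => K p.1 p.2).
Hypotheses (KR : forall x y, uball x -> uball y -> Rc x y <= K x y).
Hypotheses (KN : forall x y, uball x -> uball y -> `|K x y| <= `|Rc x y|).
Hypotheses (q1 : 1 <= q) (hK : bounded_intop K b alpha 1 beta q).

(** Jensen for the Poisson kernel, a probability density on the sphere, turns the pairing into a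
    q-th mean of |Tf|; integration in rho against the weight reaches the norm of Tf, which is
    bounded by that of f. *)
Lemma lowint_bound : exists2 C : R, 0 <= C & forall r0, 2^-1 <= r0 < 1 ->
  (\int[mu]_(rho in I01) (lowint c beta q r0 rho)%:E <= (C * (1 - r0) `^ (- ((b - alpha) * q)))%:E)%E.
Proof.
have q0 : 0 < q by exact: lt_le_trans q1.
have [eta eta1] := @usphere_nonempty R n n1.
have [C0 HC0] := hK.
pose k : R := 2 `^ `|alpha - b| * 2 `^ `|alpha - b| / @Vconst R n alpha.
have V0 := Vconst_gt0 n1 alpha; have W0 := Vconst_gt0 n1 beta.
have k0 : 0 <= k by rewrite !mulr_ge0 ?powR_ge0 ?invr_ge0 ?(ltW V0).
exists (2 * @Vconst R n beta * (`|C0| * k) `^ q).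
  by rewrite !mulr_ge0 ?powR_ge0 ?(ltW W0).
move=> r0 hr0.
have h2 : 0 < 2^-1 :> R by rewrite invr_gt0.
have r00 : 0 < r0 by case/andP: hr0 => h _; exact: lt_le_trans h.
have r01 : r0 < 1 by case/andP: hr0.
have r0' : 0 <= r0 < 1 by rewrite (ltW r00).
pose f := testf r0 eta b.
have mf : measurable_fun setT f := measurable_testf n1 hr0 eta1 b.
(* Only positivity of the mass [mm] is retained: it enters both the lower bound and the norm of f,
   to the power q, and cancels. *)
have [mm [mm0 fN TL]] : exists mm : R, [/\ 0 < mm,
   ('N[nu_ alpha]_1[EFin \o f] <= (k * (1 - r0) `^ (alpha - b) * mm)%:E)%E &
   forall rho rho', 0 <= rho < 1 -> 0 <= rho' < 1 ->
     ((Ssum c (r0 * (rho * rho' * r0)) * mm)%:E <=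
     \int[sg]_(z in usphere) (`|intop K b f (rscale rho z)| * ker (fun=> 1) (rdot z eta) rho')%:E)%E].
  eexists; split; [exact: (testf_mass_gt0 n1 hr0)|exact: (testf_norm n1 hr0 eta1 b alpha)|].
  by move=> rho rho' h h'; exact: (test_lower n1 hr0 eta1 b hZ mK KR KN h h').
have fL : f \in Lfun (nu_ alpha) 1%E.
  by apply/mem_Lfun; split => //; apply: (le_lt_trans fN); exact: ltry.
have [_ _ HT] := HC0 f fL.
set Tf := intop K b f in HT TL *.
have mT : measurable_fun setT Tf by exact: (measurable_intop b mK mf).
pose X := `|C0| * (k * (1 - r0) `^ (alpha - b) * mm).
have X0 : 0 <= X.
  apply: mulr_ge0; first exact: normr_ge0.
  by apply: mulr_ge0; [apply: mulr_ge0; [|exact: powR_ge0]|exact: ltW].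
have NT : ('N[nu_ beta]_(q%:E)[EFin \o Tf] <= X%:E)%E.
  apply: (le_trans HT); rewrite /X EFinM; apply: (@le_trans _ _ (`|C0|%:E * 'N[nu_ alpha]_1[EFin \o f])%E).
    by rewrite lee_wpmul2r ?Lnorm_ge0// lee_fin ler_norm.
  by rewrite lee_wpmul2l// lee_fin.
have NTq : (\int[nu]_(x in uball) (`|Tf x| `^ q * (weight beta x / @Vconst R n beta))%:E <= (X `^ q)%:E)%E.
  rewrite -Lnorm_nuq ?gt_eqF// -poweR_EFin; apply: le_poweR => //; first exact: ltW.
  exact: Lnorm_ge0.
pose F x := (`|Tf x| `^ q * (weight beta x / @Vconst R n beta))%:E.
have mTq : measurable_fun uball (fun x => `|Tf x| `^ q).
  by apply: measurable_norm_powR; exact: (measurable_funS measurableT).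
have mF : measurable_fun uball F.
  apply/measurable_EFinP; apply: measurable_funM => //.
  by apply: (measurable_funS measurableT) => //; exact: measurable_nu_density.
have F0 x : uball x -> (0 <= F x)%E by move=> _; rewrite lee_fin mulr_ge0 ?powR_ge0 ?nu_density_ge0.
rewrite (nu_polar_on n1 mF F0) in NTq.
have pw rho : I01 rho -> ((mm `^ q / (2 * @Vconst R n beta) * lowint c beta q r0 rho)%:E <=
   (n%:R * rho ^+ n.-1)%:E * \int[sg]_(z in usphere) F (rscale rho z))%E.
  move=> rI; have /andP[p0 p1] := in01 rI.
  have hrho : 0 <= rho < 1 by rewrite (ltW p0).
  have hrho' : 0 <= r0 * rho < 1 by rewrite mulr_ge0 ?ltW//= mulr_ilt1 ?ltW.
  have nr : `|r0 * rho| < 1 by case/andP: hrho' => ? ?; rewrite ger0_norm.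
  set S := Ssum c (r0 ^+ 3 * rho ^+ 2).
  have S1 : 1 <= S by apply: Ssum_ge1 => //; apply: arg_bnd => //; exact: I01b.
  have L0 : 0 < 1 - r0 * rho by rewrite subr_gt0; case/andP: hrho'.
  pose g (z : Rn R n) := `|Tf (rscale rho z)|.
  pose Pk (z : Rn R n) := ker (fun=> 1) (rdot z eta) (r0 * rho).
  have mg : measurable_fun usphere g.
    apply: (measurableT_comp (f := @Num.norm R R)) => //; apply: (measurable_funS measurableT) => //.
    by apply: (measurableT_comp (f := Tf)) => //; exact: measurable_rscale.
  have mPk : measurable_fun usphere Pk by apply: measurable_ker_sphere => //; exact: pgrow_cst.
  have Pk0 z : usphere z -> 0 <= Pk z by move=> z1; apply/ltW/poisson_gt0 => //; exact: cosine_sphere.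
  have mgq : measurable_fun usphere (fun z => g z `^ q).
    by apply: (measurableT_comp (f := fun r : R => r `^ q)) => //; exact: measurable_powR.
  have J := jensen_hoelder sg q1 mS mg mPk (fun z _ => normr_ge0 _) Pk0.
  rewrite (sphere_ker n1 (pgrow_cst 1) eta1 nr) poweR1r mul1e in J.
  (* Since r0 rho lies below both r0 and rho, (1 - r0 rho)^(n-1) can later be bounded below by the
     same power of 1 - r0 or of 1 - rho. *)
  have TLr := TL rho (r0 * rho) hrho hrho'.
  have Ea : r0 * (rho * (r0 * rho) * r0) = r0 ^+ 3 * rho ^+ 2 by ring.
  rewrite Ea -/S in TLr.
  have Smm : 0 <= S * mm by rewrite mulr_ge0 ?(ltW mm0)// (le_trans ler01).
  have J2 : (((S * mm) `^ q)%:E <= \int[sg]_(z in usphere) (g z `^ q * Pk z)%:E)%E.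
    apply: (le_trans _ J); rewrite -poweR_EFin; apply: le_poweR => //; exact: ltW.
  set G := (\int[sg]_(z in usphere) (g z `^ q)%:E)%E.
  have J3 : (((S * mm) `^ q)%:E <= (2 * (1 - r0 * rho) `^ (- (n%:R - 1)))%:E * G)%E.
    apply: (le_trans J2); rewrite /G -(integralZlR sg mS mgq (fun z _ => powR_ge0 _ _)); last first.
      by rewrite mulr_ge0// powR_ge0.
    apply: (le_integralR sg mS).
    - exact: measurable_funM.
    - exact: measurable_funM.
    - by move=> z z1; rewrite mulr_ge0 ?powR_ge0 ?Pk0.
    - move=> z z1; rewrite mulrC ler_wpM2r ?powR_ge0//; apply: poisson_le => //.
      exact: cosine_sphere.
  have FG : (\int[sg]_(z in usphere) F (rscale rho z) = ((1 - rho ^+ 2) `^ beta / @Vconst R n beta)%:E * G)%E.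
    rewrite /G -(integralZlR sg mS mgq (fun z _ => powR_ge0 _ _)); last first.
      by rewrite divr_ge0 ?powR_ge0 ?(ltW W0).
    apply: eq_integral => z /set_mem z1; congr EFin; rewrite mulrC /weight enorm_rscale ?(ltW p0)// z1 mulr1.
    by [].
  rewrite FG muleA -EFinM.
  set D := (1 - r0 * rho) `^ (n%:R - 1).
  have D0 : 0 < D by rewrite powR_gt0.
  have DE : (1 - r0 * rho) `^ (- (n%:R - 1)) = D^-1 by rewrite powRN.
  rewrite DE in J3.
  have J4 : ((D / 2 * (S * mm) `^ q)%:E <= G)%E.
    have := lee_wpmul2l (_ : (0 <= (D / 2)%:E)%E) J3.
    rewrite lee_fin divr_ge0 ?(ltW D0)// => /(_ isT).
    rewrite -EFinM muleA -EFinM (_ : D / 2 * (2 * D^-1) = 1) ?mul1e//.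
    by field; rewrite gt_eqF.
  apply: (le_trans _ (lee_wpmul2l _ J4)); last first.
    by rewrite lee_fin !mulr_ge0 ?powR_ge0 ?invr_ge0 ?exprn_ge0 ?(ltW W0) ?(ltW p0).
  rewrite -EFinM lee_fin le_eqVlt; apply/orP; left; apply/eqP.
  rewrite /lowint -/S -/D powRM ?(ltW mm0) ?(le_trans ler01)//.
  by field; rewrite gt_eqF.
have mL := measurable_lowint c beta q r0'.
have L0 := @lowint_ge0 c beta q r0.
have cm0 : 0 < mm `^ q / (2 * @Vconst R n beta) by rewrite divr_gt0 ?powR_gt0 ?mulr_gt0.
have : ((mm `^ q / (2 * @Vconst R n beta))%:E * \int[mu]_(rho in I01) (lowint c beta q r0 rho)%:E <= (X `^ q)%:E)%E.
  rewrite -(integralZlR mu mI mL L0 (ltW cm0)); apply: le_trans NTq.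
  apply: ge0_le_integral.
  - exact: mI.
  - by move=> r rI; rewrite lee_fin mulr_ge0 ?L0// ltW.
  - by apply/measurable_EFinP; exact: measurable_funM.
  - apply: emeasurable_funM; last exact: (measurable_sphere_section n1 mF F0).
    by apply/measurable_EFinP; apply: measurable_funM => //; exact: measurable_funX.
  - exact: pw.
move=> H; have := lee_wpmul2l (_ : (0 <= (mm `^ q / (2 * @Vconst R n beta))^-1%:E)%E) H.
rewrite lee_fin invr_ge0 (ltW cm0) => /(_ isT).
rewrite muleA -EFinM mulVf ?gt_eqF// mul1e => /le_trans; apply.
rewrite -EFinM lee_fin le_eqVlt; apply/orP; left; apply/eqP.
have -> : X = (`|C0| * k) * (1 - r0) `^ (alpha - b) * mm by rewrite /X; ring.
have r10 : 0 < 1 - r0 by rewrite subr_gt0.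
have u0 : 0 <= `|C0| * k by exact: mulr_ge0.
have -> : - ((b - alpha) * q) = (alpha - b) * q by ring.
rewrite powRrM; move: (`|C0| * k) u0 => u u0.
have w0 := powR_ge0 (1 - r0) (alpha - b).
rewrite (powRM q (mulr_ge0 u0 w0) (ltW mm0)) (powRM q u0 w0).
have m0 : mm `^ q != 0 by rewrite gt_eqF ?powR_gt0.
have vn0 : @Vconst R n beta != 0 by rewrite gt_eqF.
by field; rewrite m0 vn0.
Qed.

End Key.

(** The right side tends to 0 as r0 tends to 1; the point 1 - u with u^e <= c / (2(|C|+1)) refutes
    the bound. *)
Let no_bound (C c e : R) : 0 < c -> 0 < e -> ~ (forall r0, 2^-1 <= r0 < 1 -> c <= C * (1 - r0) `^ e).
Proof.
move=> c0 e0 H.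
have p0 : 0 < 2 * (`|C| + 1) by rewrite mulr_gt0// ltr_wpDl.
pose u : R := Num.min 2^-1 ((c / (2 * (`|C| + 1))) `^ e^-1).
have cu : 0 < c / (2 * (`|C| + 1)) by rewrite divr_gt0.
have u0 : 0 < u by rewrite lt_min invr_gt0 powR_gt0// ltr0n.
have u1 : u <= 2^-1 by rewrite ge_min lexx.
have h2 : 2^-1 < 1 :> R by rewrite invf_lt1// ltr1n.
have hh : 2^-1 + 2^-1 = 1 :> R by lra.
have := H (1 - u); rewrite opprB addrCA subrr addr0 => /(_ _)/wrap[]; first by apply/andP; split; lra.
apply/negP; rewrite -ltNge.
have ue : u `^ e <= c / (2 * (`|C| + 1)).
  apply: (@le_trans _ _ (((c / (2 * (`|C| + 1))) `^ e^-1) `^ e)).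
    by rewrite ge0_ler_powR ?nnegrE ?powR_ge0 ?(ltW e0) ?(ltW u0)// ge_min lexx orbT.
  by rewrite -powRrM mulVf ?gt_eqF// powRr1// ltW.
apply: (@le_lt_trans _ _ (`|C| * (c / (2 * (`|C| + 1))))).
  apply: (@le_trans _ _ (`|C| * u `^ e)); first by rewrite ler_wpM2r ?powR_ge0 ?ler_norm.
  by rewrite ler_wpM2l.
rewrite mulrA ltr_pdivrMr//; have := normr_ge0 C; nra.
Qed.

(** Three ranges of rho are tested. On (1/2, 1) the bound Ssum >= 1 forces alpha <= b. On (r0, 1)
    the growth of [Ssum] gives the order (1-r0)^(-sq), whence s <= b - alpha. If alpha = b and s =
    0, the integral over (1/2, r0) diverges logarithmically, which excludes equality. *)
Lemma necessity b c alpha beta q : 1 <= q -> -1 < beta ->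
  (exists2 C : R, 0 <= C & forall r0, 2^-1 <= r0 < 1 ->
  (\int[mu]_(rho in I01) (lowint c beta q r0 rho)%:E <= (C * (1 - r0) `^ (- ((b - alpha) * q)))%:E)%E) ->
  ((alpha < b /\ c <= b + (n%:R + beta) / q - (n%:R + alpha)) \/
   (alpha <= b /\ c < b + (n%:R + beta) / q - (n%:R + alpha))).
Proof.
move=> q1 hb [C C0 HC]; have q0 : 0 < q by exact: lt_le_trans q1.
have nn : (2 : R) <= n%:R by rewrite ler_nat.
have h2 : 0 < 2^-1 :> R by rewrite invr_gt0.
have h21 : 2^-1 < 1 :> R by rewrite invf_lt1// ltr1n.
pose kap : R := n%:R * 2^-1 ^+ n.-1 * 2 `^ (- `|beta|).
have kap0 : 0 < kap by rewrite !mulr_gt0 ?powR_gt0 ?exprn_gt0 ?ltr0n.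
have low (r0 rho : R) : 2^-1 < rho < 1 ->
    kap * (1 - rho) `^ beta * ((1 - r0 * rho) `^ (n%:R - 1) * Ssum c (r0 ^+ 3 * rho ^+ 2) `^ q) <= lowint c beta q r0 rho.
  move=> /andP[p2 p1]; have p0 : 0 < rho by exact: lt_trans p2.
  rewrite /lowint ler_wpM2r ?mulr_ge0 ?powR_ge0// /kap -[leLHS]mulrA.
  apply: ler_pM; rewrite ?mulr_ge0 ?powR_ge0 ?exprn_ge0 ?(ltW h2)//.
    by rewrite ler_wpM2l// lerXn2r ?nnegrE ?(ltW h2) ?(ltW p0) ?(ltW p2).
  have -> : (1 - rho ^+ 2) `^ beta = (1 + rho) `^ beta * (1 - rho) `^ beta.
    by rewrite -powRM; [congr powR; ring|lra|lra].
  have /andP[h _] : 2 `^ (- `|beta|) <= (1 + rho) `^ beta <= 2 `^ `|beta|.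
    by apply: powR_half2; apply/andP; split; lra.
  by rewrite ler_wpM2r ?powR_ge0.
have sub (D : set R) (r0 : R) (g : R -> R) : measurable D -> D `<=` `]2^-1, 1[%classic -> 2^-1 <= r0 < 1 ->
    measurable_fun D g -> (forall r, D r -> 0 <= g r) -> (forall r, D r -> g r <= lowint c beta q r0 r) ->
    (\int[mu]_(r in D) (g r)%:E <= (C * (1 - r0) `^ (- ((b - alpha) * q)))%:E)%E.
  move=> mD DI hr0 mg g0 gl; apply: le_trans (HC r0 hr0).
  have r0' : 0 <= r0 < 1 by case/andP: hr0 => h ->; rewrite andbT (le_trans _ h)// ltW.
  have mL := measurable_lowint c beta q r0'.
  have DI' : D `<=` I01.
    by move=> r /DI; rewrite /= !in_itv/= => /andP[h ->]; rewrite andbT (lt_trans _ h).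
  apply: (@le_trans _ _ (\int[mu]_(r in D) (lowint c beta q r0 r)%:E)%E).
    by apply: (le_integralR mu mD) => //; exact: (measurable_funS mI DI').
  apply: ge0_subset_integral => //; first exact/measurable_EFinP.
  by move=> r rI; rewrite lee_fin lowint_ge0.
have r0pos (r0 : R) : 2^-1 <= r0 < 1 -> [/\ 0 < r0, r0 < 1 & 0 < 1 - r0].
  by move=> /andP[h h']; split; lra.
have Harg (r0 rho : R) : 2^-1 <= r0 < 1 -> 2^-1 < rho < 1 -> 0 <= r0 ^+ 3 * rho ^+ 2 < 1.
  move=> hr0 /andP[p2 p1]; have [e1 e2 _] := r0pos _ hr0.
  by apply: arg_bnd; [rewrite (ltW e1)|rewrite (ltW (lt_trans h2 p2)) ltW].
have ab : alpha <= b.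
  rewrite leNgt; apply/negP => ba.
  pose k : R := kap * ((1 - 2^-1) `^ (beta + n%:R) / (beta + n%:R)).
  have bn : 0 < beta + n%:R by lra.
  have k0 : 0 < k by rewrite mulr_gt0// divr_gt0// powR_gt0// subr_gt0.
  have e0 : 0 < (alpha - b) * q by rewrite mulr_gt0// subr_gt0.
  apply: (no_bound (C := C) k0 e0) => r0 hr0; have [e1 e2 e3] := r0pos _ hr0.
  have -> : (alpha - b) * q = - ((b - alpha) * q) by ring.
  rewrite -lee_fin /k EFinM -(integral_1B_powR bn h21).
  have mD : measurable (`]2^-1, 1[%classic : set R) by exact: measurable_itv.
  have mp : measurable_fun (`]2^-1, 1[%classic : set R) (fun s : R => (1 - s) `^ (beta + n%:R - 1)) by exact: measurable_powR_oneB.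
  rewrite -(integralZlR mu mD mp (fun s _ => powR_ge0 _ _) (ltW kap0)).
  apply: sub => //.
  - exact: measurable_funM.
  - by move=> r _; rewrite mulr_ge0 ?powR_ge0// ltW.
  move=> rho; rewrite /= in_itv/= => hrho; apply: le_trans (low r0 rho hrho).
  have S1 := Ssum_ge1 n1 c (Harg _ _ hr0 hrho).
  case/andP: hrho => p2 p1; have p0 : 0 < rho by exact: lt_trans p2.
  have p3 : 0 < 1 - rho by lra.
  rewrite -mulrA ler_wpM2l ?(ltW kap0)//.
  have -> : (1 - rho) `^ (beta + n%:R - 1) = (1 - rho) `^ beta * (1 - rho) `^ (n%:R - 1).
    by rewrite -powRD ?(gt_eqF p3) ?implybT//; congr powR; ring.
  rewrite ler_wpM2l ?powR_ge0// -[leLHS]mulr1 ler_pM ?powR_ge0//.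
    rewrite ge0_ler_powR ?nnegrE ?subr_ge0 ?(ltW p1)//; try lra.
      by rewrite mulr_ile1 ?ltW.
    by rewrite lerD2l lerN2 ler_piMl ?(ltW p0)// ltW.
  apply: (@le_trans _ _ (1 `^ q)); first by rewrite powR1.
  by rewrite ge0_ler_powR ?nnegrE ?(ltW q0)// (le_trans ler01 S1).
(* The critical exponent: s <= b - alpha is the wanted inequality on c. *)
pose s := n%:R + c - (n%:R + beta) / q.
have sq : s * q = (n%:R + c) * q - (n%:R + beta) by rewrite /s; field; rewrite gt_eqF.
have nb : 0 < (n%:R + beta) / q by rewrite divr_gt0//; lra.
(* The argument r0^3 rho^2 is at least x^5 with x the smaller of r0 and rho, and 1 - x^5 is
   comparable to 1 - x. *)
have five (x : R) : 0 < x < 1 -> 0 < 1 - x ^+ 5 <= 5 * (1 - x).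
  move=> /andP[x0 x1]; rewrite subr_gt0 exprn_ilt1 ?(ltW x0)//=.
  have -> : 1 - x ^+ 5 = (1 - x) * (1 + x + x ^+ 2 + x ^+ 3 + x ^+ 4) by ring.
  rewrite mulrC ler_wpM2r ?subr_ge0 ?(ltW x1)//.
  have hx k : x ^+ k <= 1 by rewrite exprn_ile1 ?ltW.
  have := hx 2%N; have := hx 3%N; have := hx 4%N; lra.
have Slow (K : R) (x y : R) : 0 < n%:R + c -> 0 < K -> (forall y, 0 <= y < 1 -> K * (1 - y) `^ (- (n%:R + c)) <= Ssum c y) ->
    0 < x < 1 -> x ^+ 5 <= y -> y < 1 ->
    K `^ q * 5 `^ (- ((n%:R + c) * q)) * (1 - x) `^ (- ((n%:R + c) * q)) <= Ssum c y `^ q.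
  move=> nc K0 HK hx xy y1; have /andP[f0 f1] := five x hx; case/andP: hx => x0 x1.
  have x5 : 0 <= x ^+ 5 by rewrite exprn_ge0// ltW.
  have x51 : 0 <= x ^+ 5 < 1 by rewrite x5/= (le_lt_trans xy).
  have p1 : 0 < 1 - x by rewrite subr_gt0.
  apply: (@le_trans _ _ ((K * (1 - x ^+ 5) `^ (- (n%:R + c))) `^ q)); last first.
    rewrite ge0_ler_powR ?nnegrE ?(ltW q0) ?mulr_ge0 ?powR_ge0 ?(ltW K0)//.
      by rewrite (le_trans ler01)// Ssum_ge1// (le_trans x5).
    by apply: (le_trans (HK _ x51)); apply: Ssum_homo.
  rewrite powRM ?powR_ge0 ?(ltW K0)// -mulrA ler_wpM2l ?powR_ge0// -powRM ?(ltW p1)// -powRrM mulNr.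
  by apply: ler_powRN => //; rewrite mulr_ge0 ?(ltW nc) ?(ltW q0).
have sb : s <= b - alpha.
  (* If n + c <= 0 then s < 0 <= b - alpha at once. *)
  have [nc|nc] := leP (n%:R + c) 0; first by rewrite /s; lra.
  have [K K0 HK] := Ssum_ge n1 nc.
  rewrite leNgt; apply/negP => bs.
  have b1 : 0 < beta + 1 by lra.
  pose k : R := kap * (K `^ q * 5 `^ (- ((n%:R + c) * q))) / (beta + 1).
  have k0 : 0 < k.
    by apply: divr_gt0 => //; apply: mulr_gt0 => //; apply: mulr_gt0; exact: powR_gt0.
  have e0 : 0 < (s - (b - alpha)) * q by rewrite mulr_gt0// subr_gt0.
  apply: (no_bound (C := C) k0 e0) => r0 hr0; have [e1 e2 e3] := r0pos _ hr0.
  have mD : measurable (`]r0, 1[%classic : set R) by exact: measurable_itv.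
  have mp : measurable_fun (`]r0, 1[%classic : set R) (fun s : R => (1 - s) `^ (beta + 1 - 1)) by exact: measurable_powR_oneB.
  pose k1 : R := kap * ((1 - r0) `^ (n%:R - 1) * (K `^ q * 5 `^ (- ((n%:R + c) * q)) * (1 - r0) `^ (- ((n%:R + c) * q)))).
  have k10 : 0 <= k1 by rewrite !mulr_ge0 ?powR_ge0// ltW.
  have := sub `]r0, 1[%classic r0 (fun s => k1 * (1 - s) `^ (beta + 1 - 1)) mD.
  rewrite (integralZlR mu mD mp (fun s _ => powR_ge0 _ _) k10) (integral_1B_powR b1 e2) -EFinM lee_fin => H.
  have {}H : k1 * ((1 - r0) `^ (beta + 1) / (beta + 1)) <= C * (1 - r0) `^ (- ((b - alpha) * q)).
    apply: H => //.
    - by move=> r; rewrite /= !in_itv/= => /andP[h ->]; rewrite andbT; case/andP: hr0 => h' _; exact: le_lt_trans h.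
    - exact: measurable_funM.
    - by move=> r _; rewrite mulr_ge0 ?powR_ge0.
    move=> rho; rewrite /= in_itv/= => /andP[h p1].
    have hrho : 2^-1 < rho < 1 by rewrite p1 andbT; case/andP: hr0 => h' _; exact: le_lt_trans h.
    apply: le_trans (low r0 rho hrho); rewrite addrK /k1 mulrAC ler_wpM2l ?mulr_ge0 ?powR_ge0 ?(ltW kap0)//.
    have p0 : 0 < rho by exact: lt_trans h.
    rewrite ler_pM ?mulr_ge0 ?powR_ge0//.
      rewrite ge0_ler_powR ?nnegrE ?(ltW e3)//; first by lra.
        by rewrite subr_ge0 mulr_ile1 ?ltW.
      by rewrite lerD2l lerN2 ler_piMr ?(ltW e1)// ltW.
    apply: Slow => //; first by rewrite e1.
      have -> : r0 ^+ 5 = r0 ^+ 3 * r0 ^+ 2 by rewrite -exprD.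
      by rewrite ler_wpM2l ?exprn_ge0 ?(ltW e1)// lerXn2r ?nnegrE ?(ltW e1) ?(ltW p0)// ltW.
    by case/andP: (Harg _ _ hr0 hrho).
  (* The exponents add up to (n-1) - (n+c) q + (beta+1) = -s q. *)
  have E : k1 * ((1 - r0) `^ (beta + 1) / (beta + 1)) = k * (1 - r0) `^ (- (s * q)).
    rewrite /k1 /k sq.
    have -> : (1 - r0) `^ (- ((n%:R + c) * q - (n%:R + beta))) =
        (1 - r0) `^ (n%:R - 1) * ((1 - r0) `^ (- ((n%:R + c) * q)) * (1 - r0) `^ (beta + 1)).
      by rewrite -!powRD ?(gt_eqF e3) ?implybT//; congr powR; ring.
    by field; rewrite gt_eqF.
  rewrite E in H.
  have -> : (1 - r0) `^ ((s - (b - alpha)) * q) = (1 - r0) `^ (- ((b - alpha) * q)) * (1 - r0) `^ (s * q).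
    by rewrite -powRD ?(gt_eqF e3) ?implybT//; congr powR; ring.
  have p0 : 0 < (1 - r0) `^ (s * q) by rewrite powR_gt0.
  rewrite mulrA -ler_pdivrMr//; apply: le_trans H.
  by rewrite powRN.
have [ltab|leab] := ltP alpha b.
  by left; split => //; move: sb; rewrite /s; lra.
have {leab} abE : alpha = b by apply/eqP; rewrite eq_le ab.
right; split => //.
rewrite ltNge; apply/negP => cb.
have s0 : s = 0.
  by apply/eqP; rewrite eq_le; apply/andP; split; move: sb cb; rewrite /s abE; lra.
have nc : 0 < n%:R + c by move: s0; rewrite /s; lra.
have ncq : (n%:R + c) * q = n%:R + beta by move: sq; rewrite s0 mul0r; lra.
have [K K0 HK] := Ssum_ge n1 nc.
pose k : R := kap * (K `^ q * 5 `^ (- ((n%:R + c) * q))).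
have k0 : 0 < k by apply: mulr_gt0 => //; apply: mulr_gt0; exact: powR_gt0.
pose C1 : R := C / k.
have C10 : 0 <= C1 by rewrite divr_ge0// ltW.
(* [\int_{1/2}^{r0} (1 - rho)^(-1)] would be bounded; compare with [(1 - rho)^(e - 1)] for small [e]. *)
pose e : R := (4 * (C1 + 1))^-1.
have e0 : 0 < e by rewrite invr_gt0 mulr_gt0// ltr_wpDl.
have e1 : e <= 1 by rewrite invf_le1 ?mulr_gt0 ?ltr_wpDl//; lra.
apply: (no_bound (C := e^-1) (c := 4^-1 / e) (e := e)) => //; first by rewrite divr_gt0// invr_gt0.
move=> r0 hr0; have [r00 r01 r02] := r0pos _ hr0.
pose D : set R := `]2^-1, r0]%classic; pose D' : set R := `]r0, 1[%classic.
have mD : measurable D by exact: measurable_itv.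
have mD' : measurable D' by exact: measurable_itv.
have mp (E : set R) : measurable_fun E (fun s : R => (1 - s) `^ (e - 1)) by exact: measurable_powR_oneB.
have UD : (`]2^-1, 1[%classic : set R) = D `|` D'.
  apply/seteqP; split => r; rewrite /D /D' /= !in_itv/=.
    by move=> /andP[h ->]; rewrite h andbT/=; have [hh|hh] := leP r r0; [left|right].
  case=> /andP[h h']; first by rewrite h/= (le_lt_trans h').
  by rewrite h' andbT; case/andP: hr0 => hh _; exact: le_lt_trans h.
have int1 := integral_1B_powR e0 h21; have int2 := integral_1B_powR e0 r01.
have bD : (\int[mu]_(r in D) ((1 - r) `^ (e - 1))%:E <= C1%:E)%E.
  have : (\int[mu]_(r in D) (k * (1 - r) `^ (e - 1))%:E <= C%:E)%E.
    have -> : C = C * (1 - r0) `^ (- ((b - alpha) * q)) by rewrite abE subrr mul0r oppr0 powRr0 mulr1.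
    apply: sub => //.
    - by move=> r; rewrite /D /= !in_itv/= => /andP[-> h]; rewrite (le_lt_trans h).
    - exact: measurable_funM.
    - by move=> r _; rewrite mulr_ge0 ?powR_ge0// ltW.
    move=> rho; rewrite /D /= in_itv/= => /andP[p2 pr].
    have p1 : rho < 1 by exact: le_lt_trans r01.
    have hrho : 2^-1 < rho < 1 by rewrite p2.
    apply: le_trans (low r0 rho hrho).
    have p0 : 0 < rho by exact: lt_trans p2.
    have p3 : 0 < 1 - rho by lra.
    apply: (@le_trans _ _ (kap * (1 - rho) `^ beta * ((1 - rho) `^ (n%:R - 1) *
       (K `^ q * 5 `^ (- ((n%:R + c) * q)) * (1 - rho) `^ (- ((n%:R + c) * q)))))).
      have -> : kap * (1 - rho) `^ beta * ((1 - rho) `^ (n%:R - 1) *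
       (K `^ q * 5 `^ (- ((n%:R + c) * q)) * (1 - rho) `^ (- ((n%:R + c) * q)))) =
        k * ((1 - rho) `^ beta * ((1 - rho) `^ (n%:R - 1) * (1 - rho) `^ (- ((n%:R + c) * q)))).
        by rewrite /k; ring.
      (* The exponents of 1 - rho add up to -1, which is at most e - 1. *)
      rewrite ler_wpM2l ?(ltW k0)// -!powRD ?(gt_eqF p3) ?implybT// ger_powR//.
        by rewrite p3/= gerBl ltW.
      by rewrite ncq; lra.
    rewrite ler_wpM2l ?mulr_ge0 ?powR_ge0 ?(ltW kap0)//.
    rewrite ler_pM ?mulr_ge0 ?powR_ge0//.
      rewrite ge0_ler_powR ?nnegrE ?(ltW p3)//; first by lra.
        by rewrite subr_ge0 mulr_ile1 ?ltW.
      by rewrite lerD2l lerN2 ler_piMl ?(ltW p0)// ltW.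
    apply: Slow => //; first by rewrite p0.
      have -> : rho ^+ 5 = rho ^+ 3 * rho ^+ 2 by rewrite -exprD.
      by rewrite ler_wpM2r ?exprn_ge0 ?(ltW p0)// lerXn2r ?nnegrE ?(ltW r00) ?(ltW p0).
    by case/andP: (Harg _ _ hr0 hrho).
  rewrite (integralZlR mu mD (mp _) (fun s _ => powR_ge0 _ _) (ltW k0)) => H.
  have := lee_wpmul2l (_ : (0 <= (k^-1)%:E)%E) H; rewrite lee_fin invr_ge0 (ltW k0) => /(_ isT).
  by rewrite muleA -EFinM mulVf ?gt_eqF// mul1e -EFinM mulrC.
have : (((1 - 2^-1) `^ e / e)%:E <= C1%:E + ((1 - r0) `^ e / e)%:E)%E.
  rewrite -int1 -int2 UD ge0_integral_setU//.
  - exact: leeD.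
  - by apply/measurable_EFinP; exact: mp.
  - by move=> r _; rewrite lee_fin powR_ge0.
  - apply/disj_setPS => r; rewrite /D /D' /= !in_itv/= => -[/andP[_ h] /andP[h' _]].
    by move: (lt_le_trans h' h); rewrite ltxx.
rewrite -EFinD lee_fin => H.
have hh : 1 - 2^-1 = 2^-1 :> R by lra.
have he : 2^-1 <= (1 - 2^-1) `^ e :> R.
  rewrite hh -{1}[2^-1]powRr1 ?(ltW h2)// ger_powR//.
  by rewrite h2/= ltW.
have H2 : 2^-1 / e <= C1 + (1 - r0) `^ e / e.
  apply: le_trans H; apply: ler_wpM2r => //.
  by rewrite invr_ge0; exact: ltW.
(* The purpose of the choice of e: C1 takes at most half of 1/(2e), and the other half would have to
   stay below (1-r0)^e / e, which tends to 0. *)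
have C1e : C1 <= 4^-1 / e.
  by rewrite /e invrK mulrA mulVf// mul1r lerDl.
rewrite [e^-1 * _]mulrC.
have -> : 4^-1 / e = 2^-1 / e - 4^-1 / e by field; rewrite gt_eqF.
lra.
Qed.

End Necessity.

Theorem theorem1p2 (R : realType) (n : nat) (hn : (2 <= n)%N)
    (Z : nat -> Rn R n -> Rn R n -> R)
    (hZ : forall k : nat, is_zonal k (Z k))
    (b c alpha beta q : R) (hq : 1 <= q) (hbeta : -1 < beta) :
  (T_bounded Z b c alpha 1 beta q <-> S_bounded Z b c alpha 1 beta q) /\
  (S_bounded Z b c alpha 1 beta q <->
    ((alpha < b /\ c <= b + (n%:R + beta) / q - (n%:R + alpha)) \/
     (alpha <= b /\ c < b + (n%:R + beta) / q - (n%:R + alpha)))).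
Proof.
set cond := (_ \/ _).
have hsuff : cond -> T_bounded Z b c alpha 1 beta q /\ S_bounded Z b c alpha 1 beta q.
  by move=> h; exact: (TS_bounded hn hZ hq hbeta h).
have mK := measurable_bergman hn hZ c.
(* For T the comparisons of K with R_c are equalities; for S, below, they are x <= |x| and the
   idempotence of the modulus. *)
have nT : T_bounded Z b c alpha 1 beta q -> cond.
  move=> h; apply: (necessity hn hq hbeta).
  by apply: (lowint_bound hn (b := b) (alpha := alpha) hZ mK _ _ hq h).
have nS : S_bounded Z b c alpha 1 beta q -> cond.
  move=> h; apply: (necessity hn hq hbeta).
  apply: (lowint_bound hn (b := b) (alpha := alpha) hZ _ _ _ hq h).
  - exact: (measurableT_comp (f := @Num.norm R R)).
  - by move=> x y _ _; exact: ler_norm.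
  - by move=> x y _ _; rewrite normr_id.
split; split.
- by move=> /nT /hsuff[].
- by move=> /nS /hsuff[].
- exact: nS.
- by move=> /hsuff[].
Qed.
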